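(* Let $f_\mu$ be a family of maps as in the context (with $0<\alpha<1$, $\chi_{\rm eig},\chi\in\{-1,1\}$), so that $\lambda(\mathbf 0)=\alpha$, $\sigma(\mathbf 0)=\chi_{\rm eig}/\alpha$, $c_0(\mathbf 0)=1$, $d_0(\mathbf 0)=0$, $d_1(\mathbf 0)=\chi$, $d_2(\mathbf 0)=0$, $d_5(\mathbf 0)=d_{5,0}\neq 0$. Suppose that $a_{1,0}+b_{1,0}=0$, $\Delta_0>0$, and $-1<c_{2,0}<1-\frac{\sqrt{\Delta_0}}{2}$. Let $\mathbf v\in\mathbb R^n$. (i) If $\mathbf n_{\rm tang}^{\sf T}\mathbf v\neq 0$, then there exists $k_{\rm min}\in\mathbb Z$ such that for all $k\in K(k_{\rm min})$ there exist $\varepsilon_k^-<0$ and $\varepsilon_k^+>0$, with $\varepsilon_k^\pm=\mathcal O(\alpha^{2k})$ as $k\to\infty$, such that $f_\mu$ has an asymptotically stable period-$(k+m)$ solution for all $\mu=\varepsilon\mathbf v$ with $\varepsilon_k^-<\varepsilon<\varepsilon_k^+$. Moreover, one of the sequences $\{\varepsilon_k^-\}$, $\{\varepsilon_k^+\}$ corresponds to saddle-node bifurcations of the periodic solutions, and the other to period-doubling bifurcations. (ii) If instead $\mathbf n_{\rm tang}^{\sf T}\mathbf v=0$ and $\mathbf n_{\rm eig}^{\sf T}\mathbf v\neq 0$, then the same conclusions hold with $\varepsilon_k^\pm=\mathcal O\left(\frac{\alpha^k}{k}\right)$ in place of $\varepsilon_k^\pm=\mathcal O(\alpha^{2k})$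.
   Context: Setting. $f_\mu$ is a $C^\infty$ map on $\mathbb R^2$ with $C^\infty$ dependence on a parameter $\mu\in\mathbb R^n$; $\mathbf 0$ is the origin of $\mathbb R^n$. For all $\mu$ in some region containing $\mathbf 0$, the point $(x,y)=(0,0)$ is a fixed point of $f_\mu$ with eigenvalues $\lambda=\lambda(\mu)$, $\sigma=\sigma(\mu)$ ($C^\infty$ functions of $\mu$), where $\lambda(\mathbf 0)=\alpha$ and $\sigma(\mathbf 0)=\chi_{\rm eig}/\alpha$ with $0<\alpha<1$ and $\chi_{\rm eig}\in\{-1,1\}$. Local map. Coordinates are chosen so that there is a convex neighbourhood $\mathcal N$ of $(0,0)$ on which, for all sufficiently small $\mu$, $f_\mu=T_0$ where $$T_0(x,y)=\begin{bmatrix}\lambda x\left(1+a_1xy+\mathcal O(x^2y^2)\right)\\ \sigma y\left(1+b_1xy+\mathcal O(x^2y^2)\right)\end{bmatrix},$$ with $a_1=a_1(\mu)$, $b_1=b_1(\mu)\in\mathbb R$. If $\chi_{\rm eig}=-1$ the coordinates are chosen so that $a_1=b_1=0$. When $\mu=\mathbf 0$, the points $(1,0)$, $(\lambda,0)$, $(0,1/\sigma)$, $(0,1/\sigma^2)$ belong to $\mathcal N$. Reinjection map. For a fixed integer $m\ge1$, write $T_1=f_\mu^m$ near $(0,1)$ as $$T_1(x,y)=\begin{bmatrix}c_0+c_1x+c_2(y-1)+\mathcal O\left((x,y-1)^2\right)\\ d_0+d_1x+d_2(y-1)+d_3x^2+d_4x(y-1)+d_5(y-1)^2+\mathcal O\left((x,y-1)^3\right)\end{bmatrix},$$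 where the coefficients $c_i,d_i$ are functions of $\mu$. It is assumed that $c_0(\mathbf 0)=1$, $d_0(\mathbf 0)=0$ (so $f_{\mathbf 0}$ has an orbit homoclinic to the origin through $(1,0)$ and $(0,1)$), $d_2(\mathbf 0)=0$, $d_5(\mathbf 0)=d_{5,0}\ne0$, and $d_1(\mathbf 0)=\chi\in\{-1,1\}$. Notation. $a_{1,0},b_{1,0},c_{1,0},c_{2,0},d_{3,0},d_{4,0}$ denote the values at $\mu=\mathbf 0$ of $a_1,b_1,c_1,c_2,d_3,d_4$, and $$\Delta_0=\left(1-c_{2,0}-\chi d_{4,0}\right)^2-4d_{5,0}\left(d_{3,0}+\chi c_{1,0}\right).$$ The vectors $\mathbf n_{\rm eig},\mathbf n_{\rm tang}\in\mathbb R^n$ are the gradients at $\mu=\mathbf 0$ of $\lambda\sigma$ and $d_0$: $\lambda(\mu)\sigma(\mu)=\chi_{\rm eig}+\mathbf n_{\rm eig}^{\sf T}\mu+\mathcal O(\|\mu\|^2)$ and $d_0(\mu)=\mathbf n_{\rm tang}^{\sf T}\mu+\mathcal O(\|\mu\|^2)$. For $k_{\rm min}\in\mathbb Z$, $$K(k_{\rm min})=\left\{k\in\mathbb Z\,\middle|\,k\ge k_{\rm min},\ \chi_{\rm eig}^k=\chi\right\}.$$ *)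

(* Defs.v *)
From HB Require Import structures.
From mathcomp Require Import all_boot all_order all_algebra.
From mathcomp Require Import all_classical all_reals all_analysis.

Set Implicit Arguments.
Unset Strict Implicit.
Unset Printing Implicit Defensive.

Import Order.TTheory GRing.Theory Num.Theory.
Import numFieldNormedType.Exports.

Local Open Scope classical_set_scope.
Local Open Scope ring_scope.

Section Calculus.
Variable R : realType.

(* [Cr k A F]: F is of class C^k on the open set A. All directions are used
   instead of a basis, so that the definition also applies to product spaces;
   on finite-dimensional spaces this is the usual notion. *)
Fixpoint Cr (V W : normedModType R) (k : nat) (A : set V) (F : V -> W) : Prop :=
  if k is k'.+1 then
    (forall x v, A x -> derivable F x v) /\ (forall v, Cr k' A ('D_v F))
  else forall x, A x -> {for x, continuous F}.

Definition smooth_on (V W : normedModType R) (A : set V) (F : V -> W) : Prop :=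
  forall k, Cr k A F.

Definition grad (n : nat) (F : 'rV[R]_n -> R) (p : 'rV[R]_n) : 'rV[R]_n :=
  \row_i 'D_(delta_mx 0 i) F p.

Definition dot (n : nat) (u v : 'rV[R]_n) : R := \sum_i u 0 i * v 0 i.

Definition pt (x y : R) : 'rV[R]_2 := \row_j (if j == 0 then x else y).

End Calculus.

Section Dynamics.
Variable R : realType.
Implicit Types (z w : 'rV[R]_2).

Definition periodic_point (F : 'rV[R]_2 -> 'rV[R]_2) (p : nat) z : Prop :=
  [/\ (0 < p)%N, iter p F z = z
    & forall j, (0 < j < p)%N -> iter j F z <> z].

(* Asymptotic stability of the solution j |-> iter j F z. *)
Definition asymptotically_stable (F : 'rV[R]_2 -> 'rV[R]_2) z : Prop :=
  (forall e, 0 < e ->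
     \forall w \near z, forall j, `|iter j F w - iter j F z| < e) /\
  (\forall w \near z, (fun j => iter j F w - iter j F z) @ \oo --> (0 : 'rV[R]_2)).

(* Generic codimension-one bifurcations of a fixed point z0 of a one-parameter
   family of planar maps G at the parameter value e0 (see e.g. Kuznetsov,
   Elements of Applied Bifurcation Theory, Chapters 4 and 5).
   The library's Jacobian acts on row vectors on the right, 'D_u F z = u *m 'J F z,
   so the critical eigenvector is the row u and the adjoint one the column w.
   The second multiplier is s. *)

Definition saddle_node (G : R -> 'rV[R]_2 -> 'rV[R]_2) (e0 : R) z0 : Prop :=
  let J := 'J (G e0) z0 in
  G e0 z0 = z0 /\
  exists (s : R) (u : 'rV[R]_2) (w : 'cV[R]_2),
  [/\ char_poly J = ('X - 1%:P) * ('X - s%:P) /\ `|s| != 1,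
      (u != 0 /\ u *m J = u) /\ (w != 0 /\ J *m w = w),
      (* nondegenerate quadratic term along the critical eigenvector *)
      'D_u ('D_u (G e0)) z0 *m w != 0
    & (* the parameter unfolds the fixed points transversally *)
      derive1 (fun e => G e z0) e0 *m w != 0].

Definition period_doubling (G : R -> 'rV[R]_2 -> 'rV[R]_2) (e0 : R) z0 : Prop :=
  let J := 'J (G e0) z0 in
  G e0 z0 = z0 /\
  exists (s : R) (u : 'rV[R]_2) (w : 'cV[R]_2),
  [/\ char_poly J = ('X + 1%:P) * ('X - s%:P) /\ `|s| != 1,
      (u != 0 /\ u *m J = - u) /\ (w != 0 /\ J *m w = - w),
      (* h = (J - 1)^-1 B(u, u): the cubic coefficient of the normal form is,
         up to the normalisation of u and w, <w, C(u,u,u)>/6 - <w, B(u,h)>/2 *)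
      let h := 'D_u ('D_u (G e0)) z0 *m invmx (J - 1%:M) in
      (6^-1 *: 'D_u ('D_u ('D_u (G e0))) z0
         - 2^-1 *: 'D_h ('D_u (G e0)) z0) *m w != 0
    & (* dz is the velocity at e0 of the branch of fixed points of G e through
         z0; the condition says that the multiplier -1 has nonzero derivative
         along that branch *)
      let dz := derive1 (fun e => G e z0) e0 *m invmx (1%:M - J) in
      (derive1 (fun e => 'D_u (G e) z0) e0 + 'D_dz ('D_u (G e0)) z0) *m w != 0].

End Dynamics.

Section Setting.
Variables (R : realType) (n : nat).
Implicit Types (f : 'rV[R]_n -> 'rV[R]_2 -> 'rV[R]_2) (mu v : 'rV[R]_n).

Definition smooth_family f : Prop :=
  smooth_on setT (fun p : 'rV[R]_n * 'rV[R]_2 => f p.1 p.2).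

Definition fixed_origin f (lambda sigma : 'rV[R]_n -> R) : Prop :=
  exists U : set 'rV[R]_n,
  [/\ open U, U 0, smooth_on U lambda, smooth_on U sigma
    & forall mu, U mu ->
        f mu 0 = 0 /\
        char_poly ('J (f mu) 0) = ('X - (lambda mu)%:P) * ('X - (sigma mu)%:P)].

(* r and s are the terms O(x^2 y^2), understood as x y -> 0. *)
Definition local_map f (lambda sigma a1 b1 : 'rV[R]_n -> R)
    (N : set 'rV[R]_2) : Prop :=
  exists r s : 'rV[R]_n -> 'rV[R]_2 -> R,
  (\forall mu \near (0 : 'rV[R]_n), forall x y, N (pt x y) ->
     f mu (pt x y) =
     pt (lambda mu * x * (1 + a1 mu * (x * y) + r mu (pt x y)))
        (sigma mu * y * (1 + b1 mu * (x * y) + s mu (pt x y)))) /\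
  exists C eta : R, 0 < eta /\
  \forall mu \near (0 : 'rV[R]_n), forall x y, N (pt x y) -> `|x * y| <= eta ->
    `|r mu (pt x y)| <= C * (x ^+ 2 * y ^+ 2) /\
    `|s mu (pt x y)| <= C * (x ^+ 2 * y ^+ 2).

Definition reinjection_map f (m : nat)
    (c0 c1 c2 d0 d1 d2 d3 d4 d5 : 'rV[R]_n -> R) : Prop :=
  exists r s : 'rV[R]_n -> 'rV[R]_2 -> R,
  (\forall mu \near (0 : 'rV[R]_n) & z \near pt 0 1,
     let x := (z : 'rV[R]_2) 0 0 in let y := (z : 'rV[R]_2) 0 1 in
     iter m (f mu) z =
     pt (c0 mu + c1 mu * x + c2 mu * (y - 1) + r mu z)
        (d0 mu + d1 mu * x + d2 mu * (y - 1)
         + d3 mu * x ^+ 2 + d4 mu * x * (y - 1) + d5 mu * (y - 1) ^+ 2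
         + s mu z)) /\
  exists C : R,
  \forall mu \near (0 : 'rV[R]_n) & z \near pt 0 1,
    `|r mu z| <= C * `|z - pt 0 1| ^+ 2 /\
    `|s mu z| <= C * `|z - pt 0 1| ^+ 3.

Definition Delta0 (chi c1 c2 d3 d4 d5 : R) : R :=
  (1 - c2 - chi * d4) ^+ 2 - 4 * d5 * (d3 + chi * c1).

Definition K (chi_eig chi : R) (kmin : int) : set int :=
  [set k | kmin <= k /\ chi_eig ^ k = chi].

Definition bigO_on (S : set int) (u rate : int -> R) : Prop :=
  exists (C : R) (k0 : int),
    forall k, S k -> k0 <= k -> `|u k| <= C * `|rate k|.

(* zeta k is a branch of period-(k+m) points of f (e *: v) over the closed
   window, whose ends are the bifurcations. *)
Definition stable_windows f (m : nat) (chi_eig chi : R) v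
    (rate : int -> R) : Prop :=
  exists (kmin : int) (em ep : int -> R) (zeta : int -> R -> 'rV[R]_2),
  let p (k : int) := absz (k + m%:Z) in
  let G (k : int) (e : R) := iter (p k) (f (e *: v)) in
  [/\ forall k, K chi_eig chi kmin k -> [/\ 0 < k + m%:Z, em k < 0 & 0 < ep k],
      bigO_on (K chi_eig chi kmin) em rate /\
      bigO_on (K chi_eig chi kmin) ep rate,
      forall k, K chi_eig chi kmin k ->
        [/\ {within `[em k, ep k], continuous (zeta k)},
            forall e, em k <= e <= ep k ->
              periodic_point (f (e *: v)) (p k) (zeta k e)
          & forall e, em k < e < ep k ->
              asymptotically_stable (f (e *: v)) (zeta k e)]
    & (forall k, K chi_eig chi kmin k ->
         saddle_node (G k) (em k) (zeta k (em k)) /\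
         period_doubling (G k) (ep k) (zeta k (ep k))) \/
      (forall k, K chi_eig chi kmin k ->
         period_doubling (G k) (em k) (zeta k (em k)) /\
         saddle_node (G k) (ep k) (zeta k (ep k)))].

End Setting.

(* Main.v *)
(* Idea.  Restrict the family to mu = e v and follow one excursion of the orbit:
   T1 carries a point near (0,1) to a point near (1,0), and k iterates of T0 bring
   it back.  With s = alpha^k, put x = s (1 + s (k a + xi)) and y = 1 + s Y, where a
   is a10 chi, and let e be rho_k times a new parameter, rho_k of order s^2 or s / k.
   Along the k local iterates x / alpha^i and y / (chi_eig^i alpha^(k - i)) stay
   within O(k s) of 1 and chi.  Because a10 + b10 = 0 the resonant terms cancel to
   leading order, and the return map converges in C^3, at the rate O(1/k), to a
   quadratic family affinely conjugate to
     (zeta, D) |-> (c D + beta + k1 e, zeta + (1 - c) D - D^2 / 2 + (1/2 - k1) e)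
   with c = c20 and beta = Delta0 / 2.  Its fixed points are parametrised by D, with
   e = D^2 - 2 beta, and the Jacobian matrix has trace 1 - c - D and determinant
   - c: the stable ones are those with 0 < D < 2 (1 - c), a saddle-node bifurcation
   occurs at D = 0 and a period-doubling at D = 2 (1 - c).  The branch of fixed points,
   the two bifurcations and their nondegeneracy persist under C^3-small perturbations. *)

Require Import Defs.
From HB Require Import structures.
From mathcomp Require Import all_boot all_order all_algebra.
From mathcomp Require Import all_classical all_reals all_analysis.
From mathcomp Require Import ring lra.
Import Order.TTheory GRing.Theory Num.Theory.
Import numFieldNormedType.Exports.
Local Open Scope classical_set_scope.
Local Open Scope ring_scope.

Set Implicit Arguments.
Unset Strict Implicit.
Unset Printing Implicit Defensive.

(** * Smooth functions of several variables *)

(** The hypotheses bound the remainders of the local and reinjection maps in absolute value only,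
    whereas C^3 convergence concerns derivatives. These come from the smoothness of the family:
    Hadamard's lemma divides out coordinates with smooth quotients, the O(x^2 y^2) terms become (x
    y)^2 times a smooth function, and every estimate is about compositions of fixed smooth
    functions. At the fold the fixed points are no graph over the parameter, but they are a graph
    over D, also after perturbation. The two bifurcations occur near the parameters - 2 beta and 4
    (1 - c)^2 - 2 beta; the bounds on Delta0 and c20 say that these have opposite signs, and |c| < 1
    controls the determinant. The two rates reflect how the parameter acts. A drift of lambda sigma
    accumulates over k steps and must be comparable with s, so rho_k is of order s / k. A shift of
    d0 acts once but is divided by s when y is rescaled, so rho_k is of order s^2. Each local step
    is known up to O(s / k^2), hence k of them up to O(s / k). *)

Section RowCalculus.
Variable R : realType.

Lemma rV_norm_le p (x : 'rV[R]_p) (e : R) :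
  0 <= e -> (`|x| <= e) = [forall i, `|x 0 i| <= e].
Proof.
move=> e0; rewrite [X in X <= _ = _]/Num.Def.normr/= mx_normrE.
apply/idP/forallP => [h i|h].
  by apply: le_trans h; apply: (le_bigmax _ (fun ij => `|x ij.1 ij.2|) (0, i)).
by apply: bigmax_le => // -[i j] _ /=; rewrite ord1.
Qed.

Lemma rV_coord_le p (x : 'rV[R]_p) i : `|x 0 i| <= `|x|.
Proof. by move: (lexx `|x|); rewrite rV_norm_le// => /forallP/(_ i). Qed.

Lemma row_cvg p (T : Type) (F : set_system T) (FF : Filter F)
    (u : 'I_p -> T -> R) (l : 'rV[R]_p) :
  (forall i, u i x @[x --> F] --> l 0 i) ->
  (\row_i u i x) @[x --> F] --> l.
Proof.
move=> h; apply/cvgrPdist_le => e e0.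
have : \forall x \near F, forall i, `|l 0 i - u i x| <= e.
  by apply: filter_forall => i; exact: (cvgrPdist_le _ _).1 (h i) _ e0.
apply: filterS => x hx; rewrite rV_norm_le ?ltW//.
by apply/forallP => i; rewrite !mxE.
Qed.

Lemma comp_row_continuous p q (Phi : 'rV[R]_q -> R) (U : 'I_q -> 'rV[R]_p -> R) :
  continuous Phi -> (forall i, continuous (U i)) ->
  continuous (fun x => Phi (\row_i U i x)).
Proof.
move=> cP cU x.
have Rx : (\row_i U i z) @[z --> x] --> (\row_i U i x).
  by apply: (@row_cvg q _ (nbhs x) (nbhs_filter x) U) => i; rewrite mxE; exact: cU.
exact: (cvg_comp _ _ Rx (cP _)).
Qed.

Lemma cvg_ord_sum q (T : Type) (F : set_system T) (FF : Filter F)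
    (u : 'I_q -> T -> R) (l : 'I_q -> R) :
  (forall i, u i x @[x --> F] --> l i) ->
  \sum_i u i x @[x --> F] --> \sum_i l i.
Proof.
elim: q u l => [|q IH] u l h.
  under eq_fun do rewrite big_ord0.
  by rewrite big_ord0; exact: cvg_cst.
under eq_fun do rewrite big_ord_recl.
by rewrite big_ord_recl; apply: cvgD; [exact: h|exact: IH].
Qed.

(** Both signs of [d] are covered at once, because increments of coordinates come without a sign. *)
Lemma mvt_from0 (phi : R -> R) (d : R) :
  (forall t, derivable phi t 1) ->
  exists2 t, `|t| <= `|d| & phi d - phi 0 = 'D_1 phi t * d.
Proof.
move=> dphi.
have hd x (a b : R) : x \in `]a, b[%R -> is_derive x 1 phi ('D_1 phi x).
  by move=> _; exact/derivableP.
have hc a b : {within `[a, b], continuous phi}.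
  by apply: continuous_subspaceT => x; exact/differentiable_continuous/derivable1_diffP.
have [d0|d0] := leP 0 d.
  have [c cab ->] := MVT_segment d0 (fun x => @hd x 0 d) (hc 0 d).
  exists c; last by rewrite subr0.
  by move: cab; rewrite in_itv/= => /andP[c0 cd]; rewrite !ger0_norm.
have [c cab E] := MVT_segment (ltW d0) (fun x => @hd x d 0) (hc d 0).
exists c.
  by move: cab; rewrite in_itv/= => /andP[c0 cd]; rewrite (ler0_norm cd) (ltr0_norm d0) lerN2.
by rewrite -[LHS]opprB E sub0r mulrN opprK.
Qed.

Local Notation e_ i := (delta_mx 0 i).

Lemma derivable_line (V W : normedModType R) (F : V -> W) x v t :
  derivable F (x + t *: v) v ->
  is_derive t 1 (fun t => F (x + t *: v)) ('D_v F (x + t *: v)).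
Proof.
have E : (fun h => h^-1 *: (((fun t => F (x + t *: v)) \o shift t) (h *: 1)
    - F (x + t *: v))) =
  (fun h => h^-1 *: ((F \o shift (x + t *: v)) (h *: v) - F (x + t *: v))).
  apply/funext => h /=; congr (_ *: (F _ - _)).
  by rewrite -[h *: 1]/(h * 1) mulr1 scalerDl addrCA.
move=> dF; apply: DeriveDef; first by rewrite /derivable E.
by rewrite /derive E.
Qed.

(** The coordinates are changed from [x] to [y] one at a time, and each change is a one-variable
    mean value theorem. Only partial derivatives enter; there is one intermediate point per
    coordinate, and all of them stay in the box spanned by [x] and [y]. *)
Lemma mvt_coord p (F : 'rV[R]_p -> R) (x y : 'rV[R]_p) :
  (forall x i, derivable F x (e_ i)) ->
  exists xi : 'I_p -> 'rV[R]_p,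
    (forall i j, `|xi i 0 j - x 0 j| <= `|y 0 j - x 0 j|) /\
    F y - F x = \sum_i (y 0 i - x 0 i) * 'D_(e_ i) F (xi i).
Proof.
move=> dF.
(* The first [m] coordinates are taken from [y], so consecutive points differ along a single
   axis. *)
pose w (m : nat) : 'rV[R]_p := \row_j (if (j < m)%N then y 0 j else x 0 j).
have step (i : 'I_p) : exists z : 'rV[R]_p,
    (forall j, `|z 0 j - x 0 j| <= `|y 0 j - x 0 j|) /\
    F (w i.+1) - F (w i) = (y 0 i - x 0 i) * 'D_(e_ i) F z.
  have E : w i.+1 = w i + (y 0 i - x 0 i) *: e_ i.
    apply/rowP => j; rewrite !mxE eqxx /= ltnS leq_eqVlt.
    have [->|ji] := eqVneq j i; first by rewrite eqxx ltnn /= mulr1 subrKC.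
    by rewrite -[(j : nat) == i]/(j == i) (negbTE ji) /= mulr0 addr0.
  have dl t := @derivable_line _ _ F (w i) (e_ i) t (dF _ _).
  have [t td] := @mvt_from0 (fun t => F (w i + t *: e_ i)) (y 0 i - x 0 i)
    (fun t => @ex_derive _ _ _ _ _ _ _ (dl t)).
  rewrite scale0r addr0 -E (@derive_val _ _ _ _ _ _ _ (dl t)) => ->.
  exists (w i + t *: e_ i); split; last by rewrite mulrC.
  move=> j; rewrite !mxE eqxx /=.
  have [->|ji] := eqVneq j i; first by rewrite ltnn mulr1 addrAC subrr add0r.
  by rewrite mulr0 addr0; case: ifP => // _; rewrite subrr normr0.
have [xi hxi] := choice step.
exists xi; split=> [i|]; first exact: (hxi i).1.
have -> : F y - F x = F (w p) - F (w 0%N).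
  by congr (F _ - F _); apply/rowP => j; rewrite !mxE ?ltn_ord.
rewrite -(telescope_sumr (fun m => F (w m)) (leq0n p)) big_mkord.
by apply: eq_bigr => i _; exact: (hxi i).2.
Qed.

(** Only the coordinate directions are differentiated, unlike in [Cr], and the functions live on the
    whole space, so no domain has to be carried through products and compositions. Continuity is
    part of every level since the chain rule rests on continuous partial derivatives. *)
Fixpoint Ck p k (F : 'rV[R]_p -> R) : Prop :=
  continuous F /\
  if k is k'.+1 then
    forall i, (forall x, derivable F x (e_ i)) /\ Ck k' ('D_(e_ i) F)
  else True.

Definition smooth p (F : 'rV[R]_p -> R) := forall k, Ck k F.

Lemma smoothP p (F : 'rV[R]_p -> R) : smooth F <->
  [/\ continuous F, forall i x, derivable F x (e_ i)
    & forall i, smooth ('D_(e_ i) F)].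
Proof.
split=> [sF|[cF dF sF] [|k]]; last 2 first.
- by [].
- by split => // i; split; [exact: dF|exact: sF].
split; first by case: (sF 0%N).
- by move=> i x; case: (sF 1%N) => _ /(_ i)[].
- by move=> i k; case: (sF k.+1) => _ /(_ i)[].
Qed.

Lemma smooth_continuous p (F : 'rV[R]_p -> R) : smooth F -> continuous F.
Proof. by case/smoothP. Qed.

Lemma smooth_derivable p (F : 'rV[R]_p -> R) i x :
  smooth F -> derivable F x (e_ i).
Proof. by case/smoothP. Qed.

Lemma smooth_partial p (F : 'rV[R]_p -> R) i : smooth F -> smooth ('D_(e_ i) F).
Proof. by case/smoothP. Qed.

(** [mvt_coord] splits the increment of [Phi]; the intermediate points tend to the base point and
    the partial derivatives of [Phi] are continuous. Derivability of the inner functions in the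
    single direction [v] is enough, so [V] may be any normed space. *)
Lemma chain_rule (V : normedModType R) q (Phi : 'rV[R]_q -> R)
    (U : 'I_q -> V -> R) x v :
  smooth Phi -> (forall i, derivable (U i) x v) ->
  is_derive x v (fun z => Phi (\row_i U i z))
    (\sum_i 'D_(e_ i) Phi (\row_i U i x) * 'D_v (U i) x).
Proof.
move=> /smoothP[_ dPhi sPhi] dU.
pose u z : 'rV[R]_q := \row_i U i z.
have step h : exists xi : 'I_q -> 'rV[R]_q,
    (forall i j, `|xi i 0 j - U j x| <= `|U j (h *: v + x) - U j x|) /\
    Phi (u (h *: v + x)) - Phi (u x) =
    \sum_i (U i (h *: v + x) - U i x) * 'D_(e_ i) Phi (xi i).
  have [xi [h1 h2]] := mvt_coord (u x) (u (h *: v + x)) (fun x i => dPhi i x).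
  exists xi; split=> [i j|]; first by have := h1 i j; rewrite !mxE.
  by rewrite h2; apply: eq_bigr => i _; rewrite !mxE.
have [xi hxi] := choice step.
have Ulim j : h^-1 *: (U j (h *: v + x) - U j x) @[h --> 0^'] --> 'D_v (U j) x.
  exact: (dU j).
(* Derivability in one direction yields continuity along that line only: the increment is [h] times
   a convergent quotient. *)
have Uc j : (U j (h *: v + x) - U j x) @[h --> 0^'] --> (0 : R).
  have id0 : (h : R) @[h --> 0^'] --> (0 : R) by move=> P hP; exact: nbhs_dnbhs.
  have L := cvgM id0 (Ulim j); rewrite mul0r in L.
  have H : {near 0^', (fun h => h) * (fun h => h^-1 *: (U j (h *: v + x) - U j x)) =1
      (fun h => U j (h *: v + x) - U j x)}.
    near=> h.
    by rewrite /= -[LHS]/(h * (h^-1 * _)) mulVKf//; near: h; exact: nbhs_dnbhs_neq.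
  exact: cvg_trans (near_eq_cvg H) (L _).
have xic i : xi h i @[h --> 0^'] --> u x.
  apply/cvgrPdist_le => e e0.
  have : \forall h \near 0^', forall j, `|U j (h *: v + x) - U j x| <= e.
    apply: (@filter_forall _ _ _ (dnbhs (0:R))) => j.
    move/cvgrPdist_le : (Uc j) => /(_ _ e0).
    by apply: (@filterS _ (dnbhs (0:R)) _) => h; rewrite sub0r normrN.
  apply: (@filterS _ (dnbhs (0:R)) _) => h hh; rewrite rV_norm_le ?ltW//; apply/forallP => j.
  by rewrite !mxE distrC; exact: le_trans ((hxi h).1 i j) (hh j).
have lim : h^-1 *: (Phi (u (h *: v + x)) - Phi (u x)) @[h --> 0^'] -->
    \sum_i 'D_v (U i) x * 'D_(e_ i) Phi (u x).
  have -> : (fun h => h^-1 *: (Phi (u (h *: v + x)) - Phi (u x))) =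
     (fun h => \sum_i h^-1 *: (U i (h *: v + x) - U i x) * 'D_(e_ i) Phi (xi h i)).
    apply/funext => h; rewrite (hxi h).2 scaler_sumr.
    by apply: eq_bigr => i _; rewrite scalerAl.
  apply: cvg_ord_sum => i; apply: cvgM; first exact: Ulim.
  have cD : {for u x, continuous ('D_(e_ i) Phi)} by case: (sPhi i 0%N) => + _; apply.
  exact: (cvg_comp _ _ (xic i) cD).
have -> : \sum_i 'D_(e_ i) Phi (\row_i U i x) * 'D_v (U i) x =
    \sum_i 'D_v (U i) x * 'D_(e_ i) Phi (u x).
  by apply: eq_bigr => i _; rewrite mulrC.
by apply: DeriveDef; [apply/cvg_ex; eexists; exact: lim|exact: cvg_lim lim].
Unshelve. all: by end_near. Qed.

Lemma CkW p k (F : 'rV[R]_p -> R) : Ck k.+1 F -> Ck k F.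
Proof.
elim: k F => [F [cF _]//|k IH F [cF h]]; split=> // i.
by have [dF CF] := h i; split => //; exact: IH.
Qed.

Lemma Ck_cst p k (c : R) : Ck k (fun _ : 'rV[R]_p => c).
Proof.
elim: k c => [|k IH] c; split; try exact: cst_continuous.
  by [].
move=> i; split; first by move=> x; exact: derivable_cst.
have -> : 'D_(e_ i) (fun _ : 'rV[R]_p => c) = fun=> 0.
  by apply/funext => x; rewrite derive_cst.
exact: IH.
Qed.

Lemma CkD p k (F G : 'rV[R]_p -> R) : Ck k F -> Ck k G -> Ck k (fun x => F x + G x).
Proof.
elim: k F G => [|k IH] F G [cF hF] [cG hG]; split.
- by move=> x; exact: cvgD (cF x) (cG x).
- by [].
- by move=> x; exact: cvgD (cF x) (cG x).
move=> i; have [[dF CF] [dG CG]] := (hF i, hG i).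
split; first by move=> x; exact: derivableD.
have -> : 'D_(e_ i) (fun x => F x + G x) =
    fun x => 'D_(e_ i) F x + 'D_(e_ i) G x.
  by apply/funext => x; exact: deriveD.
exact: IH.
Qed.

Lemma CkM p k (F G : 'rV[R]_p -> R) : Ck k F -> Ck k G -> Ck k (fun x => F x * G x).
Proof.
elim: k F G => [|k IH] F G CkF CkG; have [cF hF] := CkF; have [cG hG] := CkG; split.
- by move=> x; exact: cvgM (cF x) (cG x).
- by [].
- by move=> x; exact: cvgM (cF x) (cG x).
move=> i; have [[dF CF] [dG CG]] := (hF i, hG i).
split; first by move=> x; exact: derivableM.
have -> : 'D_(e_ i) (fun x => F x * G x) =
    fun x => F x * 'D_(e_ i) G x + G x * 'D_(e_ i) F x.
  by apply/funext => x; exact: deriveM.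
by apply: CkD; apply: IH => //; exact: CkW.
Qed.

Lemma Ck_sum p k q (F : 'I_q -> 'rV[R]_p -> R) :
  (forall i, Ck k (F i)) -> Ck k (fun x => \sum_i F i x).
Proof.
elim: q F => [|q IH] F h.
  under [X in Ck k X]funext do rewrite big_ord0.
  exact: Ck_cst.
under [X in Ck k X]funext do rewrite big_ord_recl.
by apply: CkD; [exact: h|exact: IH].
Qed.

(** The induction generalises over [Phi], since differentiating replaces it by its partial
    derivatives at the same inner functions. *)
Lemma Ck_comp p k q (Phi : 'rV[R]_q -> R) (U : 'I_q -> 'rV[R]_p -> R) :
  smooth Phi -> (forall i, Ck k (U i)) -> Ck k (fun x => Phi (\row_i U i x)).
Proof.
elim: k Phi U => [|k IH] Phi U sPhi CU.
  by split=> //; apply: comp_row_continuous => [|i]; [case: (sPhi 0%N)|exact: (CU i).1].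
split.
  by apply: comp_row_continuous => [|i]; [case: (sPhi 0%N)|exact: (CU i).1].
move=> i.
have D x : is_derive x (e_ i) (fun x => Phi (\row_i U i x))
    (\sum_j 'D_(e_ j) Phi (\row_i U i x) * 'D_(e_ i) (U j) x).
  by apply: chain_rule => // j; have [_ /(_ i)[]] := CU j.
split; first by move=> x; exact: (@ex_derive _ _ _ _ _ _ _ (D x)).
have -> : 'D_(e_ i) (fun x => Phi (\row_i U i x)) =
    fun x => \sum_j 'D_(e_ j) Phi (\row_i U i x) * 'D_(e_ i) (U j) x.
  by apply/funext => x; rewrite (@derive_val _ _ _ _ _ _ _ (D x)).
apply: Ck_sum => j; apply: CkM; last by have [_ /(_ i)[]] := CU j.
by apply: (IH ('D_(e_ j) Phi)); [exact: smooth_partial|move=> l; exact: CkW].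
Qed.

Lemma Ck_coord p k (i : 'I_p) : Ck k (fun x : 'rV[R]_p => x 0 i).
Proof.
have c : continuous (fun x : 'rV[R]_p => x 0 i) by exact: coord_continuous.
case: k => [|k]; first by split.
split => // j.
have D x : is_derive x (e_ j) (fun x : 'rV[R]_p => x 0 i) (i == j)%:R.
  have d : derivable (id : 'rV[R]_p -> _) x (e_ j) by exact: derivable_id.
  have := derive_mx d; rewrite derive_id => /rowP/(_ i); rewrite !mxE eqxx/= => E.
  by apply: DeriveDef; [exact: (derivable_mxP _ _ _).1|rewrite -E].
split; first by move=> x; exact: (@ex_derive _ _ _ _ _ _ _ (D x)).
have -> : 'D_(e_ j) (fun x : 'rV[R]_p => x 0 i) = fun=> (i == j)%:R.
  by apply/funext => x; rewrite (@derive_val _ _ _ _ _ _ _ (D x)).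
exact: Ck_cst.
Qed.

Lemma smooth_cst p (c : R) : smooth (fun _ : 'rV[R]_p => c).
Proof. by move=> k; exact: Ck_cst. Qed.

Lemma smooth_coord p (i : 'I_p) : smooth (fun x : 'rV[R]_p => x 0 i).
Proof. by move=> k; exact: Ck_coord. Qed.

Lemma smoothD p (F G : 'rV[R]_p -> R) :
  smooth F -> smooth G -> smooth (fun x => F x + G x).
Proof. by move=> sF sG k; exact: CkD. Qed.

Lemma smoothM p (F G : 'rV[R]_p -> R) :
  smooth F -> smooth G -> smooth (fun x => F x * G x).
Proof. by move=> sF sG k; exact: CkM. Qed.

Lemma smoothN p (F : 'rV[R]_p -> R) : smooth F -> smooth (fun x => - F x).
Proof.
by move=> sF; under [X in smooth X]funext do rewrite -mulN1r; apply: smoothM => //;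
  exact: smooth_cst.
Qed.

Lemma smoothX p (F : 'rV[R]_p -> R) n : smooth F -> smooth (fun x => F x ^+ n).
Proof.
move=> sF; elim: n => [|n IH]; first by exact: smooth_cst.
by under [X in smooth X]funext do rewrite exprS; exact: smoothM.
Qed.

Lemma smooth_sum p q (F : 'I_q -> 'rV[R]_p -> R) :
  (forall i, smooth (F i)) -> smooth (fun x => \sum_i F i x).
Proof. by move=> sF k; apply: Ck_sum => i; exact: sF. Qed.

Lemma smooth_comp p q (Phi : 'rV[R]_q -> R) (U : 'I_q -> 'rV[R]_p -> R) :
  smooth Phi -> (forall i, smooth (U i)) -> smooth (fun x => Phi (\row_i U i x)).
Proof. by move=> sPhi sU k; apply: Ck_comp => // i; exact: sU. Qed.

Lemma derive_dir p (F : 'rV[R]_p -> R) x v : smooth F ->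
  is_derive x v F (\sum_i v 0 i * 'D_(e_ i) F x).
Proof.
move=> sF.
have D i : is_derive x v (fun x : 'rV[R]_p => x 0 i) (v 0 i).
  have d : derivable (id : 'rV[R]_p -> _) x v by exact: derivable_id.
  have := derive_mx d; rewrite derive_id => /rowP/(_ i); rewrite !mxE => E.
  by apply: DeriveDef; [exact: (derivable_mxP _ _ _).1|rewrite -E].
have := @chain_rule _ _ F (fun i (x : 'rV[R]_p) => x 0 i) x v sF
  (fun i => @ex_derive _ _ _ _ _ _ _ (D i)).
have E (z : 'rV[R]_p) : \row_i z 0 i = z by apply/rowP => i; rewrite mxE.
have -> : (fun z : 'rV[R]_p => F (\row_i z 0 i)) = F by apply/funext => z; rewrite E.
move=> [d e]; apply: DeriveDef => //; rewrite e; apply: eq_bigr => i _.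
by rewrite E mulrC (@derive_val _ _ _ _ _ _ _ (D i)).
Qed.

Lemma derive_scaled p (F : 'rV[R]_p -> R) x (c : R) i : smooth F ->
  is_derive x (c *: e_ i) F (c * 'D_(e_ i) F x).
Proof.
move=> sF; apply: is_derive_eq (derive_dir x (c *: e_ i) sF) _.
have E l : (c *: e_ i) 0 l * 'D_(e_ l) F x = (if l == i then c * 'D_(e_ i) F x else 0) :> R.
  rewrite !mxE /=; have [->|li] := eqVneq l i; first by rewrite mulr1.
  by rewrite mulr0 mul0r.
under eq_bigr do rewrite E.
by rewrite -big_mkcond /= big_pred1_eq.
Qed.

End RowCalculus.

(** * Hadamard's lemma *)

Section Hadamard.
Variable R : realType.
Local Notation e_ i := (delta_mx 0 i).

Lemma continuous_bounded_cube p (g : 'rV[R]_p -> R) (M : R) : continuous g ->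
  exists2 C : R, 0 <= C & forall x, `|x| <= M -> `|g x| <= C.
Proof.
move=> cg; have [M0|M0] := leP 0 M; last first.
  by exists 0 => // x /(le_lt_trans)/(_ M0); rewrite normr_lt0.
pose A : set 'rV[R]_p := [set x | `|x| <= M].
have cA : compact A.
  apply: bounded_closed_compact.
    exists M; split; first exact: num_real.
    by move=> y My x Ax; exact: le_trans Ax (ltW My).
  have -> : A = (fun x : 'rV[R]_p => `|x|) @^-1` [set r | r <= M] by [].
  apply: closed_comp; last exact: closed_le.
  by move=> x _; exact: norm_continuous.
have cg' : {within A, continuous (fun x => `|g x|)}.
  by apply: continuous_subspaceT => x; apply: (cvg_norm (cg x)).
have A0 : A !=set0 by exists 0; rewrite /A/= normr0.
have [c _ hc] := EVT_max_rV A0 cA cg'.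
by exists `|g c| => // x xM; apply: hc; rewrite inE.
Qed.

Lemma smooth_lipschitz_cube p (g : 'rV[R]_p -> R) (M : R) : smooth g ->
  exists2 C : R, 0 <= C & forall x y, `|x| <= M -> `|y| <= M ->
    `|g x - g y| <= C * `|x - y|.
Proof.
move=> sg.
(* The intermediate points are known to be within [|x - y| <= 2 * M] of [y], hence the larger cube
   of radius [3 * M]. *)
have h i : exists C : R, 0 <= C /\ forall x, `|x| <= 3 * M -> `|'D_(e_ i) g x| <= C.
  have [C C0 hC] := continuous_bounded_cube (3 * M)
    (smooth_continuous (smooth_partial i sg)).
  by exists C.
have [C hC] := choice h.
exists (\sum_i C i); first by apply: sumr_ge0 => i _; exact: (hC i).1.
move=> x y xM yM.
have [xi [hxi ->]] := mvt_coord y x (fun x i => smooth_derivable sg).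
rewrite (le_trans (ler_norm_sum _ _ _))// mulr_suml; apply: ler_sum => i _.
rewrite normrM mulrC ler_pM//.
  apply: (hC i).2.
  have -> : xi i = y + (xi i - y) by rewrite addrC subrK.
  have h1 : `|xi i - y| <= `|x - y|.
    rewrite rV_norm_le//; apply/forallP => j; rewrite !mxE.
    apply: le_trans (hxi i j) _.
    by apply: le_trans (rV_coord_le (x - y) j); rewrite !mxE.
  apply: le_trans (ler_normD _ _) _.
  have := ler_normB x y; lra.
by have := rV_coord_le (x - y) i; rewrite !mxE.
Qed.

(** As [t] runs from 0 to 1 this traces the segment from the projection of [x] onto the hyperplane
    [x_j = 0] to [x] itself, the path of integration in Hadamard's lemma. *)
Definition cut p (j : 'I_p) (t : R) (x : 'rV[R]_p) : 'rV[R]_p :=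
  \row_i (if i == j then t * x 0 i else x 0 i).

(** The weight [t ^+ n] serves the induction: differentiating along axis [j] produces a factor [t],
    along the other axes none, so partial derivatives of such averages are again such averages. *)
Definition avg p (j : 'I_p) (n : nat) (g : 'rV[R]_p -> R) (x : 'rV[R]_p) : R :=
  \int[lebesgue_measure]_(t in `[0, 1]) (t ^+ n * g (cut j t x)).

Lemma cut_continuous p (j : 'I_p) (x : 'rV[R]_p) : continuous (fun t => cut j t x).
Proof.
move=> t; apply: (@row_cvg _ _ _ (nbhs t) (nbhs_filter t)
  (fun i (t : R) => if i == j then t * x 0 i else x 0 i)) => i.
rewrite mxE; case: ifP => _; last exact: cvg_cst.
by apply: cvgM; [exact: cvg_id|exact: cvg_cst].
Qed.

Lemma cut_norm p (j : 'I_p) t (x : 'rV[R]_p) : 0 <= t <= 1 -> `|cut j t x| <= `|x|.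
Proof.
move=> /andP[t0 t1]; rewrite rV_norm_le//; apply/forallP => i; rewrite !mxE.
case: ifP => _; last exact: rV_coord_le.
by rewrite normrM ger0_norm// (le_trans _ (rV_coord_le x i))// ler_piMl.
Qed.

Lemma avg_integrand_continuous p (j : 'I_p) n (g : 'rV[R]_p -> R) x :
  continuous g -> continuous (fun t : R => t ^+ n * g (cut j t x)).
Proof.
move=> cg t; apply: cvgM; first exact: exprn_continuous.
exact: (cvg_comp _ _ (@cut_continuous p j x t) (cg _)).
Qed.

Lemma avg_integrable p (j : 'I_p) n (g : 'rV[R]_p -> R) x : continuous g ->
  (lebesgue_measure).-integrable `[0%R, 1%R]
    (EFin \o (fun t : R => t ^+ n * g (cut j t x))).
Proof.
move=> cg; apply: continuous_compact_integrable; first exact: segment_compact.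
by apply: continuous_subspaceT; exact: avg_integrand_continuous.
Qed.

Lemma cst_integrable (C : R) :
  (lebesgue_measure).-integrable `[0%R, 1%R] (EFin \o (fun _ : R => C)).
Proof.
apply: continuous_compact_integrable; first exact: segment_compact.
by apply: continuous_subspaceT => x; exact: cvg_cst.
Qed.

Lemma avg_continuous p (j : 'I_p) n (g : 'rV[R]_p -> R) :
  smooth g -> continuous (avg j n g).
Proof.
move=> sg x; have cg := smooth_continuous sg.
have [C C0 hC] := smooth_lipschitz_cube (`|x| + 1) sg.
have lip y : `|x - y| <= 1 -> `|avg j n g x - avg j n g y| <= C * `|x - y|.
  move=> xy.
  rewrite /avg -RintegralB//; [|exact: avg_integrable..].
  apply: le_trans (le_normr_Rintegral _ _) _ => //.
    apply: continuous_compact_integrable; first exact: segment_compact.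
    apply: continuous_subspaceT => t; apply: cvgB; exact: avg_integrand_continuous.
  have -> : C * `|x - y| = \int[lebesgue_measure]_(t in `[0%R, 1%R]) (C * `|x - y|).
    have mu1 : lebesgue_measure (`[0%R, 1%R] : set R) = 1%E.
      by rewrite lebesgue_measure_itv /= lte_fin ltr01 oppr0 adde0.
    rewrite Rintegral_cst// -[LHS]mulr1; congr (_ * _).
    exact: (esym (congr1 fine mu1)).
  apply: le_Rintegral => //; last 1 first.
  - move=> t; rewrite /= in_itv/= => t01; rewrite -mulrBr normrM.
    have [t0 t1] := andP t01.
    have -> : cut j t x = cut j t y + cut j t (x - y).
      by apply/rowP => i; rewrite !mxE; case: ifP => _; ring.
    apply: (@le_trans _ _ (1 * (C * `|cut j t (x - y)|))).
      apply: ler_pM => //; first by rewrite ger0_norm ?exprn_ge0// exprn_ile1.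
      have -> : cut j t y + cut j t (x - y) = cut j t x.
        by apply/rowP => i; rewrite !mxE; case: ifP => _; ring.
      have -> : cut j t (x - y) = cut j t x - cut j t y.
        by apply/rowP => i; rewrite !mxE; case: ifP => _; ring.
      apply: hC; apply: le_trans (cut_norm _ _ t01) _; first lra.
      have -> : y = x - (x - y) by rewrite subKr.
      by apply: le_trans (ler_normB _ _) _; lra.
    by rewrite mul1r ler_wpM2l// cut_norm.
  - apply: continuous_compact_integrable; first exact: segment_compact.
    apply: continuous_subspaceT => t; apply: cvg_norm; apply: cvgB;
      exact: avg_integrand_continuous.
  - exact: cst_integrable.
apply/(@cvgrPdist_le _ _ _ (nbhs x) (nbhs_filter x)) => e e0.
have d0 : 0 < Num.min 1 (e / (C + 1)).
  by rewrite lt_min ltr01 divr_gt0// ltr_wpDl.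
apply: filterS (nbhsx_ballx x _ d0) => y.
rewrite -ball_normE /ball_/= lt_min => /andP[y1 ye].
apply: le_trans (lip _ (ltW y1)) _.
apply: le_trans (ler_wpM2l C0 (ltW ye)) _.
by rewrite mulrCA ger_pMr// ler_pdivrMr ?ltr_wpDl//; lra.
Qed.

(** Differentiation under the integral sign: the partial derivative of [g], bounded on the cube of
    radius [|x| + 1], gives a constant dominating function for increments in [(-1, 1)]. *)
Lemma avg_derive p (j : 'I_p) n (g : 'rV[R]_p -> R) (i : 'I_p) x : smooth g ->
  is_derive x (e_ i) (avg j n g) (avg j (n + (i == j)) ('D_(e_ i) g) x).
Proof.
move=> sg.
(* The speed of [cut j t x] when [x] moves along axis [i]. *)
pose tau (t : R) : R := if i == j then t else 1.
have cutD s t : cut j t (s *: e_ i + x) = cut j t x + s *: (tau t *: e_ i).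
  apply/rowP => l; rewrite !mxE eqxx /= /tau.
  by have [->|li] := eqVneq l i; case: ifP => _ //; rewrite ?mulr0 ?mulr1 ?addr0 ?add0r //; ring.
pose f (s t : R) := t ^+ n * g (cut j t (s *: e_ i + x)).
have Df (t s : R) : is_derive s 1 (fun s => f s t : R)
    (t ^+ (n + (i == j)) * 'D_(e_ i) g (cut j t (s *: e_ i + x))).
  have := @derivable_line _ _ _ g (cut j t x) (tau t *: e_ i) s.
  have dd := derive_scaled (cut j t x + s *: (tau t *: e_ i)) (tau t) i sg.
  move=> /(_ (@ex_derive _ _ _ _ _ _ _ dd)).
  rewrite (@derive_val _ _ _ _ _ _ _ dd).
  move=> H; have H2 := is_deriveM (is_derive_cst (t ^+ n) s 1) H.
  have -> : f ^~ t = (cst (t ^+ n) * (fun t0 => g (cut j t x + t0 *: (tau t *: e_ i)))).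
    by apply/funext => u; rewrite /f cutD.
  apply: is_derive_eq H2 _.
  rewrite scaler0 addr0 cutD /= /tau exprD.
  by case: (i == j) => /=; rewrite ?expr1 ?expr0 ?mulr1 ?mul1r// -[LHS]/(_ * _) mulrA.
have [C C0 hC] := continuous_bounded_cube (`|x| + 1)
  (smooth_continuous (smooth_partial i sg)).
have key : h^-1 *: (avg j n g (h *: e_ i + x) - avg j n g x) @[h --> 0^'] -->
    avg j (n + (i == j)) ('D_(e_ i) g) x.
  have := @cvg_differentiation_under_integral R _ _ lebesgue_measure f `[0%R, 1%R]
    _ 0 (-1) 1 _ _ _ (fun=> C) _ _ _.
  move=> /(_ (measurable_itv _)).
  have I0 : [set` `](-1)%R, 1%R[] (0 : R) by rewrite /= in_itv/=; lra.
  move=> /(_ I0).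
  have c1 s : [set` `](-1)%R, 1%R[] s -> (lebesgue_measure).-integrable `[0%R, 1%R] (EFin \o f s).
    by move=> _; exact/avg_integrable/smooth_continuous.
  move=> /(_ c1 (fun s t _ _ => @ex_derive _ _ _ _ _ _ _ (Df t s))).
  move=> /(_ (fun=> C0) (cst_integrable C)).
  have c2 s t : [set` `](-1)%R, 1%R[] s -> [set` `[0%R, 1%R]] t -> `|partial1of2 f s t| <= C.
    rewrite /= !in_itv/= => s1 t01; rewrite partial1of2E (@derive_val _ _ _ _ _ _ _ (Df t s)).
    have [t0 t1] := andP t01.
    rewrite normrM -[leRHS]mul1r ler_pM//.
      by rewrite ger0_norm ?exprn_ge0// exprn_ile1.
    apply: hC; apply: le_trans (cut_norm _ _ t01) _.
    rewrite addrC (le_trans (ler_normD _ _))// lerD2l normrZ.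
    have -> : `|e_ i : 'rV[R]_p| = 1.
      apply/eqP; rewrite eq_le; apply/andP; split.
        rewrite rV_norm_le//; apply/forallP => l; rewrite !mxE /=.
        by case: (l == i); rewrite ?normr1 ?normr0.
      by have := rV_coord_le (e_ i : 'rV[R]_p) i; rewrite mxE !eqxx normr1.
    by rewrite mulr1 ler_norml; lra.
  move=> /(_ c2).
  have -> : \int[lebesgue_measure]_(y in `[0%R, 1%R]) partial1of2 f 0 y =
      avg j (n + (i == j)) ('D_(e_ i) g) x.
    rewrite /avg; apply: eq_Rintegral => t _.
    by rewrite partial1of2E (@derive_val _ _ _ _ _ _ _ (Df t 0)) scale0r add0r.
  under eq_fun do rewrite addr0.
  by rewrite /f scale0r add0r.
by apply: DeriveDef; [apply/cvg_ex; eexists; exact: key|exact: cvg_lim key].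
Qed.

Lemma smooth_avg p (j : 'I_p) n (g : 'rV[R]_p -> R) : smooth g -> smooth (avg j n g).
Proof.
move=> + k; elim: k n g => [|k IH] n g sg; split => //; try exact: avg_continuous.
move=> i; split=> [x|]; first exact: (@ex_derive _ _ _ _ _ _ _ (avg_derive j n i x sg)).
have -> : 'D_(e_ i) (avg j n g) = avg j (n + (i == j)) ('D_(e_ i) g).
  by apply/funext => x; rewrite (@derive_val _ _ _ _ _ _ _ (avg_derive j n i x sg)).
by apply: IH; exact: smooth_partial.
Qed.

(** The quotient is the average of the partial derivative along the segment traced by [cut], by the
    fundamental theorem of calculus. As an integral it is smooth across the hyperplane where
    dividing by [x 0 j] would be singular. *)
Lemma hadamard p (j : 'I_p) (g : 'rV[R]_p -> R) : smooth g ->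
  exists2 h, smooth h & forall x, g x = g (cut j 0 x) + x 0 j * h x.
Proof.
move=> sg; exists (avg j 0 ('D_(e_ j) g)); first exact/smooth_avg/smooth_partial.
move=> x.
have cutE t : cut j t x = cut j 0 x + t *: (x 0 j *: e_ j).
  apply/rowP => l; rewrite !mxE eqxx /=.
  by have [->|lj] := eqVneq l j; rewrite ?mulr1 ?mulr0 ?mul0r ?add0r ?addr0.
pose F (t : R) : R := g (cut j t x).
have DF (t : R) : is_derive t 1 F (x 0 j * 'D_(e_ j) g (cut j t x)).
  have dd := derive_scaled (cut j 0 x + t *: (x 0 j *: e_ j)) (x 0 j) j sg.
  have := @derivable_line _ _ _ g (cut j 0 x) (x 0 j *: e_ j) t
    (@ex_derive _ _ _ _ _ _ _ dd).
  rewrite (@derive_val _ _ _ _ _ _ _ dd) -(cutE t).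
  have -> // : (fun t => g (cut j 0 x + t *: (x 0 j *: e_ j))) = F.
  by apply/funext => s; rewrite /F (cutE s).
have cF : continuous F.
  by move=> t; apply/differentiable_continuous/derivable1_diffP; exact: (@ex_derive _ _ _ _ _ _ _ (DF t)).
have cD := smooth_continuous (smooth_partial j sg).
pose f t := x 0 j * (t ^+ 0 * 'D_(e_ j) g (cut j t x)).
have ftc : (\int[lebesgue_measure]_(t in `[0%R, 1%R]) (f t)%:E = (F 1)%:E - (F 0)%:E)%E.
  apply: continuous_FTC2 => //.
  - apply: continuous_subspaceT => t.
    exact: (cvgM (cvg_cst _) (@avg_integrand_continuous p j 0 _ x cD t)).
  - split => [t _||].
    + exact: (@ex_derive _ _ _ _ _ _ _ (DF t)).
    + exact/cvg_at_right_filter/cF.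
    + exact/cvg_at_left_filter/cF.
  - by move=> t _; rewrite derive1E (@derive_val _ _ _ _ _ _ _ (DF t)) /f expr0 mul1r.
have E : \int[lebesgue_measure]_(t in `[0%R, 1%R]) f t = x 0 j * avg j 0 ('D_(e_ j) g) x.
  by have := RintegralZl (x 0 j) _ (avg_integrable j 0 x cD); apply; exact: measurable_itv.
have : \int[lebesgue_measure]_(t in `[0%R, 1%R]) f t = F 1 - F 0.
  exact: (congr1 fine ftc).
rewrite E => ->; rewrite /F.
have -> : cut j 1 x = x by apply/rowP => l; rewrite mxE mul1r if_same.
by rewrite addrC subrK.
Qed.

End Hadamard.

(** * Smooth functions bounded uniformly in a parameter *)

Section UniformBounds.
Variable R : realType.
Local Notation e_ i := (delta_mx 0 i).

(** A bound on all partial derivatives of order at most [r]. They are derivatives of the globally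
    defined function; [A] restricts only the points where they are evaluated, and may be any set. *)
Fixpoint Bd p (r : nat) (A : set 'rV[R]_p) (M : R) (u : 'rV[R]_p -> R) : Prop :=
  (forall x, A x -> `|u x| <= M) /\
  if r is r'.+1 then forall j, Bd r' A M ('D_(e_ j) u) else True.

Variable p : nat.
Implicit Types (A : set 'rV[R]_p) (u v : 'rV[R]_p -> R) (M : R).

Lemma partialD u v i : smooth u -> smooth v ->
  'D_(e_ i) (fun x => u x + v x) = (fun x => 'D_(e_ i) u x + 'D_(e_ i) v x).
Proof.
by move=> su sv; apply/funext => x; apply: deriveD; exact: smooth_derivable.
Qed.

Lemma partialM u v i : smooth u -> smooth v ->
  'D_(e_ i) (fun x => u x * v x) =
  (fun x => u x * 'D_(e_ i) v x + v x * 'D_(e_ i) u x).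
Proof.
by move=> su sv; apply/funext => x; apply: deriveM; exact: smooth_derivable.
Qed.

Lemma partial_comp q (Phi : 'rV[R]_q -> R) (U : 'I_q -> 'rV[R]_p -> R) i :
  smooth Phi -> (forall j, smooth (U j)) ->
  'D_(e_ i) (fun x => Phi (\row_j U j x)) =
  (fun x => \sum_j 'D_(e_ j) Phi (\row_j U j x) * 'D_(e_ i) (U j) x).
Proof.
move=> sPhi sU; apply/funext => x.
have dU j : derivable (U j) x (e_ i) by exact: smooth_derivable.
by rewrite (@derive_val _ _ _ _ _ _ _ (chain_rule sPhi dU)).
Qed.

Lemma partial_cst (c : R) i : 'D_(e_ i) (fun _ : 'rV[R]_p => c) = fun=> 0.
Proof. by apply/funext => x; rewrite derive_cst. Qed.

Lemma partial_coord (i j : 'I_p) :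
  'D_(e_ i) (fun x : 'rV[R]_p => x 0 j) = fun=> (j == i)%:R.
Proof.
apply/funext => x.
have d : derivable (id : 'rV[R]_p -> _) x (e_ i) by exact: derivable_id.
by have := derive_mx d; rewrite derive_id => /rowP/(_ j); rewrite !mxE eqxx/= => <-.
Qed.

Lemma partialDE u v i x : smooth u -> smooth v ->
  'D_(e_ i) (fun x => u x + v x) x = 'D_(e_ i) u x + 'D_(e_ i) v x.
Proof. by move=> su sv; apply: deriveD; exact: smooth_derivable. Qed.

Lemma partialME u v i x : smooth u -> smooth v ->
  'D_(e_ i) (fun x => u x * v x) x = u x * 'D_(e_ i) v x + v x * 'D_(e_ i) u x.
Proof. by move=> su sv; apply: deriveM; exact: smooth_derivable. Qed.

Lemma partialNE u i x : smooth u -> 'D_(e_ i) (fun x => - u x) x = - 'D_(e_ i) u x.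
Proof. by move=> su; apply: deriveN; exact: smooth_derivable. Qed.

Lemma partial_cstE (c : R) i x : 'D_(e_ i) (fun _ : 'rV[R]_p => c) x = 0.
Proof. exact: derive_cst. Qed.

Lemma partial_coordE (i j : 'I_p) x :
  'D_(e_ i) (fun x : 'rV[R]_p => x 0 j) x = (j == i)%:R.
Proof. exact: (congr1 (fun f => f x) (partial_coord i j)). Qed.

Lemma BdW r A M M' u : M <= M' -> Bd r A M u -> Bd r A M' u.
Proof.
move=> MM'; elim: r u => [|r IH] u [h1 h2]; split => //;
  try by move=> x Ax; exact: le_trans (h1 _ Ax) MM'.
by move=> j; exact/IH/h2.
Qed.

Lemma BdS r A M u : Bd r.+1 A M u -> Bd r A M u.
Proof.
elim: r u => [|r IH] u [h1 h2]; split => //.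
by move=> j; exact/IH/h2.
Qed.

Lemma Bd_bound r A M u x : Bd r A M u -> A x -> `|u x| <= M.
Proof. by case: r => [|r] [h _]; exact: h. Qed.

Lemma BdD r A M1 M2 u v : smooth u -> smooth v ->
  Bd r A M1 u -> Bd r A M2 v -> Bd r A (M1 + M2) (fun x => u x + v x).
Proof.
elim: r u v => [|r IH] u v su sv [hu1 hu2] [hv1 hv2]; split => //;
  try by move=> x Ax; rewrite (le_trans (ler_normD _ _))// lerD ?hu1 ?hv1.
move=> j; rewrite partialD//.
by apply: IH; [exact: smooth_partial|exact: smooth_partial|exact: hu2|exact: hv2].
Qed.

(** Each differentiation doubles the number of terms in Leibniz' rule, whence the factor
    [2 ^+ r]. *)
Lemma BdM r A M1 M2 u v : smooth u -> smooth v ->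
  Bd r A M1 u -> Bd r A M2 v -> Bd r A (2 ^+ r * (M1 * M2)) (fun x => u x * v x).
Proof.
elim: r u v M1 M2 => [|r IH] u v M1 M2 su sv hu hv; have [hu1 hu2] := hu; have [hv1 hv2] := hv.
  by split=> // x Ax; rewrite expr0 mul1r normrM ler_pM ?hu1 ?hv1.
split=> [x Ax|j].
  (* Nonnegativity of the constants is read off at a point of [A], which might be empty. *)
  have u1 := hu1 _ Ax; have v1 := hv1 _ Ax.
  have M1_ge0 : 0 <= M1 by apply: le_trans u1.
  have M2_ge0 : 0 <= M2 by apply: le_trans v1.
  apply: (@le_trans _ _ (M1 * M2)); first by rewrite normrM ler_pM.
  by rewrite ler_peMl ?mulr_ge0// exprn_ege1// ler1n.
rewrite partialM//.
have -> : 2 ^+ r.+1 * (M1 * M2) = 2 ^+ r * (M1 * M2) + 2 ^+ r * (M2 * M1) by rewrite exprS; ring.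
apply: BdD.
- by apply: smoothM => //; exact: smooth_partial.
- by apply: smoothM => //; exact: smooth_partial.
- by apply: IH; [|exact: smooth_partial|exact: BdS|exact: hv2].
- by apply: IH; [|exact: smooth_partial|exact: BdS|exact: hu2].
Qed.

Lemma Bd_cst r A (c : R) : Bd r A `|c| (fun=> c).
Proof.
elim: r c => [|r IH] c; split => // j; rewrite partial_cst.
by apply: BdW (IH 0); rewrite normr0.
Qed.

Lemma BdN r A M u : smooth u -> Bd r A M u -> Bd r A M (fun x => - u x).
Proof.
elim: r u => [|r IH] u su [h1 h2]; split => //;
  try by move=> x Ax; rewrite normrN h1.
move=> j; have -> : 'D_(e_ j) (fun x => - u x) = fun x => - 'D_(e_ j) u x.
  by apply/funext => x; apply: deriveN; exact: smooth_derivable.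
by apply: IH; [exact: smooth_partial|exact: h2].
Qed.

Lemma Bd_coord r A M (i : 'I_p) : 1 <= M -> (forall x, A x -> `|x 0 i| <= M) ->
  Bd r A M (fun x : 'rV[R]_p => x 0 i).
Proof.
move=> M1 AM; case: r => [|r]; split => // j.
rewrite partial_coord; apply: BdW (Bd_cst r A (i == j)%:R).
by case: (i == j); rewrite ?normr1// normr0; exact: le_trans M1.
Qed.

Lemma Bd_sum r A q (M : 'I_q -> R) (u : 'I_q -> 'rV[R]_p -> R) :
  (forall i, smooth (u i)) -> (forall i, Bd r A (M i) (u i)) ->
  Bd r A (\sum_i M i) (fun x => \sum_i u i x).
Proof.
elim: q M u => [|q IH] M u su h.
  under [X in Bd _ _ _ X]funext do rewrite big_ord0.
  by rewrite big_ord0; apply: BdW (Bd_cst r A 0); rewrite normr0.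
under [X in Bd _ _ _ X]funext do rewrite big_ord_recl.
rewrite big_ord_recl; apply: BdD; [exact: su| |exact: h|].
- by apply: smooth_sum => i; exact: su.
- by apply: IH => i; [exact: su|exact: h].
Qed.

(** [C] depends on [Phi], [r] and [M], but neither on the inner functions nor on [A]; this
    uniformity is what allows compositions along orbits of growing length. *)
Lemma Bd_comp q (Phi : 'rV[R]_q -> R) r (M : R) : smooth Phi ->
  exists2 C : R, 0 <= C & forall A (U : 'I_q -> 'rV[R]_p -> R),
    (forall i, smooth (U i)) -> (forall i, Bd r A M (U i)) ->
    Bd r A C (fun x => Phi (\row_i U i x)).
Proof.
elim: r Phi => [|r IH] Phi sPhi.
all: have [C0 C0_ge0 hC0] := continuous_bounded_cube `|M| (smooth_continuous sPhi).
all: have bd0 r' A (U : 'I_q -> 'rV[R]_p -> R) : (forall i, Bd r' A M (U i)) ->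
    forall x, A x -> `|Phi (\row_i U i x)| <= C0.
  1,3: move=> BU x Ax; apply: hC0; rewrite rV_norm_le//; apply/forallP => i;
    rewrite !mxE; apply: le_trans (Bd_bound (BU i) Ax) _; exact: ler_norm.
- by exists C0 => // A U sU BU; split => //; exact: bd0 BU.
have h i : exists C : R, 0 <= C /\ forall A (U : 'I_q -> 'rV[R]_p -> R),
    (forall i, smooth (U i)) -> (forall i, Bd r A M (U i)) ->
    Bd r A C (fun x => 'D_(e_ i) Phi (\row_i U i x)).
  by have [C C_ge0 hC] := IH _ (smooth_partial i sPhi); exists C.
have [C hC] := choice h.
exists (C0 + \sum_i 2 ^+ r * (C i * `|M|)).
  rewrite addr_ge0// sumr_ge0// => i _; rewrite !mulr_ge0 ?exprn_ge0 ?ler0n//.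
  exact: (hC i).1.
have S0 : 0 <= \sum_i 2 ^+ r * (C i * `|M|).
  rewrite sumr_ge0// => i _; rewrite !mulr_ge0 ?exprn_ge0 ?ler0n//.
  exact: (hC i).1.
move=> A U sU BU; split=> [x Ax|j].
  by rewrite (le_trans (bd0 _ _ _ BU x Ax))// lerDl.
rewrite partial_comp//; apply: (@BdW _ _ (\sum_i 2 ^+ r * (C i * `|M|))).
  by rewrite lerDr.
have sD i : smooth (fun x => 'D_(e_ i) Phi (\row_i U i x)).
  exact: (smooth_comp (smooth_partial i sPhi)).
apply: Bd_sum => i.
  by apply: smoothM => //; exact: smooth_partial.
apply: BdM => //; first exact: smooth_partial.
  by apply: (hC i).2 => // l; exact: BdS.
by apply: (@BdW _ _ M); [exact: ler_norm|have [_] := BU i; apply].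
Qed.

(** On an open set the values of a function determine its derivatives. This carries estimates from
    the scaled orbit to the rescaled return map, for which the formula in terms of the orbit holds
    on the box only. *)
Lemma Bd_ext r A M u v : open A -> (forall x, A x -> u x = v x) ->
  Bd r A M u -> Bd r A M v.
Proof.
move=> oA; elim: r u v => [|r IH] u v uv [h1 h2]; split => //;
  try by move=> x Ax; rewrite -uv// h1.
move=> j; apply: IH (h2 j) => x Ax.
by apply: near_eq_derive; apply: filterS (oA _ Ax) => y Ay; exact: uv.
Qed.

(** * Families of size O(delta) in C^r *)

Section Families.
Variables (T : Type) (F : set_system T) (FF : Filter F).
Variables (r : nat) (A : set 'rV[R]_p).
Implicit Types (delta gamma : T -> R) (f g : T -> 'rV[R]_p -> R).

(* f is O(delta) in C^r(A) along F, the parameter s ranging over F. *)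
Definition bO delta f : Prop :=
  exists2 C : R, 0 <= C &
    \forall s \near F, smooth (f s) /\ Bd r A (C * delta s) (f s).

Lemma bO_le (K : R) delta gamma f : 0 <= K ->
  (\forall s \near F, delta s <= K * gamma s) -> bO delta f -> bO gamma f.
Proof.
move=> K0 h [C C0 hC]; exists (C * K); first exact: mulr_ge0.
apply: filterS2 h hC => s ds [sf Bf]; split => //.
by apply: BdW Bf; rewrite -mulrA ler_wpM2l.
Qed.

Lemma bO_eq delta f g :
  (\forall s \near F, f s = g s) -> bO delta f -> bO delta g.
Proof. by move=> h [C C0 hC]; exists C => //; apply: filterS2 h hC => s <-. Qed.

Lemma bOD delta f g : bO delta f -> bO delta g -> bO delta (fun s x => f s x + g s x).
Proof.
move=> [C C0 hC] [C' C'0 hC']; exists (C + C'); first exact: addr_ge0.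
apply: filterS2 hC hC' => s [sf Bf] [sg Bg]; split; first exact: smoothD.
by rewrite mulrDl; exact: BdD.
Qed.

Lemma bON delta f : bO delta f -> bO delta (fun s x => - f s x).
Proof.
move=> [C C0 hC]; exists C => //.
by apply: filterS hC => s [sf Bf]; split; [exact: smoothN|exact: BdN].
Qed.

Lemma bOB delta f g : bO delta f -> bO delta g -> bO delta (fun s x => f s x - g s x).
Proof. by move=> hf hg; apply: bOD => //; exact: bON. Qed.

Lemma bOM delta gamma f g : bO delta f -> bO gamma g ->
  bO (fun s => delta s * gamma s) (fun s x => f s x * g s x).
Proof.
move=> [C C0 hC] [C' C'0 hC']; exists (2 ^+ r * (C * C')).
  by rewrite !mulr_ge0 ?exprn_ge0 ?ler0n.
apply: filterS2 hC hC' => s [sf Bf] [sg Bg]; split; first exact: smoothM.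
have -> : 2 ^+ r * (C * C') * (delta s * gamma s) =
    2 ^+ r * ((C * delta s) * (C' * gamma s)) by ring.
exact: BdM.
Qed.

Lemma bO1M delta f g : bO (fun=> 1) f -> bO delta g ->
  bO delta (fun s x => f s x * g s x).
Proof.
move=> hf hg; apply: (@bO_le 1) (bOM hf hg) => //.
by near=> s; rewrite !mul1r.
Unshelve. all: by end_near. Qed.

Lemma bO_seq delta (c : T -> R) (K : R) : 0 <= K ->
  (\forall s \near F, `|c s| <= K * delta s) -> bO delta (fun s _ => c s).
Proof.
move=> K0 h; exists K => //; apply: filterS h => s cs.
by split; [exact: smooth_cst|exact: BdW cs (Bd_cst _ _ _)].
Qed.

Lemma bO_cst (c : R) : bO (fun=> 1) (fun _ _ => c).
Proof.
by apply: (@bO_seq _ (fun=> c) `|c|) => //; near=> s; rewrite mulr1.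
Unshelve. all: by end_near. Qed.

Lemma bO_coord (L : R) (i : 'I_p) : (forall x, A x -> `|x 0 i| <= L) ->
  bO (fun=> 1) (fun _ (x : 'rV[R]_p) => x 0 i).
Proof.
move=> AL; exists (Num.max 1 L); first by rewrite le_max ler01.
near=> s; split; first exact: smooth_coord.
by rewrite mulr1; apply: Bd_coord => [|x /AL]; rewrite le_max ?lexx// orbC => ->.
Unshelve. all: by end_near. Qed.

(** The sum of the individual constants is a common bound for the inner functions, as [Bd_comp]
    requires. *)
Lemma bO_comp q (Phi : 'rV[R]_q -> R) (U : 'I_q -> T -> 'rV[R]_p -> R) :
  smooth Phi -> (forall i, bO (fun=> 1) (U i)) ->
  bO (fun=> 1) (fun s x => Phi (\row_i U i s x)).
Proof.
move=> sPhi h.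
have h' i : exists C : R, 0 <= C /\
    \forall s \near F, smooth (U i s) /\ Bd r A C (U i s).
  by have [C C0 hC] := h i; exists C; split => //; apply: filterS hC => s; rewrite mulr1.
have [C hC] := choice h'.
have [K K0 hK] := Bd_comp r (\sum_i C i) sPhi.
exists K => //.
have : \forall s \near F, forall i, smooth (U i s) /\ Bd r A (C i) (U i s).
  by apply: filter_forall => i; exact: (hC i).2.
apply: filterS => s hs; rewrite mulr1; split.
  by apply: smooth_comp => // i; exact: (hs i).1.
apply: hK => i; first exact: (hs i).1.
apply: BdW (hs i).2; rewrite (bigD1 i)//= lerDl sumr_ge0// => j _.
exact: (hC j).1.
Qed.

End Families.

End UniformBounds.

(** * Planar families and their bifurcation conditions *)

Section PlanarFamilies.
Variable R : realType.
Local Notation e_ i := (delta_mx 0 i).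

(** Coordinate 0 of 3-space is the bifurcation parameter, coordinates 1 and 2 are the phase
    variables; a one-parameter family of planar maps is thus a pair of functions on 3-space. *)
Definition i0 : 'I_3 := @Ordinal 3 0 isT.
Definition i1 : 'I_3 := @Ordinal 3 1 isT.
Definition i2 : 'I_3 := @Ordinal 3 2 isT.

Definition row3 (a b c : R) : 'rV[R]_3 := \row_j [:: a; b; c]`_j.

Lemma row3_0 a b c : row3 a b c 0 i0 = a. Proof. by rewrite mxE. Qed.
Lemma row3_1 a b c : row3 a b c 0 i1 = b. Proof. by rewrite mxE. Qed.
Lemma row3_2 a b c : row3 a b c 0 i2 = c. Proof. by rewrite mxE. Qed.
Definition row3E := (row3_0, row3_1, row3_2).

Lemma ord3P (i : 'I_3) : [\/ i = i0, i = i1 | i = i2].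
Proof.
by case: i => [[|[|[|//]]] ?]; [apply: Or31|apply: Or32|apply: Or33]; exact: val_inj.
Qed.

Lemma row3_eta (x : 'rV[R]_3) : x = row3 (x 0 i0) (x 0 i1) (x 0 i2).
Proof. by apply/rowP => i; case: (ord3P i) => ->; rewrite row3E. Qed.

Lemma sum3 (V : zmodType) (F : 'I_3 -> V) : \sum_i F i = F i0 + F i1 + F i2.
Proof.
rewrite !big_ord_recl big_ord0 addr0 addrA.
by congr (F _ + F _ + F _); exact: val_inj.
Qed.

Lemma sum2 (V : zmodType) (F : 'I_2 -> V) : \sum_i F i = F 0 + F 1.
Proof. by rewrite !big_ord_recl big_ord0 addr0; congr (F _ + F _); exact: val_inj. Qed.

Lemma ord2P (i : 'I_2) : i = 0 \/ i = 1.
Proof. by case: i => [[|[|//]] ?]; [left|right]; exact: val_inj. Qed.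

Lemma pt0 (x y : R) : pt x y 0 0 = x. Proof. by rewrite mxE. Qed.
Lemma pt1 (x y : R) : pt x y 0 1 = y. Proof. by rewrite mxE. Qed.
Definition ptE := (pt0, pt1).

Lemma pt_eta (z : 'rV[R]_2) : z = pt (z 0 0) (z 0 1).
Proof. by apply/rowP => i; case: (ord2P i) => ->; rewrite ptE. Qed.

Lemma pt_inj (x y x' y' : R) : pt x y = pt x' y' -> x = x' /\ y = y'.
Proof.
by move=> h; split; [have := congr1 (fun z : 'rV_2 => z 0 0) h|
  have := congr1 (fun z : 'rV_2 => z 0 1) h]; rewrite !ptE.
Qed.

Definition comp3 p (Phi : 'rV[R]_3 -> R) (u v w : 'rV[R]_p -> R) :=
  fun x => Phi (row3 (u x) (v x) (w x)).

Lemma comp3E p Phi (u v w : 'rV[R]_p -> R) : comp3 Phi u v w =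
  fun x => Phi (\row_i [:: u; v; w]`_i x).
Proof.
apply/funext => x; congr Phi; apply/rowP => i.
by case: (ord3P i) => ->; rewrite row3E mxE.
Qed.

Lemma smooth_comp3 p Phi (u v w : 'rV[R]_p -> R) :
  smooth Phi -> smooth u -> smooth v -> smooth w -> smooth (comp3 Phi u v w).
Proof.
move=> sP su sv sw; rewrite comp3E.
by apply: (@smooth_comp _ _ _ Phi (fun i => [:: u; v; w]`_i)) => // i; case: (ord3P i) => ->.
Qed.

Definition slice (h : 'rV[R]_3 -> R) (e : R) (w : 'rV[R]_2) : R :=
  h (row3 e (w 0 0) (w 0 1)).

Definition planar (h1 h2 : 'rV[R]_3 -> R) (e : R) (w : 'rV[R]_2) : 'rV[R]_2 :=
  pt (slice h1 e w) (slice h2 e w).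

(** Differentiates in the phase variables and keeps the parameter as a variable. Derivatives of a
    [planar] family are then [planar] families, and all derivatives in the bifurcation conditions,
    the mixed ones included, reduce to partial derivatives on 3-space. *)
Definition dirop (u : 'rV[R]_2) (h : 'rV[R]_3 -> R) : 'rV[R]_3 -> R :=
  fun x => u 0 0 * 'D_(e_ i1) h x + u 0 1 * 'D_(e_ i2) h x.

Lemma smooth_dirop u h : smooth h -> smooth (dirop u h).
Proof.
by move=> sh; apply: smoothD; apply: smoothM; try exact: smooth_cst;
  exact: smooth_partial.
Qed.

Lemma smooth_slice h e : smooth h -> smooth (slice h e).
Proof.
move=> sh; apply: (@smooth_comp3 _ h (fun=> e) (fun w => w 0 0) (fun w => w 0 1)) => //.
- exact: smooth_cst.
- exact: smooth_coord.
- exact: smooth_coord.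
Qed.

Lemma is_derive_coord p (x u : 'rV[R]_p) i :
  is_derive x u (fun x : 'rV[R]_p => x 0 i) (u 0 i).
Proof.
have d : derivable (id : 'rV[R]_p -> _) x u by exact: derivable_id.
have := derive_mx d; rewrite derive_id => /rowP/(_ i); rewrite !mxE => E.
by apply: DeriveDef; [exact: (derivable_mxP _ _ _).1|rewrite -E].
Qed.

Lemma is_derive_row3 (V : normedModType R) (h : 'rV[R]_3 -> R) (u0 u1 u2 : V -> R)
    (x v : V) (d0 d1 d2 : R) : smooth h ->
  is_derive x v u0 d0 -> is_derive x v u1 d1 -> is_derive x v u2 d2 ->
  let z := row3 (u0 x) (u1 x) (u2 x) in
  is_derive x v (fun x => h (row3 (u0 x) (u1 x) (u2 x)))
    ('D_(e_ i0) h z * d0 + 'D_(e_ i1) h z * d1 + 'D_(e_ i2) h z * d2).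
Proof.
move=> sh D0 D1 D2.
pose U i : V -> R := nth (fun=> 0) [:: u0; u1; u2] i.
have dU (i : 'I_3) : derivable (U i) x v.
  by case: (ord3P i) => ->; [case: D0|case: D1|case: D2].
have E y : row3 (u0 y) (u1 y) (u2 y) = \row_i U i y.
  by apply/rowP => i; case: (ord3P i) => ->; rewrite row3E mxE.
have := chain_rule sh dU; rewrite sum3 -E.
have -> : (fun x => h (row3 (u0 x) (u1 x) (u2 x))) = (fun z => h (\row_i U i z)).
  by apply/funext => y; rewrite E.
case: D0 => _ D0; case: D1 => _ D1; case: D2 => _ D2.
by move=> H /=; apply: is_derive_eq H _; rewrite /U /= D0 D1 D2.
Qed.

Lemma is_derive_slice h e w u : smooth h ->
  is_derive w u (slice h e) (slice (dirop u h) e w).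
Proof.
move=> sh.
have := is_derive_row3 sh (is_derive_cst e w u) (is_derive_coord w u 0)
  (is_derive_coord w u 1).
move=> H; apply: is_derive_eq H _.
by rewrite mulr0 add0r [X in X + _]mulrC [X in _ + X]mulrC.
Qed.

Lemma is_derive_pt (V : normedModType R) (f g : V -> R) x v (df dg : R) :
  is_derive x v f df -> is_derive x v g dg ->
  is_derive x v (fun x => pt (f x) (g x)) (pt df dg).
Proof.
move=> [Df <-] [Dg <-].
have E j : (fun x => pt (f x) (g x) 0 j) = if j == 0 then f else g.
  by apply/funext => y; rewrite mxE; case: ifP.
have d : derivable (fun x => pt (f x) (g x)) x v.
  by apply/derivable_mxP => i j; rewrite ord1 E; case: ifP => _; [exact: Df|exact: Dg].
apply: DeriveDef => //.
rewrite derive_mx//; apply/rowP => j; rewrite mxE E mxE.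
by case: ifP.
Qed.

Lemma is_derive_planar h1 h2 e w u : smooth h1 -> smooth h2 ->
  is_derive w u (planar h1 h2 e) (planar (dirop u h1) (dirop u h2) e w).
Proof. by move=> s1 s2; apply: is_derive_pt; exact: is_derive_slice. Qed.

Lemma derive_planar h1 h2 e u : smooth h1 -> smooth h2 ->
  'D_u (planar h1 h2 e) = planar (dirop u h1) (dirop u h2) e.
Proof.
move=> s1 s2; apply/funext => w.
by rewrite (@derive_val _ _ _ _ _ _ _ (is_derive_planar e w u s1 s2)).
Qed.

Lemma derive_planarE h1 h2 e u w : smooth h1 -> smooth h2 ->
  'D_u (planar h1 h2 e) w = planar (dirop u h1) (dirop u h2) e w.
Proof. by move=> s1 s2; rewrite -derive_planar. Qed.

Lemma derive1_planar h1 h2 e w : smooth h1 -> smooth h2 ->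
  derive1 (fun e => planar h1 h2 e w) e =
  planar ('D_(e_ i0) h1) ('D_(e_ i0) h2) e w.
Proof.
move=> s1 s2.
have D h : smooth h -> is_derive e 1 (fun e => slice h e w) (slice ('D_(e_ i0) h) e w).
  move=> sh; have := is_derive_row3 sh (is_derive_id e 1)
    (is_derive_cst (w 0 0) e 1) (is_derive_cst (w 0 1) e 1).
  by move=> H; apply: is_derive_eq H _; rewrite !mulr0 !addr0 mulr1.
have := is_derive_pt (D _ s1) (D _ s2).
by move=> H; rewrite derive1E (@derive_val _ _ _ _ _ _ _ H).
Qed.

(** The partial derivatives are locally Lipschitz, so the mean value theorem leaves a remainder
    quadratic in the increment. Total differentiability is what ties the Jacobian matrix to
    directional derivatives. *)
Lemma smooth_differentiable p (F : 'rV[R]_p -> R) x : smooth F -> differentiable F x.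
Proof.
move=> sF.
pose L (v : 'rV[R]_p) : R := \sum_i v 0 i * 'D_(e_ i) F x.
have linL : linear L.
  move=> a u v; rewrite /L scaler_sumr -big_split/=; apply: eq_bigr => i _.
  by rewrite !mxE mulrDl scalerAl.
pose LL : {linear 'rV[R]_p -> R} :=
  HB.pack L (GRing.isLinear.Build _ _ _ _ L linL).
have cL : continuous LL.
  move=> v; rewrite /= /L; apply: (@cvg_ord_sum R _ _ _ (nbhs_filter v)) => i.
  by apply: cvgM; [exact: coord_continuous|exact: cvg_cst].
have [C C0 hC] : exists2 C : R, 0 <= C & forall v, `|v| <= 1 ->
    `|F (v + x) - F x - L v| <= C * `|v| ^+ 2.
  have h i : exists C : R, 0 <= C /\ forall y z, `|y| <= `|x| + 2 -> `|z| <= `|x| + 2 ->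
      `|'D_(e_ i) F y - 'D_(e_ i) F z| <= C * `|y - z|.
    by have [C] := smooth_lipschitz_cube (`|x| + 2) (smooth_partial i sF); exists C.
  have [C hC] := choice h.
  exists (\sum_i C i); first by apply: sumr_ge0 => i _; exact: (hC i).1.
  move=> v v1.
  have [xi [hxi ->]] := mvt_coord x (v + x) (fun x i => smooth_derivable sF).
  rewrite /L -sumrB (le_trans (ler_norm_sum _ _ _))// mulr_suml.
  apply: ler_sum => i _; rewrite !mxE addrK -mulrBr normrM.
  have xix : `|xi i - x| <= `|v|.
    rewrite rV_norm_le//; apply/forallP => j; rewrite !mxE.
    by apply: le_trans (hxi i j) _; rewrite mxE addrK; exact: rV_coord_le.
  have -> : C i * `|v| ^+ 2 = `|v| * (C i * `|v|) by ring.
  apply: ler_pM => //; first exact: rV_coord_le.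
  apply: le_trans ((hC i).2 _ _ _ _) _; last 1 first.
  - by apply: ler_wpM2l => //; exact: (hC i).1.
  - have -> : xi i = x + (xi i - x) by rewrite addrC subrK.
    apply: le_trans (ler_normD _ _) _; lra.
  - lra.
apply/diff_locallyP.
suff H : F \o shift x = cst (F x) + LL +o_ (nbhs (0 : 'rV[R]_p)) id.
  have E := @diff_unique R _ _ F LL x cL H.
  by split; rewrite E.
apply/eqaddoP => _/posnumP[e].
have d0 : 0 < Num.min 1 (e%:num / (C + 1)) by rewrite lt_min ltr01 divr_gt0// ltr_wpDl.
apply: filterS (nbhsx_ballx (0 : 'rV[R]_p) _ d0) => v.
rewrite -ball_normE /ball_/= sub0r normrN lt_min => /andP[v1 ve].
have := hC v (ltW v1).
rewrite [in X in X -> _](_ : F (v + x) - F x - L v = F (v + x) - (F x + L v)); last by rewrite opprD addrA.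
move=> h; apply: le_trans h _; rewrite expr2 mulrA ler_wpM2r//.
apply: le_trans (ler_wpM2l C0 (ltW ve)) _.
by rewrite mulrCA ger_pMr// ler_pdivrMr ?ltr_wpDl//; lra.
Qed.

Definition mx2 (a b c d : R) : 'M[R]_2 :=
  \matrix_(i, j) (if i == 0 then if j == 0 then a else b else if j == 0 then c else d).

Lemma mx2_eta (M : 'M[R]_2) : M = mx2 (M 0 0) (M 0 1) (M 1 0) (M 1 1).
Proof.
by apply/matrixP => i j; case: (ord2P i) => ->; case: (ord2P j) => ->; rewrite mxE.
Qed.

Lemma mul_pt_mx2 x y a b c d :
  pt x y *m mx2 a b c d = pt (x * a + y * c) (x * b + y * d).
Proof.
by apply/rowP => j; case: (ord2P j) => ->; rewrite !mxE sum2 !mxE.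
Qed.

Lemma mul_mx2 a b c d a' b' c' d' : mx2 a b c d *m mx2 a' b' c' d' =
  mx2 (a * a' + b * c') (a * b' + b * d') (c * a' + d * c') (c * b' + d * d').
Proof.
by apply/matrixP => i j; case: (ord2P i) => ->; case: (ord2P j) => ->;
  rewrite !mxE sum2 !mxE.
Qed.

Lemma mx2_1 : 1%:M = mx2 1 0 0 1.
Proof. by rewrite [LHS]mx2_eta !mxE. Qed.

Lemma tr_mx2 a b c d : \tr (mx2 a b c d) = a + d.
Proof. by rewrite /mxtrace sum2 !mxE. Qed.

Lemma det_mx2 (S : comNzRingType) (M : 'M[S]_2) :
  \det M = M 0 0 * M 1 1 - M 0 1 * M 1 0.
Proof.
rewrite (expand_det_row _ 0) !big_ord_recl big_ord0 addr0 /cofactor !det_mx11 !mxE /=.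
rewrite /= expr0 mul1r expr1 mulN1r mulrN.
congr (_ * M _ _ - M _ _ * M _ _); exact: val_inj.
Qed.

Lemma char_poly_mx2 (M : 'M[R]_2) :
  char_poly M = 'X^2 - (\tr M)%:P * 'X + (\det M)%:P.
Proof.
rewrite /char_poly det_mx2 !mxE /= !mulr1n !mulr0n !sub0r det_mx2 /mxtrace sum2.
rewrite !rmorphB !rmorphD !rmorphM /=; ring.
Qed.

Lemma invmx_mx2 a b c d : a * d - b * c != 0 ->
  invmx (mx2 a b c d) = (a * d - b * c)^-1 *: mx2 d (- b) (- c) a.
Proof.
move=> D0.
have E : mx2 a b c d *m ((a * d - b * c)^-1 *: mx2 d (- b) (- c) a) = 1%:M.
  rewrite -scalemxAr mul_mx2 mx2_1; apply/matrixP => i j.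
  by case: (ord2P i) => ->; case: (ord2P j) => ->; rewrite !mxE /=; field.
have U : mx2 a b c d \in unitmx by case/mulmx1_unit: E.
by rewrite -[RHS]mul1mx -(mulVmx U) -mulmxA E mulmx1.
Qed.

(** With [t = 1] and [t = -1] this covers both bifurcations. The product of the eigenvalues is the
    determinant and [t] is its own inverse, so the second multiplier is [t] times the
    determinant. *)
Lemma char_poly_mx2_factor a b c d (t : R) : t ^+ 2 = 1 ->
  1 - t * (a + d) + (a * d - b * c) = 0 ->
  char_poly (mx2 a b c d) = ('X - t%:P) * ('X - (t * (a * d - b * c))%:P).
Proof.
move=> t2 ev.
set q := a * d - b * c in ev *.
have tr : a + d = t * (1 + q).
  have <- : t * (a + d) = 1 + q by lra.
  by rewrite mulrA -expr2 t2 mul1r.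
have t2P : t%:P * t%:P = 1 :> {poly R} by rewrite -rmorphM /= -expr2 t2.
rewrite char_poly_mx2 tr_mx2 det_mx2 !mxE /= -/q tr !rmorphM rmorphD rmorph1 /=.
set T := t%:P in t2P *; set Q := q%:P.
have -> : ('X - T) * ('X - T * Q) = 'X^2 - (T * (1 + Q)) * 'X + (T * T) * Q by ring.
by rewrite t2P mul1r.
Qed.

Lemma dirop_e0 h x : dirop (e_ 0) h x = 'D_(e_ i1) h x.
Proof. by rewrite /dirop !mxE /= mul1r mul0r addr0. Qed.

Lemma dirop_e1 h x : dirop (e_ 1) h x = 'D_(e_ i2) h x.
Proof. by rewrite /dirop !mxE /= mul1r mul0r add0r. Qed.

Lemma mul_pt_invmx2 x y a b c d : a * d - b * c != 0 ->
  pt x y *m invmx (mx2 a b c d) =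
  pt ((a * d - b * c)^-1 * (x * d - y * c)) ((a * d - b * c)^-1 * (y * a - x * b)).
Proof.
move=> D0; rewrite invmx_mx2// -scalemxAr mul_pt_mx2; apply/rowP => j.
by case: (ord2P j) => ->; rewrite !mxE /=; ring.
Qed.

Lemma mx2_sub1 a b c d : mx2 a b c d - 1%:M = mx2 (a - 1) b c (d - 1).
Proof.
rewrite mx2_1; apply/matrixP => i j.
by case: (ord2P i) => ->; case: (ord2P j) => ->; rewrite !mxE /= ?subr0.
Qed.

Lemma sub1_mx2 a b c d : 1%:M - mx2 a b c d = mx2 (1 - a) (- b) (- c) (1 - d).
Proof.
rewrite mx2_1; apply/matrixP => i j.
by case: (ord2P i) => ->; case: (ord2P j) => ->; rewrite !mxE /= ?sub0r.
Qed.

Lemma pt_lin (s t x y x' y' : R) :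
  s *: pt x y - t *: pt x' y' = pt (s * x - t * x') (s * y - t * y').
Proof. by apply/rowP => j; case: (ord2P j) => ->; rewrite !mxE. Qed.

Lemma ptD (x y x' y' : R) : pt x y + pt x' y' = pt (x + x') (y + y').
Proof. by apply/rowP => j; case: (ord2P j) => ->; rewrite !mxE. Qed.

Lemma planar_differentiable h1 h2 e w : smooth h1 -> smooth h2 ->
  differentiable (planar h1 h2 e) w.
Proof.
move=> s1 s2.
have -> : planar h1 h2 e = (fun w => slice h1 e w *: pt 1 0) \+ (fun w => slice h2 e w *: pt 0 1).
  apply/funext => z; apply/rowP => j.
  by case: (ord2P j) => ->; rewrite /= !mxE /=; ring.
by apply: differentiableD; apply: differentiableZl; apply: smooth_differentiable;
  exact: smooth_slice.
Qed.

(** Row [i] is the derivative in direction [i], because the matrix acts on row vectors from the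
    right; the entries are therefore transposed with respect to the column convention. *)
Lemma jacobian_planar h1 h2 e (w : 'rV[R]_2) : smooth h1 -> smooth h2 ->
  let x := row3 e (w 0 0) (w 0 1) in
  'J (planar h1 h2 e) w =
  mx2 ('D_(e_ i1) h1 x) ('D_(e_ i1) h2 x) ('D_(e_ i2) h1 x) ('D_(e_ i2) h2 x).
Proof.
move=> s1 s2 x.
have E i j : 'J (planar h1 h2 e) w i j =
    planar (dirop (e_ i) h1) (dirop (e_ i) h2) e w 0 j.
  rewrite -derive_planar// deriveEjacobian; last exact: planar_differentiable.
  by rewrite -rowE [RHS]mxE.
by rewrite [LHS]mx2_eta !E /planar !ptE /slice -/x !dirop_e0 !dirop_e1.
Qed.

(** * Bifurcation conditions in terms of partial derivatives *)

Section Criteria.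
Variables (h1 h2 : 'rV[R]_3 -> R) (s1 : smooth h1) (s2 : smooth h2).
Variables (e0 : R) (z0 : 'rV[R]_2) (x : 'rV[R]_3) (a b c d : R).
Hypotheses (fix0 : planar h1 h2 e0 z0 = z0) (xE : x = row3 e0 (z0 0 0) (z0 0 1)).
Hypotheses (aE : 'D_(e_ i1) h1 x = a) (bE : 'D_(e_ i1) h2 x = b).
Hypotheses (cE : 'D_(e_ i2) h1 x = c) (dE : 'D_(e_ i2) h2 x = d).

Let jac : 'J (planar h1 h2 e0) z0 = mx2 a b c d.
Proof. by rewrite jacobian_planar// -xE aE bE cE dE. Qed.

Let planarE f g : planar f g e0 z0 = pt (f x) (g x).
Proof. by rewrite /planar /slice -xE. Qed.

(* For an eigenvalue t of [[a, b], [c, d]], the row (t - d, b) is a left and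
   the column (b, t - a) a right eigenvector. *)
Let left_eigen (t : R) : (t - a) * (t - d) = b * c -> pt (t - d) b *m mx2 a b c d = t *: pt (t - d) b.
Proof.
move=> h; rewrite mul_pt_mx2; apply/rowP => j.
by case: (ord2P j) => ->; rewrite !mxE /=; [rewrite -h|]; ring.
Qed.

Let right_eigen (t : R) : (t - a) * (t - d) = b * c ->
  mx2 a b c d *m (pt b (t - a))^T = t *: (pt b (t - a))^T.
Proof.
move=> h; apply/colP => i.
by case: (ord2P i) => ->; rewrite !mxE sum2 !mxE /=; [|rewrite mulrC -h]; ring.
Qed.

Let pair (p q t : R) : (pt p q *m (pt b (t - a))^T != 0) = (p * b + q * (t - a) != 0).
Proof.
congr (~~ _); apply/eqP/eqP => [/matrixP/(_ 0 0)|h]; first by rewrite !mxE sum2 !mxE.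
by apply/matrixP => i j; rewrite !ord1 !mxE sum2 !mxE.
Qed.

Let pt_neq0 (p q : R) : q != 0 -> pt p q != 0.
Proof. by move=> q0; apply: contraNneq q0 => /rowP/(_ 1); rewrite !mxE /= => ->. Qed.

Let pt_neq0l (p q : R) : p != 0 -> pt p q != 0.
Proof. by move=> q0; apply: contraNneq q0 => /rowP/(_ 0); rewrite !mxE /= => ->. Qed.

(** Explicit eigenvectors, nonzero because [b] is, turn the conditions into the nonvanishing of
    polynomials in the partial derivatives at [x]; such inequations pass from the limit family to
    nearby maps. *)
Lemma saddle_node_planar : b != 0 -> `|a * d - b * c| != 1 ->
  1 - (a + d) + (a * d - b * c) = 0 ->
  dirop (pt (1 - d) b) (dirop (pt (1 - d) b) h1) x * b
    + dirop (pt (1 - d) b) (dirop (pt (1 - d) b) h2) x * (1 - a) != 0 ->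
  'D_(e_ i0) h1 x * b + 'D_(e_ i0) h2 x * (1 - a) != 0 ->
  saddle_node (planar h1 h2) e0 z0.
Proof.
move=> b0 det1 ev nd tr; split; first exact: fix0.
rewrite jac; exists (a * d - b * c), (pt (1 - d) b), (pt b (1 - a))^T.
have ev' : (1 - a) * (1 - d) = b * c by apply/eqP; rewrite -subr_eq0 -ev; apply/eqP; ring.
split; first split => //.
- rewrite (@char_poly_mx2_factor _ _ _ _ 1); first by rewrite mul1r.
    by rewrite expr1n.
  by rewrite mul1r.
- split; split.
  + exact: pt_neq0.
  + by rewrite left_eigen// scale1r.
  + by rewrite trmx_eq0 pt_neq0l.
  + by rewrite right_eigen// scale1r.
- rewrite !(derive_planar, derive_planarE)//; try exact: smooth_dirop.
  by rewrite planarE pair.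
- by rewrite derive1_planar// planarE pair.
Qed.

(** [dm] is the determinant of [1 - J], which in dimension two is also that of [J - 1], so a single
    denominator serves the two inverse matrices behind [h] and [dz]. Naming the intermediate
    quantities by equations keeps the conditions short enough for taking limits. *)
Lemma period_doubling_planar (dm B1 B2 p1 p2 : R) (u h dz : 'rV[R]_2) :
  dm = 1 - (a + d) + (a * d - b * c) -> u = pt (-1 - d) b ->
  dirop u (dirop u h1) x = B1 -> dirop u (dirop u h2) x = B2 ->
  'D_(e_ i0) h1 x = p1 -> 'D_(e_ i0) h2 x = p2 ->
  h = pt (dm^-1 * (B1 * (d - 1) - B2 * c)) (dm^-1 * (B2 * (a - 1) - B1 * b)) ->
  dz = pt (dm^-1 * (p1 * (1 - d) + p2 * c)) (dm^-1 * (p2 * (1 - a) + p1 * b)) ->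
  b != 0 -> dm != 0 -> `|a * d - b * c| != 1 ->
  1 + (a + d) + (a * d - b * c) = 0 ->
  (6^-1 * dirop u (dirop u (dirop u h1)) x - 2^-1 * dirop h (dirop u h1) x) * b
    + (6^-1 * dirop u (dirop u (dirop u h2)) x - 2^-1 * dirop h (dirop u h2) x)
      * (-1 - a) != 0 ->
  ('D_(e_ i0) (dirop u h1) x + dirop dz (dirop u h1) x) * b
    + ('D_(e_ i0) (dirop u h2) x + dirop dz (dirop u h2) x) * (-1 - a) != 0 ->
  period_doubling (planar h1 h2) e0 z0.
Proof.
move=> dmD uE B1E B2E p1E p2E hE dzE b0 dm0 det1 ev nd tr; split; first exact: fix0.
rewrite jac; exists (- (a * d - b * c)), u, (pt b (-1 - a))^T.
have ev' : (-1 - a) * (-1 - d) = b * c.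
  by apply/eqP; rewrite -subr_eq0 -ev; apply/eqP; ring.
have su1 := smooth_dirop u s1; have su2 := smooth_dirop u s2.
have D1' v f g : smooth f -> smooth g ->
    'D_v (planar f g e0) = planar (dirop v f) (dirop v g) e0.
  exact: derive_planar.
have D1 := D1' u _ _ s1 s2.
have D2 v f g : smooth f -> smooth g ->
    'D_v (planar f g e0) z0 = pt (dirop v f x) (dirop v g x).
  by move=> sf sg; rewrite derive_planarE// planarE.
split; first split.
- rewrite (@char_poly_mx2_factor _ _ _ _ (-1)).
  + by rewrite rmorphN1 opprK mulN1r.
  + by rewrite sqrrN expr1n.
  + by rewrite mulN1r opprK.
- by rewrite normrN.
- split; split.
  + by rewrite uE; exact: pt_neq0.
  + by rewrite uE left_eigen// scaleN1r.
  + by rewrite trmx_eq0 pt_neq0l.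
  + by rewrite right_eigen// scaleN1r.
- have dmE : (a - 1) * (d - 1) - b * c = dm by rewrite dmD; ring.
  have hI : pt B1 B2 *m invmx (mx2 (a - 1) b c (d - 1)) = h.
    by rewrite mul_pt_invmx2 dmE.
  rewrite mx2_sub1 D1 (D1' u _ _ su1 su2) (D2 u _ _ su1 su2) B1E B2E hI.
  cbv zeta; rewrite (D2 u _ _ (smooth_dirop u su1) (smooth_dirop u su2)) (D2 h _ _ su1 su2).
  by rewrite pt_lin pair.
- have dmE : (1 - a) * (1 - d) - - b * - c = dm by rewrite dmD; ring.
  have dzI : pt p1 p2 *m invmx (mx2 (1 - a) (- b) (- c) (1 - d)) = dz.
    by rewrite mul_pt_invmx2 dmE// !mulrN !opprK dzE.
  rewrite sub1_mx2 derive1_planar// planarE p1E p2E dzI; cbv zeta.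
  have -> : (fun e => 'D_u (planar h1 h2 e) z0) =
      (fun e => planar (dirop u h1) (dirop u h2) e z0).
    by apply/funext => e; rewrite derive_planarE.
  by rewrite derive1_planar// D1 (D2 dz _ _ su1 su2) planarE ptD pair.
Qed.

End Criteria.

End PlanarFamilies.

(** * An implicit curve *)

(** Completeness of spaces of matrices, for the contraction principle. *)
HB.instance Definition _ (R : realType) (m n : nat) := Complete.on 'M[R]_(m, n).

Section RealLimits.
Variables (R : realType) (T : Type) (F : set_system T) (FF : Filter F).
Implicit Types (u v : T -> R) (a b : R).

Lemma limD u v a b : u s @[s --> F] --> a -> v s @[s --> F] --> b ->
  u s + v s @[s --> F] --> a + b.
Proof. exact: cvgD. Qed.

Lemma limB u v a b : u s @[s --> F] --> a -> v s @[s --> F] --> b ->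
  u s - v s @[s --> F] --> a - b.
Proof. exact: cvgB. Qed.

Lemma limM u v a b : u s @[s --> F] --> a -> v s @[s --> F] --> b ->
  u s * v s @[s --> F] --> a * b.
Proof. exact: cvgM. Qed.

Lemma limV u a : a != 0 -> u s @[s --> F] --> a -> (u s)^-1 @[s --> F] --> a^-1.
Proof. exact: cvgV. Qed.

Lemma lim_cst a : (fun=> a) s @[s --> F] --> a.
Proof. exact: cvg_cst. Qed.

End RealLimits.
Arguments lim_cst {R T F} FF a.

Section ImplicitCurve.
Variable R : realType.
Local Notation e_ i := (delta_mx 0 i).

Lemma row3_norm_le (a b c M : R) : `|a| <= M -> `|b| <= M -> `|c| <= M ->
  `|row3 a b c| <= M.
Proof.
move=> ha hb hc; rewrite rV_norm_le; last exact: le_trans ha.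
by apply/forallP => i; case: (ord3P i) => ->; rewrite row3E.
Qed.

Lemma pt_norm_le (a b M : R) : `|a| <= M -> `|b| <= M -> `|pt a b| <= M.
Proof.
move=> ha hb; rewrite rV_norm_le; last exact: le_trans ha.
by apply/forallP => i; case: (ord2P i) => ->; rewrite ptE.
Qed.

Lemma mvt_row3 (P : 'rV[R]_3 -> R) (a b c a' b' c' : R) : smooth P ->
  exists xi : 'I_3 -> 'rV[R]_3,
    (forall i, [/\ `|xi i 0 i0 - a| <= `|a' - a|, `|xi i 0 i1 - b| <= `|b' - b|
       & `|xi i 0 i2 - c| <= `|c' - c|]) /\
    P (row3 a' b' c') - P (row3 a b c) =
    (a' - a) * 'D_(e_ i0) P (xi i0) + (b' - b) * 'D_(e_ i1) P (xi i1)
    + (c' - c) * 'D_(e_ i2) P (xi i2).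
Proof.
move=> sP.
have [xi [h1 ->]] := mvt_coord (row3 a b c) (row3 a' b' c')
  (fun x i => smooth_derivable sP).
exists xi; split; last by rewrite sum3 !row3E.
by move=> i; have := h1 i i2; have := h1 i i1; have := h1 i i0; rewrite !row3E.
Qed.

(** The product of the diagonal terms is at least 49/64, the other product at most 1/64. *)
Let det_gt0 (a b a' b' : R) : `|a| <= 8^-1 -> `|b| <= 8^-1 -> `|a'| <= 8^-1 ->
  `|b'| <= 8^-1 -> (1 - a) * (1 - b') - b * a' != 0.
Proof.
move=> ha hb ha' hb'; apply: lt0r_neq0.
have h1 := ler_pM (normr_ge0 _) (normr_ge0 _) hb ha'.
have h2 : b * a' <= 8^-1 * 8^-1 by apply: le_trans h1; rewrite -normrM ler_norm.
have ha1 := le_trans (ler_norm _) ha; have hb1 := le_trans (ler_norm _) hb'.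
have h3 : (7 / 8) * (7 / 8) <= (1 - a) * (1 - b').
  by clear -ha1 hb1; apply: ler_pM; lra.
clear -h2 h3; lra.
Qed.

Let cramer (h a b A1 B1 A2 B2 C1 C2 : R) : h != 0 ->
  (1 - A1) * (1 - B2) - B1 * A2 != 0 ->
  a = a * A1 + b * B1 + h * C1 -> b = a * A2 + b * B2 + h * C2 ->
  h^-1 * a = (C1 * (1 - B2) + B1 * C2) * ((1 - A1) * (1 - B2) - B1 * A2)^-1 /\
  h^-1 * b = (C2 * (1 - A1) + A2 * C1) * ((1 - A1) * (1 - B2) - B1 * A2)^-1.
Proof.
move=> h0 dt0 ha hb.
have {}ha : a - a * A1 - b * B1 = h * C1 by rewrite {1}ha; ring.
have {}hb : b - a * A2 - b * B2 = h * C2 by rewrite {1}hb; ring.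
set d := (1 - A1) * _ - _ in dt0 *.
have Ea : a * d = h * (C1 * (1 - B2) + B1 * C2).
  have -> : h * (C1 * (1 - B2) + B1 * C2) = h * C1 * (1 - B2) + B1 * (h * C2) by ring.
  by rewrite -ha -hb /d; ring.
have Eb : b * d = h * (C2 * (1 - A1) + A2 * C1).
  have -> : h * (C2 * (1 - A1) + A2 * C1) = h * C2 * (1 - A1) + A2 * (h * C1) by ring.
  by rewrite -ha -hb /d; ring.
split; apply: (mulfI h0); rewrite mulVKf// mulrA.
  by rewrite -Ea mulfK.
by rewrite -Eb mulfK.
Qed.

Let near_dnbhs0 (eta : R) : 0 < eta -> \forall h \near (0 : R)^', `|h| <= eta /\ h != 0.
Proof.
move=> eta0; near=> h; split; near: h; first exact: dnbhs0_le.
exact: nbhs_dnbhs_neq.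
Unshelve. all: by end_near. Qed.

Let absorb (a b u v : R) : 0 <= a -> 0 <= b -> 0 <= u -> 0 <= v ->
  a <= a * 8^-1 + b * 8^-1 + u -> b <= a * 8^-1 + b * 8^-1 + v ->
  a <= 2 * u + 2 * v /\ b <= 2 * u + 2 * v.
Proof. by move=> *; split; lra. Qed.

Let cube_bound (z c0 c1 M : R) : 0 <= M -> c0 <= z <= c1 -> `|z| <= M + `|c0| + `|c1|.
Proof.
move=> M0 /andP[h0 h1].
have a0 : 0 <= `|c0| by []. have a1 : 0 <= `|c1| by [].
have b0 : - c0 <= `|c0| by rewrite -normrN ler_norm.
have b1 := ler_norm c1.
by rewrite ler_norml; apply/andP; split; lra.
Qed.

Variables (P1 P2 : 'rV[R]_3 -> R) (L d0 d1 : R).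
Hypotheses (s1 : smooth P1) (s2 : smooth P2) (L0 : 0 <= L).
Hypothesis bound : forall a b c, `|a| <= L -> `|b| <= L -> d0 <= c <= d1 ->
  `|P1 (row3 a b c)| <= L /\ `|P2 (row3 a b c)| <= L.
Hypothesis small : forall x : 'rV[R]_3, `|x 0 i0| <= 3 * L -> `|x 0 i1| <= 3 * L ->
  d0 <= x 0 i2 <= d1 ->
  [/\ `|'D_(e_ i0) P1 x| <= 8^-1, `|'D_(e_ i1) P1 x| <= 8^-1,
      `|'D_(e_ i0) P2 x| <= 8^-1 & `|'D_(e_ i1) P2 x| <= 8^-1].

Let between (a a' z : R) : `|a| <= L -> `|a'| <= L -> `|z - a| <= `|a' - a| -> `|z| <= 3 * L.
Proof.
move=> ha ha' hz; have -> : z = a + (z - a) by rewrite addrC subrK.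
apply: le_trans (ler_normD _ _) _; have := ler_normB a' a; lra.
Qed.

Let step c (w : 'rV[R]_2) : 'rV[R]_2 := pt (P1 (row3 (w 0 0) (w 0 1) c)) (P2 (row3 (w 0 0) (w 0 1) c)).

(** In the max norm two partial derivatives of size at most 1/8 give the Lipschitz constant 1/4,
    well below 1/2. *)
Let step_lip c (w w' : 'rV[R]_2) : d0 <= c <= d1 -> `|w| <= L -> `|w'| <= L ->
  `|step c w - step c w'| <= 2^-1 * `|w - w'|.
Proof.
move=> cI wL wL'.
have hw i : `|w 0 i| <= L by exact: le_trans (rV_coord_le w i) wL.
have hw' i : `|w' 0 i| <= L by exact: le_trans (rV_coord_le w' i) wL'.
have dw i : `|w 0 i - w' 0 i| <= `|w - w'|.
  by have := rV_coord_le (w - w') i; rewrite !mxE.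
have key P : smooth P -> (forall x : 'rV[R]_3, `|x 0 i0| <= 3 * L -> `|x 0 i1| <= 3 * L ->
    d0 <= x 0 i2 <= d1 -> `|'D_(e_ i0) P x| <= 8^-1 /\ `|'D_(e_ i1) P x| <= 8^-1) ->
    `|P (row3 (w 0 0) (w 0 1) c) - P (row3 (w' 0 0) (w' 0 1) c)| <= 2^-1 * `|w - w'|.
  move=> sP hP.
  have [xi [h ->]] := mvt_row3 (w' 0 0) (w' 0 1) c (w 0 0) (w 0 1) c sP.
  rewrite subrr mul0r addr0.
  have B i : `|'D_(e_ i0) P (xi i)| <= 8^-1 /\ `|'D_(e_ i1) P (xi i)| <= 8^-1.
    have [h0 h1 h2] := h i; apply: hP; [exact: between (hw' 0) (hw 0) h0|exact: between (hw' 1) (hw 1) h1|].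
    by move: h2; rewrite subrr normr0 normr_le0 subr_eq0 => /eqP ->.
  apply: le_trans (ler_normD _ _) _; rewrite !normrM.
  have := ler_pM (normr_ge0 _) (normr_ge0 _) (dw 0) (B i0).1.
  have := ler_pM (normr_ge0 _) (normr_ge0 _) (dw 1) (B i1).2.
  have := normr_ge0 (w - w'); lra.
rewrite /step; have -> : pt (P1 (row3 (w 0 0) (w 0 1) c)) (P2 (row3 (w 0 0) (w 0 1) c)) -
    pt (P1 (row3 (w' 0 0) (w' 0 1) c)) (P2 (row3 (w' 0 0) (w' 0 1) c)) =
  pt (P1 (row3 (w 0 0) (w 0 1) c) - P1 (row3 (w' 0 0) (w' 0 1) c))
     (P2 (row3 (w 0 0) (w 0 1) c) - P2 (row3 (w' 0 0) (w' 0 1) c)).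
  by apply/rowP => j; case: (ord2P j) => ->; rewrite !mxE.
apply: pt_norm_le; apply: key => // x x0 x1 x2; have [] := small x0 x1 x2; by split.
Qed.

Let curve_exists c : exists w : 'rV[R]_2, d0 <= c <= d1 -> `|w| <= L /\ w = step c w.
Proof.
have [cI|/negP cI] := boolP (d0 <= c <= d1); last by exists 0.
pose U : set 'rV[R]_2 := [set w | `|w| <= L].
have fU : set_fun U U (step c).
  move=> w wL; have hw i : `|w 0 i| <= L by exact: le_trans (rV_coord_le w i) wL.
  by have [b1 b2] := bound (hw 0) (hw 1) cI; exact: pt_norm_le.
pose f : {fun U >-> U} := HB.pack (step c) (isFun.Build _ _ _ _ (step c) fU).
have ctr : is_contraction f.
  exists (2^-1)%:nng; split; first by rewrite /=; lra.
  by move=> [w w'] [/= Uw Uw']; exact: step_lip.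
have cU : closed U.
  have -> : U = (fun x : 'rV[R]_2 => `|x|) @^-1` [set r | r <= L] by [].
  by apply: closed_comp; [move=> x _; exact: norm_continuous|exact: closed_le].
have U0 : U !=set0 by exists 0; rewrite /U /= normr0.
have [w Uw ww] := banach_fixed_point ctr cU U0.
by exists w.
Qed.

(** For fixed [c] the pair [(P1, P2)] contracts the square of radius [L], and Banach's theorem gives
    the point. Derivability is obtained directly: the mean value theorem yields a linear system for
    the difference quotients, its determinant stays away from 0, and Cramer's rule passes to the
    limit. Intermediate points lie in the square of radius [3 * L], which explains the domain in
    [small]. *)
Lemma implicit_curve : exists E Z : R -> R,
  (forall c, d0 <= c <= d1 -> [/\ `|E c| <= L, `|Z c| <= L,
     E c = P1 (row3 (E c) (Z c) c) & Z c = P2 (row3 (E c) (Z c) c)]) /\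
  (forall c, d0 < c < d1 -> derivable E c 1 /\ derivable Z c 1).
Proof.
have [w hw] := choice curve_exists.
pose E c := w c 0 0; pose Z c := w c 0 1.
have EZ c : d0 <= c <= d1 -> [/\ `|E c| <= L, `|Z c| <= L,
     E c = P1 (row3 (E c) (Z c) c) & Z c = P2 (row3 (E c) (Z c) c)].
  move=> cI; have [wL wE] := hw _ cI; split.
  - by apply: le_trans (rV_coord_le _ _) wL.
  - by apply: le_trans (rV_coord_le _ _) wL.
  - by rewrite /E {1}wE ptE.
  - by rewrite /Z {1}wE ptE.
exists E, Z; split => // c /andP[c0 c1].
pose p0 := row3 (E c) (Z c) c.
have cI : d0 <= c <= d1 by rewrite !ltW.
have [E0 Z0 EE ZZ] := EZ _ cI.
have eta0 : 0 < Num.min (c - d0) (d1 - c) by rewrite lt_min !subr_gt0 c0 c1.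
set eta := Num.min _ _ in eta0.
have hI h : `|h| <= eta -> d0 <= h + c <= d1.
  by rewrite /eta le_min => /andP[]; rewrite !ler_norml => /andP[? ?] /andP[? ?]; lra.
have mv P : smooth P -> exists xi : R -> 'I_3 -> 'rV[R]_3,
    forall h, (forall i, [/\ `|xi h i 0 i0 - E c| <= `|E (h + c) - E c|,
       `|xi h i 0 i1 - Z c| <= `|Z (h + c) - Z c| & `|xi h i 0 i2 - c| <= `|h|]) /\
    P (row3 (E (h + c)) (Z (h + c)) (h + c)) - P p0 =
    (E (h + c) - E c) * 'D_(e_ i0) P (xi h i0)
    + (Z (h + c) - Z c) * 'D_(e_ i1) P (xi h i1) + h * 'D_(e_ i2) P (xi h i2).
  move=> sP.
  have H h := mvt_row3 (E c) (Z c) c (E (h + c)) (Z (h + c)) (h + c) sP.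
  have [xi hxi] := choice H; exists xi => h.
  by have := hxi h; rewrite addrK.
have [x1 hx1] := mv _ s1; have [x2 hx2] := mv _ s2.
have inbox h (z : 'rV[R]_3) : `|h| <= eta -> [/\ `|z 0 i0 - E c| <= `|E (h + c) - E c|,
    `|z 0 i1 - Z c| <= `|Z (h + c) - Z c| & `|z 0 i2 - c| <= `|h|] ->
    [/\ `|z 0 i0| <= 3 * L, `|z 0 i1| <= 3 * L & d0 <= z 0 i2 <= d1].
  move=> he [z0 z1 z2]; have [EL ZL _ _] := EZ _ (hI _ he).
  split; [exact: between z0|exact: between z1|].
  by have := hI (z 0 i2 - c) (le_trans z2 he); rewrite subrK.
have [K1 K1_ge0 hK1] := continuous_bounded_cube (3 * L + `|d0| + `|d1|)
  (smooth_continuous (smooth_partial i2 s1)).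
have [K2 K2_ge0 hK2] := continuous_bounded_cube (3 * L + `|d0| + `|d1|)
  (smooth_continuous (smooth_partial i2 s2)).
have cube (z : 'rV[R]_3) : [/\ `|z 0 i0| <= 3 * L, `|z 0 i1| <= 3 * L & d0 <= z 0 i2 <= d1] ->
    `|z| <= 3 * L + `|d0| + `|d1|.
  move=> [z0 z1 z2]; rewrite (row3_eta z).
  have dd : 0 <= `|d0| + `|d1| by exact: addr_ge0.
  apply: row3_norm_le; try by rewrite -addrA; apply: le_trans z0 _ || apply: le_trans z1 _;
    rewrite lerDl.
  by apply: cube_bound => //; apply: mulr_ge0.
(* Before any derivative is known to exist, the smallness of the partial derivatives makes the curve
   Lipschitz at [c]; hence the intermediate points converge. *)
have lip h : `|h| <= eta ->
    `|E (h + c) - E c| <= 2 * (K1 + K2) * `|h| /\ `|Z (h + c) - Z c| <= 2 * (K1 + K2) * `|h|.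
  move=> he; have [_ _ E1 Z1] := EZ _ (hI _ he).
  have := (hx1 h).2; have := (hx2 h).2; rewrite -E1 -Z1 -EE -ZZ.
  have b1 i := inbox _ _ he ((hx1 h).1 i); have b2 i := inbox _ _ he ((hx2 h).1 i).
  have [A1 _ _ _] : [/\ `|'D_(e_ i0) P1 (x1 h i0)| <= 8^-1, True, True & True].
    by have [q0 q1 q2] := b1 i0; have [] := small q0 q1 q2.
  have [B1 _ _ _] : [/\ `|'D_(e_ i1) P1 (x1 h i1)| <= 8^-1, True, True & True].
    by have [q0 q1 q2] := b1 i1; have [] := small q0 q1 q2.
  have [A2 _ _ _] : [/\ `|'D_(e_ i0) P2 (x2 h i0)| <= 8^-1, True, True & True].
    by have [q0 q1 q2] := b2 i0; have [] := small q0 q1 q2.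
  have [B2 _ _ _] : [/\ `|'D_(e_ i1) P2 (x2 h i1)| <= 8^-1, True, True & True].
    by have [q0 q1 q2] := b2 i1; have [] := small q0 q1 q2.
  have C1 := hK1 _ (cube _ (b1 i2)); have C2 := hK2 _ (cube _ (b2 i2)).
  move=> eZ eE.
  have : `|E (h + c) - E c| <= `|E (h + c) - E c| * 8^-1 + `|Z (h + c) - Z c| * 8^-1 + `|h| * K1.
    rewrite {1}eE; apply: le_trans (ler_normD _ _) _; apply: lerD.
      by apply: le_trans (ler_normD _ _) _; apply: lerD; rewrite normrM ler_wpM2l.
    by rewrite normrM ler_wpM2l.
  have : `|Z (h + c) - Z c| <= `|E (h + c) - E c| * 8^-1 + `|Z (h + c) - Z c| * 8^-1 + `|h| * K2.
    rewrite {1}eZ; apply: le_trans (ler_normD _ _) _; apply: lerD.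
      by apply: le_trans (ler_normD _ _) _; apply: lerD; rewrite normrM ler_wpM2l.
    by rewrite normrM ler_wpM2l.
  move=> hZ hE.
  have -> : 2 * (K1 + K2) * `|h| = 2 * (`|h| * K1) + 2 * (`|h| * K2).
    by rewrite mulrAC mulrDr !mulrA.
  by apply: absorb hE hZ => //; exact: mulr_ge0.
have K_gt0 : 0 < 2 * (K1 + K2) + 1 by rewrite ltr_wpDl// mulr_ge0// addr_ge0.
have cvx (xi : R -> 'I_3 -> 'rV[R]_3) i : (forall h, [/\ `|xi h i 0 i0 - E c| <= `|E (h + c) - E c|,
       `|xi h i 0 i1 - Z c| <= `|Z (h + c) - Z c| & `|xi h i 0 i2 - c| <= `|h|]) ->
    xi h i @[h --> 0^'] --> p0.
  move=> hxi; apply/cvgrPdist_le => e e0.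
  have k0 : 0 < Num.min eta (e / (2 * (K1 + K2) + 1)).
    by rewrite lt_min eta0 divr_gt0.
  have := @dnbhs0_le R R _ k0.
  apply: (@filterS _ (dnbhs (0:R)) _) => h; rewrite le_min => /andP[h1 h2].
  have [q0 q1 q2] := hxi h; have [l1 l2] := lip _ h1.
  have he : (2 * (K1 + K2) + 1) * `|h| <= e by rewrite mulrC -ler_pdivlMr.
  have hh : 2 * (K1 + K2) * `|h| <= e.
    by apply: le_trans he; rewrite ler_wpM2r// lerDl.
  have hh' : `|h| <= e.
    by apply: le_trans he; rewrite ler_peMl// lerDr mulr_ge0// addr_ge0.
  rewrite distrC (row3_eta (xi h i)).
  have -> : row3 (xi h i 0 i0) (xi h i 0 i1) (xi h i 0 i2) - p0 =
      row3 (xi h i 0 i0 - E c) (xi h i 0 i1 - Z c) (xi h i 0 i2 - c).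
    by apply/rowP => j; case: (ord3P j) => ->; rewrite !mxE.
  by apply: row3_norm_le; [exact: le_trans q0 (le_trans l1 hh)|
    exact: le_trans q1 (le_trans l2 hh)|exact: le_trans q2 hh'].
have lim P (xi : R -> 'I_3 -> 'rV[R]_3) i : smooth P -> (forall h i, [/\ `|xi h i 0 i0 - E c| <= `|E (h + c) - E c|,
       `|xi h i 0 i1 - Z c| <= `|Z (h + c) - Z c| & `|xi h i 0 i2 - c| <= `|h|]) ->
    'D_(e_ i) P (xi h i) @[h --> 0^'] --> 'D_(e_ i) P p0.
  move=> sP hxi.
  have cD : {for p0, continuous ('D_(e_ i) P)} by case: (smooth_partial i sP 0%N) => + _; apply.
  exact: (cvg_comp _ _ (cvx xi i (fun h => hxi h i)) cD).
have L1 i := lim _ _ i s1 (fun h => (hx1 h).1).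
have L2 i := lim _ _ i s2 (fun h => (hx2 h).1).
pose dt (h : R) := (1 - 'D_(e_ i0) P1 (x1 h i0)) * (1 - 'D_(e_ i1) P2 (x2 h i1))
  - 'D_(e_ i1) P1 (x1 h i1) * 'D_(e_ i0) P2 (x2 h i0).
pose dt0 := (1 - 'D_(e_ i0) P1 p0) * (1 - 'D_(e_ i1) P2 p0)
  - 'D_(e_ i1) P1 p0 * 'D_(e_ i0) P2 p0.
have dt_gt := det_gt0.
have L3 : 0 <= L := L0.
have p0I : d0 <= p0 0 i2 <= d1 by rewrite row3E.
have LL : L <= 3 * L by rewrite ler_peMl// ler1n.
have p0E : `|p0 0 i0| <= 3 * L by rewrite row3E; exact: le_trans LL.
have p0Z : `|p0 0 i1| <= 3 * L by rewrite row3E; exact: le_trans LL.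
have dt0_neq0 : dt0 != 0.
  by have [q1 q2 q3 q4] := small p0E p0Z p0I; exact: (dt_gt _ _ _ _ q1 q2 q3 q4).
have FF : Filter (0 : R)^' by exact: _.
have Ldt : dt h @[h --> 0^'] --> dt0.
  exact: (limB FF (limM FF (limB FF (lim_cst FF 1) (L1 i0)) (limB FF (lim_cst FF 1) (L2 i1)))
    (limM FF (L1 i1) (L2 i0))).
have Ldti := limV FF dt0_neq0 Ldt.
have sys h : `|h| <= eta -> h != 0 ->
    h^-1 * (E (h + c) - E c) = ('D_(e_ i2) P1 (x1 h i2) * (1 - 'D_(e_ i1) P2 (x2 h i1))
      + 'D_(e_ i1) P1 (x1 h i1) * 'D_(e_ i2) P2 (x2 h i2)) * (dt h)^-1 /\
    h^-1 * (Z (h + c) - Z c) = ('D_(e_ i2) P2 (x2 h i2) * (1 - 'D_(e_ i0) P1 (x1 h i0))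
      + 'D_(e_ i0) P2 (x2 h i0) * 'D_(e_ i2) P1 (x1 h i2)) * (dt h)^-1.
  move=> he h0; have [_ _ E1 Z1] := EZ _ (hI _ he).
  have := (hx1 h).2; have := (hx2 h).2; rewrite -E1 -Z1 -EE -ZZ => eZ eE.
  have b1 i := inbox _ _ he ((hx1 h).1 i); have b2 i := inbox _ _ he ((hx2 h).1 i).
  have [a1 c1' _ _] : [/\ `|'D_(e_ i0) P1 (x1 h i0)| <= 8^-1,
      `|'D_(e_ i1) P1 (x1 h i1)| <= 8^-1, True & True].
    by have [p1 p2 p3] := b1 i0; have [q1 q2 q3] := b1 i1;
      have [] := small p1 p2 p3; have [] := small q1 q2 q3.
  have [a2 c2 _ _] : [/\ `|'D_(e_ i0) P2 (x2 h i0)| <= 8^-1,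
      `|'D_(e_ i1) P2 (x2 h i1)| <= 8^-1, True & True].
    by have [p1 p2 p3] := b2 i0; have [q1 q2 q3] := b2 i1;
      have [] := small p1 p2 p3; have [] := small q1 q2 q3.
  exact: cramer h0 (dt_gt _ _ _ _ a1 c1' a2 c2) eE eZ.
have near_h := near_dnbhs0 eta0.
split; apply/cvg_ex.
- have Lq := limM FF (limD FF (limM FF (L1 i2) (limB FF (lim_cst FF 1) (L2 i1)))
    (limM FF (L1 i1) (L2 i2))) Ldti.
  have H : {near 0^', (fun h => ('D_(e_ i2) P1 (x1 h i2) * (1 - 'D_(e_ i1) P2 (x2 h i1))
      + 'D_(e_ i1) P1 (x1 h i1) * 'D_(e_ i2) P2 (x2 h i2)) * (dt h)^-1) =1
      (fun h => h^-1 *: ((E \o shift c) (h *: 1) - E c))}.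
    apply: (@filterS _ (dnbhs (0:R)) _ _ _ _ near_h) => h [h1 h2].
    by rewrite /= -[h *: 1]/(h * 1) mulr1 -[RHS]/(_ * _) (sys _ h1 h2).1.
  by eexists; exact: cvg_trans (near_eq_cvg H) Lq.
- have Lq := limM FF (limD FF (limM FF (L2 i2) (limB FF (lim_cst FF 1) (L1 i0)))
    (limM FF (L2 i0) (L1 i2))) Ldti.
  have H : {near 0^', (fun h => ('D_(e_ i2) P2 (x2 h i2) * (1 - 'D_(e_ i0) P1 (x1 h i0))
      + 'D_(e_ i0) P2 (x2 h i0) * 'D_(e_ i2) P1 (x1 h i2)) * (dt h)^-1) =1
      (fun h => h^-1 *: ((Z \o shift c) (h *: 1) - Z c))}.
    apply: (@filterS _ (dnbhs (0:R)) _ _ _ _ near_h) => h [h1 h2].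
    by rewrite /= -[h *: 1]/(h * 1) mulr1 -[RHS]/(_ * _) (sys _ h1 h2).2.
  by eexists; exact: cvg_trans (near_eq_cvg H) Lq.
Qed.

End ImplicitCurve.

(** * The window of a map close to the limit family *)

Ltac smooth_tac := repeat first
  [ assumption | exact: smooth_cst | exact: smooth_coord | apply: smoothX
  | apply: smoothD | apply: smoothN | apply: smoothM | apply: smooth_partial ].

Lemma incr_of_derive (R : realType) (q s : R -> R) (l r : R) :
  (forall D, l < D < r -> is_derive D 1 q (s D)) ->
  forall a b, l < a -> a < b -> b < r -> (forall D, a < D < b -> 0 < s D) -> q a < q b.
Proof.
move=> hq a b la ab br hs.
have dq x : x \in `]a, b[ -> is_derive x 1 q (s x).
  by rewrite in_itv /= => /andP[ax xb]; apply: hq; rewrite (lt_trans la ax) (lt_trans xb br).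
have cq : {within `[a, b], continuous q}.
  apply: derivable_within_continuous => x; rewrite in_itv /= => /andP[ax xb].
  by have [] := hq x; rewrite ?(lt_le_trans la ax) ?(le_lt_trans xb br).
have [D abD E] := MVT ab dq cq.
rewrite -subr_gt0 E mulr_gt0 ?subr_gt0//; apply: hs.
by move: abD; rewrite in_itv.
Qed.

Section Window.
Variable R : realType.
Local Notation e_ i := (delta_mx 0 i).

Definition jdet (h1 h2 : 'rV[R]_3 -> R) x : R :=
  'D_(e_ i1) h1 x * 'D_(e_ i2) h2 x - 'D_(e_ i1) h2 x * 'D_(e_ i2) h1 x.

(* [det (t - J)] for the Jacobian matrix J of the planar map. *)
Definition jchar (t : R) (h1 h2 : 'rV[R]_3 -> R) x : R :=
  (t - 'D_(e_ i1) h1 x) * (t - 'D_(e_ i2) h2 x) - 'D_(e_ i1) h2 x * 'D_(e_ i2) h1 x.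

(* Along a curve of fixed points parametrised by the last coordinate, the
   derivative of the parameter times [fold_speed] is [jchar 1]. *)
Definition fold_speed (h1 h2 : 'rV[R]_3 -> R) x : R :=
  'D_(e_ i0) h2 x * (1 - 'D_(e_ i1) h1 x) + 'D_(e_ i1) h2 x * 'D_(e_ i0) h1 x.

Lemma smooth_jchar t h1 h2 : smooth h1 -> smooth h2 -> smooth (jchar t h1 h2).
Proof. by move=> s1 s2; rewrite /jchar; smooth_tac. Qed.

Variables c k1 beta : R.
Hypotheses (c_bd : -1 < c < 1) (beta_bd : 0 < beta < 2 * (1 - c) ^+ 2).

(** The limit family of the overview; the coordinates [i0], [i1], [i2] are the parameter, zeta and
    D. *)
Definition lim1 (x : 'rV[R]_3) : R := c * x 0 i2 + beta + k1 * x 0 i0.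
Definition lim2 (x : 'rV[R]_3) : R :=
  x 0 i1 + (1 - c) * x 0 i2 - 2^-1 * (x 0 i2 * x 0 i2) + (2^-1 - k1) * x 0 i0.

(** For [-1 <= D <= 5] one has [|D^2 - 2 beta| <= 25 + 2 beta] and [|c D| <= 5], so [radius] bounds
    the parameter and zeta along the unperturbed curve, with room for the perturbation. The box is
    four times larger because [implicit_curve] looks at points up to [3 * radius]. *)
Definition radius : R := (30 + 2 * beta) * (`|k1| + 1) + beta + 10.
Definition box : set 'rV[R]_3 := [set x | forall i, `|x 0 i| < 4 * radius].

Lemma radius_ge : 40 <= radius.
Proof.
have k0 : 0 <= `|k1| by [].
have /andP[b0 _] := beta_bd.
rewrite /radius; nra.
Qed.

Variables (h1 h2 : 'rV[R]_3 -> R) (eps : R).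
Hypotheses (s1 : smooth h1) (s2 : smooth h2).
Let g1 x := h1 x - lim1 x.
Let g2 x := h2 x - lim2 x.
Let kk := `|k1| + 1.

(** Every inequality used to build the window, with a single [eps], so that the construction itself
    involves no limits. The first conditions compare [eps] with the gaps left by the assumptions on
    [c] and [beta]; the factor 400 leaves room for the slopes 24 and [51 * kk] of the curve. *)
Record close : Prop := Close {
  close_pos : 0 < eps;
  close_k : 400 * kk * eps <= 1;
  close_c : 2 * eps < 1 - `|c|;
  close_b : 6 * eps < beta;
  close_b' : 6 * eps < 2 * (1 - c) ^+ 2 - beta;
  close_g : forall x, box x -> `|g1 x| <= eps /\ `|g2 x| <= eps;
  close_dg : forall x i, box x -> `|'D_(e_ i) g1 x| <= eps /\ `|'D_(e_ i) g2 x| <= eps;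
  close_det : forall x, box x -> `|jdet h1 h2 x + c| <= eps;
  close_minus : forall x, box x -> `|jchar 1 h1 h2 x - x 0 i2| <= eps;
  close_plus : forall x, box x -> `|jchar (-1) h1 h2 x - (2 * (1 - c) - x 0 i2)| <= eps;
  close_speed : forall x, box x -> `|fold_speed h1 h2 x - 2^-1| <= eps;
  close_dminus : forall x, box x -> [/\ `|'D_(e_ i0) (jchar 1 h1 h2) x| <= eps,
    `|'D_(e_ i1) (jchar 1 h1 h2) x| <= eps & `|'D_(e_ i2) (jchar 1 h1 h2) x - 1| <= eps];
  close_dplus : forall x, box x -> [/\ `|'D_(e_ i0) (jchar (-1) h1 h2) x| <= eps,
    `|'D_(e_ i1) (jchar (-1) h1 h2) x| <= eps & `|'D_(e_ i2) (jchar (-1) h1 h2) x + 1| <= eps];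
  close_dh1 : forall x, box x -> [/\ `|'D_(e_ i0) h1 x - k1| <= eps,
    `|'D_(e_ i1) h1 x| <= eps & `|'D_(e_ i2) h1 x - c| <= eps] }.

Hypothesis hc : close.

Let eps_small : eps <= 400^-1 /\ `|k1| * eps <= 400^-1.
Proof.
have := close_k hc; have := close_pos hc; have k0 : 0 <= `|k1| by [].
rewrite /kk => e0 h; have p0 := mulr_ge0 k0 (ltW e0).
have {}h : 400 * (`|k1| * eps) + 400 * eps <= 1.
  by move: h; rewrite [X in X <= _ -> _](_ : _ = 400 * (`|k1| * eps) + 400 * eps)//; ring.
split; lra.
Qed.

Let smooth_lim1 : smooth lim1.
Proof. by rewrite /lim1; smooth_tac. Qed.

Let smooth_lim2 : smooth lim2.
Proof. by rewrite /lim2; smooth_tac. Qed.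

Let sg1 : smooth g1. Proof. by rewrite /g1; smooth_tac; exact: smooth_lim1. Qed.
Let sg2 : smooth g2. Proof. by rewrite /g2; smooth_tac; exact: smooth_lim2. Qed.

(** Adding the two fixed-point equations eliminates zeta and gives the parameter, [D^2 - 2 beta] up
    to the perturbation; substituting back gives zeta. The unknowns occur on the right only through
    the small functions [g1] and [g2], so for each [D] this is a contraction. *)
Let P1 (x : 'rV[R]_3) : R := (x 0 i2 * x 0 i2 - 2 * beta) + (- 2) * (g1 x + g2 x).
Let P2 (x : 'rV[R]_3) : R := (c * x 0 i2 + beta + k1 * (x 0 i2 * x 0 i2 - 2 * beta))
  + ((- 2 * k1) * (g1 x + g2 x) + g1 x).

Let sP1 : smooth P1. Proof. by rewrite /P1; smooth_tac. Qed.
Let sP2 : smooth P2. Proof. by rewrite /P2; smooth_tac. Qed.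

Let poly_partial (u : 'rV[R]_3 -> R) (a b : R) i x : i != i2 -> smooth u ->
  'D_(e_ i) (fun x : 'rV[R]_3 => (a * x 0 i2 + b * (x 0 i2 * x 0 i2)) + u x) x
  = 'D_(e_ i) u x.
Proof.
move=> ii su; do !(rewrite partialDE; [|by smooth_tac..]).
do !(rewrite partialME; [|by smooth_tac..]).
by rewrite !partial_cstE !partial_coordE eq_sym (negbTE ii) !(mulr0, addr0, add0r).
Qed.

Let comb_partial (u v : 'rV[R]_3 -> R) (a b k l m : R) i x :
  i != i2 -> smooth u -> smooth v ->
  'D_(e_ i) (fun x : 'rV[R]_3 => (a * x 0 i2 + b * (x 0 i2 * x 0 i2))
     + (k + (l * (u x + v x) + m * u x))) x
  = l * ('D_(e_ i) u x + 'D_(e_ i) v x) + m * 'D_(e_ i) u x.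
Proof.
move=> ii su sv; rewrite poly_partial//; last by smooth_tac.
do !(rewrite partialDE; [|by smooth_tac..]).
do !(rewrite partialME; [|by smooth_tac..]).
do !(rewrite partialDE; [|by smooth_tac..]).
by rewrite !partial_cstE !mulr0 add0r !addr0.
Qed.

Let dP1 i x : i != i2 -> 'D_(e_ i) P1 x = (-2) * ('D_(e_ i) g1 x + 'D_(e_ i) g2 x).
Proof.
move=> ii; have -> : P1 = (fun x : 'rV[R]_3 => (0 * x 0 i2 + 1 * (x 0 i2 * x 0 i2))
    + (- 2 * beta + ((-2) * (g1 x + g2 x) + 0 * g1 x))).
  apply/funext => y; rewrite /P1; move: (g1 y) (g2 y) => u v; ring.
by rewrite (comb_partial _ _ _ _ _ _ ii sg1 sg2) mul0r addr0.
Qed.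

Let dP2 i x : i != i2 ->
  'D_(e_ i) P2 x = (-2 * k1) * ('D_(e_ i) g1 x + 'D_(e_ i) g2 x) + 'D_(e_ i) g1 x.
Proof.
move=> ii; have -> : P2 = (fun x : 'rV[R]_3 => (c * x 0 i2 + k1 * (x 0 i2 * x 0 i2))
    + ((beta - k1 * (2 * beta)) + ((-2 * k1) * (g1 x + g2 x) + 1 * g1 x))).
  apply/funext => y; rewrite /P2; move: (g1 y) (g2 y) => u v; ring.
by rewrite (comb_partial _ _ _ _ _ _ ii sg1 sg2) mul1r.
Qed.

Let in_box (x : 'rV[R]_3) : `|x 0 i0| <= 3 * radius -> `|x 0 i1| <= 3 * radius ->
  -1 <= x 0 i2 <= 5 -> box x.
Proof.
have r := radius_ge.
move=> h0 h1' /andP[h2' h2''] i; case: (ord3P i) => ->; try by lra.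
by rewrite ltr_norml; apply/andP; split; lra.
Qed.

Let norm2 (a b e : R) : `|a| <= e -> `|b| <= e -> `|a + b| <= 2 * e.
Proof. by move=> ha hb; apply: le_trans (ler_normD _ _) _; lra. Qed.

(** The interval [-1 <= D <= 5] contains, with margin 1, both critical values 0 and [2 * (1 - c)],
    the latter lying between 0 and 4. *)
Let curve : exists E Z : R -> R,
  (forall D, -1 <= D <= 5 -> [/\ box (row3 (E D) (Z D) D),
     `|E D - (D ^+ 2 - 2 * beta)| <= 4 * eps, h1 (row3 (E D) (Z D) D) = Z D
     & h2 (row3 (E D) (Z D) D) = D]) /\
  (forall D, -1 < D < 5 -> derivable E D 1 /\ derivable Z D 1).
Proof.
have r := radius_ge; have k0 : 0 <= `|k1| by [].
have e0 := close_pos hc; have [e1 e2] := eps_small.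
have /andP[b0 _] := beta_bd; have /andP[cm cp] := c_bd.
have kP (a b : R) : `|a| <= eps -> `|b| <= eps -> `|-2 * k1 * (a + b)| <= 4 * (`|k1| * eps).
  move=> ha hb; rewrite !normrM normrN (ger0_norm (ler0n _ _)).
  have := ler_wpM2l k0 (norm2 ha hb); lra.
have r0 : 0 <= radius by lra.
have bnd (a b D : R) : `|a| <= radius -> `|b| <= radius -> -1 <= D <= 5 ->
    `|P1 (row3 a b D)| <= radius /\ `|P2 (row3 a b D)| <= radius.
  move=> ha hb hD; have bx : box (row3 a b D) by apply: in_box; rewrite row3E//; lra.
  have [c1 c2] := close_g hc bx.
  have n12 := norm2 c1 c2.
  have kn := kP _ _ c1 c2.
  have /andP[D0 D1] := hD.
  have DD : `|D * D - 2 * beta| <= 25 + 2 * beta.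
    by rewrite ler_norml; apply/andP; split; nra.
  have cD : `|c * D| <= 5.
    rewrite normrM -[leRHS]mul1r ler_pM// ler_norml; apply/andP; split; lra.
  have kD : `|k1 * (D * D - 2 * beta)| <= `|k1| * (25 + 2 * beta).
    by rewrite normrM ler_wpM2l.
  rewrite /P1 /P2 !row3E; split.
    apply: le_trans (ler_normD _ _) _; rewrite normrM normrN (ger0_norm (ler0n _ _)).
    by rewrite /radius; nra.
  apply: le_trans (ler_normD _ _) _.
  have := ler_normD (c * D + beta) (k1 * (D * D - 2 * beta)).
  have := ler_normD (c * D) beta; rewrite (ger0_norm (ltW b0)).
  have := ler_normD (-2 * k1 * (g1 (row3 a b D) + g2 (row3 a b D))) (g1 (row3 a b D)).
  by rewrite /radius; nra.
have small (x : 'rV[R]_3) : `|x 0 i0| <= 3 * radius -> `|x 0 i1| <= 3 * radius ->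
    -1 <= x 0 i2 <= 5 ->
    [/\ `|'D_(e_ i0) P1 x| <= 8^-1, `|'D_(e_ i1) P1 x| <= 8^-1,
      `|'D_(e_ i0) P2 x| <= 8^-1 & `|'D_(e_ i1) P2 x| <= 8^-1].
  move=> x0 x1 x2; have bx := in_box x0 x1 x2.
  have S1 i : i != i2 -> `|'D_(e_ i) P1 x| <= 8^-1.
    move=> ii; have [d1 d2] := close_dg hc i bx.
    rewrite dP1// normrM normrN (ger0_norm (ler0n _ _)).
    by have := norm2 d1 d2; lra.
  have S2 i : i != i2 -> `|'D_(e_ i) P2 x| <= 8^-1.
    move=> ii; have [d1 d2] := close_dg hc i bx.
    rewrite dP2//; apply: le_trans (ler_normD _ _) _.
    by have := kP _ _ d1 d2; lra.
  by split; [exact: S1|exact: S1|exact: S2|exact: S2].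
have [E [Z [EZ dEZ]]] := implicit_curve sP1 sP2 r0 bnd small.
exists E, Z; split => // D hD.
have [EL ZL EE ZZ] := EZ _ hD.
have bx : box (row3 (E D) (Z D) D) by apply: in_box; rewrite row3E//; lra.
have [c1 c2] := close_g hc bx.
move: EE ZZ; rewrite /P1 /P2 !row3E; set x := row3 _ _ _ => EE ZZ.
have h1E : h1 x = lim1 x + g1 x by rewrite /g1 addrC subrK.
have h2E : h2 x = lim2 x + g2 x by rewrite /g2 addrC subrK.
split => //.
- have -> : E D - (D ^+ 2 - 2 * beta) = -2 * (g1 x + g2 x) by rewrite EE; ring.
  rewrite normrM normrN (ger0_norm (ler0n _ _)).
  by have := norm2 c1 c2; lra.
- by rewrite h1E /lim1 {1}/x !row3E EE [RHS]ZZ; ring.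
- by rewrite h2E /lim2 {1 2 3 4 5}/x !row3E [X in X + _ * D]ZZ EE; field.
Qed.

(** The last two hypotheses are the fixed-point equations differentiated in D. Eliminating [Z']
    gives the first conclusion; then [|J| <= 6] and a fold speed of at least 1/4 give the bound
    24. *)
Let slope_arith (p0 a c' q0 b d E' Z' J D : R) :
  `|p0 - k1| <= eps -> `|a| <= eps -> `|c' - c| <= eps ->
  `|q0 * (1 - a) + b * p0 - 2^-1| <= eps -> J = (1 - a) * (1 - d) - b * c' ->
  `|J - D| <= eps -> -1 < D < 5 ->
  Z' = p0 * E' + a * Z' + c' -> 1 = q0 * E' + b * Z' + d ->
  [/\ (q0 * (1 - a) + b * p0) * E' = J, `|E'| <= 24 & `|Z'| <= 51 * kk].
Proof.
have [e1 e2] := eps_small; have e0 := close_pos hc; have /andP[cm cp] := c_bd.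
have k0 : 0 <= `|k1| by [].
clear - e1 e2 e0 cm cp k0.
move=> hp ha hc' hf JE hJ /andP[D0 D1] Z1 E1.
have eq1 : (q0 * (1 - a) + b * p0) * E' = J.
  rewrite JE; have -> : 1 - d = q0 * E' + b * Z' by rewrite {1}E1; ring.
  have -> : c' = Z' - p0 * E' - a * Z' by rewrite {1}Z1; ring.
  ring.
move: hf eq1; set f := q0 * _ + _ => hf eq1.
have f4 : 4^-1 <= f by move: hf; rewrite ler_norml => /andP[? ?]; lra.
have J6 : `|J| <= 6.
  by move: hJ; rewrite !ler_norml => /andP[? ?]; apply/andP; split; lra.
have E24 : `|E'| <= 24.
  have : 4^-1 * `|E'| <= 6.
    apply: le_trans J6; rewrite -eq1 normrM ler_wpM2r//.
    by apply: le_trans f4 _; exact: ler_norm.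
  lra.
split=> //.
have Zb : `|Z'| <= (`|k1| + eps) * 24 + eps * `|Z'| + (1 + eps).
  rewrite {1}Z1; apply: le_trans (ler_normD _ _) _; apply: lerD.
    apply: le_trans (ler_normD _ _) _; apply: lerD; rewrite normrM.
      apply: ler_pM => //; have -> : p0 = k1 + (p0 - k1) by rewrite addrC subrK.
      by apply: le_trans (ler_normD _ _) _; rewrite lerD2l.
    by rewrite ler_wpM2r.
  have -> : c' = c + (c' - c) by rewrite addrC subrK.
  apply: le_trans (ler_normD _ _) _; apply: lerD => //.
  by rewrite ler_norml; apply/andP; split; lra.
have Z0 : 0 <= `|Z'| by [].
move: Zb; set z := `|Z'| in Z0 *; rewrite /kk => Zb; nra.
Qed.

Let curve_slopes E Z D : (forall D, -1 <= D <= 5 -> [/\ box (row3 (E D) (Z D) D),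
     `|E D - (D ^+ 2 - 2 * beta)| <= 4 * eps, h1 (row3 (E D) (Z D) D) = Z D
     & h2 (row3 (E D) (Z D) D) = D]) ->
  (forall D, -1 < D < 5 -> derivable E D 1 /\ derivable Z D 1) -> -1 < D < 5 ->
  let x := row3 (E D) (Z D) D in
  [/\ fold_speed h1 h2 x * 'D_1 E D = jchar 1 h1 h2 x, `|'D_1 E D| <= 24
    & `|'D_1 Z D| <= 51 * kk].
Proof.
move=> hcurve hder hD x.
have [dE dZ] := hder _ hD.
have hD' : -1 <= D <= 5 by case/andP: hD => *; rewrite !ltW.
have [bx _ _ _] := hcurve _ hD'.
have along h : smooth h -> is_derive D 1 (fun D => h (row3 (E D) (Z D) D))
    ('D_(e_ i0) h x * 'D_1 E D + 'D_(e_ i1) h x * 'D_1 Z D + 'D_(e_ i2) h x * 1).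
  move=> sh; apply: is_derive_row3 => //; exact/derivableP.
have nearD : \forall y \near D, -1 <= y <= 5.
  have := @near_in_itvoo R (-1) 5 D; rewrite in_itv /= => /(_ hD).
  by apply: filterS => y; rewrite in_itv /= => /andP[? ?]; rewrite !ltW.
have Z1 : 'D_1 Z D = 'D_(e_ i0) h1 x * 'D_1 E D + 'D_(e_ i1) h1 x * 'D_1 Z D + 'D_(e_ i2) h1 x.
  rewrite -[X in _ = _ + X]mulr1 -(@derive_val _ _ _ _ _ _ _ (along _ s1)).
  by apply: near_eq_derive; apply: filterS nearD => y /hcurve[].
have E1 : 1 = 'D_(e_ i0) h2 x * 'D_1 E D + 'D_(e_ i1) h2 x * 'D_1 Z D + 'D_(e_ i2) h2 x.
  rewrite -[X in _ = _ + X]mulr1 -(@derive_val _ _ _ _ _ _ _ (along _ s2)).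
  transitivity ('D_1 (@id R) D); first by rewrite derive_id.
  by apply: near_eq_derive; apply: filterS nearD => y /hcurve[].
have [q1 q2 q3] := close_dh1 hc bx.
have q4 := close_speed hc bx; have q5 := close_minus hc bx.
have xD : x 0 i2 = D by rewrite row3E.
rewrite xD in q5.
exact: (@slope_arith _ _ _ _ _ _ _ _ _ D q1 q2 q3 q4 (erefl _) q5 hD Z1 E1).
Qed.

(** The derivative along the curve of a function whose gradient is close to [(0, 0, 1)]: the slopes
    are bounded, so their products with [eps] cannot outweigh the last component. *)
Let along_lo (u v w E' Z' : R) : `|u| <= eps -> `|v| <= eps -> `|w - 1| <= eps ->
  `|E'| <= 24 -> `|Z'| <= 51 * kk -> 2^-1 <= u * E' + v * Z' + w * 1.
Proof.
have [e1 e2] := eps_small; have e0 := close_pos hc; have k0 : 0 <= `|k1| by [].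
rewrite /kk => hu hv hw hE hZ.
have w1 : `|u * E'| <= eps * 24 by rewrite normrM ler_pM.
have w2 : `|v * Z'| <= eps * (51 * (`|k1| + 1)) by rewrite normrM ler_pM.
have w2' : eps * (51 * (`|k1| + 1)) = 51 * (`|k1| * eps) + 51 * eps by ring.
rewrite w2' in w2.
by move: w1 w2 hw; rewrite !ler_norml => /andP[? _] /andP[? _] /andP[? _]; lra.
Qed.

Let along_hi (u v w E' Z' : R) : `|u| <= eps -> `|v| <= eps -> `|w + 1| <= eps ->
  `|E'| <= 24 -> `|Z'| <= 51 * kk -> 2^-1 <= - (u * E' + v * Z' + w * 1).
Proof.
move=> hu hv hw hE hZ.
have -> : - (u * E' + v * Z' + w * 1) = (- u) * E' + (- v) * Z' + (- w) * 1 by ring.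
apply: along_lo hE hZ; rewrite ?normrN//.
by rewrite -opprD normrN.
Qed.

(** Along the curve [jchar 1] is near [D] and increasing, [jchar (-1)] is near [2 (1 - c) - D] and
    decreasing; their zeros [D1 < D2] are the two bifurcations. Between them [jchar 1 > 0] makes the
    parameter [E] increase with [D], so the branch can be reparametrised by [e], and
    [E D1 < 0 < E D2] by the two-sided bound on [beta]. *)
Theorem window : exists (em ep : R) (zeta : R -> 'rV[R]_2),
  let pos e := row3 e (zeta e 0 0) (zeta e 0 1) in
  [/\ em < 0, 0 < ep, {within `[em, ep], continuous zeta},
    forall e, em <= e <= ep -> box (pos e) /\ planar h1 h2 e (zeta e) = zeta e
   & [/\ forall e, em < e < ep ->
         0 < jchar 1 h1 h2 (pos e) /\ 0 < jchar (-1) h1 h2 (pos e),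
       jchar 1 h1 h2 (pos em) = 0, jchar (-1) h1 h2 (pos ep) = 0,
       `|zeta em 0 1| <= eps & `|zeta ep 0 1 - 2 * (1 - c)| <= eps]].
Proof.
have [E [Z [hcurve hder]]] := curve.
have slopes (D : R) (hD : -1 < D < 5) := curve_slopes hcurve hder hD.
have e0 := close_pos hc; have [e1 e2] := eps_small.
have /andP[cm cp] := c_bd; have /andP[b0 b1] := beta_bd.
have ec := close_c hc; have eb := close_b hc; have eb' := close_b' hc.
have cabs : `|c| < 1 by rewrite ltr_norml cm cp.
have cn := ler_norm c.
pose p D := row3 (E D) (Z D) D.
have wk (D : R) : -1 < D < 5 -> -1 <= D <= 5 by case/andP => *; rewrite !ltW.
have along h (D : R) : smooth h -> -1 < D < 5 -> is_derive D 1 (fun D => h (p D))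
    ('D_(e_ i0) h (p D) * 'D_1 E D + 'D_(e_ i1) h (p D) * 'D_1 Z D + 'D_(e_ i2) h (p D) * 1).
  by move=> sh hD; have [dE dZ] := hder _ hD; apply: is_derive_row3 => //; exact/derivableP.
(* The sign of [r] is reversed so that [q] and [r] are both increasing. *)
pose q D := jchar 1 h1 h2 (p D); pose r D := - jchar (-1) h1 h2 (p D).
have sm := smooth_jchar 1 s1 s2; have sp := smooth_jchar (-1) s1 s2.
have dq (D : R) (hD : -1 < D < 5) := along _ D sm hD.
have dr (D : R) : -1 < D < 5 ->
    is_derive D 1 r (- ('D_(e_ i0) (jchar (-1) h1 h2) (p D) * 'D_1 E D +
   'D_(e_ i1) (jchar (-1) h1 h2) (p D) * 'D_1 Z D + 'D_(e_ i2) (jchar (-1) h1 h2) (p D) * 1)).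
  by move=> hD; have H := along _ D sp hD; exact: is_deriveN.
have qlo (D : R) : -1 < D < 5 -> 0 < 'D_(e_ i0) (jchar 1 h1 h2) (p D) * 'D_1 E D +
   'D_(e_ i1) (jchar 1 h1 h2) (p D) * 'D_1 Z D + 'D_(e_ i2) (jchar 1 h1 h2) (p D) * 1.
  move=> hD; have [bx _ _ _] := hcurve _ (wk _ hD); have [_ hE hZ] := slopes _ hD.
  have [u v w] := close_dminus hc bx.
  by apply: lt_le_trans (along_lo u v w hE hZ); rewrite invr_gt0 ltr0n.
have rlo (D : R) : -1 < D < 5 -> 0 < - ('D_(e_ i0) (jchar (-1) h1 h2) (p D) * 'D_1 E D +
   'D_(e_ i1) (jchar (-1) h1 h2) (p D) * 'D_1 Z D + 'D_(e_ i2) (jchar (-1) h1 h2) (p D) * 1).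
  move=> hD; have [bx _ _ _] := hcurve _ (wk _ hD); have [_ hE hZ] := slopes _ hD.
  have [u v w] := close_dplus hc bx.
  by apply: lt_le_trans (along_hi u v w hE hZ); rewrite invr_gt0 ltr0n.
have qincr (a b : R) : -1 < a -> a < b -> b < 5 -> q a < q b.
  move=> ha ab hb; apply: (incr_of_derive dq ha ab hb) => D /andP[aD Db].
  by apply: qlo; rewrite (lt_trans ha aD) (lt_trans Db hb).
have rincr (a b : R) : -1 < a -> a < b -> b < 5 -> r a < r b.
  move=> ha ab hb; apply: (incr_of_derive dr ha ab hb) => D /andP[aD Db].
  by apply: rlo; rewrite (lt_trans ha aD) (lt_trans Db hb).
have inside (a b : R) : -1 < a -> b < 5 -> forall x, x \in `[a, b] -> -1 < x < 5.
  move=> ha hb x; rewrite in_itv /= => /andP[ax xb].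
  by rewrite (lt_le_trans ha ax) (le_lt_trans xb hb).
have qc (a b : R) : -1 < a -> b < 5 -> {within `[a, b], continuous q}.
  move=> ha hb; apply: derivable_within_continuous => x /(inside _ _ ha hb) hx.
  by have [] := dq x hx.
have rc (a b : R) : -1 < a -> b < 5 -> {within `[a, b], continuous r}.
  move=> ha hb; apply: derivable_within_continuous => x /(inside _ _ ha hb) hx.
  by have [] := dr x hx.
have qD (D : R) : -1 < D < 5 -> `|q D - D| <= eps.
  move=> hD; have [bx _ _ _] := hcurve _ (wk _ hD).
  by have := close_minus hc bx; rewrite row3E.
have rD (D : R) : -1 < D < 5 -> `|r D + (2 * (1 - c) - D)| <= eps.
  move=> hD; have [bx _ _ _] := hcurve _ (wk _ hD).
  by have := close_plus hc bx; rewrite row3E /r -normrN opprB addrC.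
(* [q] differs from the identity by at most [eps], so it changes sign between -1/2 and 1/2;
   similarly [r] around [2 * (1 - c)]. *)
have [D1 hD1 qD1] : exists2 D, -1 < D < 5 & q D = 0.
  have m1 : -1 < - (2^-1 : R) < 5 by apply/andP; split; lra.
  have m2 : -1 < (2^-1 : R) < 5 by apply/andP; split; lra.
  have := qD _ m1; have := qD _ m2; rewrite !ler_norml => /andP[t1 _] /andP[_ t2].
  have le1 : - (2^-1 : R) <= 2^-1 by lra.
  have i1' : -1 < - (2^-1 : R) by lra.
  have i2' : (2^-1 : R) < 5 by lra.
  have := @IVT R q _ _ 0 le1 (qc _ _ i1' i2').
  case=> [|x xab qx].
    by apply/andP; split; [rewrite ge_min|rewrite le_max]; apply/orP; [left|right];
      lra.
  by exists x => //; exact: (inside _ _ i1' i2').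
have [D2 hD2 rD2] : exists2 D, -1 < D < 5 & r D = 0.
  pose x1 := 2 * (1 - c) - 2^-1; pose x2 := 2 * (1 - c) + 2^-1.
  have m1 : -1 < x1 < 5 by apply/andP; rewrite /x1; split; lra.
  have m2 : -1 < x2 < 5 by apply/andP; rewrite /x2; split; lra.
  have := rD _ m1; have := rD _ m2; rewrite !ler_norml => /andP[t1 _] /andP[_ t2].
  have le1 : x1 <= x2 by rewrite /x1 /x2; lra.
  have [i1' _] := andP m1; have [_ i2'] := andP m2.
  have := @IVT R r _ _ 0 le1 (rc _ _ i1' i2').
  case=> [|x xab qx].
    by apply/andP; split; [rewrite ge_min|rewrite le_max]; apply/orP; [left|right];
      move: t1 t2; rewrite /x1 /x2 => t1 t2; lra.
  by exists x => //; exact: (inside _ _ i1' i2').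
have D1e : `|D1| <= eps by have := qD _ hD1; rewrite qD1 sub0r normrN.
have D2e : `|D2 - 2 * (1 - c)| <= eps.
  by have := rD _ hD2; rewrite rD2 add0r -normrN opprB.
have [D1m D1p] := andP hD1; have [D2m D2p] := andP hD2.
have D12 : D1 < D2.
  move: D1e D2e; rewrite !ler_norml => /andP[? ?] /andP[? ?].
  lra.
have dE (D : R) : -1 < D < 5 -> is_derive D 1 E ('D_1 E D).
  by move=> hD; have [dE _] := hder _ hD; exact/derivableP.
have Epos (D : R) : D1 < D < D2 -> 0 < 'D_1 E D.
  move=> /andP[D1D DD2].
  have hD : -1 < D < 5 by rewrite (lt_trans D1m D1D) (lt_trans DD2 D2p).
  have [eq1 _ _] := slopes _ hD; have [bx _ _ _] := hcurve _ (wk _ hD).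
  have qpos : 0 < jchar 1 h1 h2 (row3 (E D) (Z D) D).
    by rewrite -qD1; apply: qincr => //; exact: lt_trans D2p.
  have f4 : 0 < fold_speed h1 h2 (row3 (E D) (Z D) D).
    have := close_speed hc bx; rewrite ler_norml => /andP[? _].
    lra.
  by move: qpos; rewrite -eq1 pmulr_rgt0.
have Eincr (a b : R) : D1 <= a -> a < b -> b <= D2 -> E a < E b.
  move=> ha ab hb; apply: (incr_of_derive dE (lt_le_trans D1m ha) ab (le_lt_trans hb D2p)).
  by move=> D /andP[aD Db]; apply: Epos; rewrite (le_lt_trans ha aD) (lt_le_trans Db hb).
have Ec : {within `[D1, D2], continuous E}.
  apply: derivable_within_continuous => x /(inside _ _ D1m D2p) hx.
  by have [] := dE x hx.
have E_near (D : R) : -1 < D < 5 -> `|E D - (D ^+ 2 - 2 * beta)| <= 4 * eps.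
  by move=> hD; have [] := hcurve _ (wk _ hD).
have em0 : E D1 < 0.
  have sq : D1 ^+ 2 <= eps * 1.
    rewrite -(ger0_norm (sqr_ge0 D1)) normrX expr2 ler_pM//.
    by apply: le_trans D1e _; lra.
  by have := E_near _ hD1; rewrite ler_norml => /andP[_ u3]; lra.
(* [E D2] is close to [4 (1 - c)^2 - 2 beta], positive with the margin recorded in [close_b']. *)
have ep0 : 0 < E D2.
  have y0 : 0 <= 2 * (1 - c) - eps by lra.
  have yD : 2 * (1 - c) - eps <= D2.
    by move: D2e; rewrite ler_norml => /andP[u1 _]; lra.
  have sq := ler_pM y0 y0 yD yD.
  have ce : (1 - c) * eps <= 2 * eps by rewrite ler_wpM2r ?ltW//; lra.
  have ee : 0 <= eps * eps by rewrite mulr_ge0// ltW.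
  have := E_near _ hD2; rewrite ler_norml => /andP[u3 _].
  by lra.
(* This yields the inverse [tau] of [E] on the window; outside it the value 0 is arbitrary. *)
have inv (e : R) : exists D, E D1 <= e <= E D2 -> D1 <= D <= D2 /\ E D = e.
  have [he|/negP he] := boolP (E D1 <= e <= E D2); last by exists 0.
  have := @IVT R E _ _ e (ltW D12) Ec.
  case=> [|x xab Ex]; last by exists x => _; move: xab; rewrite in_itv.
  have [he1 he2] := andP he.
  by rewrite ge_min he1 le_max he2 orbT.
have [tau htau] := choice inv.
have Einj (a b : R) : D1 <= a <= D2 -> D1 <= b <= D2 -> E a = E b -> a = b.
  move=> /andP[a1 a2] /andP[b1' b2]; have [ab|ab|//] := ltgtP a b => Eab.
    by have := Eincr _ _ a1 ab b2; rewrite Eab ltxx.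
  by have := Eincr _ _ b1' ab a2; rewrite Eab ltxx.
have Emono (a b : R) : D1 <= a -> a <= b -> b <= D2 -> E a <= E b.
  by move=> h; rewrite le_eqVlt => /predU1P[->//|ab] hb; exact/ltW/Eincr.
have tauK : {in `[D1, D2], cancel E tau}.
  move=> D; rewrite in_itv /= => hD; have [hD1' hD2'] := andP hD.
  have he : E D1 <= E D <= E D2 by rewrite !Emono.
  by have [h1' h2'] := htau _ he; exact: Einj.
have tauc : {within `[E D1, E D2], continuous tau}.
  exact: segment_can_le_continuous (ltW D12) Ec tauK.
have tau1 : tau (E D1) = D1 by apply: tauK; rewrite in_itv /= lexx ltW.
have tau2 : tau (E D2) = D2 by apply: tauK; rewrite in_itv /= lexx ltW.
have in5 (D : R) : D1 <= D <= D2 -> -1 < D < 5.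
  by move=> /andP[d1 d2]; rewrite (lt_le_trans D1m d1) (le_lt_trans d2 D2p).
exists (E D1), (E D2), (fun e => pt (Z (tau e)) (tau e)) => pos.
have posE e : E D1 <= e <= E D2 -> pos e = p (tau e).
  by move=> he; rewrite /pos !ptE /p; have [_ ->] := htau _ he.
split=> //.
- apply/subspace_continuousP => e he.
  have he' : E D1 <= e <= E D2 by move: he; rewrite /= in_itv.
  have ct : tau x @[x --> within [set` `[E D1, E D2]] (nbhs e)] --> tau e.
    exact: (subspace_continuousP _ _).1 tauc e he.
  have cZ : {for tau e, continuous Z}.
    have [_ dZ] := hder _ (in5 _ (htau _ he').1).
    exact/differentiable_continuous/derivable1_diffP.
  apply: (@row_cvg R 2 R (within [set` `[E D1, E D2]] (nbhs e)) _
    (fun j e => if j == 0 then Z (tau e) else tau e)) => j.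
  rewrite mxE; case: ifP => _ //.
  exact: (cvg_comp _ _ ct cZ).
- move=> e he; have [h1' h2'] := htau _ he; rewrite posE//.
  have [bx _ hh1 hh2] := hcurve _ (wk _ (in5 _ h1')).
  split=> //; rewrite /planar /slice !ptE.
  by move: hh1 hh2; rewrite h2' => -> ->.
- split.
  + move=> e he; have he' : E D1 <= e <= E D2 by case/andP: he => *; rewrite !ltW.
    have [/andP[t1 t2] t3] := htau _ he'; rewrite posE//.
    have [he1 he2] := andP he.
    have t1' : D1 < tau e.
      rewrite lt_neqAle t1 andbT; apply/eqP => tE.
      by move: he1; rewrite -t3 -tE ltxx.
    have t2' : tau e < D2.
      rewrite lt_neqAle t2 andbT; apply/eqP => tE.
      by move: he2; rewrite -t3 tE ltxx.
    split; first by rewrite -[X in X < _]qD1; apply: qincr => //; exact: lt_trans D2p.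
    by rewrite -oppr_lt0 -[X in _ < X]rD2; apply: rincr => //; exact: lt_trans t1'.
  + by rewrite posE ?tau1// lexx Emono// ltW.
  + rewrite posE ?tau2; last by rewrite lexx Emono// ltW.
    by move: rD2; rewrite /r => /eqP; rewrite oppr_eq0 => /eqP.
  + by rewrite ptE tau1.
  + by rewrite ptE tau2.
Qed.

End Window.

(** * Families converging to the limit family *)

Section NearLimit.
Variable R : realType.
Local Notation e_ i := (delta_mx 0 i).

Lemma partialZE (a : R) (h : 'rV[R]_3 -> R) i x : smooth h ->
  'D_(e_ i) (fun x => a * h x) x = a * 'D_(e_ i) h x.
Proof. by move=> sh; apply: deriveZ; exact: smooth_derivable. Qed.

Lemma partial_lin2 (a b : R) (g h : 'rV[R]_3 -> R) i x : smooth g -> smooth h ->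
  'D_(e_ i) (fun x => a * g x + b * h x) x = a * 'D_(e_ i) g x + b * 'D_(e_ i) h x.
Proof.
move=> sg sh; rewrite partialDE; [|by apply: smoothM => //; exact: smooth_cst..].
by rewrite !partialZE.
Qed.

Lemma partial_dirop (u : 'rV[R]_2) (h : 'rV[R]_3 -> R) i x : smooth h ->
  'D_(e_ i) (dirop u h) x =
  u 0 0 * 'D_(e_ i) ('D_(e_ i1) h) x + u 0 1 * 'D_(e_ i) ('D_(e_ i2) h) x.
Proof.
move=> sh.
exact: (partial_lin2 (u 0 0) (u 0 1) i x (smooth_partial i1 sh) (smooth_partial i2 sh)).
Qed.

Lemma partial_dirop_fun (u : 'rV[R]_2) (h : 'rV[R]_3 -> R) i : smooth h ->
  'D_(e_ i) (dirop u h) = fun x =>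
  u 0 0 * 'D_(e_ i) ('D_(e_ i1) h) x + u 0 1 * 'D_(e_ i) ('D_(e_ i2) h) x.
Proof. by move=> sh; apply/funext => x; exact: partial_dirop. Qed.

Lemma dirop2 (u v : 'rV[R]_2) (h : 'rV[R]_3 -> R) x : smooth h ->
  dirop u (dirop v h) x =
  u 0 0 * (v 0 0 * 'D_(e_ i1) ('D_(e_ i1) h) x + v 0 1 * 'D_(e_ i1) ('D_(e_ i2) h) x) +
  u 0 1 * (v 0 0 * 'D_(e_ i2) ('D_(e_ i1) h) x + v 0 1 * 'D_(e_ i2) ('D_(e_ i2) h) x).
Proof.
by move=> sh; rewrite {1}/dirop (partial_dirop v i1 x sh) (partial_dirop v i2 x sh).
Qed.

Lemma partial_dirop2 (u v : 'rV[R]_2) (h : 'rV[R]_3 -> R) i x : smooth h ->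
  'D_(e_ i) (dirop u (dirop v h)) x =
  u 0 0 * (v 0 0 * 'D_(e_ i) ('D_(e_ i1) ('D_(e_ i1) h)) x
    + v 0 1 * 'D_(e_ i) ('D_(e_ i1) ('D_(e_ i2) h)) x) +
  u 0 1 * (v 0 0 * 'D_(e_ i) ('D_(e_ i2) ('D_(e_ i1) h)) x
    + v 0 1 * 'D_(e_ i) ('D_(e_ i2) ('D_(e_ i2) h)) x).
Proof.
move=> sh.
have P j : 'D_(e_ i) ('D_(e_ j) (dirop v h)) x =
    v 0 0 * 'D_(e_ i) ('D_(e_ j) ('D_(e_ i1) h)) x + v 0 1 * 'D_(e_ i) ('D_(e_ j) ('D_(e_ i2) h)) x.
  rewrite (partial_dirop_fun v j sh).
  have sm l : smooth ('D_(e_ j) ('D_(e_ l) h)) by exact/smooth_partial/smooth_partial.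
  exact: (partial_lin2 (v 0 0) (v 0 1) i x (sm i1) (sm i2)).
exact: (etrans (partial_dirop u i x (smooth_dirop v sh))
  (congr2 (fun a b => u 0 0 * a + u 0 1 * b) (P i1) (P i2))).
Qed.

Variables c k1 beta : R.
Hypotheses (c_bd : -1 < c < 1) (beta_bd : 0 < beta < 2 * (1 - c) ^+ 2).
Variables (T : Type) (F : set_system T) (FF : Filter F).
Variables (h1 h2 : T -> 'rV[R]_3 -> R) (delta : T -> R).
Hypotheses (s1 : forall t, smooth (h1 t)) (s2 : forall t, smooth (h2 t)).
Hypotheses (delta_gt0 : \forall t \near F, 0 < delta t)
  (delta_lim : delta t @[t --> F] --> (0 : R)).
Let A := box k1 beta.
Let l1 := lim1 c k1 beta.
Let l2 := lim2 c k1.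
Hypothesis close1 : bO F 3 A delta (fun t x => h1 t x - l1 x).
Hypothesis close2 : bO F 3 A delta (fun t x => h2 t x - l2 x).

Let sl1 : smooth l1. Proof. by rewrite /l1 /lim1; smooth_tac. Qed.
Let sl2 : smooth l2. Proof. by rewrite /l2 /lim2; smooth_tac. Qed.

Lemma bO_partial r (B : set 'rV[R]_3) (d : T -> R) (u : T -> 'rV[R]_3 -> R) i :
  bO F r.+1 B d u -> bO F r B d (fun t => 'D_(e_ i) (u t)).
Proof.
move=> [C C0 h]; exists C => //; apply: filterS h => t [su [_ Bu]].
by split; [exact: smooth_partial|exact: Bu].
Qed.

Let Dl10 x : 'D_(e_ i0) l1 x = k1.
Proof.
rewrite /l1 /lim1; do !(rewrite partialDE; [|by smooth_tac..]).
do !(rewrite partialME; [|by smooth_tac..]).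
by rewrite !partial_cstE !partial_coordE /= !mulr0 !add0r mulr1 addr0.
Qed.
Let Dl11 x : 'D_(e_ i1) l1 x = 0.
Proof.
rewrite /l1 /lim1; do !(rewrite partialDE; [|by smooth_tac..]).
do !(rewrite partialME; [|by smooth_tac..]).
by rewrite !partial_cstE !partial_coordE /= !mulr0 !addr0.
Qed.
Let Dl12 x : 'D_(e_ i2) l1 x = c.
Proof.
rewrite /l1 /lim1; do !(rewrite partialDE; [|by smooth_tac..]).
do !(rewrite partialME; [|by smooth_tac..]).
by rewrite !partial_cstE !partial_coordE /= !mulr0 !addr0 mulr1.
Qed.
Let Dl20 x : 'D_(e_ i0) l2 x = 2^-1 - k1.
Proof.
rewrite /l2 /lim2; do !(rewrite partialDE; [|by smooth_tac..]).
rewrite partialNE; last by smooth_tac.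
do !(rewrite partialME; [|by smooth_tac..]).
by rewrite !partial_cstE !partial_coordE /= !mulr0 !addr0 !mulr0 oppr0 !addr0 mulr1 add0r.
Qed.
Let Dl21 x : 'D_(e_ i1) l2 x = 1.
Proof.
rewrite /l2 /lim2; do !(rewrite partialDE; [|by smooth_tac..]).
rewrite partialNE; last by smooth_tac.
do !(rewrite partialME; [|by smooth_tac..]).
by rewrite !partial_cstE !partial_coordE /= !mulr0 !addr0 !mulr0 oppr0 !addr0.
Qed.
Let Dl22 x : 'D_(e_ i2) l2 x = 1 - c - x 0 i2.
Proof.
rewrite /l2 /lim2; do !(rewrite partialDE; [|by smooth_tac..]).
rewrite partialNE; last by smooth_tac.
do !(rewrite partialME; [|by smooth_tac..]).
by rewrite !partial_cstE !partial_coordE /= !mulr0 !addr0 !mulr1 add0r; field.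
Qed.

Let DDl1 i j x : 'D_(e_ j) ('D_(e_ i) l1) x = 0.
Proof.
have -> : 'D_(e_ i) l1 = fun=> [:: k1; 0; c]`_i.
  by apply/funext => y; case: (ord3P i) => -> /=.
exact: partial_cstE.
Qed.

Let Dl2E i : 'D_(e_ i) l2 =
  fun x => [:: 2^-1 - k1; 1; 1 - c]`_i + - ((i == i2)%:R * x 0 i2).
Proof.
apply/funext => y; case: (ord3P i) => -> /=; rewrite ?Dl20 ?Dl21 ?Dl22.
- by rewrite mul0r subr0.
- by rewrite mul0r subr0.
- by rewrite mul1r.
Qed.

Let DDl2E i j : 'D_(e_ j) ('D_(e_ i) l2) = fun=> - ((i == i2) && (j == i2))%:R.
Proof.
apply/funext => x; rewrite Dl2E partialDE; [|by smooth_tac..].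
rewrite partialNE; last by smooth_tac.
rewrite partialME; [|by smooth_tac..].
by rewrite !partial_cstE !partial_coordE mulr0 addr0 add0r [j == i2]eq_sym -natrM mulnb.
Qed.

Let DDDl2 i j l x : 'D_(e_ l) ('D_(e_ j) ('D_(e_ i) l2)) x = 0.
Proof. by rewrite DDl2E partial_cstE. Qed.

Let DDDl1 i j l x : 'D_(e_ l) ('D_(e_ j) ('D_(e_ i) l1)) x = 0.
Proof.
have -> : 'D_(e_ j) ('D_(e_ i) l1) = fun=> 0 by apply/funext => y; exact: DDl1.
exact: partial_cstE.
Qed.

Let G1 t x := h1 t x - l1 x.
Let G2 t x := h2 t x - l2 x.
Let sG1 t : smooth (G1 t). Proof. by apply: smoothD; [exact: s1|apply: smoothN; exact: sl1]. Qed.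
Let sG2 t : smooth (G2 t). Proof. by apply: smoothD; [exact: s2|apply: smoothN; exact: sl2]. Qed.

Let h1E t : h1 t = fun x => l1 x + G1 t x.
Proof. by apply/funext => x; rewrite /G1 addrC subrK. Qed.
Let h2E t : h2 t = fun x => l2 x + G2 t x.
Proof. by apply/funext => x; rewrite /G2 addrC subrK. Qed.

Let d1E t i : 'D_(e_ i) (h1 t) = fun x => 'D_(e_ i) l1 x + 'D_(e_ i) (G1 t) x.
Proof. by rewrite h1E partialD. Qed.
Let d2E t i : 'D_(e_ i) (h2 t) = fun x => 'D_(e_ i) l2 x + 'D_(e_ i) (G2 t) x.
Proof. by rewrite h2E partialD. Qed.
Let d1p t i x : 'D_(e_ i) (h1 t) x = 'D_(e_ i) l1 x + 'D_(e_ i) (G1 t) x.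
Proof. exact: (congr1 (fun f : 'rV[R]_3 -> R => f x) (d1E t i)). Qed.
Let d2p t i x : 'D_(e_ i) (h2 t) x = 'D_(e_ i) l2 x + 'D_(e_ i) (G2 t) x.
Proof. exact: (congr1 (fun f : 'rV[R]_3 -> R => f x) (d2E t i)). Qed.
Let plus (a b d : R) : a = b -> a + d = b + d. Proof. by move=> ->. Qed.
Let h10 t x : 'D_(e_ i0) (h1 t) x = k1 + 'D_(e_ i0) (G1 t) x.
Proof. exact: (etrans (d1p t i0 x) (plus _ (Dl10 x))). Qed.
Let h11 t x : 'D_(e_ i1) (h1 t) x = 0 + 'D_(e_ i1) (G1 t) x.
Proof. exact: (etrans (d1p t i1 x) (plus _ (Dl11 x))). Qed.
Let h12 t x : 'D_(e_ i2) (h1 t) x = c + 'D_(e_ i2) (G1 t) x.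
Proof. exact: (etrans (d1p t i2 x) (plus _ (Dl12 x))). Qed.
Let h20 t x : 'D_(e_ i0) (h2 t) x = 2^-1 - k1 + 'D_(e_ i0) (G2 t) x.
Proof. exact: (etrans (d2p t i0 x) (plus _ (Dl20 x))). Qed.
Let h21 t x : 'D_(e_ i1) (h2 t) x = 1 + 'D_(e_ i1) (G2 t) x.
Proof. exact: (etrans (d2p t i1 x) (plus _ (Dl21 x))). Qed.
Let h22 t x : 'D_(e_ i2) (h2 t) x = 1 - c - x 0 i2 + 'D_(e_ i2) (G2 t) x.
Proof. exact: (etrans (d2p t i2 x) (plus _ (Dl22 x))). Qed.

Let dd1E t i j : 'D_(e_ j) ('D_(e_ i) (h1 t)) =
  fun x => 'D_(e_ j) ('D_(e_ i) l1) x + 'D_(e_ j) ('D_(e_ i) (G1 t)) x.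
Proof. by rewrite d1E partialD//; exact: smooth_partial. Qed.
Let dd2E t i j : 'D_(e_ j) ('D_(e_ i) (h2 t)) =
  fun x => 'D_(e_ j) ('D_(e_ i) l2) x + 'D_(e_ j) ('D_(e_ i) (G2 t)) x.
Proof. by rewrite d2E partialD//; exact: smooth_partial. Qed.
Let ddd1E t i j l x : 'D_(e_ l) ('D_(e_ j) ('D_(e_ i) (h1 t))) x =
  'D_(e_ l) ('D_(e_ j) ('D_(e_ i) (G1 t))) x.
Proof.
have E := congr1 (fun f : 'rV[R]_3 -> R => derive f x (e_ l)) (dd1E t i j).
apply: (etrans E); apply: (etrans (partialDE l x (smooth_partial j (smooth_partial i sl1))
  (smooth_partial j (smooth_partial i (sG1 t))))).
exact: (etrans (congr1 (fun z => z + _) (DDDl1 i j l x)) (add0r _)).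
Qed.
Let ddd2E t i j l x : 'D_(e_ l) ('D_(e_ j) ('D_(e_ i) (h2 t))) x =
  'D_(e_ l) ('D_(e_ j) ('D_(e_ i) (G2 t))) x.
Proof.
have E := congr1 (fun f : 'rV[R]_3 -> R => derive f x (e_ l)) (dd2E t i j).
apply: (etrans E); apply: (etrans (partialDE l x (smooth_partial j (smooth_partial i sl2))
  (smooth_partial j (smooth_partial i (sG2 t))))).
exact: (etrans (congr1 (fun z => z + _) (DDDl2 i j l x)) (add0r _)).
Qed.

Definition small (Q : T -> 'rV[R]_3 -> R) := exists2 C : R, 0 <= C &
  \forall t \near F, forall x, A x -> `|Q t x| <= C * delta t.

Lemma bO_small r Q : bO F r A delta Q -> small Q.
Proof.
by move=> [C C0 h]; exists C => //; apply: filterS h => t [_ B] x /(Bd_bound B).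
Qed.

Lemma small_eq Q Q' : (forall t x, A x -> Q t x = Q' t x) -> small Q -> small Q'.
Proof.
move=> e [C C0 h]; exists C => //; apply: filterS h => t h x Ax.
by rewrite -e// h.
Qed.

(** Finitely many bounds are gathered under a common constant, since [close] has a single [eps]. *)
Fixpoint all_small (K : R) (L : seq (T -> 'rV[R]_3 -> R)) (t : T) : Prop :=
  if L is Q :: L' then
    (forall x, A x -> `|Q t x| <= K * delta t) /\ all_small K L' t
  else True.

Fixpoint each_small (L : seq (T -> 'rV[R]_3 -> R)) : Prop :=
  if L is Q :: L' then small Q /\ each_small L' else True.

Lemma all_smallW K K' L t : 0 < delta t -> K <= K' -> all_small K L t -> all_small K' L t.
Proof.
move=> d0 KK; elim: L => [//|Q L IH] [h /IH]; split=> // x Ax.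
by apply: le_trans (h x Ax) _; rewrite ler_wpM2r// ltW.
Qed.

Lemma smalls L : each_small L -> exists2 K : R, 0 <= K & \forall t \near F, all_small K L t.
Proof.
elim: L => [_|Q L IH [[C C0 h] /IH[K K0 hK]]]; first by exists 0 => //; near=> t.
exists (C + K); first exact: addr_ge0.
near=> t.
have d0 : 0 < delta t by near: t.
split=> [x Ax|].
  apply: (@le_trans _ _ (C * delta t)); first by move: x Ax; near: t.
  by apply: ler_wpM2r; [exact: ltW|rewrite lerDl].
apply: (all_smallW d0 (K:=K)); first by rewrite lerDr.
by near: t.
Unshelve. all: by end_near. Qed.

Let bG1 i : bO F 2 A delta (fun t => 'D_(e_ i) (G1 t)). Proof. exact: (bO_partial i close1). Qed.
Let bG2 i : bO F 2 A delta (fun t => 'D_(e_ i) (G2 t)). Proof. exact: (bO_partial i close2). Qed.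

Let delta_le1 : \forall t \near F, delta t <= 1.
Proof.
move/cvgrPdist_le : delta_lim => /(_ _ ltr01); apply: filterS => t.
by rewrite sub0r normrN => /ler_normlP[].
Qed.

Let one u : bO F 2 A delta u -> bO F 2 A (fun=> 1) u.
Proof. by apply: (@bO_le _ _ _ _ FF _ _ 1) => //; apply: filterS delta_le1 => t; rewrite mul1r. Qed.

Let cst1 (a : R) : bO F 2 A (fun=> 1) (fun _ _ => a). Proof. exact: bO_cst. Qed.
Let co2 : bO F 2 A (fun=> 1) (fun _ x => x 0 i2).
Proof. by apply: (@bO_coord _ _ _ _ FF _ _ (4 * radius k1 beta)) => x Ax; exact/ltW/Ax. Qed.

(** The limit family has [jchar 1] equal to D; every remaining term contains a derivative of the
    perturbation, with a bounded factor. *)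
Let bplus : bO F 2 A delta (fun t x => jchar 1 (h1 t) (h2 t) x - x 0 i2).
Proof.
have -> : (fun t x => jchar 1 (h1 t) (h2 t) x - x 0 i2) =
  (fun t x => - 'D_(e_ i2) (G2 t) x - (c + x 0 i2 - 'D_(e_ i2) (G2 t) x) * 'D_(e_ i1) (G1 t) x
    - 'D_(e_ i2) (G1 t) x - (c + 'D_(e_ i2) (G1 t) x) * 'D_(e_ i1) (G2 t) x).
  apply/funext => t; apply/funext => x; rewrite /jchar (h11 t x) (h22 t x) (h21 t x) (h12 t x).
  move: ('D_(e_ i1) (G1 t) x) ('D_(e_ i2) (G1 t) x) ('D_(e_ i1) (G2 t) x) ('D_(e_ i2) (G2 t) x).
  by move=> u v w z; ring.
apply: (bOB FF (bOB FF (bOB FF (bON FF (bG2 i2)) _) (bG1 i2)) _).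
- exact: (bO1M FF (bOB FF (bOD FF (cst1 c) co2) (one (bG2 i2))) (bG1 i1)).
- exact: (bO1M FF (bOD FF (cst1 c) (one (bG1 i2))) (bG2 i1)).
Qed.

Let bminus : bO F 2 A delta (fun t x => jchar (-1) (h1 t) (h2 t) x - (2 * (1 - c) - x 0 i2)).
Proof.
have -> : (fun t x => jchar (-1) (h1 t) (h2 t) x - (2 * (1 - c) - x 0 i2)) =
  (fun t x => 'D_(e_ i2) (G2 t) x + (2 - c - x 0 i2 + 'D_(e_ i2) (G2 t) x) * 'D_(e_ i1) (G1 t) x
    - 'D_(e_ i2) (G1 t) x - (c + 'D_(e_ i2) (G1 t) x) * 'D_(e_ i1) (G2 t) x).
  apply/funext => t; apply/funext => x; rewrite /jchar (h11 t x) (h22 t x) (h21 t x) (h12 t x).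
  move: ('D_(e_ i1) (G1 t) x) ('D_(e_ i2) (G1 t) x) ('D_(e_ i1) (G2 t) x) ('D_(e_ i2) (G2 t) x).
  by move=> u v w z; ring.
apply: (bOB FF (bOB FF (bOD FF (bG2 i2) _) (bG1 i2)) _).
- exact: (bO1M FF (bOD FF (bOB FF (cst1 (2 - c)) co2) (one (bG2 i2))) (bG1 i1)).
- exact: (bO1M FF (bOD FF (cst1 c) (one (bG1 i2))) (bG2 i1)).
Qed.

Let bdet : bO F 2 A delta (fun t x => jdet (h1 t) (h2 t) x + c).
Proof.
have -> : (fun t x => jdet (h1 t) (h2 t) x + c) =
  (fun t x => (1 - c - x 0 i2 + 'D_(e_ i2) (G2 t) x) * 'D_(e_ i1) (G1 t) x
    - 'D_(e_ i2) (G1 t) x - (c + 'D_(e_ i2) (G1 t) x) * 'D_(e_ i1) (G2 t) x).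
  apply/funext => t; apply/funext => x; rewrite /jdet (h11 t x) (h22 t x) (h21 t x) (h12 t x).
  move: ('D_(e_ i1) (G1 t) x) ('D_(e_ i2) (G1 t) x) ('D_(e_ i1) (G2 t) x) ('D_(e_ i2) (G2 t) x).
  by move=> u v w z; ring.
apply: (bOB FF (bOB FF _ (bG1 i2)) _).
- exact: (bO1M FF (bOD FF (bOB FF (cst1 (1 - c)) co2) (one (bG2 i2))) (bG1 i1)).
- exact: (bO1M FF (bOD FF (cst1 c) (one (bG1 i2))) (bG2 i1)).
Qed.

Let bspeed : bO F 2 A delta (fun t x => fold_speed (h1 t) (h2 t) x - 2^-1).
Proof.
have -> : (fun t x => fold_speed (h1 t) (h2 t) x - 2^-1) =
  (fun t x => 'D_(e_ i0) (G2 t) x - (2^-1 - k1 + 'D_(e_ i0) (G2 t) x) * 'D_(e_ i1) (G1 t) x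
    + 'D_(e_ i0) (G1 t) x + (k1 + 'D_(e_ i0) (G1 t) x) * 'D_(e_ i1) (G2 t) x).
  apply/funext => t; apply/funext => x; rewrite /fold_speed (h11 t x) (h20 t x) (h21 t x) (h10 t x).
  move: ('D_(e_ i1) (G1 t) x) ('D_(e_ i0) (G1 t) x) ('D_(e_ i1) (G2 t) x) ('D_(e_ i0) (G2 t) x).
  by move=> u v w z; ring.
apply: (bOD FF (bOD FF (bOB FF (bG2 i0) _) (bG1 i0)) _).
- exact: (bO1M FF (bOD FF (cst1 (2^-1 - k1)) (one (bG2 i0))) (bG1 i1)).
- exact: (bO1M FF (bOD FF (cst1 k1) (one (bG1 i0))) (bG2 i1)).
Qed.

(** Twenty-one uniform bounds share one constant, and the smallness conditions on [eps] hold
    eventually because [delta] tends to 0. *)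
Let near_close : exists2 K : R, 0 < K & \forall t \near F,
  close c k1 beta (h1 t) (h2 t) (K * delta t).
Proof.
have sj t x := smooth_jchar x (s1 t) (s2 t).
have small_d i (u : T -> 'rV[R]_3 -> R) (v : 'rV[R]_3 -> R) : (forall t, smooth (u t)) -> smooth v ->
    bO F 2 A delta (fun t x => u t x - v x) ->
    small (fun t x => 'D_(e_ i) (u t) x - 'D_(e_ i) v x).
  move=> su sv h; have := bO_small (bO_partial i h); apply: small_eq => t x _.
  by rewrite partialDE ?partialNE//; exact: smoothN.
have sc2 : smooth (fun x : 'rV[R]_3 => x 0 i2) by smooth_tac.
have sc2' : smooth (fun x : 'rV[R]_3 => 2 * (1 - c) - x 0 i2) by smooth_tac.
have P i := small_d i _ _ (fun t => sj t 1) sc2 bplus.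
have M i := small_d i _ _ (fun t => sj t (-1)) sc2' bminus.
have Mp i x : 'D_(e_ i) (fun x : 'rV[R]_3 => 2 * (1 - c) - x 0 i2) x = - (i2 == i)%:R.
  rewrite partialDE ?partialNE; [|by smooth_tac..].
  by rewrite partial_cstE partial_coordE add0r.
have h1s i : small (fun t x => 'D_(e_ i) (h1 t) x - 'D_(e_ i) l1 x).
  by apply: small_eq (bO_small (bG1 i)) => t x _; rewrite (d1p t i x) addrC addKr.
pose L := [:: G1; G2; (fun t => 'D_(e_ i0) (G1 t)); (fun t => 'D_(e_ i1) (G1 t));
       (fun t => 'D_(e_ i2) (G1 t)); (fun t => 'D_(e_ i0) (G2 t));
       (fun t => 'D_(e_ i1) (G2 t)); (fun t => 'D_(e_ i2) (G2 t));
       (fun t x => jdet (h1 t) (h2 t) x + c);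
       (fun t x => jchar 1 (h1 t) (h2 t) x - x 0 i2);
       (fun t x => jchar (-1) (h1 t) (h2 t) x - (2 * (1 - c) - x 0 i2));
       (fun t x => fold_speed (h1 t) (h2 t) x - 2^-1);
       (fun t x => 'D_(e_ i0) (jchar 1 (h1 t) (h2 t)) x);
       (fun t x => 'D_(e_ i1) (jchar 1 (h1 t) (h2 t)) x);
       (fun t x => 'D_(e_ i2) (jchar 1 (h1 t) (h2 t)) x - 1);
       (fun t x => 'D_(e_ i0) (jchar (-1) (h1 t) (h2 t)) x);
       (fun t x => 'D_(e_ i1) (jchar (-1) (h1 t) (h2 t)) x);
       (fun t x => 'D_(e_ i2) (jchar (-1) (h1 t) (h2 t)) x + 1);
       (fun t x => 'D_(e_ i0) (h1 t) x - k1); (fun t x => 'D_(e_ i1) (h1 t) x);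
       (fun t x => 'D_(e_ i2) (h1 t) x - c)].
have [K K0 hK] : exists2 K : R, 0 <= K & \forall t \near F, all_small K L t.
  apply: smalls; rewrite /L /each_small; do !split.
  - exact: bO_small close1.
  - exact: bO_small close2.
  - exact: bO_small (bG1 _).
  - exact: bO_small (bG1 _).
  - exact: bO_small (bG1 _).
  - exact: bO_small (bG2 _).
  - exact: bO_small (bG2 _).
  - exact: bO_small (bG2 _).
  - exact: bO_small bdet.
  - exact: bO_small bplus.
  - exact: bO_small bminus.
  - exact: bO_small bspeed.
  - by apply: small_eq (P i0) => t x _; rewrite partial_coordE subr0.
  - by apply: small_eq (P i1) => t x _; rewrite partial_coordE subr0.
  - by apply: small_eq (P i2) => t x _; rewrite partial_coordE.
  - by apply: small_eq (M i0) => t x _; rewrite Mp oppr0 subr0.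
  - by apply: small_eq (M i1) => t x _; rewrite Mp oppr0 subr0.
  - by apply: small_eq (M i2) => t x _; rewrite Mp opprK.
  - by apply: small_eq (h1s i0) => t x _; rewrite (Dl10 x).
  - by apply: small_eq (h1s i1) => t x _; rewrite (Dl11 x) subr0.
  - by apply: small_eq (h1s i2) => t x _; rewrite (Dl12 x).
have K1 : 0 < K + 1 by rewrite ltr_wpDl.
have lim0 : (K + 1) * delta t @[t --> F] --> (0 : R).
  by rewrite -(mulr0 (K + 1)); exact: (limM FF (lim_cst FF _) delta_lim).
have lt_near (a b : R) : 0 <= a -> 0 < b -> \forall t \near F, a * ((K + 1) * delta t) < b.
  move=> a0 b0; have La := limM FF (lim_cst FF a) lim0; rewrite mulr0 in La.
  exact: (cvgr_lt _ La).
have /andP[cm cp] := c_bd; have /andP[b0 b1] := beta_bd.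
have cabs : 0 < 1 - `|c| by rewrite subr_gt0 ltr_norml cm cp.
have N1 := lt_near (400 * (`|k1| + 1)) 1 (mulr_ge0 (ler0n _ _) (addr_ge0 (normr_ge0 _) ler01)) ltr01.
have N2 := lt_near 2 _ (ler0n _ _) cabs.
have N3 := lt_near 6 _ (ler0n _ _) b0.
have b1' : 0 < 2 * (1 - c) ^+ 2 - beta by rewrite subr_gt0.
have N4 := lt_near 6 _ (ler0n _ _) b1'.
have KL : K <= K + 1 by rewrite lerDl.
exists (K + 1) => //.
apply: (filterS _ (filterI delta_gt0 (filterI hK (filterI N1 (filterI N2 (filterI N3 N4))))))
  => t [d0 [hL' [n1 [n2 [n3 n4]]]]].
have := all_smallW d0 KL hL'.
move=> [q1 [q2 [q3 [q4 [q5 [q6 [q7 [q8 [q9 [q10 [q11 [q12 [q13 [q14 [q15 [q16 [q17 [q18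
  [q19 [q20 [q21 _]]]]]]]]]]]]]]]]]]]]].
split.
- exact: mulr_gt0.
- exact: ltW n1.
- exact: n2.
- exact: n3.
- exact: n4.
- by move=> x Ax; split; [exact: q1|exact: q2].
- by move=> x i Ax; case: (ord3P i) => ->; split;
    [exact: q3|exact: q6|exact: q4|exact: q7|exact: q5|exact: q8].
- exact: q9.
- exact: q10.
- exact: q11.
- exact: q12.
- by move=> x Ax; split; [exact: q13|exact: q14|exact: q15].
- by move=> x Ax; split; [exact: q16|exact: q17|exact: q18].
- by move=> x Ax; split; [exact: q19|exact: q20|exact: q21].
Qed.

(** * Nondegeneracy conditions in the limit *)

Section JetLimits.
Variables (K Ds : R).

(** A bifurcation point is located only by its coordinate D, up to [K * delta]; the other
    coordinates are merely known to lie in the box. Limits along this filter are uniform over all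
    such points, and they exist because the derivatives of the limit family depend on D alone. *)
Definition near_line : set_system (T * 'rV[R]_3) :=
  [set P | \forall t \near F, forall x, A x -> `|x 0 i2 - Ds| <= K * delta t -> P (t, x)].

Global Instance near_line_filter : Filter near_line.
Proof.
split; first by rewrite /near_line /=; apply: filterE.
- move=> P Q hP hQ.
  have inc : (fun t => forall x, A x -> `|x 0 i2 - Ds| <= K * delta t -> P (t, x)) `&`
      (fun t => forall x, A x -> `|x 0 i2 - Ds| <= K * delta t -> Q (t, x)) `<=`
      (fun t => forall x, A x -> `|x 0 i2 - Ds| <= K * delta t -> (P `&` Q) (t, x)).
    by move=> t [p q] x Ax xD; split; [exact: p|exact: q].
  exact: (@filterS _ F FF _ _ inc (@filterI _ F FF _ _ hP hQ)).
- move=> P Q PQ hP.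
  have inc : (fun t => forall x, A x -> `|x 0 i2 - Ds| <= K * delta t -> P (t, x)) `<=`
      (fun t => forall x, A x -> `|x 0 i2 - Ds| <= K * delta t -> Q (t, x)).
    by move=> t p x Ax xD; exact/PQ/p.
  exact: (@filterS _ F FF _ _ inc hP).
Qed.

Let NF := near_line_filter.

Let small_lim Q : small Q -> Q s.1 s.2 @[s --> near_line] --> (0 : R).
Proof.
move=> [C C0 h]; apply/cvgrPdist_le => e e0.
have La := limM FF (lim_cst FF C) delta_lim; rewrite mulr0 in La.
apply: (filterS _ (filterI h (cvgr_lt _ La _ e0))) => t [h1' h2'] x Ax _ /=.
by rewrite sub0r normrN (le_trans (h1' x Ax))// ltW.
Qed.

Let lim_x2 : (fun s : T * 'rV[R]_3 => s.2 0 i2) @ near_line --> Ds.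
Proof.
apply/cvgrPdist_le => e e0.
have La := limM FF (lim_cst FF K) delta_lim; rewrite mulr0 in La.
apply: (filterS _ (cvgr_lt _ La _ e0)) => t h2' x Ax xD /=.
by rewrite distrC (le_trans xD)// ltW.
Qed.

Let S : Type := (T * 'rV[R]_3)%type.
Let q1 (s : S) : R := 'D_(e_ i0) (h1 s.1) s.2.
Let q2 (s : S) : R := 'D_(e_ i0) (h2 s.1) s.2.
Let a (s : S) : R := 'D_(e_ i1) (h1 s.1) s.2.
Let b (s : S) : R := 'D_(e_ i1) (h2 s.1) s.2.
Let cc (s : S) : R := 'D_(e_ i2) (h1 s.1) s.2.
Let d (s : S) : R := 'D_(e_ i2) (h2 s.1) s.2.

Let lim_shift (f : S -> R) (g : S -> R) (l : R) (Q : T -> 'rV[R]_3 -> R) :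
  (forall s, f s = g s + Q s.1 s.2) -> g s @[s --> near_line] --> l -> small Q ->
  f s @[s --> near_line] --> l.
Proof.
move=> fE gl hQ; rewrite -[l]addr0.
have -> : f = (fun s => g s + Q s.1 s.2) by exact/funext.
exact: (limD NF gl (small_lim hQ)).
Qed.

Let Lq1 : q1 s @[s --> near_line] --> k1.
Proof. exact: (lim_shift (fun s => h10 s.1 s.2) (lim_cst NF k1) (bO_small (bG1 i0))). Qed.
Let Lq2 : q2 s @[s --> near_line] --> 2^-1 - k1.
Proof. exact: (lim_shift (fun s => h20 s.1 s.2) (lim_cst NF _) (bO_small (bG2 i0))). Qed.
Let La : a s @[s --> near_line] --> (0 : R).
Proof. exact: (lim_shift (fun s => h11 s.1 s.2) (lim_cst NF 0) (bO_small (bG1 i1))). Qed.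
Let Lb : b s @[s --> near_line] --> (1 : R).
Proof. exact: (lim_shift (fun s => h21 s.1 s.2) (lim_cst NF 1) (bO_small (bG2 i1))). Qed.
Let Lc : cc s @[s --> near_line] --> c.
Proof. exact: (lim_shift (fun s => h12 s.1 s.2) (lim_cst NF c) (bO_small (bG1 i2))). Qed.
Let Ld : d s @[s --> near_line] --> 1 - c - Ds.
Proof.
exact: (lim_shift (fun s => h22 s.1 s.2) (limB NF (lim_cst NF (1 - c)) lim_x2)
  (bO_small (bG2 i2))).
Qed.

Let LDD1 i j : 'D_(e_ j) ('D_(e_ i) (h1 s.1)) s.2 @[s --> near_line] --> (0 : R).
Proof.
apply: (lim_shift _ (lim_cst NF 0) (bO_small (bO_partial j (bG1 i)))) => -[t x] /=.
apply: (etrans (congr1 (fun f : 'rV[R]_3 -> R => f x) (dd1E t i j))).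
exact: (plus _ (DDl1 i j x)).
Qed.

Let LDD2 i j : 'D_(e_ j) ('D_(e_ i) (h2 s.1)) s.2 @[s --> near_line] -->
  (- ((i == i2) && (j == i2))%:R : R).
Proof.
apply: (lim_shift _ (lim_cst NF _) (bO_small (bO_partial j (bG2 i)))) => -[t x] /=.
apply: (etrans (congr1 (fun f : 'rV[R]_3 -> R => f x) (dd2E t i j))).
exact: (plus _ (congr1 (fun f : 'rV[R]_3 -> R => f x) (DDl2E i j))).
Qed.

Let LDDD1 i j l :
  'D_(e_ l) ('D_(e_ j) ('D_(e_ i) (h1 s.1))) s.2 @[s --> near_line] --> (0 : R).
Proof.
apply: (lim_shift _ (lim_cst NF 0) (bO_small (bO_partial l (bO_partial j (bG1 i))))) => -[t x] /=.
exact: (etrans (ddd1E t i j l x) (esym (add0r _))).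
Qed.

Let LDDD2 i j l :
  'D_(e_ l) ('D_(e_ j) ('D_(e_ i) (h2 s.1))) s.2 @[s --> near_line] --> (0 : R).
Proof.
apply: (lim_shift _ (lim_cst NF 0) (bO_small (bO_partial l (bO_partial j (bG2 i))))) => -[t x] /=.
exact: (etrans (ddd2E t i j l x) (esym (add0r _))).
Qed.

Section Directions.
Variables (u0 u1 v0 v1 : S -> R) (a0 a1 b0 b1 : R).
Hypotheses (U0 : u0 s @[s --> near_line] --> a0) (U1 : u1 s @[s --> near_line] --> a1).
Hypotheses (V0 : v0 s @[s --> near_line] --> b0) (V1 : v1 s @[s --> near_line] --> b1).

Let quad (m00 m01 m10 m11 : S -> R) (n00 n01 n10 n11 : R) :
  m00 s @[s --> near_line] --> n00 -> m01 s @[s --> near_line] --> n01 ->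
  m10 s @[s --> near_line] --> n10 -> m11 s @[s --> near_line] --> n11 ->
  u0 s * (v0 s * m00 s + v1 s * m01 s) + u1 s * (v0 s * m10 s + v1 s * m11 s)
    @[s --> near_line] --> a0 * (b0 * n00 + b1 * n01) + a1 * (b0 * n10 + b1 * n11).
Proof.
move=> M00 M01 M10 M11.
exact: (limD NF (limM NF U0 (limD NF (limM NF V0 M00) (limM NF V1 M01)))
  (limM NF U1 (limD NF (limM NF V0 M10) (limM NF V1 M11)))).
Qed.

Let dirop2E (h : T -> 'rV[R]_3 -> R) : (forall t, smooth (h t)) ->
  (fun s : S => dirop (pt (u0 s) (u1 s)) (dirop (pt (v0 s) (v1 s)) (h s.1)) s.2) =
  (fun s => u0 s * (v0 s * 'D_(e_ i1) ('D_(e_ i1) (h s.1)) s.2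
      + v1 s * 'D_(e_ i1) ('D_(e_ i2) (h s.1)) s.2)
    + u1 s * (v0 s * 'D_(e_ i2) ('D_(e_ i1) (h s.1)) s.2
      + v1 s * 'D_(e_ i2) ('D_(e_ i2) (h s.1)) s.2)).
Proof.
move=> sh; apply/funext => s.
apply: (etrans (dirop2 (pt (u0 s) (u1 s)) (pt (v0 s) (v1 s)) s.2 (sh s.1))).
by rewrite !pt0 !pt1.
Qed.

Lemma lim_dirop2_1 :
  dirop (pt (u0 s) (u1 s)) (dirop (pt (v0 s) (v1 s)) (h1 s.1)) s.2 @[s --> near_line] --> (0 : R).
Proof.
rewrite (dirop2E s1).
have := quad (@LDD1 i1 i1) (@LDD1 i2 i1) (@LDD1 i1 i2) (@LDD1 i2 i2).
by rewrite !mulr0 !addr0 !mulr0 addr0.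
Qed.

(** The only nonzero second derivative of the limit family is that of [lim2] taken twice in D, equal
    to -1. *)
Lemma lim_dirop2_2 :
  dirop (pt (u0 s) (u1 s)) (dirop (pt (v0 s) (v1 s)) (h2 s.1)) s.2 @[s --> near_line] -->
  - (a1 * b1).
Proof.
rewrite (dirop2E s2).
have := quad (@LDD2 i1 i1) (@LDD2 i2 i1) (@LDD2 i1 i2) (@LDD2 i2 i2).
rewrite /= !oppr0 !mulr0 !addr0 !mulr0 !add0r.
by rewrite mulrN1 mulrN.
Qed.

Let partial2E (h : T -> 'rV[R]_3 -> R) i : (forall t, smooth (h t)) ->
  (fun s : S => 'D_(e_ i) (dirop (pt (u0 s) (u1 s)) (dirop (pt (v0 s) (v1 s)) (h s.1))) s.2) =
  (fun s => u0 s * (v0 s * 'D_(e_ i) ('D_(e_ i1) ('D_(e_ i1) (h s.1))) s.2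
      + v1 s * 'D_(e_ i) ('D_(e_ i1) ('D_(e_ i2) (h s.1))) s.2)
    + u1 s * (v0 s * 'D_(e_ i) ('D_(e_ i2) ('D_(e_ i1) (h s.1))) s.2
      + v1 s * 'D_(e_ i) ('D_(e_ i2) ('D_(e_ i2) (h s.1))) s.2)).
Proof.
move=> sh; apply/funext => s.
apply: (etrans (partial_dirop2 (pt (u0 s) (u1 s)) (pt (v0 s) (v1 s)) i s.2 (sh s.1))).
by rewrite !pt0 !pt1.
Qed.

Let lim_partial2_1 i :
  'D_(e_ i) (dirop (pt (u0 s) (u1 s)) (dirop (pt (v0 s) (v1 s)) (h1 s.1))) s.2
    @[s --> near_line] --> (0 : R).
Proof.
rewrite (partial2E i s1).
have := quad (@LDDD1 i1 i1 i) (@LDDD1 i2 i1 i) (@LDDD1 i1 i2 i) (@LDDD1 i2 i2 i).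
by rewrite !mulr0 !addr0 !mulr0 addr0.
Qed.

Let lim_partial2_2 i :
  'D_(e_ i) (dirop (pt (u0 s) (u1 s)) (dirop (pt (v0 s) (v1 s)) (h2 s.1))) s.2
    @[s --> near_line] --> (0 : R).
Proof.
rewrite (partial2E i s2).
have := quad (@LDDD2 i1 i1 i) (@LDDD2 i2 i1 i) (@LDDD2 i1 i2 i) (@LDDD2 i2 i2 i).
by rewrite !mulr0 !addr0 !mulr0 addr0.
Qed.

Variables (w0 w1 : S -> R) (c0 c1 : R).
Hypotheses (W0 : w0 s @[s --> near_line] --> c0) (W1 : w1 s @[s --> near_line] --> c1).

Let dirop3E (h : T -> 'rV[R]_3 -> R) :
  (fun s : S => dirop (pt (w0 s) (w1 s))
    (dirop (pt (u0 s) (u1 s)) (dirop (pt (v0 s) (v1 s)) (h s.1))) s.2) =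
  (fun s => w0 s *
     'D_(e_ i1) (dirop (pt (u0 s) (u1 s)) (dirop (pt (v0 s) (v1 s)) (h s.1))) s.2 + w1 s *
     'D_(e_ i2) (dirop (pt (u0 s) (u1 s)) (dirop (pt (v0 s) (v1 s)) (h s.1))) s.2).
Proof. by apply/funext => s; rewrite [LHS]/dirop pt0 pt1. Qed.

Lemma lim_dirop3_1 :
  dirop (pt (w0 s) (w1 s))
    (dirop (pt (u0 s) (u1 s)) (dirop (pt (v0 s) (v1 s)) (h1 s.1))) s.2
    @[s --> near_line] --> (0 : R).
Proof.
rewrite dirop3E.
have := limD NF (limM NF W0 (lim_partial2_1 i1)) (limM NF W1 (lim_partial2_1 i2)).
by rewrite !mulr0 addr0.
Qed.

Lemma lim_dirop3_2 :
  dirop (pt (w0 s) (w1 s))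
    (dirop (pt (u0 s) (u1 s)) (dirop (pt (v0 s) (v1 s)) (h2 s.1))) s.2
    @[s --> near_line] --> (0 : R).
Proof.
rewrite dirop3E.
have := limD NF (limM NF W0 (lim_partial2_2 i1)) (limM NF W1 (lim_partial2_2 i2)).
by rewrite !mulr0 addr0.
Qed.

Let partial1E (h : T -> 'rV[R]_3 -> R) : (forall t, smooth (h t)) ->
  (fun s : S => 'D_(e_ i0) (dirop (pt (u0 s) (u1 s)) (h s.1)) s.2) =
  (fun s => u0 s * 'D_(e_ i0) ('D_(e_ i1) (h s.1)) s.2
      + u1 s * 'D_(e_ i0) ('D_(e_ i2) (h s.1)) s.2).
Proof.
move=> sh; apply/funext => s.
apply: (etrans (partial_dirop (pt (u0 s) (u1 s)) i0 s.2 (sh s.1))).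
by rewrite !pt0 !pt1.
Qed.

Lemma lim_partial_dirop_1 :
  'D_(e_ i0) (dirop (pt (u0 s) (u1 s)) (h1 s.1)) s.2 @[s --> near_line] --> (0 : R).
Proof.
rewrite (partial1E s1).
have := limD NF (limM NF U0 (@LDD1 i1 i0)) (limM NF U1 (@LDD1 i2 i0)).
by rewrite !mulr0 addr0.
Qed.

Lemma lim_partial_dirop_2 :
  'D_(e_ i0) (dirop (pt (u0 s) (u1 s)) (h2 s.1)) s.2 @[s --> near_line] --> (0 : R).
Proof.
rewrite (partial1E s2).
have := limD NF (limM NF U0 (@LDD2 i1 i0)) (limM NF U1 (@LDD2 i2 i0)).
by rewrite /= oppr0 !mulr0 addr0.
Qed.

End Directions.

Let sc (k : R) (f : S -> R) (l : R) : f s @[s --> near_line] --> l ->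
  k * f s @[s --> near_line] --> k * l.
Proof. by move=> h; exact: (limM NF (lim_cst NF k) h). Qed.

Let neq (f : S -> R) (l l' : R) : f s @[s --> near_line] --> l -> l = l' -> l' != 0 ->
  \forall t \near F, forall x, A x -> `|x 0 i2 - Ds| <= K * delta t -> f (t, x) != 0.
Proof. by move=> h le l0; rewrite le in h; exact: (@cvgr_neq0 _ _ _ near_line NF _ l' h l0). Qed.

Let Lb_neq : \forall t \near F, forall x, A x -> `|x 0 i2 - Ds| <= K * delta t ->
  b (t, x) != 0.
Proof. by apply: (neq Lb (erefl _)); rewrite oner_neq0. Qed.

(** In the limit the quadratic coefficient is -1 and the unfolding coefficient 1/2, whatever [k1]
    is; being nonzero, they stay so for nearby maps. *)
Lemma near_saddle_node : Ds = 0 -> \forall t \near F, forall x, A x ->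
  `|x 0 i2 - Ds| <= K * delta t -> forall (e0 : R) (z0 : 'rV[R]_2),
  x = row3 e0 (z0 0 0) (z0 0 1) -> planar (h1 t) (h2 t) e0 z0 = z0 ->
  jchar 1 (h1 t) (h2 t) x = 0 -> `|jdet (h1 t) (h2 t) x| != 1 ->
  saddle_node (planar (h1 t) (h2 t)) e0 z0.
Proof.
move=> Ds0.
have U0 := limB NF (lim_cst NF 1) Ld.
have Q1 := limD NF (limM NF (lim_dirop2_1 U0 Lb U0 Lb) Lb)
  (limM NF (lim_dirop2_2 U0 Lb U0 Lb) (limB NF (lim_cst NF 1) La)).
have Q2 := limD NF (limM NF Lq1 Lb) (limM NF Lq2 (limB NF (lim_cst NF 1) La)).
have q1E : 0 * 1 + - (1 * 1) * (1 - 0) = -1 :> R by ring.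
have q2E : k1 * 1 + (2^-1 - k1) * (1 - 0) = 2^-1 :> R by ring.
have n1 : (-1 : R) != 0 by rewrite oppr_eq0 oner_neq0.
have n2 : (2^-1 : R) != 0 by rewrite invr_eq0 pnatr_eq0.
apply: filterS (filterI Lb_neq (filterI (neq Q1 q1E n1) (neq Q2 q2E n2))).
move=> t [g0 [g1 g2]] x Ax xD e0 z0 xE fix0 ch dt.
apply: (saddle_node_planar (s1 t) (s2 t) fix0 xE (erefl _) (erefl _) (erefl _) (erefl _)).
- exact: (g0 x Ax xD).
- exact: dt.
- by rewrite -[RHS]ch /jchar; move: ('D_(e_ i1) _ _) ('D_(e_ i1) _ _) ('D_(e_ i2) _ _) ('D_(e_ i2) _ _) => *; ring.
- exact: (g1 x Ax xD).
- exact: (g2 x Ax xD).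
Qed.

(** Third derivatives vanish in the limit, so the cubic coefficient comes entirely from the
    quadratic correction by [h]: it tends to [- 1 / (2 Ds)], and the transversality coefficient to
    [1 / (2 Ds)]. The denominator appears because [Ds] is the limit of the determinant of
    [1 - J]. *)
Lemma near_period_doubling : Ds != 0 -> \forall t \near F, forall x, A x ->
  `|x 0 i2 - Ds| <= K * delta t -> forall (e0 : R) (z0 : 'rV[R]_2),
  x = row3 e0 (z0 0 0) (z0 0 1) -> planar (h1 t) (h2 t) e0 z0 = z0 ->
  jchar (-1) (h1 t) (h2 t) x = 0 -> `|jdet (h1 t) (h2 t) x| != 1 ->
  period_doubling (planar (h1 t) (h2 t)) e0 z0.
Proof.
move=> Ds0.
have U0 := limB NF (lim_cst NF (-1)) Ld.
pose dm s := 1 - (a s + d s) + (a s * d s - b s * cc s).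
have Ldm : dm s @[s --> near_line] --> Ds.
  have := limD NF (limB NF (lim_cst NF 1) (limD NF La Ld)) (limB NF (limM NF La Ld) (limM NF Lb Lc)).
  rewrite [X in _ --> X -> _](_ : _ = Ds)//; first ring.
have LdmV := limV NF Ds0 Ldm.
have LB1 := lim_dirop2_1 U0 Lb U0 Lb.
have LB2 := lim_dirop2_2 U0 Lb U0 Lb.
have Lh0 := limM NF LdmV (limB NF (limM NF LB1 (limB NF Ld (lim_cst NF 1))) (limM NF LB2 Lc)).
have Lh1 := limM NF LdmV (limB NF (limM NF LB2 (limB NF La (lim_cst NF 1))) (limM NF LB1 Lb)).
have Lz0 := limM NF LdmV (limD NF (limM NF Lq1 (limB NF (lim_cst NF 1) Ld)) (limM NF Lq2 Lc)).
have Lz1 := limM NF LdmV (limD NF (limM NF Lq2 (limB NF (lim_cst NF 1) La)) (limM NF Lq1 Lb)).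
have Lm := limB NF (lim_cst NF (-1)) La.
have Q1 := limD NF
  (limM NF (limB NF (@sc 6^-1 _ _ (lim_dirop3_1 U0 Lb U0 Lb U0 Lb)) (@sc 2^-1 _ _ (lim_dirop2_1 Lh0 Lh1 U0 Lb))) Lb)
  (limM NF (limB NF (@sc 6^-1 _ _ (lim_dirop3_2 U0 Lb U0 Lb U0 Lb)) (@sc 2^-1 _ _ (lim_dirop2_2 Lh0 Lh1 U0 Lb))) Lm).
have Q2 := limD NF
  (limM NF (limD NF (lim_partial_dirop_1 U0 Lb) (lim_dirop2_1 Lz0 Lz1 U0 Lb)) Lb)
  (limM NF (limD NF (lim_partial_dirop_2 U0 Lb) (lim_dirop2_2 Lz0 Lz1 U0 Lb)) Lm).
have n1 : - (2^-1 * Ds^-1) != 0 by rewrite oppr_eq0 mulf_neq0 ?invr_eq0// pnatr_eq0.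
have n2 : 2^-1 * Ds^-1 != 0 by rewrite mulf_neq0 ?invr_eq0// pnatr_eq0.
have N1 := neq Q1 (_ : _ = - (2^-1 * Ds^-1)) n1.
have N2 := neq Q2 (_ : _ = 2^-1 * Ds^-1) n2.
have {}N1 := N1 ltac:(by move: (Ds^-1) => W; field).
have {}N2 := N2 ltac:(by move: (Ds^-1) => W; field).
apply: filterS (filterI Lb_neq (filterI (neq Ldm (erefl _) Ds0) (filterI N1 N2))).
move=> t [g0 [gd [g1 g2]]] x Ax xD e0 z0 xE fix0 ch dt.
apply: (period_doubling_planar (s1 t) (s2 t) fix0 xE (erefl _) (erefl _) (erefl _) (erefl _)
  (erefl _) (erefl _) (erefl _) (erefl _) (erefl _) (erefl _) (erefl _) (erefl _)).
- exact: (g0 x Ax xD).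
- exact: (gd x Ax xD).
- exact: dt.
- by rewrite -[RHS]ch /jchar; move: ('D_(e_ i1) _ _) ('D_(e_ i1) _ _) ('D_(e_ i2) _ _) ('D_(e_ i2) _ _) => *; ring.
- exact: (g1 x Ax xD).
- exact: (g2 x Ax xD).
Qed.

End JetLimits.

(** The determinant is within [eps] of [- c], hence of modulus below 1; together with the positivity
    of the characteristic polynomial at 1 and -1 this is the planar stability criterion. *)
Theorem near_windows : \forall t \near F, exists (em ep : R) (zeta : R -> 'rV[R]_2),
  let pos e := row3 e (zeta e 0 0) (zeta e 0 1) in
  [/\ em < 0, 0 < ep, {within `[em, ep], continuous zeta},
    forall e, em <= e <= ep -> A (pos e) /\ planar (h1 t) (h2 t) e (zeta e) = zeta e
   & [/\ forall e, em < e < ep -> [/\ 0 < jchar 1 (h1 t) (h2 t) (pos e),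
         0 < jchar (-1) (h1 t) (h2 t) (pos e) & `|jdet (h1 t) (h2 t) (pos e)| < 1],
       saddle_node (planar (h1 t) (h2 t)) em (zeta em)
     & period_doubling (planar (h1 t) (h2 t)) ep (zeta ep)]].
Proof.
have [K K0 hK] := near_close.
have /andP[cm cp] := c_bd.
have D0 : 2 * (1 - c) != 0 by rewrite mulf_neq0 ?pnatr_eq0// subr_eq0 eq_sym lt_eqF.
apply: filterS (filterI hK (filterI (near_saddle_node K (erefl _)) (near_period_doubling K D0))).
move=> t [hc [hs hp]].
have [em [ep [zeta [em0 ep0 cz hfix [hint chm chp zm zp]]]]] := window c_bd beta_bd (s1 t) (s2 t) hc.
exists em, ep, zeta => pos.
have dt e : em <= e <= ep -> `|jdet (h1 t) (h2 t) (pos e)| < 1.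
  move=> /hfix[Ae _]; have := close_det hc Ae; have := close_c hc.
  have := ler_normB (jdet (h1 t) (h2 t) (pos e) + c) c.
  rewrite addrK; have := close_pos hc.
  move: (`|_|) (`|_|) (`|_|) (K * delta t) => *; lra.
have em1 : em <= em <= ep by rewrite lexx (le_trans (ltW em0) (ltW ep0)).
have ep1 : em <= ep <= ep by rewrite lexx (le_trans (ltW em0) (ltW ep0)).
have ptE e : pos e 0 i2 = zeta e 0 1 by rewrite row3E.
split => //; split.
- move=> e /[dup] he /hint[? ?]; split => //.
  by apply: dt; case/andP: he => *; rewrite !ltW.
- have [Ae fe] := hfix _ em1.
  apply: (hs _ Ae _ em (zeta em) (erefl _) fe chm) => //; last by rewrite lt_eqF ?dt.
  by rewrite ptE// subr0.
- have [Ae fe] := hfix _ ep1.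
  apply: (hp _ Ae _ ep (zeta ep) (erefl _) fe chp) => //; last by rewrite lt_eqF ?dt.
  by rewrite ptE.
Qed.

End NearLimit.

(** * Affine conjugacy *)

Section AffineConjugacy.
Variable R : realType.
Local Notation e_ i := (delta_mx 0 i).

Lemma mulmxr_continuous m n (P : 'M[R]_(m, n)) : continuous (fun u : 'rV[R]_m => u *m P).
Proof.
move=> u.
have -> : (fun u : 'rV[R]_m => u *m P) = fun u => \row_j (\sum_i u 0 i * P i j).
  by apply/funext => w; apply/rowP => j; rewrite !mxE.
apply: (@row_cvg _ _ _ _ (nbhs_filter u) (fun j (w : 'rV[R]_m) => \sum_i w 0 i * P i j)) => j.
rewrite mxE; apply: (@cvg_ord_sum R _ _ _ (nbhs_filter u)) => i.
by apply: cvgM; [exact: coord_continuous|exact: cvg_cst].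
Qed.

Lemma is_derive_mulmxr (V : normedModType R) m n (f : V -> 'rV[R]_m) (P : 'M[R]_(m, n)) x v d :
  is_derive x v f d -> is_derive x v (fun z => f z *m P) (d *m P).
Proof.
move=> [df <-].
have C : (fun h => h^-1 *: (((fun z => f z *m P) \o shift x) (h *: v) - f x *m P)) @ 0^' -->
    'D_v f x *m P.
  have -> : (fun h => h^-1 *: (((fun z => f z *m P) \o shift x) (h *: v) - f x *m P)) =
      (fun u => u *m P) \o (fun h => h^-1 *: ((f \o shift x) (h *: v) - f x)).
    by apply/funext => h /=; rewrite -scalemxAl mulmxBl.
  exact: cvg_comp df (@mulmxr_continuous _ _ P _).
by apply: DeriveDef; [exact: cvgP C|exact: cvg_lim C].
Qed.

(** [A] is affine and its linear part is recovered as [u |-> A (u + b)]; the difference quotients of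
    [f \o A] and of [f] then coincide. *)
Lemma is_derive_affine (V W : normedModType R) (f : V -> W) n (b : 'rV[R]_n)
    (A : 'rV[R]_n -> V) z u :
  (forall (h : R) w, A (h *: u + w) = h *: (A (u + b)) + A w) ->
  derivable f (A z) (A (u + b)) -> is_derive z u (f \o A) ('D_(A (u + b)) f (A z)).
Proof.
move=> hA df.
have E : (fun h => h^-1 *: ((f \o A \o shift z) (h *: u) - (f \o A) z)) =
    (fun h => h^-1 *: ((f \o shift (A z)) (h *: A (u + b)) - f (A z))).
  by apply/funext => h /=; rewrite hA.
by apply: DeriveDef; [rewrite /derivable E|rewrite /derive E].
Qed.

Variables (H : R -> 'rV[R]_2 -> 'rV[R]_2) (G : R -> 'rV[R]_2 -> 'rV[R]_2).
Variables (r : R) (b : 'rV[R]_2) (P Q : 'M[R]_2).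
Hypotheses (r0 : r != 0) (PQ : P *m Q = 1%:M) (QP : Q *m P = 1%:M).
Hypothesis GE : forall e z, G e z = H (r * e) ((z - b) *m Q) *m P + b.
Hypothesis dG : forall e z, differentiable (G e) z.
Hypothesis smH : exists h1 h2, [/\ smooth h1, smooth h2 & H = planar h1 h2].

Let A (z : 'rV[R]_2) := (z - b) *m Q.

Let is_derive_A (f : 'rV[R]_2 -> 'rV[R]_2) z u d : is_derive (A z) (u *m Q) f d ->
  is_derive z u (fun z => f (A z) *m P) (d *m P).
Proof.
move=> [df <-]; apply: is_derive_mulmxr.
have := @is_derive_affine _ _ f _ b A z u; rewrite /A addrK; apply => //.
by move=> h w; rewrite -addrA mulmxDl scalemxAl.
Qed.

Let is_derive_H e w u : is_derive w u (H e) ('D_u (H e) w).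
Proof.
have [h1 [h2 [s1 s2 ->]]] := smH; have D := is_derive_planar e w u s1 s2.
exact: (is_derive_eq D (esym (derive_planarE e u w s1 s2))).
Qed.

Let is_derive_H2 e w u v : is_derive w v ('D_u (H e)) ('D_v ('D_u (H e)) w).
Proof.
have [h1 [h2 [s1 s2 ->]]] := smH.
have [su1 su2] := (smooth_dirop u s1, smooth_dirop u s2).
have E1 := derive_planar e u s1 s2; rewrite E1.
have D := is_derive_planar e w v su1 su2.
exact: (is_derive_eq D (esym (derive_planarE e v w su1 su2))).
Qed.

Let is_derive_H3 e w u v t : is_derive w t ('D_v ('D_u (H e))) ('D_t ('D_v ('D_u (H e))) w).
Proof.
have [h1 [h2 [s1 s2 ->]]] := smH.
have [su1 su2] := (smooth_dirop u s1, smooth_dirop u s2).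
have [sv1 sv2] := (smooth_dirop v su1, smooth_dirop v su2).
have E1 := derive_planar e u s1 s2; rewrite E1.
have E2 := derive_planar e v su1 su2; rewrite E2.
have D := is_derive_planar e w t sv1 sv2.
exact: (is_derive_eq D (esym (derive_planarE e t w sv1 sv2))).
Qed.

Lemma derive_conj e u : 'D_u (G e) = fun z => 'D_(u *m Q) (H (r * e)) (A z) *m P.
Proof.
apply/funext => z; have -> : G e = fun z => H (r * e) (A z) *m P + b by exact/funext/GE.
have D := is_derive_A (is_derive_H (r * e) (A z) (u *m Q)).
have := @is_deriveD _ _ _ _ _ _ _ _ _ D (is_derive_cst b z u); rewrite addr0 => -[_].
exact.
Qed.

Lemma derive2_conj e u v :
  'D_v ('D_u (G e)) = fun z => 'D_(v *m Q) ('D_(u *m Q) (H (r * e))) (A z) *m P.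
Proof.
apply/funext => z; have E := derive_conj e u; rewrite E.
by have [_] := is_derive_A (is_derive_H2 (r * e) (A z) (u *m Q) (v *m Q)).
Qed.

Lemma derive3_conj e u v t :
  'D_t ('D_v ('D_u (G e))) =
  fun z => 'D_(t *m Q) ('D_(v *m Q) ('D_(u *m Q) (H (r * e)))) (A z) *m P.
Proof.
apply/funext => z; 
have E := congr1 (fun g => derive g z t) (derive2_conj e u v); rewrite [LHS]E {E}.
have D1 := is_derive_H3 (r * e) (A z) (u *m Q) (v *m Q) (t *m Q).
have D2 := @is_derive_A ('D_(v *m Q) ('D_(u *m Q) (H (r * e)))) z t _ D1.
exact: (@derive_val _ _ _ _ _ _ _ D2).
Qed.

Let is_derive_param (g1 g2 : 'rV[R]_3 -> R) (e : R) w : smooth g1 -> smooth g2 ->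
  is_derive e 1 (fun e => planar g1 g2 (r * e) w) (r *: planar ('D_(e_ i0) g1) ('D_(e_ i0) g2) (r * e) w).
Proof.
move=> sg1 sg2.
have dr : is_derive e 1 (fun e => r * e) r.
  by apply: is_derive_eq (is_deriveZ r (is_derive_id e 1)) _; rewrite /GRing.scale/= mulr1.
have D g : smooth g ->
    is_derive e 1 (fun e => slice g (r * e) w) (r * slice ('D_(e_ i0) g) (r * e) w).
  move=> sg; have := is_derive_row3 sg dr (is_derive_cst (w 0 0) e 1) (is_derive_cst (w 0 1) e 1).
  by move=> E; apply: is_derive_eq E _; rewrite !mulr0 !addr0 mulrC.
have D2 := is_derive_pt (D _ sg1) (D _ sg2).
by apply: is_derive_eq D2 _; apply/rowP => j; case: (ord2P j) => ->; rewrite !mxE.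
Qed.

Lemma derive1_conj e z :
  derive1 (fun e => G e z) e = r *: (derive1 (fun e => H e (A z)) (r * e) *m P).
Proof.
have -> : (fun e => G e z) = fun e => H (r * e) (A z) *m P + b by apply/funext => e'; exact: GE.
have [h1 [h2 [s1 s2 ->]]] := smH.
have D := is_derive_mulmxr P (is_derive_param e (A z) s1 s2).
have := @is_deriveD _ _ _ _ _ _ _ _ _ D (is_derive_cst b e 1); rewrite addr0 => -[_].
by rewrite derive1E => ->; rewrite derive1_planar// scalemxAl.
Qed.

Lemma derive1_derive_conj e u z : derive1 (fun e => 'D_u (G e) z) e =
  r *: (derive1 (fun e => 'D_(u *m Q) (H e) (A z)) (r * e) *m P).
Proof.
have -> : (fun e => 'D_u (G e) z) = fun e => 'D_(u *m Q) (H (r * e)) (A z) *m P.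
  by apply/funext => e'; exact: (congr1 (fun g => g z) (derive_conj e' u)).
have [h1 [h2 [s1 s2 ->]]] := smH.
have [su1 su2] := (smooth_dirop (u *m Q) s1, smooth_dirop (u *m Q) s2).
have dE e' : 'D_(u *m Q) (planar h1 h2 e') (A z) =
    planar (dirop (u *m Q) h1) (dirop (u *m Q) h2) e' (A z) by rewrite derive_planarE.
rewrite (funext dE) derive1_planar//.
have -> : (fun e => 'D_(u *m Q) (planar h1 h2 (r * e)) (A z) *m P) =
   (fun e => planar (dirop (u *m Q) h1) (dirop (u *m Q) h2) (r * e) (A z) *m P).
  by apply/funext => e'; rewrite dE.
have [_] := is_derive_mulmxr P (is_derive_param e (A z) su1 su2).
by rewrite derive1E => ->; rewrite scalemxAl.
Qed.

Lemma jacobian_conj e z : 'J (G e) z = Q *m 'J (H (r * e)) (A z) *m P.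
Proof.
apply/row_matrixP => i; rewrite !rowE.
apply: (etrans (esym (deriveEjacobian _ (dG e z)))).
apply: (etrans (congr1 (fun g => g z) (derive_conj e (delta_mx 0 i)))).
have [h1 [h2 [s1 s2 HE]]] := smH.
by rewrite deriveEjacobian ?mulmxA// HE; exact: planar_differentiable.
Qed.

Let det_PQ : \det P * \det Q = 1. Proof. by rewrite -det_mulmx PQ det1. Qed.

Let derive_scale e u (w : 'rV[R]_2) z :
  'D_(r *: w) ('D_u (H e)) z = r *: 'D_w ('D_u (H e)) z.
Proof.
have [h1 [h2 [s1 s2 HE]]] := smH; rewrite HE derive_planar//.
have [su1 su2] := (smooth_dirop u s1, smooth_dirop u s2).
by rewrite !deriveEjacobian ?scalemxAl//; exact: planar_differentiable.
Qed.

Lemma tr_jacobian_conj e z : \tr ('J (G e) z) = \tr ('J (H (r * e)) (A z)).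
Proof. by rewrite jacobian_conj mxtrace_mulC mulmxA PQ mul1mx. Qed.

Lemma det_jacobian_conj e z : \det ('J (G e) z) = \det ('J (H (r * e)) (A z)).
Proof. by rewrite jacobian_conj !det_mulmx mulrC mulrA det_PQ mul1r. Qed.

Let char_poly_conj e z : char_poly ('J (G e) z) = char_poly ('J (H (r * e)) (A z)).
Proof.
apply: (etrans (char_poly_mx2 _)); apply: (etrans _ (esym (char_poly_mx2 _))).
exact: (congr2 (fun t d : R => 'X^2 - t%:P * 'X + d%:P) (tr_jacobian_conj e z)
  (det_jacobian_conj e z)).
Qed.

Let fix_conj e z : H (r * e) (A z) = A z -> G e z = z.
Proof.
move=> h; apply: (etrans (GE e z)); rewrite -/(A z) h.
by rewrite /A -mulmxA QP mulmx1 subrK.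
Qed.

Let mulr_neq0 (u : 'rV[R]_2) : u != 0 -> u *m P != 0.
Proof.
by apply: contraNneq => h; rewrite -[u]mulmx1 -PQ mulmxA h mul0mx.
Qed.

Let mull_neq0 (w : 'cV[R]_2) : w != 0 -> Q *m w != 0.
Proof.
by apply: contraNneq => h; rewrite -[w]mul1mx -PQ -mulmxA h mulmx0.
Qed.

Let PQK (u : 'rV[R]_2) : u *m P *m Q = u. Proof. by rewrite -mulmxA PQ mulmx1. Qed.

Let pairing (u : 'rV[R]_2) (w : 'cV[R]_2) : u *m P *m (Q *m w) = u *m w.
Proof. by rewrite mulmxA PQK. Qed.

Let derive2P e u v z :
  'D_(v *m P) ('D_(u *m P) (G e)) z = 'D_v ('D_u (H (r * e))) (A z) *m P.
Proof.
apply: (etrans (congr1 (fun g => g z) (derive2_conj e (u *m P) (v *m P)))).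
exact: (congr2 (fun a b => 'D_b ('D_a (H (r * e))) (A z) *m P) (PQK u) (PQK v)).
Qed.

Let derive3P e u z : 'D_(u *m P) ('D_(u *m P) ('D_(u *m P) (G e))) z =
  'D_u ('D_u ('D_u (H (r * e)))) (A z) *m P.
Proof.
apply: (etrans (congr1 (fun g => g z) (derive3_conj e (u *m P) (u *m P) (u *m P)))).
exact: (congr1 (fun a => 'D_a ('D_a ('D_a (H (r * e)))) (A z) *m P) (PQK u)).
Qed.

Let derive1P e u z : derive1 (fun e => 'D_(u *m P) (G e) z) e =
  r *: (derive1 (fun e => 'D_u (H e) (A z)) (r * e) *m P).
Proof.
apply: (etrans (derive1_derive_conj e (u *m P) z)).
exact: (congr1 (fun a => r *: (derive1 (fun e => 'D_a (H e) (A z)) (r * e) *m P)) (PQK u)).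
Qed.

Let transfer (x y : 'M[R]_1) : y = x -> x != 0 -> y != 0. Proof. by move=> ->. Qed.

(** Critical rows are carried over by [P] and critical columns by [Q], so the pairings agree with
    those of [H]; derivatives in the parameter pick up the nonzero factor [r]. *)
Lemma saddle_node_conj e z :
  saddle_node H (r * e) (A z) -> saddle_node G e z.
Proof.
move=> [fx [s [u [w [[cp s1] [[u0 uJ] [w0 wJ]] nd tr]]]]].
split; first exact: fix_conj.
exists s, (u *m P), (Q *m w); split.
- by rewrite char_poly_conj.
- rewrite jacobian_conj; split; split.
  + exact: mulr_neq0.
  + by rewrite !mulmxA PQK uJ.
  + exact: mull_neq0.
  + by rewrite -!mulmxA (mulmxA P) PQ mul1mx wJ.
- apply: transfer nd; apply: (etrans (congr1 (fun d => d *m (Q *m w)) (derive2P e u u z))).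
  exact: pairing.
- apply: transfer (_ : r *: (_ *m w) != 0); last by rewrite scaler_eq0 negb_or r0; exact: tr.
  apply: (etrans (congr1 (fun d => d *m (Q *m w)) (derive1_conj e z))).
  by rewrite -scalemxAl pairing.
Qed.

Let conj_unitmx (M : 'M[R]_2) : (Q *m M *m P \in unitmx) = (M \in unitmx).
Proof. by rewrite !unitmxE !det_mulmx mulrC mulrA det_PQ mul1r. Qed.

Let invmx_conj (M : 'M[R]_2) : invmx (Q *m M *m P) = Q *m invmx M *m P.
Proof.
have [hM|hM] := boolP (M \in unitmx); last by rewrite !invmx_out// inE conj_unitmx.
have E : Q *m M *m P *m (Q *m invmx M *m P) = 1%:M.
  by rewrite -!mulmxA (mulmxA P) PQ mul1mx (mulmxA M) mulmxV// mul1mx QP.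
have U : Q *m M *m P \in unitmx by rewrite conj_unitmx.
by rewrite -[RHS]mul1mx -(mulVmx U) -(mulmxA (invmx _)) E mulmx1.
Qed.

Let subl_conj (M : 'M[R]_2) : Q *m M *m P - 1%:M = Q *m (M - 1%:M) *m P.
Proof. by rewrite mulmxBr mulmxBl mulmx1 QP. Qed.

Let subr_conj (M : 'M[R]_2) : 1%:M - Q *m M *m P = Q *m (1%:M - M) *m P.
Proof. by rewrite mulmxBr mulmxBl mulmx1 QP. Qed.

Let transport (u : 'rV[R]_2) (M : 'M[R]_2) : u *m P *m (Q *m M *m P) = u *m M *m P.
Proof. by rewrite !mulmxA PQK. Qed.

(** The auxiliary vectors transform into [h *m P] and [(r *: dz) *m P]: the cubic coefficient is
    unchanged, and the transversality expression is multiplied by [r]. *)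
Lemma period_doubling_conj e z :
  period_doubling H (r * e) (A z) -> period_doubling G e z.
Proof.
move=> [fx [s [u [w [[cp s1] [[u0 uJ] [w0 wJ]] nd tr]]]]].
split; first exact: fix_conj.
exists s, (u *m P), (Q *m w); split.
- by rewrite char_poly_conj.
- rewrite jacobian_conj; split; split.
  + exact: mulr_neq0.
  + by rewrite !mulmxA PQK uJ mulNmx.
  + exact: mull_neq0.
  + by rewrite -!mulmxA (mulmxA P) PQ mul1mx wJ mulmxN.
- pose h := 'D_u ('D_u (H (r * e))) (A z) *m invmx ('J (H (r * e)) (A z) - 1%:M).
  have hE : 'D_(u *m P) ('D_(u *m P) (G e)) z *m invmx ('J (G e) z - 1%:M) = h *m P.
    apply: (etrans (congr2 (fun a b => a *m invmx (b - 1%:M)) (derive2P e u u z)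
      (jacobian_conj e z))).
    by rewrite subl_conj invmx_conj transport.
  have E2 := etrans (congr1 (fun a => 'D_a ('D_(u *m P) (G e)) z) hE) (derive2P e u h z).
  have E := congr2 (fun a b => (6^-1 *: a - 2^-1 *: b) *m (Q *m w)) (derive3P e u z) E2.
  apply: (transfer (etrans E _) nd).
  by rewrite !scalemxAl -mulmxBl pairing.
- pose dz := derive1 (fun e => H e (A z)) (r * e) *m invmx (1%:M - 'J (H (r * e)) (A z)).
  have dzE : derive1 (fun e => G e z) e *m invmx (1%:M - 'J (G e) z) = (r *: dz) *m P.
    apply: (etrans (congr2 (fun a b => a *m invmx (1%:M - b)) (derive1_conj e z)
      (jacobian_conj e z))).
    by rewrite subr_conj invmx_conj -!scalemxAl transport.
  have E2 := etrans (congr1 (fun a => 'D_a ('D_(u *m P) (G e)) z) dzE) (derive2P e u (r *: dz) z).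
  have E3 := etrans E2 (congr1 (fun d => d *m P) (derive_scale (r * e) u dz (A z))).
  have E := congr2 (fun a b => (a + b) *m (Q *m w)) (derive1P e u z) E3.
  have tr' : r *: ((derive1 (fun e => 'D_u (H e) (A z)) (r * e) +
      'D_dz ('D_u (H (r * e))) (A z)) *m w) != 0.
    by rewrite scaler_eq0 negb_or r0; exact: tr.
  apply: (transfer (etrans E _) tr').
  by rewrite -scalemxAl -scalerDr -mulmxDl -scalemxAl pairing.
Qed.

End AffineConjugacy.

(** * Asymptotic stability and minimal periods *)

Section Stability.
Variable R : realType.

Lemma sqr_norm_le (w : 'rV[R]_2) : `|w| ^+ 2 <= w 0 0 ^+ 2 + w 0 1 ^+ 2.
Proof.
suff h : `|w| <= Num.sqrt (w 0 0 ^+ 2 + w 0 1 ^+ 2).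
  rewrite -[leRHS]sqr_sqrtr ?addr_ge0 ?sqr_ge0//.
  by rewrite ler_sqr ?nnegrE ?sqrtr_ge0.
rewrite rV_norm_le ?sqrtr_ge0//; apply/forallP => j; rewrite -[`|_|]ger0_norm// -sqrtr_sqr ler_wsqrtr// real_normK ?num_real//.
by case: (ord2P j) => ->; rewrite ?lerDl ?lerDr sqr_ge0.
Qed.

(** * Lyapunov functions for an iterate *)

Section Lyapunov.
Variables (F : 'rV[R]_2 -> 'rV[R]_2) (p : nat) (z : 'rV[R]_2) (U : 'rV[R]_2 -> R).
Variables (kappa m M : R).
Hypotheses (cF : continuous F) (p0 : (0 < p)%N) (fixz : iter p F z = z).
Hypotheses (k_bd : 0 <= kappa < 1) (m0 : 0 < m).
Hypothesis U_bd : forall w, m * `|w| ^+ 2 <= U w <= M * `|w| ^+ 2.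
Hypothesis contr : \forall w \near z, U (iter p F w - z) <= kappa * U (w - z).

Let iter_continuous j : continuous (iter j F).
Proof.
elim: j => [|j IH] w; first exact: cvg_id.
have -> : iter j.+1 F = F \o iter j F by exact/funext.
apply: cvg_comp; [exact: IH|exact: cF].
Qed.

Let near_orbit e : 0 < e ->
  \forall w \near z, forall j, (j < p)%N -> `|iter j F w - iter j F z| < e.
Proof.
move=> e0; elim: (p) => [|q IH]; first by apply: (@nearW _ _ _ (nbhs_filter z)) => w j; rewrite ltn0.
have h : \forall w \near z, `|iter q F w - iter q F z| < e.
  have C : iter q F w @[w --> z] --> iter q F z := @iter_continuous q z.
  apply: filterS (@cvgr_dist_lt _ _ _ _ (nbhs_filter z) _ _ C e e0) => w.
  by rewrite distrC.
apply: filterS (filterI IH h) => w [h1 h2] j; rewrite ltnS leq_eqVlt => /orP[/eqP->|] //.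
exact: h1.
Qed.

Let small_U c : 0 < c -> \forall w \near z, U (w - z) < c.
Proof.
move=> c0.
have M1 : 0 < `|M| + 1 by rewrite ltr_wpDl.
have d0 : 0 < Num.min 1 (c / (`|M| + 1)) by rewrite lt_min ltr01 divr_gt0.
apply: filterS (nbhsx_ballx z _ d0) => w.
rewrite -ball_normE /ball_/= distrC lt_min => /andP[w1 wc].
have /andP[_ h] := U_bd (w - z); apply: le_lt_trans h _.
have n0 : 0 <= `|w - z| by [].
have : M * `|w - z| ^+ 2 <= (`|M| + 1) * `|w - z|.
  apply: (@le_trans _ _ ((`|M| + 1) * `|w - z| ^+ 2)).
    by rewrite ler_wpM2r ?sqr_ge0// (le_trans (ler_norm _))// lerDl.
  by rewrite ler_wpM2l ?(ltW M1)// expr2 ler_piMr// ltW.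
move=> h; apply: le_lt_trans h _.
by rewrite mulrC -ltr_pdivlMr.
Qed.

Let G := iter p F.

(** The sublevel set at [m * d ^+ 2] lies in the ball of radius [d] where the contraction is known,
    and it is mapped into itself, so the estimate can be iterated. *)
Let basin : exists2 r : R, 0 < r & forall w, U (w - z) < r ->
  forall i, U (iter i G w - z) <= kappa ^+ i * U (w - z).
Proof.
have /andP[k0 k1] := k_bd.
have [d d0 hd] := (@nbhs_ballP _ _ _ _).1 contr.
exists (m * d ^+ 2) => [|w wr i]; first by rewrite mulr_gt0// exprn_gt0.
elim: i => [|i IH]; first by rewrite expr0 mul1r.
have Uw : 0 <= U (w - z) by have /andP[h _] := U_bd (w - z); apply: le_trans h; rewrite mulr_ge0 ?sqr_ge0// ltW.
have Ui : U (iter i G w - z) < m * d ^+ 2.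
  apply: le_lt_trans wr; apply: le_trans IH _; apply: ler_piMl => //.
  by rewrite exprn_ile1// ltW.
rewrite iterS; apply: (@le_trans _ _ (kappa * U (iter i G w - z))).
  apply: hd; rewrite -ball_normE /ball_/= distrC.
  have /andP[h _] := U_bd (iter i G w - z).
  by have := le_lt_trans h Ui; rewrite ltr_pM2l// ltr_sqr ?nnegrE// ltW.
by rewrite exprS -mulrA ler_wpM2l.
Qed.

Let iter_split w j : iter j F w = iter (j %% p) F (iter (j %/ p) G w).
Proof.
rewrite /G; have -> : iter (j %/ p) (iter p F) w = iter (j %/ p * p) F w.
  by elim: (j %/ p)%N => //= n ->; rewrite mulSn iterD.
by rewrite -iterD addnC -divn_eq.
Qed.

Let iter_fix i : iter i G z = z.
Proof. by elim: i => //= i ->. Qed.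

(** Geometric decay is available at multiples of the period. A general time is split by Euclidean
    division, and the fewer than [p] remaining iterates are controlled by continuity. *)
Lemma lyapunov_stable : asymptotically_stable F z.
Proof.
have /andP[k0 k1] := k_bd.
have [r r0 hr] := basin.
have U0 w : 0 <= U w by have /andP[h _] := U_bd w; apply: le_trans h; rewrite mulr_ge0 ?sqr_ge0// ltW.
have ball_of d w : 0 < d -> U (w - z) < m * d ^+ 2 -> `|w - z| < d.
  move=> d0 h; have /andP[h' _] := U_bd (w - z).
  by have := le_lt_trans h' h; rewrite ltr_pM2l// ltr_sqr ?nnegrE// ltW.
split.
- move=> e e0; have [d d0 hd] := (@nbhs_ballP _ _ _ _).1 (near_orbit e0).
  have c0 : 0 < Num.min r (m * d ^+ 2) by rewrite lt_min r0 mulr_gt0// exprn_gt0.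
  apply: filterS (small_U c0) => w; rewrite lt_min => /andP[wr wd] j.
  rewrite (iter_split w) (iter_split z) iter_fix.
  apply: hd; last by rewrite ltn_mod.
  rewrite -ball_normE /ball_/= distrC; apply: ball_of => //.
  apply: le_lt_trans wd; apply: le_trans (hr _ wr _) _; apply: ler_piMl => //.
  by rewrite exprn_ile1// ltW.
- apply: filterS (small_U r0) => w wr.
  apply/cvgrPdist_lt => e e0; rewrite /=.
  have [d d0 hd] := (@nbhs_ballP _ _ _ _).1 (near_orbit e0).
  have c0 : 0 < m * d ^+ 2 by rewrite mulr_gt0// exprn_gt0.
  have Lk : (fun i => kappa ^+ i * U (w - z)) @ \oo --> (0 : R).
    rewrite -[X in _ --> X](mul0r (U (w - z))).
    by apply: cvgM; [apply: cvg_expr; rewrite ger0_norm|exact: cvg_cst].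
  have [I _ hI] := cvgr_lt _ Lk _ c0.
  exists (I * p)%N => // j Ij /=.
  rewrite sub0r normrN (iter_split w) (iter_split z) iter_fix.
  apply: hd; last by rewrite ltn_mod.
  rewrite -ball_normE /ball_/= distrC; apply: ball_of => //.
  apply: le_lt_trans (hr _ wr _) _; apply: hI.
  by rewrite /= leq_divRL.
Qed.

End Lyapunov.

(** * A quadratic Lyapunov function from trace and determinant *)

Section Contraction.
Variables (a b c d q : R).
Let tau := (a + d) / q.
Let delta := (a * d - b * c) / q ^+ 2.
Hypotheses (q0 : 0 < q) (h1 : 0 < 1 - tau + delta) (h2 : 0 < 1 + tau + delta) (h3 : delta < 1).

Let X (w : 'rV[R]_2) := (w 0 0 * a + w 0 1 * c) / q.
Let Y (w : 'rV[R]_2) := (w 0 0 * b + w 0 1 * d) / q.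
(** Let [M] be the matrix [mx2 a b c d] divided by [q], so that [X] and [Y] are the components of
    [w M]. The form is [(1 + delta) (|w M|^2 + |w|^2) - 2 tau <w M, w>] for the Euclidean norm. By
    Cayley-Hamilton its decrease from [w] to [w M] equals [(1 - delta) |tau w M - (1 + delta) w|^2],
    which treats real and complex eigenvalues alike. *)
Let U (w : 'rV[R]_2) := (1 + delta) * (X w ^+ 2 + Y w ^+ 2 + (w 0 0 ^+ 2 + w 0 1 ^+ 2))
  - 2 * tau * (X w * w 0 0 + Y w * w 0 1).

(** Positive definiteness rests on [|tau| < 1 + delta], which combines the first two stability
    conditions. *)
Let U_lower : exists2 m, 0 < m & forall w, m * `|w| ^+ 2 <= U w.
Proof.
have t0 : `|tau| < 1 + delta by rewrite ltr_norml; move: tau delta h1 h2 => t e *; apply/andP; split; lra.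
exists (1 + delta - `|tau|) => [|w]; first by rewrite subr_gt0.
apply: le_trans (ler_wpM2l _ (sqr_norm_le w)) _; first by rewrite subr_ge0 ltW.
rewrite /U; move: (w 0 0) (w 0 1) (X w) (Y w) => x y x' y'.
have := ler_norm tau; have := ler_norm (- tau); rewrite normrN; have := normr_ge0 tau.
move: (`|tau|) t0 => T; move: tau delta => t e t0 T0 l1 l2.
have prod (u v : R) : t * (u * v) <= T * ((u ^+ 2 + v ^+ 2) / 2).
  have T1 : 0 <= T + t by lra.
  have T2 : 0 <= T - t by lra.
  have := mulr_ge0 T1 (sqr_ge0 (u - v)); have := mulr_ge0 T2 (sqr_ge0 (u + v)); nra.
have A := prod x' x; have B := prod y' y.
have C : 0 <= (1 + e - T) * (x' ^+ 2 + y' ^+ 2).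
  by apply: mulr_ge0; [lra|exact: addr_ge0 (sqr_ge0 _) (sqr_ge0 _)].
nra.
Qed.

Let U_upper : exists M, forall w, U w <= M * `|w| ^+ 2.
Proof.
exists ((1 + `|delta|) * (((`|a| + `|c|) / q) ^+ 2 + ((`|b| + `|d|) / q) ^+ 2 + 2)
  + 2 * `|tau| * ((`|a| + `|c|) / q + (`|b| + `|d|) / q)) => w.
have hX (s t : R) : `|(w 0 0 * s + w 0 1 * t) / q| <= (`|s| + `|t|) / q * `|w|.
  rewrite normrM normfV (gtr0_norm q0) mulrAC ler_pM2r ?invr_gt0//.
  apply: le_trans (ler_normD _ _) _; rewrite mulrDl !normrM; apply: lerD.
    by rewrite mulrC ler_wpM2l// rV_coord_le.
  by rewrite mulrC ler_wpM2l// rV_coord_le.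
have x0 := rV_coord_le w 0; have y0 := rV_coord_le w 1.
have hx := hX a c; have hy := hX b d.
rewrite /U -/(X w) -/(Y w) in hx hy *.
move: (w 0 0) (w 0 1) (X w) (Y w) (`|w|) (normr_ge0 w) x0 y0 hx hy => x y x' y' n n0 x0 y0 hx hy.
have sq (s B : R) : `|s| <= B -> s ^+ 2 <= B ^+ 2.
  by move=> h; rewrite -(real_normK (num_real s)) ler_sqr ?nnegrE// (le_trans _ h).
have D : (1 + delta) * (x' ^+ 2 + y' ^+ 2 + (x ^+ 2 + y ^+ 2)) <=
    (1 + `|delta|) * ((((`|a| + `|c|) / q) * n) ^+ 2 + (((`|b| + `|d|) / q) * n) ^+ 2 + (n ^+ 2 + n ^+ 2)).
  apply: ler_pM; last by rewrite !lerD// sq.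
  - by move: h1 h2; move: tau delta => *; lra.
  - by rewrite !addr_ge0 ?sqr_ge0.
  - by rewrite lerD2l ler_norm.
have pr (s t B : R) : `|s| <= B * n -> `|t| <= n -> `|s * t| <= B * n ^+ 2.
  by move=> hs ht; rewrite normrM expr2 mulrA ler_pM.
have E : - (2 * tau * (x' * x + y' * y)) <=
    2 * `|tau| * ((`|a| + `|c|) / q * n ^+ 2 + (`|b| + `|d|) / q * n ^+ 2).
  apply: le_trans (ler_norm _) _; rewrite normrN !normrM (ger0_norm (ler0n _ 2)).
  apply: ler_wpM2l; first by rewrite mulr_ge0.
  by apply: le_trans (ler_normD _ _) _; apply: lerD; exact: pr.
apply: le_trans (lerD D E) _; rewrite le_eqVlt; apply/orP; left; apply/eqP.
by move: (`|tau|) (`|delta|) (`|a|) (`|b|) (`|c|) (`|d|) (q^-1) => *; ring.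
Qed.

Let U_ge0 w : 0 <= U w.
Proof. by have [m m0 h] := U_lower; apply: le_trans (h w); rewrite mulr_ge0 ?sqr_ge0// ltW. Qed.

Let U_jac w : U (w *m mx2 a b c d) <= q ^+ 2 * U w.
Proof.
have E : q ^+ 2 * U w - U (w *m mx2 a b c d) = q ^+ 2 * ((1 - delta) *
    ((tau * X w - (1 + delta) * w 0 0) ^+ 2 + (tau * Y w - (1 + delta) * w 0 1) ^+ 2)).
  rewrite /U /X /Y /tau /delta !mxE !sum2 !mxE /=.
  by move: (w 0 0) (w 0 1) => x y; field; rewrite gt_eqF.
rewrite -subr_ge0 E; apply: mulr_ge0; first exact: sqr_ge0.
by apply: mulr_ge0; [rewrite subr_ge0 ltW|exact: addr_ge0 (sqr_ge0 _) (sqr_ge0 _)].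
Qed.

(** Young's inequality for the quadratic form: the two sides differ by [t * U (v - t^-1 *: w)]. *)
Let U_add (t : R) v w : 0 < t -> U (v + w) <= (1 + t) * U v + (1 + t^-1) * U w.
Proof.
move=> t0.
have E : (1 + t) * U v + (1 + t^-1) * U w - U (v + w) = t * U (v - t^-1 *: w).
  rewrite /U /X /Y !mxE; move: (v 0 0) (v 0 1) (w 0 0) (w 0 1) tau delta => *.
  by field; rewrite !gt_eqF.
by rewrite -subr_ge0 E mulr_ge0// ltW.
Qed.

Variables (F : 'rV[R]_2 -> 'rV[R]_2) (p : nat) (z : 'rV[R]_2).
Hypotheses (cF : continuous F) (p0 : (0 < p)%N) (fixz : iter p F z = z).
Hypotheses (dG : differentiable (iter p F) z) (JE : 'J (iter p F) z = mx2 a b c d) (q1 : q < 1).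

Let remainder eta : 0 < eta -> \forall w \near z,
  `|iter p F w - z - (w - z) *m mx2 a b c d| <= eta * `|w - z|.
Proof.
move=> e0; have /diff_locallyP[_ /eqaddoP/(_ _ e0) h] := dG.
have [r r0 hr] := (@nbhs_ballP _ _ _ _).1 h.
apply: filterS (nbhsx_ballx z _ r0) => w; rewrite -ball_normE /ball_/= distrC => wr.
have := hr (w - z); rewrite -ball_normE /ball_/= sub0r normrN => /(_ wr).
rewrite !fctE /= subrK fixz.
rewrite -(deriveE _ dG) (deriveEjacobian _ dG) JE.
by rewrite opprD addrA.
Qed.

Let stable_of_scaled : asymptotically_stable F z.
Proof.
have [m m0 Um] := U_lower; have [M UM] := U_upper.
have M0 : 0 < `|M| + 1 by rewrite ltr_wpDl.
have qq0 : 0 <= q ^+ 2 < 1 by rewrite sqr_ge0/= expr_lt1// ltW.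
have /andP[Q0 Q1] := qq0.
set Q := q ^+ 2 in Q0 Q1.
(* The linear part contracts by [Q] and the factor aimed at is [(1 + Q) / 2]. Of the gap [1 - Q],
   one quarter goes to Young's parameter [t] and one quarter to the remainder, through [eta]. *)
pose t := (1 - Q) / 4.
have t0 : 0 < t by rewrite divr_gt0// subr_gt0.
pose B := (1 + t^-1) * (`|M| + 1) / m.
have B0 : 0 < B by rewrite divr_gt0// mulr_gt0// addr_gt0// invr_gt0.
pose eta := Num.min 1 ((1 - Q) / 4 / B).
have eta0 : 0 < eta by rewrite lt_min ltr01 divr_gt0.
have etaB : B * eta ^+ 2 <= (1 - Q) / 4.
  have e1 : eta <= 1 by rewrite ge_min lexx.
  have e2 : eta <= (1 - Q) / 4 / B by rewrite ge_min lexx orbT.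
  have e3 : B * eta <= (1 - Q) / 4 by rewrite mulrC -ler_pdivlMr.
  apply: le_trans e3; rewrite ler_pM2l// expr2 ler_piMr// ltW//.
apply: (@lyapunov_stable F p z U ((1 + Q) / 2) m M) => //.
- by apply/andP; split; lra.
- by move=> w; rewrite Um UM.
apply: filterS (remainder eta0) => w; set r := _ - _ *m _ => hr.
have -> : iter p F w - z = (w - z) *m mx2 a b c d + r by rewrite [RHS]addrC subrK.
apply: le_trans (U_add _ _ t0) _.
have Ur : U r <= (`|M| + 1) * (eta ^+ 2 * `|w - z| ^+ 2).
  apply: le_trans (UM r) _; apply: (@le_trans _ _ ((`|M| + 1) * `|r| ^+ 2)).
    by rewrite ler_wpM2r ?sqr_ge0// (le_trans (ler_norm _))// lerDl.
  by rewrite ler_wpM2l ?(ltW M0)// -exprMn ler_sqr ?nnegrE// mulr_ge0// ltW.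
have Um' := Um (w - z); have UJ := U_jac (w - z); rewrite -/Q in UJ.
have {}Ur : (1 + t^-1) * U r <= B * eta ^+ 2 * U (w - z).
  apply: (@le_trans _ _ ((1 + t^-1) * ((`|M| + 1) * (eta ^+ 2 * `|w - z| ^+ 2)))).
    by rewrite ler_wpM2l// addr_ge0// invr_ge0 ltW.
  have -> : (1 + t^-1) * ((`|M| + 1) * (eta ^+ 2 * `|w - z| ^+ 2)) =
      B * eta ^+ 2 * (m * `|w - z| ^+ 2).
    by rewrite /B; move: (t^-1) (`|M|) (`|w - z|) (eta ^+ 2) => *; field; rewrite gt_eqF.
  by rewrite ler_wpM2l// mulr_ge0 ?sqr_ge0// ltW.
have U0 := U_ge0 (w - z).
have {}Ur := le_trans Ur (ler_wpM2r U0 etaB).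
have UJ' : (1 + t) * U ((w - z) *m mx2 a b c d) <= (1 + t) * (Q * U (w - z)).
  by rewrite ler_wpM2l// addr_ge0// ltW.
apply: le_trans (lerD UJ' Ur) _.
have tQ : t * Q * U (w - z) <= t * U (w - z).
  by rewrite ler_wpM2r// ler_piMr// ltW.
have -> : (1 + Q) / 2 * U (w - z) = Q * U (w - z) + t * U (w - z) + (1 - Q) / 4 * U (w - z).
  by rewrite /t; field.
by rewrite lerD2r mulrDl mul1r lerD2l mulrA.
Qed.

Lemma asymptotically_stable_scaled : asymptotically_stable F z.
Proof. exact: stable_of_scaled. Qed.

End Contraction.

(** The three inequalities are strict, hence still hold for the Jacobian matrix divided by some
    [q < 1]; the quadratic form built for the quotient is contracted by [q ^+ 2], which leaves room
    for the nonlinear remainder. *)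
Lemma asymptotically_stable_jacobian (F : 'rV[R]_2 -> 'rV[R]_2) p z : continuous F ->
  (0 < p)%N -> iter p F z = z -> differentiable (iter p F) z ->
  let J := 'J (iter p F) z in
  0 < 1 - \tr J + \det J -> 0 < 1 + \tr J + \det J -> \det J < 1 ->
  asymptotically_stable F z.
Proof.
move=> cF p0 fz dG J h1 h2 h3.
have [a [b [c [d JE]]]] : exists a b c d, J = mx2 a b c d.
  by exists (J 0 0), (J 0 1), (J 1 0), (J 1 1); exact: mx2_eta.
move: h1 h2 h3; rewrite JE tr_mx2 det_mx2 !mxE /=.
move=> h1 h2 h3.
pose tau := a + d; pose del := a * d - b * c.
have E1 : 0 < 1 - tau + del := h1.
have E2 : 0 < 1 + tau + del := h2.
have E3 : del < 1 := h3.
have [q [q0 q1 H1 H2 H3]] : exists q : R, [/\ 0 < q, q < 1, 0 < q ^+ 2 - tau * q + del,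
    0 < q ^+ 2 + tau * q + del & del < q ^+ 2].
  move: tau del E1 E2 E3 => t e E1 E2 E3.
  (* The smallest of the three gaps; lowering [q] from 1 by [g / 8] uses up only a part of it. *)
  pose g := Num.min (1 - t + e) (Num.min (1 + t + e) (1 - e)).
  have g0 : 0 < g by rewrite !lt_min E1 E2 subr_gt0.
  have g1 : g <= 1 - t + e by rewrite ge_min lexx.
  have g2 : g <= 1 + t + e by rewrite !ge_min lexx orbT.
  have g3 : g <= 1 - e by rewrite !ge_min lexx !orbT.
  exists (1 - g / 8); clearbody g; split; nra.
have qq : 0 < q ^+ 2 by rewrite exprn_gt0.
have quot (s : R) : 1 + s * tau / q + del / q ^+ 2 = (q ^+ 2 + s * tau * q + del) / q ^+ 2.
  by field; rewrite gt_eqF.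
apply: (@asymptotically_stable_scaled a b c d q _ _ _ _ F p z) => //; rewrite -/tau -/del.
- by have := quot (-1); rewrite !mulN1r !mulNr => ->; rewrite divr_gt0.
- by have := quot 1; rewrite !mul1r => ->; rewrite divr_gt0.
- by rewrite ltr_pdivrMr// mul1r.
Qed.

(** A return time [j < m] would fall within the reinjection, where the orbit is not located. But
    then [m * j] is a return time as well, and [m <= m * j < m * m <= k] puts it in the controlled
    range. *)
Lemma minimal_period (F : 'rV[R]_2 -> 'rV[R]_2) (m k : nat) z : (0 < m)%N -> (m * m <= k)%N ->
  (forall j, (m <= j < m + k)%N -> iter j F z <> z) ->
  forall j, (0 < j < m + k)%N -> iter j F z <> z.
Proof.
move=> m0 mk h j /andP[j0 jk] fz.
have [mj|jm] := leqP m j; first by apply: h fz; rewrite mj.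
apply: (h (m * j)%N).
  rewrite leq_pmulr//=; apply: (@leq_trans (m * m)); first by rewrite ltn_pmul2l.
  exact: leq_trans mk (leq_addl _ _).
by elim: (m) => //= n; rewrite mulSn iterD => ->.
Qed.

End Stability.

(** * Resonant normal form *)

Section NormalForms.
Variable R : realType.
Local Notation e_ i := (delta_mx 0 i).
Implicit Types (g : 'rV[R]_3 -> R).

Lemma lim_row3 (u0 u1 u2 : R -> R) (t : R) (FF := nbhs_filter t) :
  continuous_at t u0 -> continuous_at t u1 -> continuous_at t u2 ->
  continuous_at t (fun t => row3 (u0 t) (u1 t) (u2 t)).
Proof.
move=> c0 c1 c2.
have E s : row3 (u0 s) (u1 s) (u2 s) = \row_i [:: u0; u1; u2]`_i s.
  by apply/rowP => i; case: (ord3P i) => ->; rewrite row3E mxE.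
have -> : (fun t => row3 (u0 t) (u1 t) (u2 t)) = fun t => \row_i [:: u0; u1; u2]`_i t.
  exact/funext/E.
apply: (@row_cvg _ _ _ _ FF (fun (i : 'I_3) s => [:: u0; u1; u2]`_i s)) => i.
by rewrite mxE; case: (ord3P i) => ->.
Qed.

Lemma smooth_row3_continuous g (u0 u1 u2 : R -> R) (t : R) : smooth g ->
  continuous_at t u0 -> continuous_at t u1 -> continuous_at t u2 ->
  continuous_at t (fun t => g (row3 (u0 t) (u1 t) (u2 t))).
Proof.
move=> sg c0 c1 c2.
apply: (cvg_comp (fun t => row3 (u0 t) (u1 t) (u2 t)) g); first exact: lim_row3.
exact: smooth_continuous.
Qed.

Lemma near_dnbhs0 (P : R -> Prop) : (\forall t \near (0 : R), P t) ->
  \forall t \near (0 : R)^', t != 0 /\ P t.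
Proof.
by rewrite /dnbhs /within /=; apply: filterS => t Pt t0.
Qed.

Lemma vanish_const (p C : R) (phi : R -> R) : continuous_at 0 phi ->
  (\forall t \near (0 : R)^', `|p + t * phi t| <= C * `|t|) -> p = 0.
Proof.
move=> cphi h.
have FD := dnbhs_filter (0 : R).
have Lid : (id : R -> R) @ (0 : R)^' --> (0 : R) by exact: cvg_within.
have Lphi : phi @ (0 : R)^' --> phi 0.
  by apply: cvg_trans cphi; apply: cvg_app; exact: cvg_within.
have L1 := cvg_norm (limD FD (lim_cst FD p) (limM FD Lid Lphi)).
have L2 := limM FD (lim_cst FD C) (cvg_norm Lid).
have := @ler_cvg_to _ _ (Proper_dnbhs_numFieldType (0 : R)) _ _ _ _ _ (L1 FD) (L2 FD) h.
by rewrite mul0r addr0 normr0 mulr0 normr_le0 => /eqP.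
Qed.

Lemma eq_of_near (phi : R -> R) (l : R) : continuous_at 0 phi ->
  (\forall t \near (0 : R)^', phi t = l) -> phi 0 = l.
Proof.
move=> cphi h; apply/eqP; rewrite -subr_eq0; apply/eqP.
apply: (@vanish_const _ 0 (fun=> 0)); first exact: cvg_cst.
have FD := dnbhs_filter (0 : R).
have Lphi : phi @ (0 : R)^' --> phi 0.
  by apply: cvg_trans cphi; apply: cvg_app; exact: cvg_within.
have L2 : phi @ (0 : R)^' --> l.
  apply: (@cvg_trans _ ((fun=> l) @ (0 : R)^')); last exact: cvg_cst.
  by apply: near_eq_cvg; apply: filterS h => t ->.
have E : phi 0 = l := @cvg_unique _ (@Rhausdorff R) _ _ _ _ Lphi L2.
by rewrite E subrr; apply: nearW => t; rewrite mulr0 addr0 normr0 mul0r.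
Qed.

Let hadamard_gen g (j : 'I_3) (c : R -> R -> R -> 'rV[R]_3) : smooth g ->
  (forall a b d, cut j 0 (row3 a b d) = c a b d) ->
  exists2 h, smooth h & forall a b d,
    g (row3 a b d) = g (c a b d) + (row3 a b d) 0 j * h (row3 a b d).
Proof.
move=> sg hc; have [h sh hE] := hadamard j sg.
by exists h => // a b d; rewrite hE hc.
Qed.

Lemma hadamard0 g : smooth g -> exists2 h, smooth h & forall a b d,
  g (row3 a b d) = g (row3 0 b d) + a * h (row3 a b d).
Proof.
move=> sg; have [|h sh hE] := @hadamard_gen g i0 (fun a b d => row3 0 b d) sg.
  by move=> a b d; apply/rowP => i; rewrite mxE; case: (ord3P i) => ->; rewrite !row3E /= ?mul0r.
by exists h => // a b d; rewrite hE row3E.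
Qed.

Lemma hadamard1 g : smooth g -> exists2 h, smooth h & forall a b d,
  g (row3 a b d) = g (row3 a 0 d) + b * h (row3 a b d).
Proof.
move=> sg; have [|h sh hE] := @hadamard_gen g i1 (fun a b d => row3 a 0 d) sg.
  by move=> a b d; apply/rowP => i; rewrite mxE; case: (ord3P i) => ->; rewrite !row3E /= ?mul0r.
by exists h => // a b d; rewrite hE row3E.
Qed.

Lemma hadamard2 g : smooth g -> exists2 h, smooth h & forall a b d,
  g (row3 a b d) = g (row3 a b 0) + d * h (row3 a b d).
Proof.
move=> sg; have [|h sh hE] := @hadamard_gen g i2 (fun a b d => row3 a b 0) sg.
  by move=> a b d; apply/rowP => i; rewrite mxE; case: (ord3P i) => ->; rewrite !row3E /= ?mul0r.
by exists h => // a b d; rewrite hE row3E.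
Qed.

Lemma row3_zero : row3 0 0 0 = 0 :> 'rV[R]_3.
Proof. by apply/rowP => i; case: (ord3P i) => ->; rewrite row3E mxE. Qed.

(** The coordinates are divided out one after the other, so the later quotients depend on fewer
    variables. Coefficients obtained by iterating this are not symmetric; only sums such as
    [q i1 i2 + q i2 i1] are meaningful. *)
Lemma taylor_step g : smooth g -> exists2 G : 'I_3 -> 'rV[R]_3 -> R,
  forall i, smooth (G i) & forall z, g z = g 0 + \sum_i z 0 i * G i z.
Proof.
move=> sg; have [h0 sh0 E0] := hadamard0 sg; have [h1 sh1 E1] := hadamard1 sg.
have [h2 sh2 E2] := hadamard2 sg.
exists (fun i => nth h0 [:: h0; (fun z : 'rV[R]_3 => h1 (row3 0 (z 0 i1) (z 0 i2)));
    (fun z : 'rV[R]_3 => h2 (row3 0 0 (z 0 i2)))] i) => [i|z].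
  case: (ord3P i) => -> //=.
    by apply: (@smooth_comp3 _ _ h1 (fun=> 0) (fun z => z 0 i1) (fun z => z 0 i2)) => //;
      [exact: smooth_cst|exact: smooth_coord|exact: smooth_coord].
  by apply: (@smooth_comp3 _ _ h2 (fun=> 0) (fun=> 0) (fun z => z 0 i2)) => //;
    [exact: smooth_cst|exact: smooth_cst|exact: smooth_coord].
rewrite sum3 /=; have := row3_eta z; move: (z 0 i0) (z 0 i1) (z 0 i2) => a b d zE.
by rewrite zE E0 E1 E2 row3_zero; ring.
Qed.

Lemma taylor2 g : smooth g -> exists (l : 'I_3 -> R) (G : 'I_3 -> 'I_3 -> 'rV[R]_3 -> R),
  (forall i j, smooth (G i j)) /\
  forall z, g z = g 0 + \sum_i z 0 i * (l i + \sum_j z 0 j * G i j z).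
Proof.
move=> sg; have [G sG E] := taylor_step sg.
have h i : exists H : 'I_3 -> 'rV[R]_3 -> R, (forall j, smooth (H j)) /\
    forall z, G i z = G i 0 + \sum_j z 0 j * H j z.
  by have [H sH EH] := taylor_step (sG i); exists H.
have [H hH] := choice h.
exists (fun i => G i 0), H; split=> [i j|z]; first exact: (hH i).1.
by rewrite E; congr (_ + _); apply: eq_bigr => i _; rewrite (hH i).2.
Qed.

Lemma taylor3 g : smooth g -> exists (l : 'I_3 -> R) (q : 'I_3 -> 'I_3 -> R)
    (G : 'I_3 -> 'I_3 -> 'I_3 -> 'rV[R]_3 -> R),
  (forall i j k, smooth (G i j k)) /\
  forall z, g z = g 0 + \sum_i z 0 i * (l i + \sum_j z 0 j * (q i j + \sum_k z 0 k * G i j k z)).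
Proof.
move=> sg; have [l [G [sG E]]] := taylor2 sg.
have h i : exists H : 'I_3 -> 'I_3 -> 'rV[R]_3 -> R, (forall j k, smooth (H j k)) /\
    forall j z, G i j z = G i j 0 + \sum_k z 0 k * H j k z.
  have h' j : exists H : 'I_3 -> 'rV[R]_3 -> R, (forall k, smooth (H k)) /\
      forall z, G i j z = G i j 0 + \sum_k z 0 k * H k z.
    by have [H sH EH] := taylor_step (sG i j); exists H.
  have [H hH] := choice h'.
  by exists H; split => [j k|j z]; [exact: (hH j).1|exact: (hH j).2].
have [H hH] := choice h.
exists l, (fun i j => G i j 0), H; split=> [i j k|z]; first exact: (hH i).1.
rewrite E; congr (_ + _); apply: eq_bigr => i _; congr (_ * (_ + _)).
by apply: eq_bigr => j _; rewrite (hH i).2.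
Qed.

Section LocalForm.
Variables (g : 'rV[R]_3 -> R) (sg : smooth g) (N : R -> R -> Prop).
Hypotheses (Nx : forall x, N x 0 -> \forall t \near (0 : R), N x t)
  (Ny : forall y, N 0 y -> \forall t \near (0 : R), N t y) (N0 : N 0 0).

(** The assumption on one component of the local map at a single parameter value; the remainder is
    bounded but carries no regularity of its own. *)
Definition resonant_form (e lam al : R) := exists r : R -> R -> R,
  (forall x y, N x y -> g (row3 e x y) = lam * x * (1 + al * (x * y) + r x y)) /\
  exists C eta, 0 < eta /\ forall x y, N x y -> `|x * y| <= eta ->
    `|r x y| <= C * (x ^+ 2 * y ^+ 2).

(* The quotients are identified one coefficient at a time, letting first [y]
   and then [x] tend to zero; only the points [(x, 0)] and [(0, y)] are needed in [N]. *)
Lemma local_form : exists L a h : 'rV[R]_3 -> R, [/\ smooth L, smooth a, smooth h &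
  forall e lam al, resonant_form e lam al ->
  [/\ L (row3 e 0 0) = lam, a (row3 e 0 0) = lam * al & forall x y, N x 0 -> N 0 y ->
    g (row3 e x y) = x * (L (row3 e 0 0) + a (row3 e 0 0) * (x * y)
      + (x * y) ^+ 2 * h (row3 e x y))]].
Proof.
(* [A] divides [g] by [x]; [B] and [A2] come from dividing by [y] twice, [A11] from dividing [B] by
   [x], and [P], [H] from dividing [A2] by [x] twice. It remains to see that on [N] the function [A]
   is constant for [y = 0], that [B] is linear in [x] for [y = 0], and that [A2] and [P] vanish for
   [x = 0]. *)
have [A sA AE] := hadamard1 sg.
have [B sB BE] := hadamard2 sA.
have [A2 sA2 A2E] := hadamard2 sB.
have [A11 sA11 A11E] := hadamard1 sB.
have [P sP PE] := hadamard1 sA2.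
have [H sH HE] := hadamard1 sP.
exists A, A11, H; split => // e lam al [r [rE [C [eta [eta0 rC]]]]].
have cst (c : R) : continuous_at (0 : R) (fun=> c) by exact: cvg_cst.
have idc : continuous_at (0 : R) id by exact: cvg_id.
have cx h y : smooth h -> continuous_at 0 (fun t => h (row3 e t y)).
  by move=> sh; apply: smooth_row3_continuous.
have cy h x : smooth h -> continuous_at 0 (fun t => h (row3 e x t)).
  by move=> sh; apply: smooth_row3_continuous.
have small x : \forall t \near (0 : R), `|x * t| <= eta.
  have d0 : 0 < eta / (`|x| + 1) by rewrite divr_gt0// ltr_wpDl.
  apply: filterS (nbhsx_ballx (0 : R) _ d0) => t.
  rewrite /ball/= sub0r normrN ltr_pdivlMr ?ltr_wpDl// => h.
  by rewrite normrM (le_trans _ (ltW h))// mulrC ler_wpM2l// lerDl ler01.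
have g0 y : N 0 y -> g (row3 e 0 y) = 0 by move=> /rE ->; rewrite mulr0 mul0r.
have Axy : forall x y, N x y -> N 0 y -> x != 0 ->
    A (row3 e x y) = lam * (1 + al * (x * y) + r x y).
  move=> x y Nxy N0y x0; apply: (mulfI x0).
  have := AE e x y; rewrite (rE x y Nxy) (g0 y N0y) add0r => <-; ring.
have Ax0' x : N x 0 -> x != 0 -> A (row3 e x 0) = lam.
  move=> Nx0 x0; rewrite Axy//.
  have : `|r x 0| <= C * (x ^+ 2 * 0 ^+ 2) by rewrite rC// mulr0 normr0 ltW.
  by rewrite expr0n/= !mulr0 normr_le0 => /eqP ->; rewrite !addr0 mulr1.
have A0 : A (row3 e 0 0) = lam.
  apply: (eq_of_near (cx A 0 sA)).
  by apply: filterS (near_dnbhs0 (Ny N0)) => t [t0 Nt]; exact: Ax0'.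
have Ax0 x : N x 0 -> A (row3 e x 0) = lam.
  by move=> Nx0; have [->//|x0] := eqVneq x 0; exact: Ax0'.
(* The remainder [r] in terms of the quotients. Its bound is used at fixed [x] with [y] tending to 0
   to find [B], then at fixed [y] with [x] tending to 0 for [A2] and [P]. *)
have key (x y : R) : N x y -> N 0 y -> N x 0 -> x != 0 -> y != 0 ->
    (B (row3 e x 0) - lam * al * x) + y * A2 (row3 e x y) = lam * r x y / y.
  move=> Nxy N0y Nx0 x0 y0; apply: (mulfI y0).
  have := Axy x y Nxy N0y x0; rewrite BE Ax0// A2E.
  move: (B _) (A2 _) (r x y) => b a2 rr h.
  have -> : y * (lam * rr / y) = lam * rr by field.
  have e1 : y * (b - lam * al * x + y * a2) = (lam + y * (b + y * a2)) - lam - lam * al * (x * y) by ring.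
  by rewrite e1 h; ring.
have bnd (x y : R) : N x y -> `|x * y| <= eta -> y != 0 ->
    `|lam * r x y / y| <= `|lam| * `|C| * x ^+ 2 * `|y|.
  move=> Nxy xy y0; have := rC x y Nxy xy.
  rewrite !normrM normfV ler_pdivrMr ?normr_gt0// => h.
  have -> : `|lam| * `|C| * x ^+ 2 * `|y| * `|y| = `|lam| * (`|C| * (x ^+ 2 * y ^+ 2)).
    by rewrite -[y ^+ 2]real_normK ?num_real//; ring.
  apply: ler_wpM2l => //; apply: le_trans h _; apply: ler_wpM2r; last exact: ler_norm.
  by apply: mulr_ge0; exact: sqr_ge0.
have nI := @filterI R (nbhs (0 : R)) (nbhs_filter (0 : R)).
have Bx' x : N x 0 -> x != 0 -> B (row3 e x 0) = lam * al * x.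
  move=> Nx0 x0; apply/eqP; rewrite -subr_eq0; apply/eqP.
  apply: (@vanish_const _ (`|lam| * `|C| * x ^+ 2) (fun t => A2 (row3 e x t))); first exact: cy.
  have h := near_dnbhs0 (nI _ _ (Nx Nx0) (nI _ _ (small x) (Nx N0))).
  by apply: (@filterS _ _ (dnbhs_filter (0 : R)) _ _ _ h) => t [t0 [Nt [st N0t]]]; rewrite key//; exact: bnd.
have nearx := near_dnbhs0 (Ny N0).
have B0 : B (row3 e 0 0) = 0.
  apply: (@vanish_const _ 0 (fun t => A11 (row3 e t 0) - lam * al)).
    exact: (limB (nbhs_filter (0:R)) (cx A11 0 sA11) (cst _)).
  apply: (@filterS _ _ (dnbhs_filter (0 : R)) _ _ _ nearx) => t [t0 Nt].
  have := Bx' t Nt t0; rewrite A11E => h.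
  by rewrite mulrBr addrA h mulrC subrr normr0 mul0r.
have Bx x : N x 0 -> B (row3 e x 0) = lam * al * x.
  by move=> Nx0; have [->|x0] := eqVneq x 0; [rewrite B0 mulr0|exact: Bx'].
have a0 : A11 (row3 e 0 0) = lam * al.
  apply: (eq_of_near (cx A11 0 sA11)).
  apply: (@filterS _ _ (dnbhs_filter (0 : R)) _ _ _ nearx) => t [t0 Nt]; apply: (mulfI t0).
  by have := Bx t Nt; rewrite A11E B0 add0r => ->; rewrite mulrC.
have A2b y : N 0 y -> y != 0 -> \forall t \near (0 : R)^',
    t != 0 /\ `|A2 (row3 e t y)| <= `|lam| * `|C| * t ^+ 2.
  move=> N0y y0.
  have small' : \forall t \near (0 : R), `|t * y| <= eta.
    by apply: filterS (small y) => t; rewrite mulrC.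
  have h := near_dnbhs0 (nI _ _ (Ny N0y) (nI _ _ small' (Ny N0))).
  apply: (@filterS _ _ (dnbhs_filter (0 : R)) _ _ _ h) => t [t0 [Nt [st Nt0]]]; split => //.
  have := bnd t y Nt st y0; rewrite -key// Bx// subrr add0r normrM mulrC ler_pM2r ?normr_gt0//.
have A20 y : N 0 y -> y != 0 -> A2 (row3 e 0 y) = 0.
  move=> N0y y0; apply: (@vanish_const _ (`|lam| * `|C|) (fun t => P (row3 e t y))); first exact: cx.
  have b1 : \forall t \near (0 : R)^', t != 0 /\ `|t| <= 1.
    apply: near_dnbhs0; apply: filterS (nbhsx_ballx (0 : R) _ (ltr01 : 0 < 1 :> R)) => t.
    by rewrite /ball/= sub0r normrN => /ltW.
  apply: (@filterS2 _ _ (dnbhs_filter (0:R)) _ _ _ _ (A2b y N0y y0) b1) => t [_ h] [_ t1].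
  rewrite -PE; apply: le_trans h _; rewrite -!mulrA !ler_wpM2l//.
  by rewrite -real_normK ?num_real// expr2 ler_piMr.
have P0 y : N 0 y -> y != 0 -> P (row3 e 0 y) = 0.
  move=> N0y y0; apply: (@vanish_const _ (`|lam| * `|C|) (fun t => H (row3 e t y))); first exact: cx.
  apply: (@filterS _ _ (dnbhs_filter (0 : R)) _ _ _ (A2b y N0y y0)) => t [t0]; rewrite PE A20// add0r normrM -HE => h.
  rewrite -(ler_pM2l (_ : 0 < `|t|)) ?normr_gt0//; apply: le_trans h _.
  by rewrite -real_normK ?num_real// expr2 mulrCA.
split => // x y Nx0 N0y; rewrite AE g0// add0r A0 a0 BE Ax0// A2E Bx//.
have [->|y0] := eqVneq y 0; first by rewrite mul0r !mulr0 expr0n mul0r !addr0.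
by rewrite PE A20// HE P0//; ring.
Qed.

End LocalForm.

End NormalForms.

(** * Smooth families and their Taylor coefficients *)

Section Families.
Variable R : realType.
Local Notation e_ i := (delta_mx 0 i).

(** Translates differentiability in all directions on a general normed space into coordinate
    smoothness on row vectors: [L] is linear, so a partial derivative of the composite is a
    directional derivative of [Phi] composed with [L], and the argument repeats. *)
Lemma smooth_pull (W : normedModType R) p (L : 'rV[R]_p -> W) (Phi : W -> 'rV[R]_2) j :
  (forall (h : R) u w, L (h *: u + w) = h *: L u + L w) -> continuous L ->
  smooth_on setT Phi -> smooth (fun x => Phi (L x) 0 j).
Proof.
move=> lL cL sPhi k.
have cont (Psi : W -> 'rV[R]_2) : (forall y, setT y -> {for y, continuous Psi}) ->
    continuous (fun x => Psi (L x) 0 j).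
  move=> c x; apply: (cvg_comp (fun x => Psi (L x)) (fun w : 'rV[R]_2 => w 0 j)).
    by apply: (cvg_comp L Psi); [exact: cL|exact: c].
  exact: coord_continuous.
have L0 x : L (0 + x) = L x by rewrite add0r.
have der (Psi : W -> 'rV[R]_2) (x : 'rV[R]_p) i : derivable Psi (L x) (L (e_ i)) ->
    is_derive x (e_ i) (fun x => Psi (L x) 0 j) ('D_(L (e_ i)) Psi (L x) 0 j).
  move=> d; have := @is_derive_affine _ _ _ Psi _ 0 L x (e_ i).
  rewrite addr0 => /(_ (fun h w => lL h _ w) d) [dd DE].
  have E := derive_mx dd.
  apply: DeriveDef; first exact: ((derivable_mxP _ _ _).1 dd).
  by move: E; rewrite DE => /matrixP/(_ 0 j); rewrite mxE => <-.
have partialE (Psi : W -> 'rV[R]_2) i : (forall x v, derivable Psi x v) ->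
    'D_(e_ i) (fun x => Psi (L x) 0 j) = fun x => 'D_(L (e_ i)) Psi (L x) 0 j.
  by move=> d; apply/funext => x; have [_] := der Psi x i (d (L x) (L (e_ i))).
elim: k Phi sPhi => [|k IH] Phi sPhi; split => //; try exact: (cont _ (sPhi 0%N)).
have d x v : derivable Phi x v := (sPhi 1%N).1 x v I.
move=> i; split => [x|]; first by have [] := der Phi x i (d _ _).
rewrite (partialE _ _ d).
exact: (IH ('D_(L (e_ i)) Phi) (fun l => (sPhi l.+1).2 (L (e_ i)))).
Qed.

Variables (n : nat) (f : 'rV[R]_n -> 'rV[R]_2 -> 'rV[R]_2).
Hypothesis f_smooth : smooth_family f.

Let unpack (y : 'rV[R]_(n + 2)) : 'rV[R]_n * 'rV[R]_2 := (lsubmx y, rsubmx y).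

Let unpack_continuous : continuous unpack.
Proof.
move=> y.
have cl : (fun y : 'rV[R]_(n + 2) => lsubmx y) z @[z --> y] --> lsubmx y.
  have -> : (fun y : 'rV[R]_(n + 2) => lsubmx y) = fun y => \row_i y 0 (lshift 2 i).
    by apply/funext => z; apply/rowP => i; rewrite !mxE.
  apply: (@row_cvg _ _ _ _ (nbhs_filter y) (fun i (z : 'rV[R]_(n + 2)) => z 0 (lshift 2 i))) => i.
  by rewrite mxE; exact: coord_continuous.
have cr : (fun y : 'rV[R]_(n + 2) => rsubmx y) z @[z --> y] --> rsubmx y.
  have -> : (fun y : 'rV[R]_(n + 2) => rsubmx y) = fun y => \row_i y 0 (rshift n i).
    by apply/funext => z; apply/rowP => i; rewrite !mxE.
  apply: (@row_cvg _ _ _ _ (nbhs_filter y) (fun i (z : 'rV[R]_(n + 2)) => z 0 (rshift n i))) => i.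
  by rewrite mxE; exact: coord_continuous.
exact: cvg_pair cl cr.
Qed.

Lemma smooth_family_comp p (M : 'I_n -> 'rV[R]_p -> R) (u v : 'rV[R]_p -> R) j :
  (forall i, smooth (M i)) -> smooth u -> smooth v ->
  smooth (fun x => f (\row_i M i x) (pt (u x) (v x)) 0 j).
Proof.
move=> sM su sv.
have lin (h : R) y w : unpack (h *: y + w) = h *: unpack y + unpack w.
  by rewrite /unpack; congr (_, _); apply/rowP => i; rewrite !mxE.
have sF := smooth_pull j lin unpack_continuous f_smooth.
pose U (i : 'I_(n + 2)) := match fintype.split i with inl a => M a | inr b => if b == 0 then u else v end.
have sU i : smooth (U i).
  by rewrite /U; case: (fintype.split i) => // b; case: ifP.
have := smooth_comp sF sU.
have E x : unpack (\row_i U i x) = (\row_i M i x, pt (u x) (v x)).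
  congr (_, _); apply/rowP => i; rewrite !mxE /U.
    by rewrite (unsplitK (inl i : 'I_n + 'I_2)).
  by rewrite (unsplitK (inr i : 'I_n + 'I_2)); case: ifP.
by under [X in smooth X -> _]funext do rewrite E.
Qed.

Lemma smooth_family_iter p (M : 'I_n -> 'rV[R]_p -> R) (u v : 'rV[R]_p -> R) k :
  (forall i, smooth (M i)) -> smooth u -> smooth v ->
  forall j, smooth (fun x => iter k (f (\row_i M i x)) (pt (u x) (v x)) 0 j).
Proof.
move=> sM su sv; elim: k => [|k IH] j.
  have -> : (fun x => iter 0 (f (\row_i M i x)) (pt (u x) (v x)) 0 j) = if j == 0 then u else v.
    by apply/funext => x; rewrite /= mxE; case: ifP.
  by case: ifP.
have := smooth_family_comp j sM (IH 0) (IH 1).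
by under [X in smooth X -> _]funext do rewrite -pt_eta.
Qed.

Lemma family_continuous mu : continuous (f mu).
Proof.
move=> w.
have sM i : smooth (fun _ : 'rV[R]_2 => mu 0 i) by exact: smooth_cst.
have s j := smooth_family_comp j sM (@smooth_coord R 2 0) (@smooth_coord R 2 1).
have E z : f mu z = \row_j f (\row_i mu 0 i) (pt (z 0 0) (z 0 1)) 0 j.
  have -> : \row_i mu 0 i = mu by apply/rowP => i; rewrite mxE.
  by rewrite -pt_eta; apply/rowP => j; rewrite mxE.
have -> : f mu = fun z => \row_j f (\row_i mu 0 i) (pt (z 0 0) (z 0 1)) 0 j by exact/funext.
apply: (@row_cvg _ _ _ _ (nbhs_filter w)
  (fun j (z : 'rV[R]_2) => f (\row_i mu 0 i) (pt (z 0 0) (z 0 1)) 0 j)) => j.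
by rewrite mxE; exact: (smooth_continuous (s j)).
Qed.

End Families.

(** * Comparison of expansions *)

Section Coefficients.
Variable R : realType.
Local Notation e_ i := (delta_mx 0 i).

(** Near 0 the function agrees with a smooth [G], in practice read off from the family; the gradient
    paired with [v] is then the derivative of [G] along the line [e *: v]. *)
Lemma dot_grad_slope n (F G : 'rV[R]_n -> R) v (p : R) (phi : R -> R) : smooth G ->
  (\forall mu \near (0 : 'rV[R]_n), F mu = G mu) ->
  (\forall e \near (0 : R), G (e *: v) = p + e * phi e) -> continuous_at 0 phi ->
  dot (grad F 0) v = phi 0.
Proof.
move=> sG FG h cphi.
have -> : dot (grad F 0) v = 'D_v G 0.
  have D := derive_dir (0 : 'rV[R]_n) v sG; rewrite (@derive_val _ _ _ _ _ _ _ D).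
  by apply: eq_bigr => i _; rewrite mxE mulrC; congr (_ * _); exact: near_eq_derive.
apply: cvg_lim => //.
have Lphi : phi @ (0 : R)^' --> phi 0.
  by apply: cvg_trans cphi; apply: cvg_app; exact: cvg_within.
apply: cvg_trans Lphi; apply: near_eq_cvg.
have G0 : G 0 = p by have := nbhs_singleton h; rewrite scale0r mul0r addr0.
apply: (@filterS _ _ (dnbhs_filter (0 : R)) _ _ _ (near_dnbhs0 h)) => e [e0 he].
by rewrite /= addr0 he G0 addrAC subrr add0r /GRing.scale/= mulrA mulVf// mul1r.
Qed.

Lemma vanish_jet2 (p0 p1 C : R) (psi : R -> R) : continuous_at 0 psi ->
  (\forall t \near (0 : R), `|p0 + t * (p1 + t * psi t)| <= C * `|t| ^+ 2) ->
  p0 = 0 /\ p1 = 0.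
Proof.
move=> cpsi h.
have FD := dnbhs_filter (0 : R); have F0 := nbhs_filter (0 : R).
have cid : continuous_at (0 : R) id by exact: cvg_id.
have ccst (c : R) : continuous_at (0 : R) (fun=> c) by exact: cvg_cst.
have b1 : \forall t \near (0 : R), `|t| <= 1.
  apply: filterS (nbhsx_ballx (0 : R) _ (ltr01 : 0 < 1 :> R)) => t.
  by rewrite /ball/= sub0r normrN => /ltW.
have c1 : continuous_at 0 (fun t : R => p1 + t * psi t).
  exact: (limD F0 (ccst p1) (limM F0 cid cpsi)).
have p00 : p0 = 0.
  apply: (@vanish_const _ _ `|C| _ c1).
  apply: (@filterS _ _ FD _ _ _ (near_dnbhs0 (@filterI _ _ F0 _ _ h b1))) => t [_ [ht t1]].
  apply: le_trans ht _; apply: (@le_trans _ _ (`|C| * `|t| ^+ 2)).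
    by rewrite ler_wpM2r ?exprn_ge0 ?ler_norm.
  by rewrite ler_wpM2l// expr2 ler_piMr.
split => //; apply: (@vanish_const _ _ C _ cpsi).
apply: (@filterS _ _ FD _ _ _ (near_dnbhs0 h)) => t [t0].
rewrite p00 add0r normrM expr2 mulrCA ler_pM2l ?normr_gt0//.
Qed.

Lemma vanish_jet3 (p0 p1 p2 C : R) (psi : R -> R) : continuous_at 0 psi ->
  (\forall t \near (0 : R), `|p0 + t * (p1 + t * (p2 + t * psi t))| <= C * `|t| ^+ 3) ->
  [/\ p0 = 0, p1 = 0 & p2 = 0].
Proof.
move=> cpsi h.
have FD := dnbhs_filter (0 : R); have F0 := nbhs_filter (0 : R).
have cid : continuous_at (0 : R) id by exact: cvg_id.
have ccst (c : R) : continuous_at (0 : R) (fun=> c) by exact: cvg_cst.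
have b1 : \forall t \near (0 : R), `|t| <= 1.
  apply: filterS (nbhsx_ballx (0 : R) _ (ltr01 : 0 < 1 :> R)) => t.
  by rewrite /ball/= sub0r normrN => /ltW.
have c1 : continuous_at 0 (fun t : R => p2 + t * psi t).
  exact: (limD F0 (ccst p2) (limM F0 cid cpsi)).
have [p00 p10] : p0 = 0 /\ p1 = 0.
  apply: (@vanish_jet2 _ _ `|C| _ c1).
  apply: (@filterS _ _ F0 _ _ _ (@filterI _ _ F0 _ _ h b1)) => t [ht t1].
  apply: le_trans ht _; apply: (@le_trans _ _ (`|C| * `|t| ^+ 3)).
    by rewrite ler_wpM2r ?exprn_ge0 ?ler_norm.
  by rewrite ler_wpM2l// exprSr ler_piMr// exprn_ge0.
split => //; apply: (@vanish_const _ _ C _ cpsi).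
apply: (@filterS _ _ FD _ _ _ (near_dnbhs0 h)) => t [t0].
rewrite p00 p10 !add0r !normrM.
have -> : C * `|t| ^+ 3 = `|t| * (`|t| * (C * `|t|)) by ring.
by rewrite !ler_pM2l ?normr_gt0.
Qed.

(** Along a line [(t u, t v)] the difference of the two expansions is a polynomial in [t] plus a
    remainder of higher order, so its coefficients vanish; the two axes separate the linear
    coefficients. *)
Lemma coefficients2 (tau : 'rV[R]_3 -> R) (l : 'I_3 -> R) (G : 'I_3 -> 'I_3 -> 'rV[R]_3 -> R)
    (c0 c1 c2 : R) :
  (forall i j, smooth (G i j)) ->
  (forall z, tau z = tau 0 + \sum_i z 0 i * (l i + \sum_j z 0 j * G i j z)) ->
  (forall u v : R, exists C, \forall t \near (0 : R),
    `|tau (row3 0 (t * u) (t * v)) - (c0 + c1 * (t * u) + c2 * (t * v))| <= C * `|t| ^+ 2) ->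
  [/\ tau 0 = c0, l i1 = c1 & l i2 = c2].
Proof.
move=> sG E h.
have F0 := nbhs_filter (0 : R).
have line (u v : R) : tau 0 - c0 = 0 /\ (l i1 - c1) * u + (l i2 - c2) * v = 0.
  have [C hC] := h u v.
  pose psi t := \sum_(i < 3) (row3 0 u v) 0 i * \sum_(j < 3) (row3 0 u v) 0 j *
    G i j (row3 0 (t * u) (t * v)).
  apply: (@vanish_jet2 _ _ C psi).
    have c i j : continuous_at 0 (fun t : R => G i j (row3 0 (t * u) (t * v))).
      apply: smooth_row3_continuous => //; first exact: cvg_cst.
        exact: (limM F0 (@cvg_id _ _) (lim_cst F0 u)).
      exact: (limM F0 (@cvg_id _ _) (lim_cst F0 v)).
    rewrite /psi; apply: (@cvg_ord_sum R _ _ _ F0) => i.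
    apply: (limM F0 (lim_cst F0 _)); apply: (@cvg_ord_sum R _ _ _ F0) => j.
    exact: (limM F0 (lim_cst F0 _) (c i j)).
  apply: (@filterS _ _ F0 _ _ _ hC) => t; rewrite E !sum3 !row3E /psi !sum3 !row3E.
  set a := _ - _; set b := (X in _ -> is_true (`|X| <= _)); have -> // : a = b.
  by rewrite /a /b; ring.
have [t0 h1] := line 1 0; have [_ h2] := line 0 1.
by split; apply/eqP; rewrite -subr_eq0; apply/eqP; move: t0 h1 h2; rewrite ?mulr1 ?mulr0 ?addr0 ?add0r.
Qed.

(** Besides the axes, the diagonal direction [(1, 1)] is used: it separates the mixed coefficient
    from the pure squares. *)
Lemma coefficients3 (tau : 'rV[R]_3 -> R) (l : 'I_3 -> R) (q : 'I_3 -> 'I_3 -> R)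
    (G : 'I_3 -> 'I_3 -> 'I_3 -> 'rV[R]_3 -> R) (d0 d1 d2 d3 d4 d5 : R) :
  (forall i j k, smooth (G i j k)) ->
  (forall z, tau z = tau 0 + \sum_i z 0 i * (l i + \sum_j z 0 j * (q i j + \sum_k z 0 k * G i j k z))) ->
  (forall u v : R, exists C, \forall t \near (0 : R),
    `|tau (row3 0 (t * u) (t * v)) - (d0 + d1 * (t * u) + d2 * (t * v) + d3 * (t * u) ^+ 2
      + d4 * (t * u) * (t * v) + d5 * (t * v) ^+ 2)| <= C * `|t| ^+ 3) ->
  [/\ tau 0 = d0, l i1 = d1, l i2 = d2 & [/\ q i1 i1 = d3, q i1 i2 + q i2 i1 = d4 & q i2 i2 = d5]].
Proof.
move=> sG E h.
have F0 := nbhs_filter (0 : R).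
have line (u v : R) : [/\ tau 0 - d0 = 0, (l i1 - d1) * u + (l i2 - d2) * v = 0 &
    (q i1 i1 - d3) * u ^+ 2 + (q i1 i2 + q i2 i1 - d4) * (u * v) + (q i2 i2 - d5) * v ^+ 2 = 0].
  have [C hC] := h u v.
  pose psi t := \sum_(i < 3) (row3 0 u v) 0 i * \sum_(j < 3) (row3 0 u v) 0 j *
    \sum_(k < 3) (row3 0 u v) 0 k * G i j k (row3 0 (t * u) (t * v)).
  apply: (@vanish_jet3 _ _ _ C psi).
    have c i j k : continuous_at 0 (fun t : R => G i j k (row3 0 (t * u) (t * v))).
      apply: smooth_row3_continuous => //; first exact: cvg_cst.
        exact: (limM F0 (@cvg_id _ _) (lim_cst F0 u)).
      exact: (limM F0 (@cvg_id _ _) (lim_cst F0 v)).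
    rewrite /psi; apply: (@cvg_ord_sum R _ _ _ F0) => i.
    apply: (limM F0 (lim_cst F0 _)); apply: (@cvg_ord_sum R _ _ _ F0) => j.
    apply: (limM F0 (lim_cst F0 _)); apply: (@cvg_ord_sum R _ _ _ F0) => k.
    exact: (limM F0 (lim_cst F0 _) (c i j k)).
  apply: (@filterS _ _ F0 _ _ _ hC) => t; rewrite E !sum3 !row3E /psi !sum3 !row3E.
  set a := _ - _; set b := (X in _ -> is_true (`|X| <= _)); have -> // : a = b.
  by rewrite /a /b; ring.
have [t0 h1 h1'] := line 1 0; have [_ h2 h2'] := line 0 1; have [_ _ h3] := line 1 1.
have e3 : q i1 i1 = d3 by move: h1'; rewrite expr1n expr0n/= !mulr0 mulr1 !addr0; lra.
have e5 : q i2 i2 = d5 by move: h2'; rewrite expr1n expr0n/= mul0r !mulr0 mulr1 !add0r; lra.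
split; [lra|by move: h1; lra|by move: h2; lra|split => //].
by move: h3; rewrite e3 e5 !subrr !mul0r add0r addr0 !mulr1; lra.
Qed.

(** Openness gives a point slightly beyond [P] on its ray, and convexity fills the segment back to
    the origin. *)
Lemma segment_extends (N : set 'rV[R]_2) (P : 'rV[R]_2) : open N ->
  convex_set (N : set (convex_lmodType 'rV[R]_2)) -> N 0 -> N P ->
  exists2 eta : R, 0 < eta & forall t, 0 <= t <= 1 + eta -> N (t *: P).
Proof.
move=> oN cN N0 NP.
have scale w (t : R) : N w -> 0 <= t <= 1 -> N (t *: w).
  move=> Nw /andP[t0 t1].
  have := cN w 0 (Itv01 t0 t1) (mem_set Nw) (mem_set N0) => /set_mem.
  by rewrite /conv/= scaler0 addr0.
have h : \forall t \near (1 : R), N (t *: P).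
  have c : (fun t : R => t *: P) t @[t --> (1 : R)] --> P.
    rewrite -[X in _ --> X]scale1r; apply: cvgZr_tmp; exact: cvg_id.
  by apply: (c N); apply: open_nbhs_nbhs.
have [d d0 hd] := (@nbhs_ballP _ _ _ _).1 h.
have {}d0 : 0 < d := d0.
exists (d / 2) => [|t /andP[t0 t1]]; first by rewrite divr_gt0.
have d2 : 0 < 1 + d / 2 by rewrite addr_gt0// divr_gt0.
have NQ : N ((1 + d / 2) *: P).
  apply: hd; rewrite /ball/= opprD addrA subrr add0r normrN gtr0_norm ?divr_gt0//; lra.
have := scale _ (t / (1 + d / 2)) NQ; rewrite scalerA divfK ?gt_eqF//; apply.
by rewrite divr_ge0 ?(ltW d2)//= ler_pdivrMr// mul1r.
Qed.

End Coefficients.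

(** * The local and the reinjection map *)

Section Transport.
Variable R : realType.
Variables (Fm : R -> 'rV[R]_2 -> 'rV[R]_2) (p : nat) (u1 u2 h1 h2 : 'rV[R]_3 -> R).
Variables (rho : R) (b : 'rV[R]_2) (P Q : 'M[R]_2).
Hypotheses (su1 : smooth u1) (su2 : smooth u2) (sh1 : smooth h1) (sh2 : smooth h2).
Hypothesis iterE : forall e z, iter p (Fm e) z = planar u1 u2 e z.
Hypotheses (rho0 : rho != 0) (PQ : P *m Q = 1%:M) (QP : Q *m P = 1%:M).
Hypothesis hE : forall e w, planar h1 h2 e w = (iter p (Fm (rho * e)) (w *m P + b) - b) *m Q.

Let r0 : rho^-1 != 0. Proof. by rewrite invr_eq0. Qed.
Let GE e z : iter p (Fm e) z = planar h1 h2 (rho^-1 * e) ((z - b) *m Q) *m P + b.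
Proof. by rewrite hE mulVKf// -!mulmxA QP !mulmx1 !subrK. Qed.
Let dG e z : differentiable (iter p (Fm e)) z.
Proof.
have -> : iter p (Fm e) = planar u1 u2 e by exact/funext/iterE.
exact: planar_differentiable.
Qed.
Let smH : exists g1 g2, [/\ smooth g1, smooth g2 & planar h1 h2 = planar g1 g2].
Proof. by exists h1, h2. Qed.
Let AK w : (w *m P + b - b) *m Q = w. Proof. by rewrite addrK -mulmxA PQ mulmx1. Qed.

Let congr2_pred (S : R -> 'rV[R]_2 -> Prop) e e' w w' : e = e' -> w = w' -> S e' w' -> S e w.
Proof. by move=> -> ->. Qed.

Lemma fixed_transport e w : planar h1 h2 e w = w ->
  iter p (Fm (rho * e)) (w *m P + b) = w *m P + b.
Proof. by move=> h; rewrite GE mulKf// AK h. Qed.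

Lemma saddle_node_transport e w : saddle_node (planar h1 h2) e w ->
  saddle_node (fun e => iter p (Fm e)) (rho * e) (w *m P + b).
Proof.
move=> h; have h' := @congr2_pred (saddle_node (planar h1 h2)) _ _ _ _ (mulKf rho0 e) (AK w) h.
exact: (saddle_node_conj r0 PQ QP GE dG smH h').
Qed.

Lemma period_doubling_transport e w : period_doubling (planar h1 h2) e w ->
  period_doubling (fun e => iter p (Fm e)) (rho * e) (w *m P + b).
Proof.
move=> h; have h' := @congr2_pred (period_doubling (planar h1 h2)) _ _ _ _ (mulKf rho0 e) (AK w) h.
exact: (period_doubling_conj r0 PQ QP GE dG smH h').
Qed.

(** Trace and determinant are invariant under the affine change, and [jchar 1], [jchar (-1)], [jdet]
    are the combinations of them in the stability criterion. *)
Lemma stable_transport e w : (0 < p)%N -> continuous (Fm (rho * e)) ->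
  planar h1 h2 e w = w -> let x := row3 e (w 0 0) (w 0 1) in
  0 < jchar 1 h1 h2 x -> 0 < jchar (-1) h1 h2 x -> `|jdet h1 h2 x| < 1 ->
  asymptotically_stable (Fm (rho * e)) (w *m P + b).
Proof.
move=> p0 cF fx x c1 c2 c3.
have trE := tr_jacobian_conj PQ GE dG smH (rho * e) (w *m P + b).
have detE := det_jacobian_conj PQ GE dG smH (rho * e) (w *m P + b).
have JE := jacobian_planar e w sh1 sh2.
have {}trE := etrans trE (congr2 (fun e w => \tr ('J (planar h1 h2 e) w)) (mulKf rho0 e) (AK w)).
have {}detE := etrans detE (congr2 (fun e w => \det ('J (planar h1 h2 e) w)) (mulKf rho0 e) (AK w)).
have {}trE := etrans trE (etrans (congr1 mxtrace JE) (tr_mx2 _ _ _ _)).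
have {}detE := etrans detE (etrans (congr1 determinant JE) (det_mx2 _)).
rewrite !mxE /= in detE.
move: c1 c2 c3 trE detE; rewrite /jchar /jdet -/x.
move: ('D_(delta_mx 0 i1) h1 x) ('D_(delta_mx 0 i1) h2 x) ('D_(delta_mx 0 i2) h1 x)
  ('D_(delta_mx 0 i2) h2 x) => a b' c d c1 c2 c3 trE detE.
apply: (asymptotically_stable_jacobian cF p0 (fixed_transport fx) (dG _ _)).
- by rewrite trE detE; suff <- : (1 - a) * (1 - d) - b' * c = 1 - (a + d) + (a * d - b' * c); [|ring].
- by rewrite trE detE; suff <- : (-1 - a) * (-1 - d) - b' * c = 1 + (a + d) + (a * d - b' * c); [|ring].
- by rewrite detE; apply: le_lt_trans c3; exact: ler_norm.
Qed.

End Transport.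

Section Reparametrise.
Variable R : realType.

Lemma within_affine (zeta : R -> 'rV[R]_2) (B B' : set R) (r : R) (P : 'M[R]_2) (b : 'rV[R]_2) :
  (forall e, B' e -> B (r * e)) -> {within B, continuous zeta} ->
  {within B', continuous (fun e => zeta (r * e) *m P + b)}.
Proof.
move=> BB /subspace_continuousP h; apply/subspace_continuousP => e B'e.
have hz := h (r * e) (BB e B'e).
have c : (fun e => r * e) x @[x --> within B' (nbhs e)] --> within B (nbhs (r * e)).
  move=> S hS.
  have cm : (fun e => r * e) x @[x --> e] --> r * e.
    exact: (limM (nbhs_filter e) (lim_cst (nbhs_filter e) r) (@cvg_id _ _)).
  have := cm _ hS; rewrite /within /= => hh.
  by apply: (@filterS _ _ (nbhs_filter e) _ _ _ hh) => x hx B'x; apply: hx; exact: BB.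
have c2 := cvg_comp _ _ c hz.
have c3 : (fun w => w *m P + b) w @[w --> zeta (r * e)] --> zeta (r * e) *m P + b.
  have c4 := @mulmxr_continuous R 2 2 P (zeta (r * e)).
  exact: (cvgD c4 (cvg_cst b)).
exact: cvg_comp _ _ c2 c3.
Qed.

End Reparametrise.

(** * Normal forms of the given family *)

Section Setting.
Variables (R : realType) (n m : nat) (f : 'rV[R]_n -> 'rV[R]_2 -> 'rV[R]_2).
Variables (alpha chi_eig chi : R).
Variables (lambda sigma a1 b1 c0 c1 c2 d0 d1 d2 d3 d4 d5 : 'rV[R]_n -> R).
Variable N : set 'rV[R]_2.
Hypotheses (f_smooth : smooth_family f) (alpha_bounds : 0 < alpha < 1)
  (chi_eig2 : chi_eig * chi_eig = 1)
  (lambda0 : lambda 0 = alpha) (sigma0 : sigma 0 = chi_eig / alpha)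
  (N_open : open N) (N_convex : convex_set (N : set (convex_lmodType 'rV[R]_2)))
  (N_origin : N 0) (N_x : N (pt 1 0)) (N_y : N (pt 0 (chi_eig * alpha)))
  (N_yy : N (pt 0 (alpha ^+ 2)))
  (f_local : local_map f lambda sigma a1 b1 N)
  (f_reinjection : reinjection_map f m c0 c1 c2 d0 d1 d2 d3 d4 d5).
Variable v : 'rV[R]_n.

Let a0 : 0 < alpha. Proof. by case/andP: alpha_bounds. Qed.

(** The parameter vector on the line through [v], written by components because the smoothness
    lemmas for the family take each component as a function on 3-space. *)
Definition speed (x : 'rV[R]_3) := \row_i (x 0 i0 * v 0 i).

Lemma speedE x : speed x = x 0 i0 *: v.
Proof. by apply/rowP => i; rewrite !mxE. Qed.

Lemma smooth_speed i : smooth (fun x : 'rV[R]_3 => x 0 i0 * v 0 i).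
Proof. by apply: smoothM; [exact: smooth_coord|exact: smooth_cst]. Qed.

Definition along_iter k (j : 'I_2) (x : 'rV[R]_3) : R :=
  iter k (f (speed x)) (pt (x 0 i1) (x 0 i2)) 0 j.

Lemma smooth_along_iter k j : smooth (along_iter k j).
Proof.
exact: (smooth_family_iter f_smooth k smooth_speed (@smooth_coord R 3 i1) (@smooth_coord R 3 i2)).
Qed.

Lemma along_iterE k e z : iter k (f (e *: v)) z = planar (along_iter k 0) (along_iter k 1) e z.
Proof.
by rewrite /planar /slice /along_iter !speedE !row3E -!pt_eta.
Qed.

Lemma near_dir (P : 'rV[R]_n -> Prop) : (\forall mu \near (0 : 'rV[R]_n), P mu) ->
  \forall e \near (0 : R), P (e *: v).
Proof.
move=> h; have c : (fun e : R => e *: v) x @[x --> (0 : R)] --> (0 : 'rV[R]_n).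
  by rewrite -[X in _ --> X](scale0r v); apply: cvgZr_tmp; exact: cvg_id.
exact: (c _ h).
Qed.

Let N_x0 x : N (pt x 0) -> \forall t \near (0 : R), N (pt x t).
Proof.
move=> Nx; have c : (fun t : R => pt x t) t @[t --> (0 : R)] --> pt x 0.
  have -> : (fun t : R => pt x t) = fun t => \row_j (if j == 0 then x else t) by [].
  apply: (@row_cvg _ _ _ _ (nbhs_filter (0 : R)) (fun (j : 'I_2) (t : R) => if j == 0 then x else t)).
  by move=> j; rewrite mxE; case: ifP => _; [exact: cvg_cst|exact: cvg_id].
by apply: (c N); apply: open_nbhs_nbhs.
Qed.

Let N_0y y : N (pt 0 y) -> \forall t \near (0 : R), N (pt t y).
Proof.
move=> Nx; have c : (fun t : R => pt t y) t @[t --> (0 : R)] --> pt 0 y.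
  have -> : (fun t : R => pt t y) = fun t => \row_j (if j == 0 then t else y) by [].
  apply: (@row_cvg _ _ _ _ (nbhs_filter (0 : R)) (fun (j : 'I_2) (t : R) => if j == 0 then t else y)).
  by move=> j; rewrite mxE; case: ifP => _; [exact: cvg_id|exact: cvg_cst].
by apply: (c N); apply: open_nbhs_nbhs.
Qed.

Let pt00 : pt 0 0 = 0 :> 'rV[R]_2.
Proof. by apply/rowP => j; rewrite !mxE; case: ifP. Qed.

(** The remainders become [(x y)^2] times functions that are smooth jointly in the parameter and the
    phase variables, and the formula holds wherever both projections to the axes lie in [N]. *)
Lemma local_forms : exists La Ca ha Sb Cb hb : 'rV[R]_3 -> R, exists2 e0, 0 < e0 &
  [/\ smooth La /\ smooth Sb, smooth Ca /\ smooth Cb, smooth ha /\ smooth hb &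
  forall e, `|e| < e0 -> [/\ La (row3 e 0 0) = lambda (e *: v) /\ Sb (row3 e 0 0) = sigma (e *: v),
    Ca (row3 e 0 0) = lambda (e *: v) * a1 (e *: v) /\
    Cb (row3 e 0 0) = sigma (e *: v) * b1 (e *: v) &
    forall x y, N (pt x 0) -> N (pt 0 y) -> f (e *: v) (pt x y) =
      pt (x * (La (row3 e 0 0) + Ca (row3 e 0 0) * (x * y) + (x * y) ^+ 2 * ha (row3 e x y)))
         (y * (Sb (row3 e 0 0) + Cb (row3 e 0 0) * (x * y) + (x * y) ^+ 2 * hb (row3 e x y)))]].
Proof.
have [r [s [fE [C [eta [eta0 rs]]]]]] := f_local.
(* Exchanging the phase variables lets [local_form] treat the second component as well. *)
pose g2 (z : 'rV[R]_3) := along_iter 1 1 (row3 (z 0 i0) (z 0 i2) (z 0 i1)).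
have sg2 : smooth g2.
  apply: (@smooth_comp3 _ _ (along_iter 1 1) (fun z => z 0 i0) (fun z => z 0 i2) (fun z => z 0 i1));
    [exact: smooth_along_iter|exact: smooth_coord..].
have N00 : N (pt 0 0) by rewrite pt00.
have [La [Ca [ha [sLa sCa sha hx]]]] := local_form (smooth_along_iter 1 0) (N := fun x y => N (pt x y))
  N_x0 N_0y N00.
have [Sb [Cb [hb [sSb sCb shb hy]]]] := local_form sg2 (N := fun x y => N (pt y x)) N_0y N_x0 N00.
have [e0 e00 he] := (@nbhs_ballP _ _ _ _).1 (near_dir (filterI fE rs)).
exists La, Ca, ha, Sb, Cb, (fun z => hb (row3 (z 0 i0) (z 0 i2) (z 0 i1))), e0 => //.
split => //.
  split => //; apply: (@smooth_comp3 _ _ hb (fun z => z 0 i0) (fun z => z 0 i2) (fun z => z 0 i1)) => //;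
    exact: smooth_coord.
move=> e ee.
have [fe rse] : (forall x y, N (pt x y) -> f (e *: v) (pt x y) =
     pt (lambda (e *: v) * x * (1 + a1 (e *: v) * (x * y) + r (e *: v) (pt x y)))
        (sigma (e *: v) * y * (1 + b1 (e *: v) * (x * y) + s (e *: v) (pt x y)))) /\
   forall x y, N (pt x y) -> `|x * y| <= eta ->
    `|r (e *: v) (pt x y)| <= C * (x ^+ 2 * y ^+ 2) /\
    `|s (e *: v) (pt x y)| <= C * (x ^+ 2 * y ^+ 2).
  by apply: he; rewrite /ball/= sub0r normrN.
have g1E x y : along_iter 1 0 (row3 e x y) = f (e *: v) (pt x y) 0 0.
  by rewrite /along_iter speedE !row3E.
have g2E x y : g2 (row3 e x y) = f (e *: v) (pt y x) 0 1.
  by rewrite /g2 /along_iter speedE !row3E.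
have [|E1 E2 E3] := hx e (lambda (e *: v)) (a1 (e *: v)).
  exists (fun x y => r (e *: v) (pt x y)); split.
    by move=> x y Nxy; rewrite g1E fe// pt0.
  by exists C, eta; split => // x y Nxy xy; have [] := rse x y Nxy xy.
have [|G1 G2 G3] := hy e (sigma (e *: v)) (b1 (e *: v)).
  exists (fun x y => s (e *: v) (pt y x)); split.
    by move=> x y Nxy; rewrite g2E fe// pt1 [y * x]mulrC.
  exists C, eta; split => // x y Nxy xy; rewrite [x ^+ 2 * _]mulrC.
  by have [|//] := rse y x Nxy; rewrite mulrC.
split => // x y Nx Ny; rewrite [LHS]pt_eta -g1E E3// -g2E G3// !row3E.
by rewrite [y * x]mulrC.
Qed.

Definition reinj (j : 'I_2) (x : 'rV[R]_3) : R :=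
  iter m (f (speed x)) (pt (x 0 i1) (1 + x 0 i2)) 0 j.

Lemma smooth_reinj j : smooth (reinj j).
Proof.
apply: (smooth_family_iter f_smooth m smooth_speed (@smooth_coord R 3 i1)
  (v := fun x : 'rV[R]_3 => 1 + x 0 i2)).
by apply: smoothD; [exact: smooth_cst|exact: smooth_coord].
Qed.

Lemma reinjE e x w : iter m (f (e *: v)) (pt x (1 + w)) =
  pt (reinj 0 (row3 e x w)) (reinj 1 (row3 e x w)).
Proof. by rewrite /reinj speedE !row3E -pt_eta. Qed.

(** Only the parameter value 0 enters, and [reinj] has its origin at [(0, 1)]; the displacement is
    at most [|t| (|u| + |w|)] in the max norm, so the two error terms become powers of [|t|]. *)
Let reinj_line (u w : R) : exists C, \forall t \near (0 : R),
  `|reinj 0 (row3 0 (t * u) (t * w)) - (c0 0 + c1 0 * (t * u) + c2 0 * (t * w))| <= C * `|t| ^+ 2 /\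
  `|reinj 1 (row3 0 (t * u) (t * w)) - (d0 0 + d1 0 * (t * u) + d2 0 * (t * w)
     + d3 0 * (t * u) ^+ 2 + d4 0 * (t * u) * (t * w) + d5 0 * (t * w) ^+ 2)| <= C * `|t| ^+ 3.
Proof.
have [r [s [[[U1 V1] [/= U10 V11] h1] [C [[U2 V2] [/= U20 V21] h2]]]]] := f_reinjection.
pose L := `|u| + `|w|.
have c : (fun t : R => pt (t * u) (1 + t * w)) t @[t --> (0 : R)] --> pt 0 1.
  apply: (@row_cvg _ _ _ _ (nbhs_filter (0 : R))
    (fun (j : 'I_2) (t : R) => if j == 0 then t * u else 1 + t * w)) => j.
  have F0 := nbhs_filter (0 : R).
  have idc : id x @[x --> (0 : R)] --> (0 : R) by exact: cvg_id.
  rewrite mxE; case: ifP => _.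
    by have := limM F0 idc (lim_cst F0 u); rewrite mul0r.
  by have := limD F0 (lim_cst F0 1) (limM F0 idc (lim_cst F0 w)); rewrite mul0r addr0.
exists (`|C| * L ^+ 2 + `|C| * L ^+ 3).
apply: (@filterS _ _ (nbhs_filter (0 : R)) _ _ _ (@filterI _ _ (nbhs_filter (0 : R)) _ _ (c _ V11) (c _ V21))).
move=> t [v1 v2].
have E := h1 (0, pt (t * u) (1 + t * w)) (conj (nbhs_singleton U10) v1).
have [B1 B2] := h2 (0, pt (t * u) (1 + t * w)) (conj (nbhs_singleton U20) v2).
rewrite /= !pt0 !pt1 [1 + _]addrC addrK in E.
have := reinjE 0 (t * u) (t * w); rewrite scale0r [1 + _]addrC E => /pt_inj[<- <-].
rewrite /= in B1 B2; rewrite [1 + t * w]addrC in B1 B2.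
have nL : `|pt (t * u) (t * w + 1) - pt 0 1| <= `|t| * L.
  rewrite rV_norm_le ?mulr_ge0 ?addr_ge0//; apply/forallP => j; rewrite !mxE.
  case: ifP => _; first by rewrite subr0 normrM ler_wpM2l// lerDl.
  by rewrite addrK normrM ler_wpM2l// lerDr.
have L0 : 0 <= L by rewrite addr_ge0.
have n0 : 0 <= `|pt (t * u) (t * w + 1) - pt 0 1| by [].
have pw (k : nat) (y : R) : `|y| <= C * `|pt (t * u) (t * w + 1) - pt 0 1| ^+ k ->
    `|y| <= `|C| * L ^+ k * `|t| ^+ k.
  move=> h; apply: le_trans h _; apply: (@le_trans _ _ (`|C| * `|pt (t * u) (t * w + 1) - pt 0 1| ^+ k)).
    by rewrite ler_wpM2r ?exprn_ge0 ?ler_norm.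
  rewrite -mulrA -exprMn ler_wpM2l//; apply: lerXn2r; rewrite ?nnegrE// ?mulr_ge0//.
  by rewrite [L * _]mulrC.
split.
- rewrite addrAC subrr add0r; apply: le_trans (pw _ _ B1) _.
  by rewrite ler_wpM2r ?exprn_ge0// lerDl mulr_ge0 ?exprn_ge0.
- rewrite addrAC subrr add0r; apply: le_trans (pw _ _ B2) _.
  by rewrite ler_wpM2r ?exprn_ge0// lerDr mulr_ge0 ?exprn_ge0.
Qed.

Lemma reinj0_taylor : exists (l : 'I_3 -> R) (G : 'I_3 -> 'I_3 -> 'rV[R]_3 -> R),
  [/\ forall i j, smooth (G i j),
    forall z, reinj 0 z = c0 0 + \sum_i z 0 i * (l i + \sum_j z 0 j * G i j z),
    l i1 = c1 0 & l i2 = c2 0].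
Proof.
have [l [G [sG E]]] := taylor2 (smooth_reinj 0).
have [|h0 h1 h2] := @coefficients2 R _ l G (c0 0) (c1 0) (c2 0) sG E.
  move=> u w; have [C hC] := reinj_line u w; exists C.
  by apply: (@filterS _ _ (nbhs_filter (0 : R)) _ _ _ hC) => t [].
by exists l, G; split => // z; rewrite E h0.
Qed.

Lemma reinj1_taylor : exists (l : 'I_3 -> R) (q : 'I_3 -> 'I_3 -> R)
    (G : 'I_3 -> 'I_3 -> 'I_3 -> 'rV[R]_3 -> R),
  [/\ forall i j k, smooth (G i j k),
    forall z, reinj 1 z = d0 0 + \sum_i z 0 i * (l i + \sum_j z 0 j * (q i j + \sum_k z 0 k * G i j k z)),
    l i0 = dot (grad d0 0) v,
    l i1 = d1 0 /\ l i2 = d2 0 & [/\ q i1 i1 = d3 0, q i1 i2 + q i2 i1 = d4 0 & q i2 i2 = d5 0]].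
Proof.
have [l [q [G [sG E]]]] := taylor3 (smooth_reinj 1).
have [|h0 h1 h2 h3] := @coefficients3 R _ l q G (d0 0) (d1 0) (d2 0) (d3 0) (d4 0) (d5 0) sG E.
  move=> u w; have [C hC] := reinj_line u w; exists C.
  by apply: (@filterS _ _ (nbhs_filter (0 : R)) _ _ _ hC) => t [].
exists l, q, G; split => //; first by move=> z; rewrite E h0.
(* For parameters near 0, [d0] is the second component of the image of [(0, 1)]. This identifies it
   with a smooth function and its slope with the coefficient of [e]. *)
pose D (mu : 'rV[R]_n) := iter m (f (\row_i mu 0 i)) (pt 0 1) 0 1.
have row_id (mu : 'rV[R]_n) : \row_i mu 0 i = mu by apply/rowP => i; rewrite mxE.
have sD : smooth D.
  exact: (smooth_family_iter f_smooth m (fun i => @smooth_coord R n i) (@smooth_cst R n 0) (@smooth_cst R n 1)).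
have nD : \forall mu \near (0 : 'rV[R]_n), d0 mu = D mu.
  have [r [s [[[U1 V1] [/= U10 V11] g1] [C [[U2 V2] [/= U20 V21] g2]]]]] := f_reinjection.
  apply: (@filterS _ _ (nbhs_filter (0 : 'rV[R]_n)) _ _ _ (@filterI _ _ (nbhs_filter (0 : 'rV[R]_n)) _ _ U10 U20)) => mu [u1 u2].
  have := g1 (mu, pt 0 1) (conj u1 (nbhs_singleton V11)).
  have [_] := g2 (mu, pt 0 1) (conj u2 (nbhs_singleton V21)).
  rewrite /= subrr normr0 expr0n/= mulr0 normr_le0 => /eqP s0.
  by rewrite /D row_id => ->; rewrite pt1 s0 !pt0 !pt1 subrr expr0n/= !mulr0 !addr0.
pose phi e := l i0 + e * (q i0 i0 + e * G i0 i0 i0 (row3 e 0 0)).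
have -> : l i0 = phi 0 by rewrite /phi mul0r addr0.
have F0 := nbhs_filter (0 : R).
have cid : continuous_at (0 : R) id by exact: cvg_id.
have ccst (c : R) : continuous_at (0 : R) (fun=> c) by exact: cvg_cst.
apply/esym/(dot_grad_slope sD nD (p := d0 0)).
  apply: (@nearW _ _ _ F0) => e; rewrite /D row_id.
  have := reinjE e 0 0; rewrite addr0 => ->; rewrite pt1 E h0 !sum3 !row3E /phi.
  by ring.
apply: (limD F0 (ccst _) (limM F0 cid (limD F0 (ccst _) (limM F0 cid _)))).
exact: (smooth_row3_continuous (sG i0 i0 i0) cid (ccst 0) (ccst 0)).
Qed.

Lemma eigen_slope (La Sb L2 S2 : 'rV[R]_3 -> R) (e0 lam1 sig1 : R) :
  smooth L2 -> smooth S2 -> 0 < e0 ->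
  (forall e, `|e| < e0 -> La (row3 e 0 0) = lambda (e *: v) /\ Sb (row3 e 0 0) = sigma (e *: v)) ->
  (forall e, La (row3 e 0 0) = alpha + e * (lam1 + e * L2 (row3 e 0 0))) ->
  (forall e, Sb (row3 e 0 0) = chi_eig / alpha + e * (sig1 + e * S2 (row3 e 0 0))) ->
  dot (grad (fun mu => lambda mu * sigma mu) 0) v = chi_eig / alpha * lam1 + alpha * sig1.
Proof.
move=> sL2 sS2 e00 hls LE SE.
have an : alpha != 0 by rewrite gt_eqF.
have cn : chi_eig != 0 by apply/eqP => h; move: chi_eig2; rewrite h mul0r => /eqP; rewrite eq_sym oner_eq0.
have ci : chi_eig^-1 = chi_eig by apply: (mulfI cn); rewrite divff.
pose y0 := chi_eig * alpha.
(* On the axes the remainders vanish, so [lambda] is read off from the image of [(1, 0)] and [sigma]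
   from that of [(0, y0)]. *)
pose D (mu : 'rV[R]_n) := f (\row_i mu 0 i) (pt 1 0) 0 0 * (y0^-1 * f (\row_i mu 0 i) (pt 0 y0) 0 1).
have row_id (mu : 'rV[R]_n) : \row_i mu 0 i = mu by apply/rowP => i; rewrite mxE.
have sD : smooth D.
  have sf (a b' : R) j := smooth_family_comp f_smooth j (fun i => @smooth_coord R n i) (@smooth_cst R n a) (@smooth_cst R n b').
  apply: smoothM; first exact: sf.
  by apply: smoothM; [exact: smooth_cst|exact: sf].
have y00 : y0 != 0 by rewrite mulf_neq0.
have nD : \forall mu \near (0 : 'rV[R]_n), lambda mu * sigma mu = D mu.
  have [r [s [fE [C [eta [eta0 rs]]]]]] := f_local.
  apply: (@filterS _ _ (nbhs_filter (0 : 'rV[R]_n)) _ _ _ (@filterI _ _ (nbhs_filter (0 : 'rV[R]_n)) _ _ fE rs)) => mu [fe rse].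
  have [r0 _] := rse 1 0 N_x ltac:(by rewrite mulr0 normr0 ltW).
  have [_ s0] := rse 0 y0 N_y ltac:(by rewrite mul0r normr0 ltW).
  move: r0 s0; rewrite !expr0n/= mulr0 mul0r mulr0 !normr_le0 => /eqP r0 /eqP s0.
  rewrite /D row_id !fe// pt0 pt1 r0 s0 !mulr0 mul0r !addr0 !mulr1.
  by field.
pose phi e := chi_eig / alpha * (lam1 + e * L2 (row3 e 0 0)) + alpha * (sig1 + e * S2 (row3 e 0 0))
  + e * ((lam1 + e * L2 (row3 e 0 0)) * (sig1 + e * S2 (row3 e 0 0))).
have -> : chi_eig / alpha * lam1 + alpha * sig1 = phi 0 by rewrite /phi !mul0r !addr0.
have F0 := nbhs_filter (0 : R).
have cid : continuous_at (0 : R) id by exact: cvg_id.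
have ccst (c : R) : continuous_at (0 : R) (fun=> c) by exact: cvg_cst.
apply: (dot_grad_slope sD nD (p := alpha * (chi_eig / alpha))).
  have nb : \forall e \near (0 : R), `|e| < e0.
    apply: filterS (nbhsx_ballx (0 : R) _ e00) => e.
    by rewrite /ball/= sub0r normrN.
  apply: (@filterS _ _ F0 _ _ _ (@filterI _ _ F0 _ _ nb (near_dir nD))) => e [ee <-].
  have [<- <-] := hls e ee; rewrite LE SE /phi; ring.
have cL : continuous_at 0 (fun e : R => lam1 + e * L2 (row3 e 0 0)).
  apply: (limD F0 (ccst _) (limM F0 cid _)).
  exact: (smooth_row3_continuous sL2 cid (ccst 0) (ccst 0)).
have cS : continuous_at 0 (fun e : R => sig1 + e * S2 (row3 e 0 0)).
  apply: (limD F0 (ccst _) (limM F0 cid _)).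
  exact: (smooth_row3_continuous sS2 cid (ccst 0) (ccst 0)).
exact: (limD F0 (limD F0 (limM F0 (ccst _) cL) (limM F0 (ccst _) cS)) (limM F0 cid (limM F0 cL cS))).
Qed.

(* The orbit visits only points whose projections to the axes lie between the
   origin and the four points assumed to be in [N]. *)
Lemma orbit_in_N : exists2 eta, 0 < eta /\ alpha * (1 + eta) < 1 - eta &
  forall k i t u, chi_eig ^+ k = chi -> (i < k)%N -> `|t - 1| <= eta -> `|u - chi| <= eta ->
  N (pt (alpha ^+ i * t) 0) /\ N (pt 0 (chi_eig ^+ i * alpha ^+ (k - i) * u)).
Proof.
have [ex ex0 hx] := segment_extends N_open N_convex N_origin N_x.
have [ey ey0 hy] := segment_extends N_open N_convex N_origin N_y.
have [ez ez0 hz] := segment_extends N_open N_convex N_origin N_yy.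
have [_ al1] := andP alpha_bounds.
(* The bound [(1 - alpha) / 4] yields [alpha * (1 + eta) < 1 - eta], which later separates the orbit
   from its return point. *)
pose eta := Num.min (Num.min ex ey) (Num.min ez ((1 - alpha) / 4)).
have eta0 : 0 < eta by rewrite !lt_min ex0 ey0 ez0 divr_gt0// subr_gt0.
have [l1 l2 l3 l4] : [/\ eta <= ex, eta <= ey, eta <= ez & eta <= (1 - alpha) / 4].
  by rewrite /eta !ge_min !lexx ?orbT.
clearbody eta; exists eta; first by split => //; nra.
have al0 := a0; have eta1 : eta <= 1 by lra.
move=> k i t u ck ik ht hu.
have [t0 t1] : 0 <= t /\ t <= 1 + eta by move: ht; rewrite ler_norml => /andP[? ?]; split; lra.
have chi2 : chi * chi = 1 by rewrite -ck -exprMn chi_eig2 expr1n.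
have cabs : `|chi| = 1.
  have : `|chi| ^+ 2 = 1 by rewrite expr2 -normrM chi2 normr1.
  by move=> /eqP; rewrite sqrf_eq1 => /orP[/eqP //|/eqP h]; have := normr_ge0 chi; rewrite h lerNr oppr0 ler10.
have [u0 u1] : 0 <= chi * u /\ chi * u <= 1 + eta.
  have : `|chi * u - 1| <= eta by rewrite -chi2 -mulrBr normrM cabs mul1r.
  by rewrite ler_norml => /andP[? ?]; split; lra.
have scale (y e x : R) j : eta <= e -> 0 <= x -> x <= 1 + eta -> 0 <= alpha ^+ j * x <= 1 + e.
  move=> le x0 x1; rewrite mulr_ge0 ?exprn_ge0 ?(ltW a0)//=.
  apply: (@le_trans _ _ x); first by rewrite ler_piMl// exprn_ile1 ?ltW.
  by apply: le_trans x1 _; rewrite lerD2l.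
split.
  have := hx _ (scale 0 ex t i l1 t0 t1).
  by rewrite (_ : _ *: pt 1 0 = pt (alpha ^+ i * t) 0)//; apply/rowP => j;
    case: (ord2P j) => ->; rewrite !mxE /= ?mulr1 ?mulr0.
(* Since [chi_eig ^+ k = chi], the sign at time [i] is determined by [k - i] and [chi]. *)
have cj : chi_eig ^+ i = chi_eig ^+ (k - i) * chi.
  have ei : chi_eig ^+ (k - i) * chi_eig ^+ (k - i) = 1 by rewrite -exprMn chi_eig2 expr1n.
  by rewrite -ck -{2}(subnKC (ltnW ik)) exprD mulrCA ei mulr1.
rewrite cj.
have j0 : (0 < k - i)%N by rewrite subn_gt0.
case: (k - i)%N j0 => // j _.
have even_pow h : chi_eig ^+ (h + h) = 1 by rewrite exprD -exprMn chi_eig2 expr1n.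
(* For [k - i] even the point is a nonnegative multiple of [(0, alpha ^+ 2)], for [k - i] odd of
   [(0, chi_eig * alpha)]; the factor is at most [1 + eta] in both cases. *)
have := odd_double_half j; rewrite -addnn; case: (odd j) => <- /=.
  set h := (j./2)%N.
  have := hz _ (scale 0 ez (chi * u) (h + h)%N l3 u0 u1).
  rewrite (_ : _ *: pt 0 _ = pt 0 (chi_eig ^+ (1 + (h + h)).+1 * chi * alpha ^+ (1 + (h + h)).+1 * u))//.
  apply/rowP => j'; case: (ord2P j') => ->; rewrite !mxE /= ?mulr0//.
  by rewrite add1n !exprS even_pow mulr1 chi_eig2; ring.
set h := (j./2)%N.
have := hy _ (scale 0 ey (chi * u) (h + h)%N l2 u0 u1).
rewrite (_ : _ *: pt 0 _ = pt 0 (chi_eig ^+ (0 + (h + h)).+1 * chi * alpha ^+ (0 + (h + h)).+1 * u))//.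
apply/rowP => j'; case: (ord2P j') => ->; rewrite !mxE /= ?mulr0//.
by rewrite add0n !exprS even_pow mulr1; ring.
Qed.

End Setting.

(** * Rescaling of the return map *)

(** Bernoulli's inequality for the inverse of the fourth root of [a]. The power 4 leaves room to
    trade [s] and [k s] for negative powers of [k] in the estimates of the orbit. *)
Lemma geometric_decay (R : realType) (a : R) : 0 < a < 1 ->
  exists2 C : R, 0 < C & forall k, (0 < k)%N -> a ^+ k <= C * k%:R^-1 ^+ 4.
Proof.
move=> /andP[a0 a1].
pose q := Num.sqrt (Num.sqrt a).
have q0 : 0 < q by rewrite !sqrtr_gt0.
have q4 : q ^+ 4 = a by rewrite -[4%N]/(2 * 2)%N exprM !sqr_sqrtr ?sqrtr_ge0// ltW.
have q1 : q < 1.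
  by rewrite ltNge; apply/negP => /(exprn_ege1 4); rewrite q4 leNgt a1.
pose b := q^-1 - 1.
have b0 : 0 < b by rewrite subr_gt0 invf_gt1.
have bern k : 1 + k%:R * b <= q^-1 ^+ k.
  elim: k => [|k IH]; first by rewrite mul0r addr0 expr0.
  rewrite exprS -natr1; have -> : q^-1 = 1 + b by rewrite /b addrC subrK.
  have k0 : 0 <= k%:R :> R by [].
  have e : q^-1 = 1 + b by rewrite /b addrC subrK.
  rewrite e in IH; apply: (@le_trans _ _ ((1 + b) * (1 + k%:R * b))); first by nra.
  by rewrite ler_wpM2l// addr_ge0// ltW.
exists (b^-1 ^+ 4) => [|k k0]; first by rewrite exprn_gt0// invr_gt0.
have kR : 0 < k%:R :> R by rewrite ltr0n.
rewrite -q4 -exprM mulnC exprM -exprMn; apply: lerXn2r; rewrite ?nnegrE.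
- by rewrite exprn_ge0// ltW.
- by rewrite mulr_ge0 ?invr_ge0// ltW.
have kb : 0 < k%:R * b by rewrite mulr_gt0.
rewrite -invfM -[q ^+ k]invrK -exprVn lef_pV2 ?posrE ?exprn_gt0 ?invr_gt0//.
  by apply: le_trans (bern k); rewrite mulrC lerDr.
by rewrite mulrC.
Qed.

Section Rescaling.
Variable R : realType.
Local Notation e_ i := (delta_mx 0 i).

Lemma bO_comp3 (T : Type) (F : set_system T) (FF : Filter F) p r (A : set 'rV[R]_p)
    (Phi : 'rV[R]_3 -> R) (u v w : T -> 'rV[R]_p -> R) : smooth Phi ->
  bO F r A (fun=> 1) u -> bO F r A (fun=> 1) v -> bO F r A (fun=> 1) w ->
  bO F r A (fun=> 1) (fun t x => Phi (row3 (u t x) (v t x) (w t x))).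
Proof.
move=> sP bu bv bw.
have := @bO_comp R p T F FF r A 3 Phi (fun i => nth u [:: u; v; w] i) sP.
have h (i : 'I_3) : bO F r A (fun=> 1) (nth u [:: u; v; w] i).
  by case: (ord3P i) => ->.
move=> /(_ h); apply: bO_eq; apply: nearW => t; apply/funext => x; congr Phi.
by apply/rowP => i; rewrite mxE; case: (ord3P i) => ->; rewrite row3E.
Qed.

Variables (alpha sg chi : R).
Hypotheses (alpha_bd : 0 < alpha < 1) (sg2 : sg * sg = 1) (chi2 : chi * chi = 1).
Variables (La Ca ha Sb Cb hb L2 S2 Ca1 Cb1 : 'rV[R]_3 -> R) (lam1 sig1 ca cb : R).
Hypotheses (sha : smooth ha) (shb : smooth hb) (sLa : smooth La) (sSb : smooth Sb)
  (sCa : smooth Ca) (sCb : smooth Cb)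
  (sL2 : smooth L2) (sS2 : smooth S2) (sCa1 : smooth Ca1) (sCb1 : smooth Cb1).
Hypotheses (LaE : forall e, La (row3 e 0 0) = alpha + e * (lam1 + e * L2 (row3 e 0 0)))
  (SbE : forall e, Sb (row3 e 0 0) = sg / alpha + e * (sig1 + e * S2 (row3 e 0 0)))
  (CaE : forall e, Ca (row3 e 0 0) = ca + e * Ca1 (row3 e 0 0))
  (CbE : forall e, Cb (row3 e 0 0) = cb + e * Cb1 (row3 e 0 0)).
Hypotheses (sgca : sg * ca = ca) (sgcb : sg * cb = cb)
  (resonance : ca / alpha + sg * alpha * cb = 0).
Variables (tau1 tau2 : 'rV[R]_3 -> R) (l m : 'I_3 -> R) (q : 'I_3 -> 'I_3 -> R).
Variables (G : 'I_3 -> 'I_3 -> 'rV[R]_3 -> R) (H : 'I_3 -> 'I_3 -> 'I_3 -> 'rV[R]_3 -> R).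
Hypotheses (stau1 : smooth tau1) (stau2 : smooth tau2)
  (sG : forall i j, smooth (G i j)) (sH : forall i j k, smooth (H i j k)).
Hypothesis tau1E : forall z, tau1 z = 1 + \sum_i z 0 i * (l i + \sum_j z 0 j * G i j z).
Hypothesis tau2E : forall z, tau2 z =
  \sum_i z 0 i * (m i + \sum_j z 0 j * (q i j + \sum_k z 0 k * H i j k z)).
Hypotheses (m1 : m i1 = chi) (m2 : m i2 = 0).
(** [rho k] is the scale of the parameter. The limit [q1] of [k rho_k / s] measures the drift of the
    eigenvalues accumulated over [k] steps, and the limit [kap0] of [m i0 * rho k / s^2] the shift
    of the tangency. In the first case of the theorem [q1 = 0], in the second [kap0 = 0]. *)
Variables (rho : nat -> R) (q1 kap0 Cs Cr Cq Ck : R).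
Let sc (k : nat) : R := alpha ^+ k.
Hypotheses (Cs0 : 0 < Cs) (Cr0 : 0 <= Cr) (Cq0 : 0 <= Cq) (Ck0 : 0 <= Ck).
Hypothesis sc_le : forall k, (0 < k)%N -> sc k <= Cs * k%:R^-1 ^+ 4.
Hypothesis rho_le : forall k, (0 < k)%N -> `|rho k| <= Cr * (sc k * k%:R^-1).
Hypothesis rho_q1 : forall k, (0 < k)%N -> `|k%:R * rho k / sc k - q1| <= Cq * k%:R^-1.
Hypothesis rho_kap : forall k, (0 < k)%N ->
  `|m i0 * rho k - sc k * sc k * kap0| <= Ck * (sc k * sc k * k%:R^-1).

Variables (w2 c0p Bc : R).
Let abar := ca / alpha * chi.
(** [w2] will be the inverse of [2 chi d5]. This is the affine change from [(zeta, D)] to the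
    variables [(xi, Y)] of the overview, with the shifts [c0p] and [Bc] that put the limit family in
    its normal form. *)
Definition x_coord (x : 'rV[R]_3) : R := (c0p - x 0 i1) * w2.
Definition y_coord (x : 'rV[R]_3) : R := (Bc - x 0 i2) * w2.
Definition parameter k (x : 'rV[R]_3) : R := x 0 i0 * rho k.
Definition section_w k (x : 'rV[R]_3) : R := sc k * y_coord x.
Definition section_x k (x : 'rV[R]_3) : R := sc k + sc k * (sc k * (k%:R * abar + x_coord x)).
Definition return_point k (x : 'rV[R]_3) := row3 (parameter k x) (section_x k x) (section_w k x).

(* In the variables X = x / alpha^i and V = y / (sg^i alpha^(k - i)) at time i,
   the product xy is sg^i alpha^k X V. *)
Definition point k i (X V : 'rV[R]_3 -> R) (x : 'rV[R]_3) :=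
  row3 (parameter k x) (alpha ^+ i * X x) (sg ^+ i * alpha ^+ (k - i) * V x).
Definition growth1 k i (X V : 'rV[R]_3 -> R) (x : 'rV[R]_3) : R := alpha^-1 *
  (La (row3 (parameter k x) 0 0) - alpha + Ca (row3 (parameter k x) 0 0) * (sg ^+ i * sc k * (X x * V x))
   + (sc k * (X x * V x)) ^+ 2 * ha (point k i X V x)).
Definition growth2 k i (X V : 'rV[R]_3 -> R) (x : 'rV[R]_3) : R := sg * alpha *
  (Sb (row3 (parameter k x) 0 0) - sg / alpha + Cb (row3 (parameter k x) 0 0) * (sg ^+ i * sc k * (X x * V x))
   + (sc k * (X x * V x)) ^+ 2 * hb (point k i X V x)).

(** After the reinjection [y] is of order [s], so [V = y / s] starts near [chi]. Growth is recorded
    additively, which makes the sum over the orbit telescope. *)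
Fixpoint scaled_orbit k i : ('rV[R]_3 -> R) * ('rV[R]_3 -> R) :=
  if i is i'.+1 then
    let: (X, V) := scaled_orbit k i' in
    (fun x => X x + X x * growth1 k i' X V x, fun x => V x + V x * growth2 k i' X V x)
  else (fun x => tau1 (return_point k x), fun x => (sc k)^-1 * tau2 (return_point k x)).

Lemma scaled_orbitS1 k i : (scaled_orbit k i.+1).1 =
  fun x => (scaled_orbit k i).1 x + (scaled_orbit k i).1 x * growth1 k i (scaled_orbit k i).1 (scaled_orbit k i).2 x.
Proof. by rewrite /=; case: (scaled_orbit k i). Qed.

Lemma scaled_orbitS2 k i : (scaled_orbit k i.+1).2 =
  fun x => (scaled_orbit k i).2 x + (scaled_orbit k i).2 x * growth2 k i (scaled_orbit k i).1 (scaled_orbit k i).2 x.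
Proof. by rewrite /=; case: (scaled_orbit k i). Qed.

Variables (A : set 'rV[R]_3) (LA : R).
Hypothesis A_bd : forall x, A x -> forall i, `|x 0 i| <= LA.

Let a0 : 0 < alpha. Proof. by case/andP: alpha_bd. Qed.
Let sc_gt0 k : 0 < sc k. Proof. exact: exprn_gt0. Qed.
Let sc_le1 k : sc k <= 1. Proof. by case/andP: alpha_bd => h1 h2; rewrite exprn_ile1// ltW. Qed.
Let sgabs : `|sg| = 1.
Proof.
have : `|sg| ^+ 2 = 1 by rewrite expr2 -normrM sg2 normr1.
by move=> /eqP; rewrite sqrf_eq1 => /orP[/eqP //|/eqP h]; have := normr_ge0 sg; rewrite h lerNr oppr0 ler10.
Qed.

(** * Estimates at a single time *)

Section Scaled.
Variables (T : Type) (FT : set_system T) (FTf : Filter FT) (kk : T -> nat).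
Hypothesis kk_pos : \forall t \near FT, (0 < kk t)%N.
Local Notation ka t := ((kk t)%:R^-1 : R).
Local Notation s t := (sc (kk t)).
Local Notation bo := (bO FT 3 A).

Lemma rates : \forall t \near FT, [/\ 0 < s t, 0 < ka t, ka t <= 1, (kk t)%:R * ka t = 1
  & [/\ s t <= Cs * ka t ^+ 2, (kk t)%:R * s t <= Cs * ka t ^+ 2, s t <= Cs * ka t,
     (kk t)%:R * s t <= Cs * ka t & s t <= Cs]].
Proof.
apply: filterS kk_pos => t k0.
have kR : 0 < (kk t)%:R :> R by rewrite ltr0n.
have k1 : 1 <= (kk t)%:R :> R by rewrite ler1n.
have i0' : 0 < ka t by rewrite invr_gt0.
have i1' : ka t <= 1 by rewrite invf_le1.
have kE : (kk t)%:R * ka t = 1 by rewrite divff// gt_eqF.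
have h := sc_le k0.
have p23 : ka t ^+ 4 <= ka t ^+ 3 by rewrite ler_wiXn2l// ltW.
have p22 : ka t ^+ 3 <= ka t ^+ 2 by rewrite ler_wiXn2l// ltW.
have p21 : ka t ^+ 2 <= ka t by rewrite -[leRHS]expr1 ler_wiXn2l// ltW.
have ks : (kk t)%:R * s t <= Cs * ka t ^+ 3.
  apply: (@le_trans _ _ ((kk t)%:R * (Cs * ka t ^+ 4))); first by rewrite ler_pM2l.
  have -> : (kk t)%:R * (Cs * ka t ^+ 4) = (kk t)%:R * ka t * (Cs * ka t ^+ 3) by ring.
  by rewrite kE mul1r.
have up x y : x <= y -> Cs * x <= Cs * y by move=> xy; rewrite ler_pM2l.
split => //; split.
- by apply: le_trans h _; apply: up; exact: le_trans p22.
- by apply: le_trans ks _; exact: up.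
- by apply: le_trans h _; apply: up; apply: le_trans p21; exact: le_trans p22.
- by apply: le_trans ks _; apply: up; exact: le_trans p21.
- apply: le_trans h _; rewrite -[leRHS]mulr1; apply: up.
  by apply: le_trans i1'; apply: le_trans p21; exact: le_trans p22.
Qed.

Lemma bO_box_coord i : bo (fun=> 1) (fun _ (x : 'rV[R]_3) => x 0 i).
Proof. exact: (bO_coord FTf 3 (fun x Ax => A_bd Ax i)). Qed.

Lemma bO_scale : bo (fun t => s t) (fun t _ => s t).
Proof.
apply: (bO_seq FTf 3 A ler01); apply: nearW => t.
by rewrite mul1r ger0_norm// ltW.
Qed.

Let one_rate (d : T -> R) : (\forall t \near FT, d t <= 1) ->
  forall u, bo d u -> bo (fun=> 1) u.
Proof.
by move=> h u; apply: (bO_le FTf ler01); apply: filterS h => t; rewrite mulr1.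
Qed.

Let s_le1 : \forall t \near FT, s t <= 1. Proof. by apply: nearW => t. Qed.
Let sk_le1 : \forall t \near FT, s t * ka t <= 1.
Proof. by apply: filterS rates => t [? ? ? _ _]; rewrite mulr_ile1// ltW. Qed.

Lemma bO_parameter : bo (fun t => s t * ka t) (fun t => parameter (kk t)).
Proof.
apply: (bO1M FTf (bO_box_coord i0)); apply: (bO_seq FTf 3 A Cr0).
by apply: filterS kk_pos => t; exact: rho_le.
Qed.

Lemma bO_x_coord : bo (fun=> 1) (fun=> x_coord).
Proof. exact: (bO1M FTf (bOB FTf (bO_cst FTf 3 A c0p) (bO_box_coord i1)) (bO_cst FTf 3 A w2)). Qed.

Lemma bO_y_coord : bo (fun=> 1) (fun=> y_coord).
Proof. exact: (bO1M FTf (bOB FTf (bO_cst FTf 3 A Bc) (bO_box_coord i2)) (bO_cst FTf 3 A w2)). Qed.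

Lemma bO_section_w : bo (fun t => s t) (fun t => section_w (kk t)).
Proof.
have := bO1M FTf bO_y_coord bO_scale; apply: bO_eq; apply: nearW => t; apply/funext => x.
by rewrite /section_w mulrC.
Qed.

Lemma bO_natmul (c : R) : bo (fun t => (kk t)%:R) (fun t _ => (kk t)%:R * c).
Proof.
apply: (bO_seq FTf 3 A (normr_ge0 c)); apply: nearW => t.
by rewrite normrM ger0_norm// mulrC.
Qed.

Lemma bO_section_x_sub : bo (fun t => s t * ka t)
  (fun t x => s t * (s t * ((kk t)%:R * abar + x_coord x))).
Proof.
have bx : bo (fun t => (kk t)%:R) (fun=> x_coord).
  apply: (bO_le FTf ler01 _ bO_x_coord); apply: filterS kk_pos => t k0.
  by rewrite mul1r ler1n.
apply: (bO_le FTf (ltW Cs0) _ (bOM FTf bO_scale (bOM FTf bO_scale (bOD FTf (bO_natmul abar) bx)))).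
apply: filterS rates => t [s0 k0 _ _ [_ _ _ h _]].
have -> : Cs * (s t * ka t) = s t * (Cs * ka t) by ring.
by rewrite ler_pM2l// mulrC.
Qed.

Lemma bO_section_x : bo (fun t => s t) (fun t => section_x (kk t)).
Proof.
apply: (bOD FTf bO_scale); apply: (bO_le FTf ler01 _ bO_section_x_sub).
by apply: filterS rates => t [s0 k0 k1 _ _]; rewrite mul1r ler_piMr// ltW.
Qed.

Lemma bO_return_point i : bo (fun t => s t) (fun t x => return_point (kk t) x 0 i).
Proof.
case: (ord3P i) => ->.
- apply: (bO_eq FTf (f := fun t => parameter (kk t))).
    by apply: nearW => t; apply/funext => x; rewrite /return_point row3E.
  apply: (bO_le FTf ler01 _ bO_parameter).
  by apply: filterS rates => t [s0 k0 k1 _ _]; rewrite mul1r ler_piMr// ltW.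
- by apply: (bO_eq FTf _ bO_section_x); apply: nearW => t; apply/funext => x; rewrite /return_point row3E.
- by apply: (bO_eq FTf _ bO_section_w); apply: nearW => t; apply/funext => x; rewrite /return_point row3E.
Qed.

Lemma bO_comp_return_point Phi : smooth Phi -> bo (fun=> 1) (fun t x => Phi (return_point (kk t) x)).
Proof.
move=> sP; apply: (bO_comp3 FTf sP).
- exact: one_rate sk_le1 _ bO_parameter.
- exact: one_rate s_le1 _ bO_section_x.
- exact: one_rate s_le1 _ bO_section_w.
Qed.

Lemma bO_comp_parameter Phi : smooth Phi -> bo (fun=> 1) (fun t x => Phi (row3 (parameter (kk t) x) 0 0)).
Proof.
move=> sP; apply: (bO_comp3 FTf sP); first exact: one_rate sk_le1 _ bO_parameter.
  exact: (bO_cst FTf 3 A 0).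
exact: (bO_cst FTf 3 A 0).
Qed.

Let b_sum d (u : 'I_3 -> T -> 'rV[R]_3 -> R) : (forall i, bo d (u i)) ->
  bo d (fun t x => \sum_i u i t x).
Proof.
move=> h; have := bOD FTf (bOD FTf (h i0) (h i1)) (h i2).
by apply: bO_eq; apply: nearW => t; apply/funext => x; rewrite sum3.
Qed.

Let b_zG Phi i : smooth Phi -> bo (fun t => s t) (fun t x => return_point (kk t) x 0 i * Phi (return_point (kk t) x)).
Proof.
move=> sP; have := bO1M FTf (bO_comp_return_point sP) (bO_return_point i).
by apply: bO_eq; apply: nearW => t; apply/funext => x; rewrite mulrC.
Qed.

Let ss_le : \forall t \near FT, s t * s t <= Cs * (s t * ka t).
Proof. by apply: filterS rates => t [s0 _ _ _ [_ _ h _ _]]; rewrite mulrCA ler_pM2l. Qed.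

(** The parameter term and the deviation of [section_x] from [s] are O(s / k), and the quadratic
    terms are O(s^2); what is kept is linear in [s] and [w]. *)
Lemma X0_est : bo (fun t => s t * ka t)
  (fun t x => (scaled_orbit (kk t) 0).1 x - 1 - s t * (l i1 + l i2 * y_coord x)).
Proof.
have bG i : bo (fun t => s t) (fun t x => \sum_j return_point (kk t) x 0 j * G i j (return_point (kk t) x)).
  by apply: b_sum => j; exact: b_zG.
have bT i : bo (fun t => s t * ka t)
    (fun t x => return_point (kk t) x 0 i * \sum_j return_point (kk t) x 0 j * G i j (return_point (kk t) x)).
  exact: (bO_le FTf (ltW Cs0) ss_le (bOM FTf (bO_return_point i) (bG i))).
have := bOD FTf (b_sum bT) (bOD FTf (bO1M FTf (bO_cst FTf 3 A (l i0)) bO_parameter)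
  (bO1M FTf (bO_cst FTf 3 A (l i1)) bO_section_x_sub)).
apply: bO_eq; apply: nearW => t; apply/funext => x.
rewrite /= tau1E sum3 [in RHS]sum3 /return_point !row3E /section_x /section_w.
move: (\sum_j _) (\sum_j _) (\sum_j _) => S0 S1 S2'.
by ring.
Qed.

(** Division by [s] costs one order, so the expansion goes one order further than for [X]. The
    coefficient of [w] vanishes at the tangency: the linear part gives [chi] and, at order [s], the
    displacements in [x] and in the parameter, which the quadratic terms in [x] and [w] join. *)
Lemma V0_est : bo (fun t => s t * ka t)
  (fun t x => (scaled_orbit (kk t) 0).2 x - chi - s t * (chi * ((kk t)%:R * abar + x_coord x) + kap0 * x 0 i0
    + (q i1 i1 + (q i1 i2 + q i2 i1) * y_coord x + q i2 i2 * y_coord x ^+ 2))).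
Proof.
pose d t := s t * s t * ka t.
have d1 : \forall t \near FT, s t * ka t * s t <= 1 * d t.
  by apply: nearW => t; rewrite mul1r /d mulrAC.
have d2 : \forall t \near FT, s t * (s t * ka t) <= 1 * d t.
  by apply: nearW => t; rewrite mul1r /d mulrA.
have d3 : \forall t \near FT, s t * (s t * s t) <= Cs * d t.
  apply: filterS rates => t [s0 _ _ _ [_ _ h _ _]].
  have -> : Cs * d t = s t * (s t * (Cs * ka t)) by rewrite /d; ring.
  by rewrite !ler_pM2l.
have bH i j : bo (fun t => s t) (fun t x => \sum_k return_point (kk t) x 0 k * H i j k (return_point (kk t) x)).
  by apply: b_sum => k; exact: b_zG.
have b3 : bo d (fun t x => \sum_i \sum_j return_point (kk t) x 0 i * (return_point (kk t) x 0 j *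
    \sum_k return_point (kk t) x 0 k * H i j k (return_point (kk t) x))).
  apply: b_sum => i; apply: b_sum => j.
  exact: (bO_le FTf (ltW Cs0) d3 (bOM FTf (bO_return_point i) (bOM FTf (bO_return_point j) (bH i j)))).
have bEz i : bo d (fun t x => parameter (kk t) x * return_point (kk t) x 0 i).
  exact: (bO_le FTf ler01 d1 (bOM FTf bO_parameter (bO_return_point i))).
have bXz (u : T -> 'rV[R]_3 -> R) : bo (fun t => s t) u ->
    bo d (fun t x => s t * (s t * ((kk t)%:R * abar + x_coord x)) * u t x).
  by move=> bu; exact: (bO_le FTf ler01 d1 (bOM FTf bO_section_x_sub bu)).
have cst c u : bo d u -> bo d (fun t x => c * u t x).
  exact: (bO1M FTf (bO_cst FTf 3 A c)).
have bk : bo d (fun t x => x 0 i0 * (m i0 * rho (kk t) - s t * s t * kap0)).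
  apply: (bO1M FTf (bO_box_coord i0)); apply: (bO_seq FTf 3 A Ck0).
  by apply: filterS kk_pos => t; exact: rho_kap.
have bs := bOD FTf bO_section_x bO_scale.
have tot := bOD FTf (bOD FTf b3 bk) (bOD FTf
  (bOD FTf (bOD FTf (cst (q i0 i0) _ (bEz i0)) (cst (q i0 i1 + q i1 i0) _ (bEz i1)))
    (cst (q i0 i2 + q i2 i0) _ (bEz i2)))
  (bOD FTf (cst (q i1 i1) _ (bXz _ bs)) (cst (q i1 i2 + q i2 i1) _ (bXz _ bO_section_w)))).
have binv : bo (fun t => (s t)^-1) (fun t _ => (s t)^-1).
  apply: (bO_seq FTf 3 A ler01); apply: nearW => t.
  by rewrite mul1r ger0_norm// invr_ge0 ltW.
have := bOM FTf binv tot.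
have dr : \forall t \near FT, (s t)^-1 * d t <= 1 * (s t * ka t).
  by apply: nearW => t; rewrite mul1r /d -!mulrA mulKf// gt_eqF.
move=> /(bO_le FTf ler01 dr); apply: bO_eq; apply: nearW => t; apply/funext => x.
have s0 : s t != 0 by rewrite gt_eqF.
rewrite /= tau2E !sum3 /return_point !row3E m1 m2 /section_x /section_w /parameter.
(* The 27 cubic remainders become variables, leaving a rational identity in [s]. *)
move: (H _ _ _ _) (H _ _ _ _) (H _ _ _ _) => h000 h001 h002.
do 24 move: (H _ _ _ _) => ?.
move: (x_coord x) (y_coord x) (x 0 i0) (s t) s0 => X Y x0 S S0.
by field.
Qed.

Section Step.
Variables (ii : T -> nat) (X V : T -> 'rV[R]_3 -> R).
Hypotheses (bX : bo (fun=> 1) X) (bV : bo (fun=> 1) V).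
Let P t x := X t x * V t x.
Let bP : bo (fun=> 1) P. Proof. exact: (bO1M FTf bX bV). Qed.

Let b_point Phi : smooth Phi ->
  bo (fun=> 1) (fun t x => Phi (point (kk t) (ii t) (X t) (V t) x)).
Proof.
have p1 n : `|alpha ^+ n| <= 1.
  by rewrite ger0_norm ?exprn_ge0 ?exprn_ile1 ?ltW//; case/andP: alpha_bd.
move=> sP; apply: (bO_comp3 FTf sP); first exact: one_rate sk_le1 _ bO_parameter.
  apply: (bO1M FTf (bO_seq FTf 3 A ler01 _) bX).
  by apply: nearW => t; rewrite mulr1.
apply: (bO1M FTf (bO_seq FTf 3 A ler01 _) bV).
by apply: nearW => t; rewrite normrM normrX sgabs expr1n mul1r mulr1.
Qed.

Let rk t := s t * ka t ^+ 2.
Let ks_le : \forall t \near FT, (kk t)%:R * s t * s t <= Cs * rk t.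
Proof.
apply: filterS rates => t [s0 _ _ _ [_ h _ _ _]].
by rewrite /rk [s t * _ ^+ 2]mulrC mulrA ler_pM2r.
Qed.

(** An error of order [s / k^2] per step still sums to O(s / k) over [k] steps. The terms quadratic
    in the parameter, those with the parameter times [s], and those of order [s^2] all meet this
    bound. *)
Let growth_est (c base lam cr : R) (Lf Cf hf Lf2 Cf1 : 'rV[R]_3 -> R) :
  smooth hf -> smooth Lf2 -> smooth Cf1 ->
  (forall e, Lf (row3 e 0 0) = base + e * (lam + e * Lf2 (row3 e 0 0))) ->
  (forall e, Cf (row3 e 0 0) = cr + e * Cf1 (row3 e 0 0)) -> sg * cr = cr ->
  bo rk (fun t x => c * (Lf (row3 (parameter (kk t) x) 0 0) - base
     + Cf (row3 (parameter (kk t) x) 0 0) * (sg ^+ ii t * s t * P t x)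
     + (s t * P t x) ^+ 2 * hf (point (kk t) (ii t) (X t) (V t) x))
    - (parameter (kk t) x * (c * lam) + s t * (c * cr) * P t x)).
Proof.
move=> sh sL sC LE CE sgc.
(* Either [sg = 1] or the resonant coefficient [cr] vanishes, so the alternating sign of the product
   [x y] does not show. *)
have sgi n : sg ^+ n * cr = cr by elim: n => [|n IH]; rewrite ?mul1r// exprS -mulrA IH.
have r1 : \forall t \near FT, s t * ka t * (s t * ka t) <= Cs * rk t.
  apply: filterS rates => t [s0 k0 _ _ [_ _ _ _ h]].
  have -> : s t * ka t * (s t * ka t) = s t * rk t by rewrite /rk; ring.
  by rewrite ler_wpM2r// mulr_ge0 ?exprn_ge0 ?ltW.
have r2 : \forall t \near FT, s t * ka t * s t <= Cs * rk t.
  apply: filterS rates => t [s0 k0 _ _ [_ _ h _ _]].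
  have -> : Cs * rk t = s t * ka t * (Cs * ka t) by rewrite /rk; ring.
  by rewrite ler_pM2l// mulr_gt0.
have r3 : \forall t \near FT, s t * s t <= Cs * rk t.
  apply: filterS rates => t [s0 k0 _ _ [h _ _ _ _]].
  have -> : Cs * rk t = s t * (Cs * ka t ^+ 2) by rewrite /rk; ring.
  by rewrite ler_pM2l.
have bsg : bo (fun=> 1) (fun t _ => sg ^+ ii t).
  by apply: (bO_seq FTf 3 A ler01); apply: nearW => t; rewrite normrX sgabs expr1n mulr1.
have t1 := bO1M FTf (bO_comp_parameter sL) (bO_le FTf (ltW Cs0) r1 (bOM FTf bO_parameter bO_parameter)).
have t2 := bO1M FTf (bO1M FTf bsg (bO1M FTf (bO_comp_parameter sC) bP)) (bO_le FTf (ltW Cs0) r2 (bOM FTf bO_parameter bO_scale)).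
have t3 := bO1M FTf (bO1M FTf (bO1M FTf bP bP) (b_point sh)) (bO_le FTf (ltW Cs0) r3 (bOM FTf bO_scale bO_scale)).
have := bO1M FTf (bO_cst FTf 3 A c) (bOD FTf t1 (bOD FTf t2 t3)).
apply: bO_eq; apply: nearW => t; apply/funext => x.
have key (L' C' h' E' p g S : R) : g * cr = cr ->
    c * (L' * (E' * E') + (g * (C' * p) * (E' * S) + p * p * h' * (S * S))) =
    c * (base + E' * (lam + E' * L') - base + (cr + E' * C') * (g * S * p) + (S * p) ^+ 2 * h')
      - (E' * (c * lam) + S * (c * cr) * p).
  move=> gE; apply/eqP; rewrite -subr_eq0.
  set z := (X in X == 0); have -> : z = c * S * p * (cr - g * cr) by rewrite /z; ring.
  by rewrite gE subrr mulr0.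
by rewrite LE CE; exact: key (sgi _).
Qed.

Lemma growth1_est : bo rk (fun t x => growth1 (kk t) (ii t) (X t) (V t) x
  - (parameter (kk t) x * (alpha^-1 * lam1) + s t * (alpha^-1 * ca) * (X t x * V t x))).
Proof. exact: (growth_est alpha^-1 sha sL2 sCa1 LaE CaE sgca). Qed.

Lemma growth2_est : bo rk (fun t x => growth2 (kk t) (ii t) (X t) (V t) x
  - (parameter (kk t) x * (sg * alpha * sig1) + s t * (sg * alpha * cb) * (X t x * V t x))).
Proof. exact: (growth_est (sg * alpha) shb sS2 sCb1 SbE CbE sgcb). Qed.

Let growth_rate (a b : R) (Mf : T -> 'rV[R]_3 -> R) :
  bo rk (fun t x => Mf t x - (parameter (kk t) x * a + s t * b * P t x)) -> bo (fun t => s t) Mf.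
Proof.
move=> h.
have r1 : \forall t \near FT, rk t <= 1 * s t.
  apply: filterS rates => t [s0 k0 k1 _ _].
  by rewrite mul1r /rk; apply: ler_piMr; [exact: ltW|apply: exprn_ile1 => //; exact: ltW].
have r2 : \forall t \near FT, s t * ka t <= 1 * s t.
  by apply: filterS rates => t [s0 k0 k1 _ _]; rewrite mul1r ler_piMr// ltW.
have := bOD FTf (bO_le FTf ler01 r1 h) (bOD FTf
  (bO1M FTf (bO_cst FTf 3 A a) (bO_le FTf ler01 r2 bO_parameter))
  (bO1M FTf (bO1M FTf (bO_cst FTf 3 A b) bP) bO_scale)).
by apply: bO_eq; apply: nearW => t; apply/funext => x; ring.
Qed.

Lemma step1_rate : bo (fun t => s t) (fun t x => X t x * growth1 (kk t) (ii t) (X t) (V t) x).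
Proof. exact: (bO1M FTf bX (growth_rate growth1_est)). Qed.

Lemma step2_rate : bo (fun t => s t) (fun t x => V t x * growth2 (kk t) (ii t) (X t) (V t) x).
Proof. exact: (bO1M FTf bV (growth_rate growth2_est)). Qed.

Hypotheses (bX1 : bo (fun t => (kk t)%:R * s t) (fun t x => X t x - 1))
  (bV1 : bo (fun t => (kk t)%:R * s t) (fun t x => V t x - chi)).

(** [X] and [V] stay within O(k s) of 1 and [chi], so the product in the resonant term may be
    replaced by [chi] at a cost O(k s^2), which is within the same error. *)
Let D_est (a b w : R) (U Mf : T -> 'rV[R]_3 -> R) :
  bo rk (fun t x => Mf t x - (parameter (kk t) x * a + s t * b * P t x)) ->
  bo (fun t => (kk t)%:R * s t) (fun t x => U t x - w) ->
  bo rk (fun t x => U t x * Mf t x - w * (parameter (kk t) x * a + s t * b * chi)).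
Proof.
move=> h hU.
have bPc : bo (fun t => (kk t)%:R * s t) (fun t x => P t x - chi).
  have := bOD FTf (bO1M FTf bV bX1) bV1.
  by apply: bO_eq; apply: nearW => t; apply/funext => x; rewrite /P; ring.
have := bOD FTf (bO_le FTf (ltW Cs0) ks_le (bOM FTf hU (growth_rate h)))
  (bO1M FTf (bO_cst FTf 3 A w) (bOD FTf h
   (bO1M FTf (bO_cst FTf 3 A b) (bO_le FTf (ltW Cs0) ks_le (bOM FTf bPc bO_scale))))).
by apply: bO_eq; apply: nearW => t; apply/funext => x; ring.
Qed.

Lemma step1_est : bo rk (fun t x => X t x * growth1 (kk t) (ii t) (X t) (V t) x
  - (parameter (kk t) x * (alpha^-1 * lam1) + s t * (alpha^-1 * ca) * chi)).
Proof.
have := D_est growth1_est bX1.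
by apply: bO_eq; apply: nearW => t; apply/funext => x; rewrite mul1r.
Qed.

Lemma step2_est : bo rk (fun t x => V t x * growth2 (kk t) (ii t) (X t) (V t) x
  - chi * (parameter (kk t) x * (sg * alpha * sig1) + s t * (sg * alpha * cb) * chi)).
Proof. exact: (D_est growth2_est bV1). Qed.

End Step.

End Scaled.

(** * Estimates along the whole orbit *)

Variables (F : set_system nat) (FF : Filter F).
Hypotheses (F_pos : \forall k \near F, (0 < k)%N)
  (F_lim : (fun k => k%:R^-1 : R) @ F --> (0 : R)).

Lemma Bd_telescope r (B : set 'rV[R]_3) (U D : nat -> 'rV[R]_3 -> R) (c : R) k :
  smooth (U 0) -> (forall i, U i.+1 = fun x => U i x + D i x) ->
  (forall i, (i < k)%N -> smooth (D i) /\ Bd r B c (D i)) ->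
  forall i, (i <= k)%N -> smooth (U i) /\ Bd r B (i%:R * c) (fun x => U i x - U 0 x).
Proof.
move=> sU0 US h; elim=> [_|i IH ik].
  split => //; have -> : (fun x => U 0 x - U 0 x) = fun=> 0 by apply/funext => x; rewrite subrr.
  by apply: BdW (Bd_cst r B 0); rewrite normr0 mul0r.
have [sU bU] := IH (ltnW ik); have [sD bD] := h i ik.
rewrite US; split; first exact: smoothD.
have -> : (fun x => U i x + D i x - U 0 x) = (fun x => (U i x - U 0 x) + D i x).
  by apply/funext => x; rewrite addrAC.
by rewrite -natr1 mulrDl mul1r; apply: BdD => //; apply: smoothD => //; exact: smoothN.
Qed.

(** Along this filter the estimates are uniform over all times [i <= k] while [k] follows [F]; the
    single-time estimates then apply as they stand to pairs. *)
Definition below : set_system (nat * nat) :=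
  [set P | \forall k \near F, forall i, (i <= k)%N -> P (k, i)].

Global Instance below_filter : Filter below.
Proof.
split; first by rewrite /below /=; apply: filterE.
- move=> P Q hP hQ.
  have inc : (fun k => forall i, (i <= k)%N -> P (k, i)) `&` (fun k => forall i, (i <= k)%N -> Q (k, i))
      `<=` (fun k => forall i, (i <= k)%N -> (P `&` Q) (k, i)).
    by move=> t [p p'] i ik; split; [exact: p|exact: p'].
  exact: (@filterS _ F FF _ _ inc (@filterI _ F FF _ _ hP hQ)).
- move=> P Q PQ hP.
  have inc : (fun k => forall i, (i <= k)%N -> P (k, i)) `<=` (fun k => forall i, (i <= k)%N -> Q (k, i)).
    by move=> t p i ik; exact/PQ/p.
  exact: (@filterS _ F FF _ _ inc hP).
Qed.

Let fn := 'rV[R]_3 -> R.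

(* Indexing by all pairs of bounded functions makes the constants of one step
   uniform in the time i, as the induction over the orbit requires. *)
Definition bounded_pairs (B : R) : set_system (nat * nat * (fn * fn)) :=
  [set P | \forall k \near F, forall i X V, smooth X /\ smooth V ->
    Bd 3 A B X /\ Bd 3 A B V -> P (k, i, (X, V))].

Global Instance bounded_pairs_filter B : Filter (bounded_pairs B).
Proof.
split; first by rewrite /bounded_pairs /=; apply: filterE.
- move=> P Q hP hQ; set S := fun P : set (nat * nat * (fn * fn)) => fun k => forall i X V,
    smooth X /\ smooth V -> Bd 3 A B X /\ Bd 3 A B V -> P (k, i, (X, V)).
  have inc : S P `&` S Q `<=` S (P `&` Q).
    by move=> t [p p'] i X V sX bX; split; [exact: p|exact: p'].
  exact: (@filterS _ F FF _ _ inc (@filterI _ F FF _ _ hP hQ)).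
- move=> P Q PQ hP; set S := fun P : set (nat * nat * (fn * fn)) => fun k => forall i X V,
    smooth X /\ smooth V -> Bd 3 A B X /\ Bd 3 A B V -> P (k, i, (X, V)).
  have inc : S P `<=` S Q by move=> t p i X V sX bX; exact/PQ/p.
  exact: (@filterS _ F FF _ _ inc hP).
Qed.

(** [C] is chosen before the time [i] and the pair of functions, which the bootstrap over the orbit
    relies on. *)
Let step_const B : exists2 C : R, 0 <= C & \forall k \near F, forall i X V,
  smooth X /\ smooth V -> Bd 3 A B X /\ Bd 3 A B V ->
  (smooth (fun x => X x * growth1 k i X V x) /\ Bd 3 A (C * sc k) (fun x => X x * growth1 k i X V x)) /\
  (smooth (fun x => V x * growth2 k i X V x) /\ Bd 3 A (C * sc k) (fun x => V x * growth2 k i X V x)).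
Proof.
have FB := bounded_pairs_filter B.
have kp : \forall t \near bounded_pairs B, (0 < t.1.1)%N.
  by apply: (@filterS _ F FF _ _ _ F_pos) => k k0 i X V _ _.
have bX : bO (bounded_pairs B) 3 A (fun=> 1) (fun t => t.2.1).
  exists `|B| => //; apply: (@filterS _ F FF _ _ _ F_pos) => k k0 i X V [sX _] [BX _].
  by split => //; apply: BdW BX; rewrite mulr1 ler_norm.
have bV : bO (bounded_pairs B) 3 A (fun=> 1) (fun t => t.2.2).
  exists `|B| => //; apply: (@filterS _ F FF _ _ _ F_pos) => k k0 i X V [_ sX] [_ BX].
  by split => //; apply: BdW BX; rewrite mulr1 ler_norm.
have [C1 C10 h1] := step1_rate FB kp (fun t => t.1.2) bX bV.
have [C2 C20 h2] := step2_rate FB kp (fun t => t.1.2) bX bV.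
exists (Num.max C1 C2); first by rewrite le_max C10.
apply: (@filterS _ F FF _ _ _ (@filterI _ F FF _ _ h1 h2)) => k [g1 g2] i X V sXV BXV.
have [sm1 B1] := g1 i X V sXV BXV; have [sm2 B2] := g2 i X V sXV BXV.
by split; split => //; [apply: BdW B1|apply: BdW B2];
  rewrite ler_wpM2r ?(ltW (sc_gt0 k))// le_max lexx ?orbT.
Qed.

(** A bootstrap: while the orbit is bounded by [B + 1], each step moves it by at most [C * s], hence
    all steps together by at most [C k s <= 1], which confirms the bound [B + 1] from the initial
    bound [B]. *)
Lemma scaled_orbit_bounds : exists C B : R, \forall k \near F, forall i, (i <= k)%N ->
  [/\ smooth (scaled_orbit k i).1 /\ smooth (scaled_orbit k i).2,
     Bd 3 A B (scaled_orbit k i).1 /\ Bd 3 A B (scaled_orbit k i).2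
   & Bd 3 A (C * (k%:R * sc k)) (fun x => (scaled_orbit k i).1 x - (scaled_orbit k 0).1 x) /\
     Bd 3 A (C * (k%:R * sc k)) (fun x => (scaled_orbit k i).2 x - (scaled_orbit k 0).2 x)].
Proof.
have [B [B0 hB]] : exists B, 0 <= B /\ \forall k \near F,
    [/\ smooth (scaled_orbit k 0).1, smooth (scaled_orbit k 0).2, Bd 3 A B (scaled_orbit k 0).1 & Bd 3 A B (scaled_orbit k 0).2].
  have r1 : \forall k \near F, sc k * k%:R^-1 <= 1 * 1 :> R.
    by apply: (@filterS _ F FF _ _ _ (rates FF F_pos)) => k [? ? ? _ _]; rewrite mulr1 mulr_ile1// ltW.
  have r2 : \forall k \near F, k%:R * sc k <= Cs * 1.
    apply: (@filterS _ F FF _ _ _ (rates FF F_pos)) => k [s0 k0 k1 _ [_ _ _ h _]].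
    by apply: le_trans h _; rewrite ler_pM2l.
  have bs1 : bO F 3 A (fun=> 1) (fun k _ => sc k).
    by apply: (bO_le FF ler01 _ (bO_scale FF id)); apply: nearW => k; rewrite mulr1.
  have bxi := bO_x_coord FF; have byy := bO_y_coord FF.
  have ks : bO F 3 A (fun=> 1) (fun k x => sc k * (k%:R * abar)).
    have kr : \forall k \near F, sc k * k%:R <= Cs * 1.
      by apply: (@filterS _ F FF _ _ _ r2) => k; rewrite mulrC.
    exact: (bO_le FF (ltW Cs0) kr (bOM FF (bO_scale FF id) (bO_natmul FF id abar))).
  have X1 : bO F 3 A (fun=> 1) (fun k => (scaled_orbit k 0).1).
    have := bOD FF (bO_le FF ler01 r1 (X0_est FF F_pos)) (bOD FF (bO_cst FF 3 A 1)
      (bO1M FF bs1 (bOD FF (bO_cst FF 3 A (l i1)) (bO1M FF (bO_cst FF 3 A (l i2)) byy)))).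
    by apply: bO_eq; apply: nearW => k; apply/funext => x; ring.
  have V1 : bO F 3 A (fun=> 1) (fun k => (scaled_orbit k 0).2).
    have := bOD FF (bO_le FF ler01 r1 (V0_est FF F_pos)) (bOD FF (bO_cst FF 3 A chi)
      (bOD FF (bO1M FF (bO_cst FF 3 A chi) (bOD FF ks (bO1M FF bs1 bxi)))
       (bOD FF (bO1M FF bs1 (bO1M FF (bO_cst FF 3 A kap0) (bO_box_coord FF i0)))
        (bO1M FF bs1 (bOD FF (bOD FF (bO_cst FF 3 A (q i1 i1)) (bO1M FF (bO_cst FF 3 A (q i1 i2 + q i2 i1)) byy))
          (bO1M FF (bO_cst FF 3 A (q i2 i2)) (bO1M FF byy byy))))))).
    by apply: bO_eq; apply: nearW => k; apply/funext => x; ring.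
  have [Ca' C0 g1] := X1; have [Cb' C0' g2] := V1.
  exists (Num.max Ca' Cb'); split; first by rewrite le_max C0.
  apply: (@filterS _ F FF _ _ _ (@filterI _ F FF _ _ g1 g2)) => k [[sX BX] [sV BV]].
  by split => //; [apply: BdW BX|apply: BdW BV]; rewrite mulr1 le_max lexx ?orbT.
have [C C0 hC] := step_const (B + 1).
exists C, (B + 1).
have small : \forall k \near F, C * (k%:R * sc k) <= 1.
  have Lk := limM FF (lim_cst FF (C * Cs)) F_lim; rewrite mulr0 in Lk.
  apply: (@filterS _ F FF _ _ _ (@filterI _ F FF _ _ (rates FF F_pos) (cvgr_le _ Lk _ ltr01))).
  move=> k [[_ _ _ _ [_ _ _ h _]] h']; apply: le_trans h'.
  by rewrite -mulrA ler_wpM2l.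
apply: (@filterS _ F FF _ _ _ (@filterI _ F FF _ _ hB (@filterI _ F FF _ _ hC small))).
move=> k [[sX0 sV0 BX0 BV0] [st sm]].
have ksn (i : nat) : (i <= k)%N -> i%:R * (C * sc k) <= C * (k%:R * sc k).
  move=> ik; rewrite mulrCA ler_wpM2l// ler_pM2r// ler_nat//.
have up (i : nat) (U U0 : 'rV[R]_3 -> R) : (i <= k)%N -> smooth U -> smooth U0 -> Bd 3 A B U0 ->
    Bd 3 A (i%:R * (C * sc k)) (fun x => U x - U0 x) -> Bd 3 A (B + 1) U.
  move=> ik sU sU0 b0 b1.
  have -> : U = fun x => U0 x + (U x - U0 x) by apply/funext => x; rewrite addrC subrK.
  apply: BdD => //; first by apply: smoothD => //; exact: smoothN.
  by apply: BdW b1; apply: le_trans (ksn i ik) sm.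
have zero (U : 'rV[R]_3 -> R) : Bd 3 A (0%:R * (C * sc k)) (fun x => U x - U x).
  have -> : (fun x => U x - U x) = fun=> 0 by apply/funext => x; rewrite subrr.
  by apply: BdW (Bd_cst 3 A 0); rewrite normr0 mul0r.
have add (i : nat) (U U0 D : 'rV[R]_3 -> R) : smooth U -> smooth U0 -> smooth D ->
    Bd 3 A (i%:R * (C * sc k)) (fun x => U x - U0 x) -> Bd 3 A (C * sc k) D ->
    Bd 3 A (i.+1%:R * (C * sc k)) (fun x => U x + D x - U0 x).
  move=> sU sU0 sD b1 b2; have -> : (fun x => U x + D x - U0 x) = (fun x => (U x - U0 x) + D x).
    by apply/funext => x; rewrite addrAC.
  by rewrite -natr1 mulrDl mul1r; apply: BdD => //; apply: smoothD => //; exact: smoothN.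
have inv : forall i, (i <= k)%N ->
    [/\ smooth (scaled_orbit k i).1 /\ smooth (scaled_orbit k i).2,
     Bd 3 A (i%:R * (C * sc k)) (fun x => (scaled_orbit k i).1 x - (scaled_orbit k 0).1 x)
   & Bd 3 A (i%:R * (C * sc k)) (fun x => (scaled_orbit k i).2 x - (scaled_orbit k 0).2 x)].
  elim=> [_|i IH ik]; first by split; [split|exact: zero|exact: zero].
  have [[sX sV] BX BV] := IH (ltnW ik).
  have [[sD1 bD1] [sD2 bD2]] := st i _ _ (conj sX sV)
    (conj (up i _ _ (ltnW ik) sX sX0 BX0 BX) (up i _ _ (ltnW ik) sV sV0 BV0 BV)).
  by rewrite scaled_orbitS1 scaled_orbitS2; split; [split; exact: smoothD|exact: add|exact: add].
move=> i ik; have [[sX sV] BX BV] := inv i ik.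
split => //; split; [exact: up BX|exact: up BV|exact: BdW (ksn i ik) BX|exact: BdW (ksn i ik) BV].
Qed.

Let kk2 : \forall t \near below, (0 < t.1)%N.
Proof. by apply: (@filterS _ F FF _ _ _ F_pos) => k k0 i _. Qed.

Let X2 (t : nat * nat) := (scaled_orbit t.1 t.2).1.
Let V2 (t : nat * nat) := (scaled_orbit t.1 t.2).2.

Let b2 : [/\ bO below 3 A (fun=> 1) X2, bO below 3 A (fun=> 1) V2,
  bO below 3 A (fun t => t.1%:R * sc t.1) (fun t x => X2 t x - 1)
  & bO below 3 A (fun t => t.1%:R * sc t.1) (fun t x => V2 t x - chi)].
Proof.
have BF := below_filter.
have [C [B h]] := scaled_orbit_bounds.
have r0 : \forall t \near below, sc t.1 <= 1 * (t.1%:R * sc t.1).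
  apply: filterS kk2 => t k0; rewrite mul1r ler_peMl ?(ltW (sc_gt0 _))//.
  by rewrite ler1n.
have r1 : \forall t \near below, sc t.1 * t.1%:R^-1 <= 1 * (t.1%:R * sc t.1).
  apply: filterS (filterI kk2 (filterI r0 (rates BF kk2))) => t [k0 [h0 [s0 i0' i1' _ _]]].
  by apply: le_trans h0; rewrite ler_piMr// ltW.
have bk1 : bO below 3 A (fun t => t.1%:R * sc t.1) (fun t x => (scaled_orbit t.1 0).1 x - 1).
  have := bOD BF (bO_le BF ler01 r1 (X0_est BF kk2)) (bO_le BF ler01 r0
    (bO1M BF (bOD BF (bO_cst BF 3 A (l i1)) (bO1M BF (bO_cst BF 3 A (l i2)) (bO_y_coord BF))) (bO_scale BF fst))).
  by apply: bO_eq; apply: nearW => t; apply/funext => x; ring.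
have bk2 : bO below 3 A (fun t => t.1%:R * sc t.1) (fun t x => (scaled_orbit t.1 0).2 x - chi).
  have c := bO_cst BF 3 A.
  have := bOD BF (bO_le BF ler01 r1 (V0_est BF kk2)) (bOD BF
    (bO1M BF (c chi) (bOM BF (bO_natmul BF fst abar) (bO_scale BF fst)))
    (bO_le BF ler01 r0 (bO1M BF
      (bOD BF (bOD BF (bO1M BF (c chi) (bO_x_coord BF)) (bO1M BF (c kap0) (bO_box_coord BF i0)))
        (bOD BF (bOD BF (c (q i1 i1)) (bO1M BF (c (q i1 i2 + q i2 i1)) (bO_y_coord BF)))
          (bO1M BF (c (q i2 i2)) (bO1M BF (bO_y_coord BF) (bO_y_coord BF)))))
      (bO_scale BF fst)))).
  by apply: bO_eq; apply: nearW => t; apply/funext => x; ring.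
have dX : bO below 3 A (fun t => t.1%:R * sc t.1) (fun t x => X2 t x - (scaled_orbit t.1 0).1 x).
  exists `|C| => //; apply: (@filterS _ F FF _ _ _ h) => k hk i ik.
  have [[sX _] _ [BX _]] := hk i ik; have [[sX0 _] _ _] := hk 0 (leq0n k).
  split; first by apply: smoothD => //; exact: smoothN.
  by apply: BdW BX; rewrite ler_wpM2r ?ler_norm// mulr_ge0// ltW.
have dV : bO below 3 A (fun t => t.1%:R * sc t.1) (fun t x => V2 t x - (scaled_orbit t.1 0).2 x).
  exists `|C| => //; apply: (@filterS _ F FF _ _ _ h) => k hk i ik.
  have [[_ sX] _ [_ BX]] := hk i ik; have [[_ sX0] _ _] := hk 0 (leq0n k).
  split; first by apply: smoothD => //; exact: smoothN.
  by apply: BdW BX; rewrite ler_wpM2r ?ler_norm// mulr_ge0// ltW.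
split.
- exists `|B| => //; apply: (@filterS _ F FF _ _ _ h) => k hk i ik.
  have [[sX _] [BX _] _] := hk i ik.
  by split => //; apply: BdW BX; rewrite mulr1 ler_norm.
- exists `|B| => //; apply: (@filterS _ F FF _ _ _ h) => k hk i ik.
  have [[_ sX] [_ BX] _] := hk i ik.
  by split => //; apply: BdW BX; rewrite mulr1 ler_norm.
- have := bOD BF dX bk1; apply: bO_eq; apply: nearW => t; apply/funext => x.
  by rewrite addrA subrK.
- have := bOD BF dV bk2; apply: bO_eq; apply: nearW => t; apply/funext => x.
  by rewrite addrA subrK.
Qed.

(** The main part [N] of an increment is the same at all times, so [k] steps give [k * N] with the
    accumulated error [k * O(s / k^2)]. *)
Let collect (Z D : nat * nat -> 'rV[R]_3 -> R) (N : nat -> 'rV[R]_3 -> R) :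
  (\forall k \near F, smooth (Z (k, 0)) /\ smooth (N k)) ->
  (forall k i, Z (k, i.+1) = fun x => Z (k, i) x + D (k, i) x) ->
  bO below 3 A (fun t => sc t.1 * t.1%:R^-1 ^+ 2) (fun t x => D t x - N t.1 x) ->
  bO F 3 A (fun k => sc k * k%:R^-1) (fun k x => Z (k, k) x - Z (k, 0) x - k%:R * N k x).
Proof.
move=> sm ZS [C C0 hC]; exists C => //.
apply: (@filterS _ F FF _ _ _ (@filterI _ F FF _ _ sm (@filterI _ F FF _ _ hC (rates FF F_pos)))).
move=> k [[sZ sN] [hk [_ _ _ kE _]]].
have sK (c : R) : smooth (fun x => c * N k x) by apply: smoothM => //; exact: smooth_cst.
have [|||sU bU] := @Bd_telescope 3 A (fun i x => Z (k, i) x - i%:R * N k x)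
    (fun i x => D (k, i) x - N k x) (C * (sc k * k%:R^-1 ^+ 2)) k _ _ _ k (leqnn k).
- by apply: smoothD => //; exact/smoothN/sK.
- by move=> i; apply/funext => x; rewrite ZS -natr1; ring.
- by move=> i ik; exact: (hk i (ltnW ik)).
have E : k%:R * (C * (sc k * k%:R^-1 ^+ 2)) = C * (sc k * k%:R^-1).
  have -> : k%:R * (C * (sc k * k%:R^-1 ^+ 2)) = k%:R * k%:R^-1 * (C * (sc k * k%:R^-1)) by ring.
  by rewrite kE mul1r.
have fE : (fun x => Z (k, k) x - k%:R * N k x - (Z (k, 0) x - 0%:R * N k x)) =
    (fun x => Z (k, k) x - Z (k, 0) x - k%:R * N k x) by apply/funext => x; ring.
rewrite E fE in bU; split => //.
by rewrite -fE; apply: smoothD => //; apply: smoothN; apply: smoothD => //; exact/smoothN/sK.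
Qed.

Let smooth_start : \forall k \near F, smooth (scaled_orbit k 0).1 /\ smooth (scaled_orbit k 0).2.
Proof.
have [C [B h]] := scaled_orbit_bounds.
by apply: (@filterS _ F FF _ _ _ h) => k hk; have [] := hk 0 (leq0n k).
Qed.

Let smooth_lin (a b : R) k : smooth (fun x => parameter k x * a + sc k * b * chi).
Proof.
by apply: smoothD; [apply: smoothM; [apply: smoothM; [exact: smooth_coord|]|]|];
  exact: smooth_cst.
Qed.

Lemma scaled_orbit_end1 : bO F 3 A (fun k => sc k * k%:R^-1) (fun k x => (scaled_orbit k k).1 x - (scaled_orbit k 0).1 x
  - k%:R * (parameter k x * (alpha^-1 * lam1) + sc k * (alpha^-1 * ca) * chi)).
Proof.
have [bX bV bX1 bV1] := b2.
apply: (collect (Z := X2) _ _ (step1_est below_filter kk2 snd bX bV bX1 bV1)).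
  by apply: (@filterS _ F FF _ _ _ smooth_start) => k [sX _]; split => //; exact: smooth_lin.
by move=> k i; rewrite /X2 scaled_orbitS1.
Qed.

Lemma scaled_orbit_end2 : bO F 3 A (fun k => sc k * k%:R^-1) (fun k x => (scaled_orbit k k).2 x - (scaled_orbit k 0).2 x
  - k%:R * (chi * (parameter k x * (sg * alpha * sig1) + sc k * (sg * alpha * cb) * chi))).
Proof.
have [bX bV bX1 bV1] := b2.
apply: (collect (Z := V2) _ _ (step2_est below_filter kk2 snd bX bV bX1 bV1)).
  apply: (@filterS _ F FF _ _ _ smooth_start) => k [_ sX]; split => //.
  by apply: smoothM; [exact: smooth_cst|exact: smooth_lin].
by move=> k i; rewrite /V2 scaled_orbitS2.
Qed.

(** The constants are forced by the normal form: [A22] makes the coefficient of D^2 equal to -1/2,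
    [Bc] makes that of D in the second component [1 - c], [c0p] removes its constant term, and
    [beta] is the constant left in the first component. The last condition scales the parameter so
    that the coefficients of [e] add up to 1/2, hence [e = D^2 - 2 beta] at fixed points. *)
Variables (A22 k1 beta : R).
Hypotheses (A22w2 : A22 * w2 = 1) (A22E : A22 = 2 * (chi * q i2 i2))
  (BcE : Bc = 1 - l i2 - chi * (q i1 i2 + q i2 i1))
  (c0pE : c0p = Bc - A22 * (chi * q i1 i1) - chi * (q i1 i2 + q i2 i1) * Bc - Bc ^+ 2 / 2)
  (betaE : beta = c0p - A22 * l i1 - l i2 * Bc)
  (k1E : k1 = - A22 * (q1 * (alpha^-1 * lam1)))
  (k2E : 2^-1 - k1 = - A22 * (chi * kap0 + q1 * (sg * alpha * sig1))).

Let inv_s : bO F 3 A (fun k => (sc k)^-1) (fun k _ => (sc k)^-1).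
Proof.
by apply: (bO_seq FF 3 A ler01); apply: nearW => t; rewrite mul1r ger0_norm// invr_ge0 ltW.
Qed.

Let rdiv : \forall k \near F, (sc k)^-1 * (sc k * k%:R^-1) <= 1 * k%:R^-1.
Proof. by apply: nearW => k; rewrite mul1r mulKf// gt_eqF. Qed.

Let b_rhoq (c : R) : bO F 3 A (fun k => k%:R^-1)
  (fun k x => c * (x 0 i0 * (k%:R * rho k / sc k - q1))).
Proof.
apply: (bO1M FF (bO_cst FF 3 A c)); apply: (bO1M FF (bO_box_coord FF i0)).
by apply: (bO_seq FF 3 A Cq0); apply: (@filterS _ F FF _ _ _ F_pos) => k; exact: rho_q1.
Qed.

(** The gain of [X] divided by [s] contains [k * abar], which is unbounded; the centre of the
    section contains the same term and absorbs it. *)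
Lemma return1 : bO F 3 A (fun k => k%:R^-1) (fun k x =>
  (c0p - A22 * ((sc k)^-1 * ((scaled_orbit k k).1 x - 1) - k%:R * abar)) - lim1 (l i2) k1 beta x).
Proof.
have := bO1M FF (bO_cst FF 3 A (- A22)) (bOD FF
  (bO_le FF ler01 rdiv (bOM FF inv_s (bOD FF (X0_est FF F_pos) scaled_orbit_end1)))
  (b_rhoq (alpha^-1 * lam1))).
apply: bO_eq; apply: nearW => k; apply/funext => x.
have s0 : sc k != 0 by rewrite gt_eqF.
have h2 : A22 * y_coord x = Bc - x 0 i2 by rewrite /y_coord mulrCA A22w2 mulr1.
rewrite /lim1 betaE k1E /parameter /abar.
move: h2.
move: (y_coord x) ((scaled_orbit k k).1 x) ((scaled_orbit k 0).1 x) (x 0 i0) (x 0 i1) (x 0 i2) (sc k) s0.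
move=> Y O1 O0 x0 x1 x2 S S0 h2.
have E1 : - A22 * (S^-1 * (O0 - 1 - S * (l i1 + l i2 * Y) + (O1 - O0 -
     k%:R * (x0 * rho k * (alpha^-1 * lam1) + S * (alpha^-1 * ca) * chi))) +
     alpha^-1 * lam1 * (x0 * (k%:R * rho k / S - q1))) =
   - (A22 * (S^-1 * (O1 - 1) - k%:R * (ca / alpha * chi))) + A22 * l i1 + l i2 * (A22 * Y)
   + A22 * (q1 * (alpha^-1 * lam1)) * x0 by field; rewrite S0 gt_eqF.
by apply: (etrans E1); rewrite h2; ring.
Qed.

(** The starting displacement contributes [k * abar], and the resonant growth of [V] over [k] steps
    contributes the opposite, by [resonance]. This is where [a10 + b10 = 0] enters: otherwise a term
    of order [k] would remain. *)
Lemma return2 : bO F 3 A (fun k => k%:R^-1) (fun k x =>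
  (Bc - A22 * ((sc k)^-1 * (chi * (scaled_orbit k k).2 x - 1))) - lim2 (l i2) k1 x).
Proof.
have := bO1M FF (bO_cst FF 3 A (- A22)) (bOD FF
  (bO1M FF (bO_cst FF 3 A chi) (bO_le FF ler01 rdiv (bOM FF inv_s (bOD FF (V0_est FF F_pos) scaled_orbit_end2))))
  (b_rhoq (sg * alpha * sig1))).
apply: bO_eq; apply: nearW => k; apply/funext => x.
have s0 : sc k != 0 by rewrite gt_eqF.
have res : sg * alpha * cb = - (ca / alpha) by apply/eqP; rewrite -subr_eq0 opprK addrC resonance.
rewrite /lim2 k2E res /parameter /abar.
have h1 : A22 * x_coord x = c0p - x 0 i1 by rewrite /x_coord mulrCA A22w2 mulr1.
have h2 : A22 * y_coord x = Bc - x 0 i2 by rewrite /y_coord mulrCA A22w2 mulr1.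
have h3 : A22 * (chi * q i2 i2 * y_coord x ^+ 2) = (Bc - x 0 i2) ^+ 2 / 2.
  have -> : A22 * (chi * q i2 i2 * y_coord x ^+ 2) = A22 * (2 * (chi * q i2 i2)) * y_coord x ^+ 2 / 2 by field.
  by rewrite -A22E -h2; field.
move: h1 h2 h3.
move: (x_coord x) (y_coord x) ((scaled_orbit k k).2 x) ((scaled_orbit k 0).2 x) (x 0 i0) (x 0 i1) (x 0 i2) (sc k) s0.
move=> X Y O1 O0 x0 x1 x2 S S0 h1 h2 h3.
have BcE' := BcE; have c0pE' := c0pE.
set qq := q i1 i2 + q i2 i1 in BcE' c0pE' *.
have chiX (y : R) : chi * (chi * y) = y by rewrite mulrA chi2 mul1r.
have E1 : - A22 * (chi * (S^-1 * (O0 - chi - S * (chi * (k%:R * (ca / alpha * chi) + X) + kap0 * x0 +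
    (q i1 i1 + qq * Y + q i2 i2 * Y ^+ 2)) + (O1 - O0 - k%:R * (chi * (x0 * rho k * (sg * alpha * sig1) +
     S * - (ca / alpha) * chi))))) + sg * alpha * sig1 * (x0 * (k%:R * rho k / S - q1))) =
   - (A22 * (S^-1 * (chi * O1 - chi * chi))) + chi * chi * (A22 * (k%:R * (ca / alpha * chi)))
   + chi * chi * (A22 * X) + A22 * (chi * kap0) * x0 + A22 * (chi * q i1 i1) + chi * qq * (A22 * Y)
   + A22 * (chi * q i2 i2 * Y ^+ 2)
   + (chi * chi - 1) * (A22 * (k%:R * (x0 * rho k / S * (sg * alpha * sig1))))
   - chi * chi * (A22 * (k%:R * (ca / alpha * chi)))
   + A22 * (q1 * (sg * alpha * sig1)) * x0.
  by field; rewrite S0 gt_eqF.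
apply: (etrans E1); rewrite chi2 subrr mul0r addr0 !mul1r h1 h2 h3 c0pE'.
rewrite [in RHS](_ : 1 - l i2 = Bc + chi * qq); last by rewrite BcE'; ring.
by field; rewrite S0 gt_eqF.
Qed.

(** * Windows of the original maps *)

Variables (Fm : R -> 'rV[R]_2 -> 'rV[R]_2) (e0 eta : R).
Hypotheses (e00 : 0 < e0) (eta0 : 0 < eta).
Hypothesis loc : \forall k \near F, forall i e t u, (i < k)%N -> `|e| < e0 -> `|t - 1| <= eta ->
  `|u - chi| <= eta -> let x := alpha ^+ i * t in let y := sg ^+ i * alpha ^+ (k - i) * u in
  Fm e (pt x y) =
  pt (x * (La (row3 e 0 0) + Ca (row3 e 0 0) * (x * y) + (x * y) ^+ 2 * ha (row3 e x y)))
     (y * (Sb (row3 e 0 0) + Cb (row3 e 0 0) * (x * y) + (x * y) ^+ 2 * hb (row3 e x y))).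

(** The estimates keep [X] and [V] within [eta] of 1 and [chi], where the local form is valid; by
    induction on the time the recursion is therefore the true dynamics. *)
Lemma orbit_points : \forall k \near F, forall x, A x -> `|parameter k x| < e0 /\
  forall i, (i <= k)%N ->
  [/\ iter i (Fm (parameter k x)) (pt (tau1 (return_point k x)) (tau2 (return_point k x))) =
       pt (alpha ^+ i * (scaled_orbit k i).1 x) (sg ^+ i * alpha ^+ (k - i) * (scaled_orbit k i).2 x),
     `|(scaled_orbit k i).1 x - 1| <= eta & `|(scaled_orbit k i).2 x - chi| <= eta].
Proof.
have [_ _ [C1 C10 h1] [C2 C20 h2]] := b2.
have [C3 C30 h3] := bO_parameter FF F_pos.
have small (C c : R) : 0 <= C -> 0 < c -> \forall k \near F,
    C * (k%:R * sc k) <= c /\ C * (sc k * k%:R^-1) < c.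
  move=> C0 c0; have Lk := limM FF (lim_cst FF (C * Cs + C)) F_lim; rewrite mulr0 in Lk.
  apply: (@filterS _ F FF _ _ _ (@filterI _ F FF _ _ (rates FF F_pos) (cvgr_lt _ Lk _ c0))).
  move=> k [[s0 k0 k1' _ [_ _ _ h _]] h'].
  have p1 : C * (k%:R * sc k) <= C * Cs * k%:R^-1 by rewrite -mulrA ler_wpM2l.
  have p2 : C * (sc k * k%:R^-1) <= C * k%:R^-1 by rewrite ler_wpM2l// ler_piMl// ltW.
  have p3 : 0 <= C * Cs * k%:R^-1 by apply: mulr_ge0; [apply: mulr_ge0 => //; exact: ltW|exact: ltW].
  have p4 : 0 <= C * k%:R^-1 by rewrite mulr_ge0// ltW.
  move: h'; rewrite /= mulrDl => h'; split; lra.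
have F1 := @filterI _ F FF.
apply: (@filterS _ F FF _ _ _ (F1 _ _ h1 (F1 _ _ h2 (F1 _ _ h3 (F1 _ _ loc
  (F1 _ _ (small _ _ C10 eta0) (F1 _ _ (small _ _ C20 eta0) (small _ _ C30 e00)))))))).
move=> k [g1 [g2 [[_ g3] [lk [[w1 _] [[w2' _] [_ w3]]]]]]] x Ax.
have Ee : `|parameter k x| < e0 by apply: le_lt_trans (Bd_bound g3 Ax) w3.
split => // .
have bd i (ik : (i <= k)%N) : `|(scaled_orbit k i).1 x - 1| <= eta /\ `|(scaled_orbit k i).2 x - chi| <= eta.
  have [_ b1] := g1 i ik; have [_ b2'] := g2 i ik.
  by split; [apply: le_trans (Bd_bound b1 Ax) w1|apply: le_trans (Bd_bound b2' Ax) w2'].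
elim=> [ik|i IH ik].
  have [u1 u2] := bd 0 ik; split => //.
  by rewrite /= !expr0 !mul1r subn0 mulVKf// gt_eqF.
have [u1 u2] := bd i.+1 ik; split => //.
have [E v1 v2] := IH (ltnW ik).
rewrite iterS E lk// scaled_orbitS1 scaled_orbitS2.
have sgi : sg ^+ i * sg ^+ i = 1 by rewrite -exprMn sg2 expr1n.
have ak : alpha ^+ (k - i) = alpha * alpha ^+ (k - i.+1) by rewrite -exprS subnSK.
have ai : alpha ^+ i * alpha ^+ (k - i) = sc k by rewrite -exprD subnKC// ltnW.
rewrite /growth1 /growth2 /point.
move: ((scaled_orbit k i).1 x) ((scaled_orbit k i).2 x) => X V.
have xy : alpha ^+ i * X * (sg ^+ i * alpha ^+ (k - i) * V) = sg ^+ i * sc k * (X * V).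
  by rewrite -ai; ring.
have xy2 : (sg ^+ i * sc k * (X * V)) ^+ 2 = (sc k * (X * V)) ^+ 2.
  by rewrite !exprMn expr2 sgi mul1r.
rewrite xy xy2 ak (exprS alpha i) (exprS sg i).
move: (ha _) (hb _) (La _) (Ca _) (Sb _) (Cb _) (sg ^+ i * sc k * (X * V)) ((sc k * (X * V)) ^+ 2).
move=> h h' L' C' S' C'' Q1 Q2.
have an : alpha != 0 by rewrite gt_eqF.
congr pt; first by field.
move: (alpha ^+ (k - i.+1)) (sg ^+ i) => p g.
(* The leading eigenvalue enters [growth2] as [sg / alpha]; the terms without [S'], [C''] or [h']
   cancel because [sg * sg = 1]. *)
rewrite [RHS](_ : _ = g * p * V * (sg - sg * sg * sg + sg * sg * (alpha * (S' + C'' * Q1 + Q2 * h')))); last by field.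
by rewrite sg2 mul1r subrr add0r mul1r; ring.
Qed.

Hypotheses (AE : A = box k1 beta) (c_bd : -1 < l i2 < 1)
  (beta_bd : 0 < beta < 2 * (1 - l i2) ^+ 2).
Variables (mI : nat) (U : nat -> 'I_2 -> 'rV[R]_3 -> R).
Hypotheses (mI0 : (0 < mI)%N) (sU : forall k j, smooth (U k j))
  (iterE : forall k e z, iter k (Fm e) z = planar (U k 0) (U k 1) e z)
  (reinjE : forall e x w, iter mI (Fm e) (pt x (1 + w)) =
    pt (tau1 (row3 e x w)) (tau2 (row3 e x w)))
  (cFm : forall e, continuous (Fm e))
  (rho_neq0 : forall k, (0 < k)%N -> rho k != 0)
  (F_sg : \forall k \near F, sg ^+ k = chi) (F_big : \forall k \near F, (mI * mI <= k)%N)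
  (eta_bd : alpha * (1 + eta) < 1 - eta).

Let A22n : A22 != 0.
Proof. by apply/eqP => h; move: A22w2; rewrite h mul0r => /eqP; rewrite eq_sym oner_eq0. Qed.
Let w2E : w2 = A22^-1. Proof. by apply: (mulfI A22n); rewrite A22w2 divff. Qed.

(** [bk k] is the point of the section with [zeta = D = 0]; [Pk k] scales by [s^2] in [x] and by [s]
    in [y], and [Qk k] is its inverse. *)
Let bk k : 'rV[R]_2 := pt (sc k + sc k * (sc k * (k%:R * abar + c0p * w2))) (1 + sc k * (Bc * w2)).
Let Pk k : 'M[R]_2 := mx2 (- (sc k * sc k * w2)) 0 0 (- (sc k * w2)).
Let Qk k : 'M[R]_2 := mx2 (- (A22 / (sc k * sc k))) 0 0 (- (A22 / sc k)).

Let sc_neq0 k : sc k != 0. Proof. by rewrite gt_eqF. Qed.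

Let PQk k : Pk k *m Qk k = 1%:M.
Proof.
rewrite mul_mx2 mx2_1 !mulr0 !mul0r !addr0 !add0r w2E.
by congr mx2; field; rewrite A22n sc_neq0.
Qed.

Let QPk k : Qk k *m Pk k = 1%:M.
Proof.
rewrite mul_mx2 mx2_1 !mulr0 !mul0r !addr0 !add0r w2E.
by congr mx2; field; rewrite A22n sc_neq0.
Qed.

Let chart k e (w : 'rV[R]_2) (x := row3 e (w 0 0) (w 0 1)) :
  w *m Pk k + bk k = pt (section_x k x) (1 + section_w k x).
Proof.
rewrite [w]pt_eta mul_pt_mx2 ptD /section_x /section_w /x_coord /y_coord /x !row3E !mulr0 !addr0 !add0r.
by congr pt; ring.
Qed.

(** Defined from exact iterates of the original maps, hence smooth everywhere and globally conjugate
    to the return map; the formulas in terms of the scaled orbit are established on [A]. *)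
Let h1 k (x : 'rV[R]_3) : R :=
  (U (k + mI) 0 (row3 (x 0 i0 * rho k) (section_x k x) (1 + section_w k x)) - bk k 0 0) * - (A22 / (sc k * sc k)).
Let h2 k (x : 'rV[R]_3) : R :=
  (U (k + mI) 1 (row3 (x 0 i0 * rho k) (section_x k x) (1 + section_w k x)) - bk k 0 1) * - (A22 / sc k).

Let smooth_Xk k : smooth (section_x k).
Proof. by rewrite /section_x /x_coord; smooth_tac. Qed.

Let smooth_Wk k : smooth (fun x => 1 + section_w k x).
Proof. by rewrite /section_w /y_coord; smooth_tac. Qed.

Let smooth_U k j : smooth (fun x => U (k + mI) j (row3 (x 0 i0 * rho k) (section_x k x) (1 + section_w k x))).
Proof.
apply: (@smooth_comp3 _ _ (U (k + mI) j) (fun x => x 0 i0 * rho k) (section_x k) (fun x => 1 + section_w k x)) => //.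
by apply: smoothM; [exact: smooth_coord|exact: smooth_cst].
Qed.

Let sh1 k : smooth (h1 k).
Proof.
apply: smoothM; last exact: smooth_cst.
by apply: smoothD; [exact: smooth_U|exact: smooth_cst].
Qed.

Let sh2 k : smooth (h2 k).
Proof.
apply: smoothM; last exact: smooth_cst.
by apply: smoothD; [exact: smooth_U|exact: smooth_cst].
Qed.

Let hE k e w : planar (h1 k) (h2 k) e w =
  (iter (k + mI) (Fm (rho k * e)) (w *m Pk k + bk k) - bk k) *m Qk k.
Proof.
rewrite (chart k e) iterE /planar /slice !ptE /h1 /h2 !row3E [e * _]mulrC.
set u := U _ 0 _; set u' := U _ 1 _; rewrite [bk k]pt_eta.
have -> : pt u u' - pt (bk k 0 0) (bk k 0 1) = pt (u - bk k 0 0) (u' - bk k 0 1).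
  by apply/rowP => j; case: (ord2P j) => ->; rewrite !mxE.
by rewrite -pt_eta mul_pt_mx2 !mulr0 addr0 add0r.
Qed.

Let end_point : \forall k \near F, forall x, A x ->
  [/\ U (k + mI) 0 (row3 (x 0 i0 * rho k) (section_x k x) (1 + section_w k x)) = sc k * (scaled_orbit k k).1 x,
     U (k + mI) 1 (row3 (x 0 i0 * rho k) (section_x k x) (1 + section_w k x)) = chi * (scaled_orbit k k).2 x
   & forall i, (i <= k)%N ->
     iter (mI + i) (Fm (parameter k x)) (pt (section_x k x) (1 + section_w k x)) =
       pt (alpha ^+ i * (scaled_orbit k i).1 x) (sg ^+ i * alpha ^+ (k - i) * (scaled_orbit k i).2 x) /\
     `|(scaled_orbit k i).2 x - chi| <= eta].
Proof.
apply: (@filterS _ F FF _ _ _ (@filterI _ F FF _ _ orbit_points F_sg)) => k [h ck] x Ax.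
have [_ hi] := h x Ax.
have E i : (i <= k)%N -> iter (mI + i) (Fm (parameter k x)) (pt (section_x k x) (1 + section_w k x)) =
    pt (alpha ^+ i * (scaled_orbit k i).1 x) (sg ^+ i * alpha ^+ (k - i) * (scaled_orbit k i).2 x).
  by move=> ik; rewrite addnC iterD reinjE; have [] := hi i ik.
have := E k (leqnn k); rewrite addnC iterE /planar /slice !ptE ck subnn expr0 mulr1 => /pt_inj[E1 E2].
split => // i ik; split; first exact: E.
by have [] := hi i ik.
Qed.

Let openA : open A.
Proof.
rewrite AE; set r := 4 * radius k1 beta.
have o i : open [set x : 'rV[R]_3 | `|x 0 i| < r].
  apply: (@open_comp _ _ (fun x : 'rV[R]_3 => `|x 0 i|) [set t | t < r]); last exact: open_lt.
  by move=> x _; apply: (cvg_comp (fun x : 'rV[R]_3 => x 0 i) Num.norm);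
    [exact: coord_continuous|exact: norm_continuous].
have -> : box k1 beta = [set x : 'rV[R]_3 | `|x 0 i0| < r] `&`
    ([set x : 'rV[R]_3 | `|x 0 i1| < r] `&` [set x : 'rV[R]_3 | `|x 0 i2| < r]).
  apply/seteqP; split=> x /=; first by move=> h; split; [|split]; exact: h.
  by move=> [? [? ?]] i; case: (ord3P i) => ->.
by apply: openI; [exact: o|apply: openI; exact: o].
Qed.

Let h1E : \forall k \near F, forall x, A x ->
  h1 k x = c0p - A22 * ((sc k)^-1 * ((scaled_orbit k k).1 x - 1) - k%:R * abar).
Proof.
apply: (@filterS _ F FF _ _ _ end_point) => k h x Ax; have [E _ _] := h x Ax.
rewrite /h1 E /bk pt0 w2E; move: (sc k) (sc_neq0 k) => S S0; field.
by rewrite S0 A22n.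
Qed.

Let h2E : \forall k \near F, forall x, A x ->
  h2 k x = Bc - A22 * ((sc k)^-1 * (chi * (scaled_orbit k k).2 x - 1)).
Proof.
apply: (@filterS _ F FF _ _ _ end_point) => k h x Ax; have [_ E _] := h x Ax.
rewrite /h2 E /bk pt1 w2E; move: (sc k) (sc_neq0 k) => S S0; field.
by rewrite S0 A22n.
Qed.

Let transfer_close (h : nat -> 'rV[R]_3 -> R) (h' : nat -> 'rV[R]_3 -> R) (lim : 'rV[R]_3 -> R) :
  (forall k, smooth (h k)) -> smooth lim ->
  (\forall k \near F, forall x, A x -> h k x = h' k x) ->
  bO F 3 A (fun k => k%:R^-1) (fun k x => h' k x - lim x) ->
  bO F 3 A (fun k => k%:R^-1) (fun k x => h k x - lim x).
Proof.
move=> sh sl hh [C C0 hC]; exists C; first exact: C0.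
apply: (@filterS _ F FF _ _ _ (@filterI _ F FF _ _ hh hC)) => k [E [_ B]].
split; first by apply: smoothD; [exact: sh|exact: smoothN].
apply: (Bd_ext openA _ B) => x Ax; exact: (congr1 (fun a => a - lim x) (esym (E x Ax))).
Qed.

(** The windows of the nearby quadratic family are pulled back through the chart. Minimality of the
    period is seen on the coordinate [y], whose modulus is near 1 again only at the end of the
    excursion. *)
Theorem windows_near : \forall k \near F, exists (em ep : R) (zeta : R -> 'rV[R]_2),
  [/\ em < 0 /\ 0 < ep, `|em| <= 4 * radius k1 beta /\ `|ep| <= 4 * radius k1 beta,
    {within `[em, ep], continuous zeta}
   & [/\ forall e, em <= e <= ep -> periodic_point (Fm (rho k * e)) (k + mI) (zeta e),
     forall e, em < e < ep -> asymptotically_stable (Fm (rho k * e)) (zeta e),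
     saddle_node (fun e => iter (k + mI) (Fm e)) (rho k * em) (zeta em)
   & period_doubling (fun e => iter (k + mI) (Fm e)) (rho k * ep) (zeta ep)]].
Proof.
have sl1 : smooth (lim1 (l i2) k1 beta) by rewrite /lim1; smooth_tac.
have sl2 : smooth (lim2 (l i2) k1) by rewrite /lim2; smooth_tac.
have cl1 := transfer_close sh1 sl1 h1E return1.
have cl2 := transfer_close sh2 sl2 h2E return2.
rewrite AE in cl1 cl2.
have dpos : \forall k \near F, 0 < k%:R^-1 :> R.
  by apply: (@filterS _ F FF _ _ _ F_pos) => k k0; rewrite invr_gt0 ltr0n.
have W := near_windows c_bd beta_bd FF sh1 sh2 dpos F_lim cl1 cl2.
have F1 := @filterI _ F FF.
apply: (@filterS _ F FF _ _ _ (F1 _ _ W (F1 _ _ end_point (F1 _ _ F_big (F1 _ _ F_pos F_sg))))).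
move=> k [[em [ep [zeta [em0 ep0 cz hfix [hst hsn hpd]]]]] [hend [big [k0 ck]]]].
have rk0 := rho_neq0 k0.
have iE e z := iterE (k + mI) e z.
have pk0 : (0 < k + mI)%N by rewrite addn_gt0 k0.
exists em, ep, (fun e => zeta e *m Pk k + bk k); split.
- by [].
- have em1 : em <= em <= ep by rewrite lexx (le_trans (ltW em0) (ltW ep0)).
  have ep1 : em <= ep <= ep by rewrite lexx (le_trans (ltW em0) (ltW ep0)).
  have [/(_ i0) b1 _] := hfix _ em1; have [/(_ i0) b2' _] := hfix _ ep1.
  by rewrite !row3E in b1 b2'; rewrite !ltW.
- have := @within_affine R zeta `[em, ep] `[em, ep] 1 (Pk k) (bk k).
  have -> : (fun e => zeta (1 * e) *m Pk k + bk k) = (fun e => zeta e *m Pk k + bk k).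
    by apply/funext => e; rewrite mul1r.
  by apply => // e; rewrite mul1r.
split.
- move=> e he; have [Ax fx] := hfix e he; rewrite -AE in Ax.
  have fz := fixed_transport rk0 (PQk k) (QPk k) (hE k) fx.
  set x := row3 _ _ _ in Ax; set z := _ + bk k.
  have Ez : z = pt (section_x k x) (1 + section_w k x) by rewrite /z (chart k e).
  have Ee : parameter k x = rho k * e by rewrite /parameter row3E mulrC.
  have [_ _ orbE] := hend x Ax; rewrite Ee -Ez in orbE.
  split => //.
  move=> j; rewrite [(k + mI)%N]addnC; move: j.
  apply: minimal_period => // j /andP[mj jk] jz.
  have [ij ji] : (j - mI < k)%N /\ (mI + (j - mI) = j)%N.
    by rewrite subnKC//; split => //; rewrite ltn_subLR.
  have [Ej bj] := orbE _ (ltnW ij); have [Ek' bk'] := orbE k (leqnn k).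
  rewrite ji jz in Ej; rewrite addnC fz in Ek'.
  have := etrans (esym Ej) Ek'; rewrite subnn expr0 mulr1 ck => /pt_inj[_ yE].
  have chi1 : `|chi| = 1.
    have : `|chi| ^+ 2 = 1 by rewrite expr2 -normrM chi2 normr1.
    move=> /eqP; rewrite sqrf_eq1 => /orP[/eqP //|/eqP h].
    by have := normr_ge0 chi; rewrite h lerNr oppr0 ler10.
  (* Before the end [|y| <= alpha * (1 + eta)], at the return point [|y| >= 1 - eta]; the choice of
     [eta] excludes equality. *)
  have : `|sg ^+ (j - mI) * alpha ^+ (k - (j - mI)) * (scaled_orbit k (j - mI)).2 x| =
      `|chi * (scaled_orbit k k).2 x| by rewrite yE.
  rewrite !normrM normrX sgabs expr1n mul1r chi1 mul1r ger0_norm ?exprn_ge0 ?(ltW a0)// => E.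
  have v1 : `|(scaled_orbit k (j - mI)).2 x| <= 1 + eta.
    have := ler_normD ((scaled_orbit k (j - mI)).2 x - chi) chi; rewrite subrK chi1 => h.
    by apply: le_trans h _; rewrite addrC lerD2l.
  have v2 : 1 - eta <= `|(scaled_orbit k k).2 x|.
    have := ler_normD ((scaled_orbit k k).2 x) (chi - (scaled_orbit k k).2 x).
    rewrite addrC subrK chi1 distrC => h; rewrite lerBlDr; apply: le_trans h _.
    by rewrite lerD2l.
  have al : alpha ^+ (k - (j - mI)) <= alpha.
    have /andP[_ al1] := alpha_bd.
    rewrite -[leRHS]expr1; apply: ler_wiXn2l; rewrite ?(ltW a0) ?(ltW al1)//.
    by rewrite subn_gt0.
  have : alpha ^+ (k - (j - mI)) * `|(scaled_orbit k (j - mI)).2 x| <= alpha * (1 + eta).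
    by apply: ler_pM => //; rewrite exprn_ge0 ?ltW.
  by rewrite E => h; have := le_lt_trans (le_trans v2 h) eta_bd; rewrite ltxx.
- move=> e he; have [c1 c2 c3] := hst e he.
  have he' : em <= e <= ep by case/andP: he => *; rewrite !ltW.
  have [_ fx] := hfix e he'.
  exact: (stable_transport (sU (k + mI) 0) (sU (k + mI) 1) (sh1 k) (sh2 k) iE rk0
    (PQk k) (QPk k) (hE k) pk0 (@cFm _) fx c1 c2 c3).
- exact: (saddle_node_transport (sU (k + mI) 0) (sU (k + mI) 1) (sh1 k) (sh2 k) iE rk0
    (PQk k) (QPk k) (hE k) hsn).
- exact: (period_doubling_transport (sU (k + mI) 0) (sU (k + mI) 1) (sh1 k) (sh2 k) iE rk0
    (PQk k) (QPk k) (hE k) hpd).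
Qed.

End Rescaling.

(** * Assembly *)

Section Assembly.
Variable R : realType.

Lemma within_oo (D P : nat -> Prop) : (\forall k \near \oo, P k) ->
  \forall k \near within D \oo, P k.
Proof. by move=> [K _ h]; exists K => // k Kk _; exact: h. Qed.

Lemma invn_lim (D : nat -> Prop) : (fun k => k%:R^-1 : R) @ within D \oo --> (0 : R).
Proof.
apply/cvgrPdist_lt => e e0; apply: within_oo; exists (Num.bound (e^-1)) => // k /= Kk.
have b := archi_boundP (ltW (_ : 0 < e^-1)); rewrite invr_gt0 in b.
have h : e^-1 < k%:R by apply: lt_le_trans (b e0) _; rewrite ler_nat.
have k0 : 0 < k%:R :> R by apply: lt_trans h; rewrite invr_gt0.
by rewrite sub0r normrN ger0_norm ?invr_ge0 ?ltW// -[ltRHS]invrK ltf_pV2 ?posrE ?invr_gt0.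
Qed.

Lemma expand1 (L : 'rV[R]_3 -> R) : smooth L -> exists2 L1, smooth L1 &
  forall e, L (row3 e 0 0) = L (row3 0 0 0) + e * L1 (row3 e 0 0).
Proof. by move=> sL; have [h sh E] := hadamard0 sL; exists h => // e; exact: E. Qed.

Lemma expand2 (L : 'rV[R]_3 -> R) : smooth L -> exists p1 L2, smooth L2 /\
  forall e, L (row3 e 0 0) = L (row3 0 0 0) + e * (p1 + e * L2 (row3 e 0 0)).
Proof.
move=> sL; have [h sh E] := expand1 sL; have [h' sh' E'] := expand1 sh.
by exists (h (row3 0 0 0)), h'; split => // e; rewrite E E'.
Qed.

(** Windows are chosen for each natural [k], extended to integers through [absz], and multiplied by
    [rho k] to return to the original parameter. A negative [rho k] reverses them, so the constant
    sign of [rho] decides which end is the saddle-node. *)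
Lemma stable_windows_of_near n (f : 'rV[R]_n -> 'rV[R]_2 -> 'rV[R]_2) (m : nat)
    (sg chi : R) (v : 'rV[R]_n) (rate : int -> R) (rho : nat -> R) (Rd C : R) :
  (0 < m)%N ->
  (forall k, (0 < k)%N -> 0 < rho k) \/ (forall k, (0 < k)%N -> rho k < 0) ->
  (forall k, (0 < k)%N -> `|rho k| <= C * `|rate (Posz k)|) ->
  (\forall k \near within (fun k => sg ^+ k = chi) \oo,
   exists (em ep : R) (zeta : R -> 'rV[R]_2),
    [/\ em < 0 /\ 0 < ep, `|em| <= Rd /\ `|ep| <= Rd,
      {within `[em, ep], continuous zeta}
     & [/\ forall e, em <= e <= ep -> periodic_point (f ((rho k * e) *: v)) (k + m) (zeta e),
       forall e, em < e < ep -> asymptotically_stable (f ((rho k * e) *: v)) (zeta e),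
       saddle_node (fun e => iter (k + m) (f (e *: v))) (rho k * em) (zeta em)
     & period_doubling (fun e => iter (k + m) (f (e *: v))) (rho k * ep) (zeta ep)]]) ->
  stable_windows f m sg chi v rate.
Proof.
move=> m0 sgn hrate [k0 _ W].
pose good k (t : R * R * (R -> 'rV[R]_2)) := let em := t.1.1 in let ep := t.1.2 in let zeta := t.2 in
  [/\ em < 0 /\ 0 < ep, `|em| <= Rd /\ `|ep| <= Rd,
      {within `[em, ep], continuous zeta}
     & [/\ forall e, em <= e <= ep -> periodic_point (f ((rho k * e) *: v)) (k + m) (zeta e),
       forall e, em < e < ep -> asymptotically_stable (f ((rho k * e) *: v)) (zeta e),
       saddle_node (fun e => iter (k + m) (f (e *: v))) (rho k * em) (zeta em)
     & period_doubling (fun e => iter (k + m) (f (e *: v))) (rho k * ep) (zeta ep)]].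
have ex k : exists t, (k0 <= k)%N -> sg ^+ k = chi -> good k t.
  have [[ck kk]|no] := pselect (sg ^+ k = chi /\ (k0 <= k)%N).
    by have [em [ep [z h]]] := W k kk ck; exists (em, ep, z).
  by exists (0, 0, fun=> 0) => kk ck; case: no.
have [T hT] := choice ex.
(* At least 1, so that only positive integers are concerned and [absz] loses nothing. *)
pose kmin := maxn k0 1.
have KE k : K sg chi (Posz kmin) k -> exists k', [/\ k = Posz k', (0 < k')%N & good k' (T k')].
  case: k => k [] //; rewrite lez_nat geq_max => /andP[kk k1] ck.
  by exists k; split => //; exact: hT.
have pE k' : absz (Posz k' + m%:Z) = (k' + m)%N by rewrite -PoszD absz_nat.
have C0 k : (0 < k)%N -> 0 <= C * `|rate (Posz k)|.
  by move=> k1; apply: le_trans (hrate k k1).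
have bnd k (x : R) : (0 < k)%N -> `|x| <= Rd -> `|rho k * x| <= C * Rd * `|rate (Posz k)|.
  move=> k1 hx; rewrite normrM mulrAC; apply: ler_pM => //; exact: hrate.
have cont (B B' : set R) (r : R) (z : R -> 'rV[R]_2) : (forall e, B' e -> B (r * e)) ->
    {within B, continuous z} -> {within B', continuous (fun e => z (r * e))}.
  move=> BB cz; have := @within_affine R z B B' r 1%:M 0 BB cz.
  have -> // : (fun e => z (r * e) *m 1%:M + 0) = (fun e => z (r * e)).
  by apply/funext => e; rewrite mulmx1 addr0.
pose rk (k : int) := rho (absz k); pose zt k e := (T (absz k)).2 ((rk k)^-1 * e).
case: sgn => sgn.
- exists (Posz kmin), (fun k => rk k * (T (absz k)).1.1), (fun k => rk k * (T (absz k)).1.2), zt.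
  split.
  + move=> k /KE[k' [-> k1 [[e1 e2] _ _ _]]]; rewrite /rk /=; have r0 := sgn k' k1.
    by split; [rewrite -PoszD ltz_nat addn_gt0 k1|rewrite pmulr_rlt0|rewrite mulr_gt0].
  + by split; exists (C * Rd), 0 => k /KE[k' [-> k1 [_ [e1 e2] _ _]]] _; exact: bnd.
  + move=> k /KE[k' [-> k1 [_ _ cz [hp hs _ _]]]]; rewrite /zt /rk /= ?pE; have r0 := sgn k' k1.
    have rn : rho k' != 0 by rewrite gt_eqF.
    have sc e : rho k' * ((rho k')^-1 * e) = e by rewrite mulVKf.
    split.
    * apply: cont cz => e; rewrite /= !in_itv /= => /andP[a b].
      by rewrite mulrC ler_pdivlMr// ler_pdivrMr// [_ * rho _]mulrC a mulrC.
    * move=> e /andP[a b]; rewrite -{1}(sc e); apply: hp.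
      by rewrite mulrC ler_pdivlMr// ler_pdivrMr// [_ * rho _]mulrC a mulrC.
    * move=> e /andP[a b]; rewrite -{1}(sc e); apply: hs.
      by rewrite mulrC ltr_pdivlMr// ltr_pdivrMr// [_ * rho _]mulrC a mulrC.
  + left=> k /KE[k' [-> k1 [_ _ _ [_ _ hsn hpd]]]]; rewrite /zt /rk /= ?pE.
    have rn : rho k' != 0 by rewrite gt_eqF// sgn.
    have E (x : R) : (rho k')^-1 * (rho k' * x) = x by rewrite mulKf.
    by split; [rewrite (E (T k').1.1)|rewrite (E (T k').1.2)].
(* Multiplication by a negative [rho k] exchanges the two ends. *)
- exists (Posz kmin), (fun k => rk k * (T (absz k)).1.2), (fun k => rk k * (T (absz k)).1.1), zt.
  split.
  + move=> k /KE[k' [-> k1 [[e1 e2] _ _ _]]]; rewrite /rk /=; have r0 := sgn k' k1.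
    by split; [rewrite -PoszD ltz_nat addn_gt0 k1|rewrite nmulr_rlt0|rewrite nmulr_rgt0].
  + by split; exists (C * Rd), 0 => k /KE[k' [-> k1 [_ [e1 e2] _ _]]] _; exact: bnd.
  + move=> k /KE[k' [-> k1 [_ _ cz [hp hs _ _]]]]; rewrite /zt /rk /= ?pE; have r0 := sgn k' k1.
    have rn : rho k' != 0 by rewrite lt_eqF.
    have sc e : rho k' * ((rho k')^-1 * e) = e by rewrite mulVKf.
    split.
    * apply: cont cz => e; rewrite /= !in_itv /= => /andP[a b].
      by rewrite mulrC ler_ndivlMr// ler_ndivrMr// [_ * rho _]mulrC b mulrC.
    * move=> e /andP[a b]; rewrite -{1}(sc e); apply: hp.
      by rewrite mulrC ler_ndivlMr// ler_ndivrMr// [_ * rho _]mulrC b mulrC.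
    * move=> e /andP[a b]; rewrite -{1}(sc e); apply: hs.
      by rewrite mulrC ltr_ndivlMr// ltr_ndivrMr// [_ * rho _]mulrC b mulrC.
  + right=> k /KE[k' [-> k1 [_ _ _ [_ _ hsn hpd]]]]; rewrite /zt /rk /= ?pE.
    have rn : rho k' != 0 by rewrite lt_eqF// sgn.
    have E (x : R) : (rho k')^-1 * (rho k' * x) = x by rewrite mulKf.
    by split; [rewrite (E (T k').1.2)|rewrite (E (T k').1.1)].
Qed.

End Assembly.

Theorem theorem6p1 (R : realType) (n m : nat)
    (f : 'rV[R]_n -> 'rV[R]_2 -> 'rV[R]_2)
    (alpha chi_eig chi : R)
    (lambda sigma a1 b1 c0 c1 c2 d0 d1 d2 d3 d4 d5 : 'rV[R]_n -> R)
    (N : set 'rV[R]_2)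
    (f_smooth : smooth_family f)
    (alpha_bounds : 0 < alpha < 1)
    (chi_eig_sign : chi_eig = -1 \/ chi_eig = 1)
    (chi_sign : chi = -1 \/ chi = 1)
    (f_fixed : fixed_origin f lambda sigma)
    (lambda0 : lambda 0 = alpha)
    (sigma0 : sigma 0 = chi_eig / alpha)
    (N_open : open N)
    (N_convex : convex_set (N : set (convex_lmodType 'rV[R]_2)))
    (N_origin : N 0)
    (N_points : [/\ N (pt 1 0), N (pt (lambda 0) 0),
                    N (pt 0 (1 / sigma 0)) & N (pt 0 (1 / sigma 0 ^+ 2))])
    (f_local : local_map f lambda sigma a1 b1 N)
    (a1_b1_zero : chi_eig = -1 ->
       \forall mu \near (0 : 'rV[R]_n), a1 mu = 0 /\ b1 mu = 0)
    (m_ge1 : (1 <= m)%N)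
    (f_reinjection : reinjection_map f m c0 c1 c2 d0 d1 d2 d3 d4 d5)
    (c0_0 : c0 0 = 1) (d0_0 : d0 0 = 0) (d1_0 : d1 0 = chi)
    (d2_0 : d2 0 = 0) (d5_0 : d5 0 != 0)
    (a1_plus_b1 : a1 0 + b1 0 = 0)
    (Delta0_pos : 0 < Delta0 chi (c1 0) (c2 0) (d3 0) (d4 0) (d5 0))
    (c2_bounds : -1 < c2 0 <
       1 - Num.sqrt (Delta0 chi (c1 0) (c2 0) (d3 0) (d4 0) (d5 0)) / 2)
    (v : 'rV[R]_n) :
  let n_eig := grad (fun mu => lambda mu * sigma mu) 0 in
  let n_tang := grad d0 0 in
  (dot n_tang v != 0 ->
     stable_windows f m chi_eig chi v (fun k => alpha ^ (2 * k))) /\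
  (dot n_tang v = 0 -> dot n_eig v != 0 ->
     stable_windows f m chi_eig chi v (fun k => alpha ^ k / k%:~R)).
Proof.
move=> n_eig n_tang.
have /andP[al0 al1] := alpha_bounds.
have an : alpha != 0 by rewrite gt_eqF.
have sq1 (x : R) : x = -1 \/ x = 1 -> x * x = 1 by case=> ->; rewrite ?mulrNN mulr1.
have sg2 := sq1 _ chi_eig_sign; have chi2 := sq1 _ chi_sign.
have sgn : chi_eig != 0.
  by apply/eqP => h; move: sg2; rewrite h mul0r => /eqP; rewrite eq_sym oner_eq0.
have chin : chi != 0.
  by apply/eqP => h; move: chi2; rewrite h mul0r => /eqP; rewrite eq_sym oner_eq0.
have sgV : chi_eig^-1 = chi_eig by apply: (mulfI sgn); rewrite divff.
have [N_x _ N_y0 N_yy0] := N_points.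
have N_y : N (pt 0 (chi_eig * alpha)).
  by move: N_y0; rewrite sigma0 mul1r invf_div mulrC sgV.
have N_yy : N (pt 0 (alpha ^+ 2)).
  by move: N_yy0; rewrite sigma0 mul1r -exprVn invf_div sgV exprMn [chi_eig ^+ 2]expr2 sg2 mulr1.
have [La [Ca [ha [Sb [Cb [hb [e0 e00 [[sLa sSb] [sCa sCb] [sha shb] loc]]]]]]]] :=
  local_forms f_smooth N_open N_origin f_local v.
have [eta [eta0 eta_bd] inN] :=
  orbit_in_N chi alpha_bounds sg2 N_open N_convex N_origin N_x N_y N_yy.
have [[La0 Sb0] [Ca0 Cb0] _] := loc 0 ltac:(by rewrite normr0).
rewrite scale0r in La0 Sb0 Ca0 Cb0.
have [lam1 [L2 [sL2 LE]]] := expand2 sLa; rewrite La0 lambda0 in LE.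
have [sig1 [S2 [sS2 SE]]] := expand2 sSb; rewrite Sb0 sigma0 in SE.
have [Ca1 sCa1 CaE] := expand1 sCa; have [Cb1 sCb1 CbE] := expand1 sCb.
rewrite Ca0 lambda0 in CaE; rewrite Cb0 sigma0 in CbE.
have slope := eigen_slope f_smooth alpha_bounds sg2 N_x N_y f_local sL2 sS2 e00
  (fun e he => let: And3 h _ _ := loc e he in h) LE SE.
have [l [G [sG t1E l1 l2]]] := reinj0_taylor f_smooth f_reinjection v.
have [mm [q [H [sH t2E m0E [m1 m2] [q11 q12 q22]]]]] := reinj1_taylor f_smooth f_reinjection v.
rewrite c0_0 in t1E; rewrite d1_0 in m1; rewrite d2_0 in m2.
have {}t2E z : reinj m f v 1 z = _ := etrans (t2E z) (etrans (congr1 (fun a => a + _) d0_0) (add0r _)).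
(* For [chi_eig = -1] the coefficients [a1] and [b1] vanish at 0, for [chi_eig = 1] the identities
   are trivial. *)
have [sgca sgcb] : chi_eig * (alpha * a1 0) = alpha * a1 0 /\
    chi_eig * (chi_eig / alpha * b1 0) = chi_eig / alpha * b1 0.
  case: chi_eig_sign (a1_b1_zero) => [-> /(_ erefl)/nbhs_singleton[-> ->]|->].
    by rewrite !mulr0.
  by rewrite !mul1r.
have reson : alpha * a1 0 / alpha + chi_eig * alpha * (chi_eig / alpha * b1 0) = 0.
  have -> : alpha * a1 0 / alpha + chi_eig * alpha * (chi_eig / alpha * b1 0) =
      a1 0 + (chi_eig * chi_eig) * b1 0 by field.
  by rewrite sg2 mul1r.
have [Cs Cs0 sc_le] := geometric_decay alpha_bounds.
pose A22 := 2 * (chi * d5 0).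
have A22n : A22 != 0 by rewrite !mulf_neq0// pnatr_eq0.
pose Bc := 1 - c2 0 - chi * d4 0.
pose c0p := Bc - A22 * (chi * d3 0) - chi * d4 0 * Bc - Bc ^+ 2 / 2.
pose beta := c0p - A22 * c1 0 - c2 0 * Bc.
set Dl := Delta0 _ _ _ _ _ _ in Delta0_pos c2_bounds.
(* With [chi * chi = 1] the normalising constants combine into half the discriminant. *)
have betaE : beta = Dl / 2.
  rewrite /beta /c0p /Dl /Delta0 /A22 -/Bc.
  have -> : 2 * (chi * d5 0) * (chi * d3 0) = 2 * (chi * chi) * d5 0 * d3 0 by ring.
  by rewrite chi2 /Bc; field.
have /andP[c2m c2p] := c2_bounds.
have sq0 : 0 < Num.sqrt Dl by rewrite sqrtr_gt0.
have sqE : Num.sqrt Dl ^+ 2 = Dl by rewrite sqr_sqrtr// ltW.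
have c_bd : -1 < c2 0 < 1.
  by rewrite c2m /=; apply: lt_trans c2p _; rewrite gtrBl divr_gt0.
(* The upper bound on [c2 0] says that the root of the discriminant is below [2 (1 - c)]; squaring
   gives the upper bound on [beta]. *)
have beta_bd : 0 < beta < 2 * (1 - c2 0) ^+ 2.
  rewrite betaE divr_gt0//=.
  have h1 : Num.sqrt Dl < 2 * (1 - c2 0) by lra.
  have h2 : Dl < (2 * (1 - c2 0)) ^+ 2.
    by rewrite -sqE ltr_sqr ?nnegrE ?(ltW sq0)//; lra.
  by move: h2; rewrite exprMn ltr_pdivrMr//; lra.
(* The two cases differ in the scale [rho] alone: each supplies its asymptotics, its constant sign
   and the normalisation to 1/2. *)
have core (rho : nat -> R) (q1 kap0 Cr Cq Ck C : R) (rate : int -> R) :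
    0 <= Cr -> 0 <= Cq -> 0 <= Ck ->
    (forall k, (0 < k)%N -> `|rho k| <= Cr * (alpha ^+ k * k%:R^-1)) ->
    (forall k, (0 < k)%N -> `|k%:R * rho k / alpha ^+ k - q1| <= Cq * k%:R^-1) ->
    (forall k, (0 < k)%N -> `|mm i0 * rho k - alpha ^+ k * alpha ^+ k * kap0| <=
       Ck * (alpha ^+ k * alpha ^+ k * k%:R^-1)) ->
    (forall k, (0 < k)%N -> 0 < rho k) \/ (forall k, (0 < k)%N -> rho k < 0) ->
    - A22 * (chi * kap0 + q1 * (chi_eig * alpha * sig1 + alpha^-1 * lam1)) = 2^-1 ->
    (forall k, (0 < k)%N -> `|rho k| <= C * `|rate (Posz k)|) ->
    stable_windows f m chi_eig chi v rate.
  move=> Cr0 Cq0 Ck0 rho_le rho_q1 rho_kap rho_sgn norm hrate.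
  pose k1 := - A22 * (q1 * (alpha^-1 * lam1)).
  have k2E : 2^-1 - k1 = - A22 * (chi * kap0 + q1 * (chi_eig * alpha * sig1)).
    by rewrite -norm /k1; ring.
  pose D k := chi_eig ^+ k = chi.
  have FF : Filter (within D \oo) by exact: within_filter.
  have near_ge K0 : \forall k \near within D \oo, (K0 <= k)%N by apply: within_oo; exists K0.
  have F_sg : \forall k \near within D \oo, chi_eig ^+ k = chi.
    by exists 0%N => // k _.
  have locF : \forall k \near within D \oo, forall i e t u, (i < k)%N -> `|e| < e0 ->
      `|t - 1| <= eta -> `|u - chi| <= eta ->
      let x := alpha ^+ i * t in let y := chi_eig ^+ i * alpha ^+ (k - i) * u in
      f (e *: v) (pt x y) =
      pt (x * (La (row3 e 0 0) + Ca (row3 e 0 0) * (x * y) + (x * y) ^+ 2 * ha (row3 e x y)))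
         (y * (Sb (row3 e 0 0) + Cb (row3 e 0 0) * (x * y) + (x * y) ^+ 2 * hb (row3 e x y))).
    apply: (@filterS _ _ FF _ _ _ F_sg) => k ck i e t u ik he ht hu x y.
    have [Nx Ny] := inN k i t u ck ik ht hu.
    by have [_ _ h] := loc e he; exact: h.
  have rho_neq0 k : (0 < k)%N -> rho k != 0.
    by case: rho_sgn => h k0; [rewrite gt_eqF// h|rewrite lt_eqF// h].
  have A_bd (x : 'rV[R]_3) : box k1 beta x -> forall i, `|x 0 i| <= 4 * radius k1 beta.
    by move=> bx i; exact/ltW/bx.
  apply: (@stable_windows_of_near R n f m chi_eig chi v rate rho (4 * radius k1 beta) C m_ge1 rho_sgn hrate).
  have A22w2 : A22 * A22^-1 = 1 by rewrite divff.
  have A22E : A22 = 2 * (chi * q i2 i2) by rewrite q22.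
  have BcE : Bc = 1 - l i2 - chi * (q i1 i2 + q i2 i1) by rewrite l2 q12.
  have c0pE : c0p = Bc - A22 * (chi * q i1 i1) - chi * (q i1 i2 + q i2 i1) * Bc - Bc ^+ 2 / 2.
    by rewrite q11 q12.
  have bE : beta = c0p - A22 * l i1 - l i2 * Bc by rewrite l1 l2.
  rewrite -l2 in c_bd beta_bd.
  have W := (windows_near (Fm := fun e => f (e *: v)) alpha_bounds sg2 chi2 sha shb sL2 sS2 sCa1 sCb1 LE SE CaE CbE sgca sgcb reson
    sG sH t1E t2E m1 m2 Cs0 Cr0 Cq0 Ck0 sc_le rho_le rho_q1 rho_kap A_bd FF (near_ge 1%N)
    (invn_lim D) A22w2 A22E BcE c0pE bE (erefl k1) k2E e00 eta0 locF (erefl (box k1 beta)) c_bd beta_bd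
    m_ge1 (smooth_along_iter f_smooth v) (along_iterE f v) (reinjE m f v)
    (fun e => @family_continuous R n f f_smooth (e *: v)) rho_neq0 F_sg (near_ge (m * m)%N) eta_bd).
  exact: W.
have s0 k : 0 < alpha ^+ k :> R by rewrite exprn_gt0.
have sk k : (0 < k)%N -> [/\ alpha ^+ k <= Cs * k%:R^-1, k%:R * alpha ^+ k <= Cs * k%:R^-1
    & 0 < k%:R :> R].
  move=> k0; have kR : 0 < k%:R :> R by rewrite ltr0n.
  have i0 : 0 <= k%:R^-1 :> R by rewrite invr_ge0 ltW.
  have i1 : k%:R^-1 <= 1 :> R by rewrite invf_le1// ler1n.
  have pw j : k%:R^-1 ^+ j.+1 <= k%:R^-1 :> R by rewrite -[leRHS]expr1 ler_wiXn2l.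
  split => //; first by apply: le_trans (sc_le k k0) _; rewrite ler_pM2l.
  apply: (@le_trans _ _ (k%:R * (Cs * k%:R^-1 ^+ 4))); first by rewrite ler_pM2l// sc_le.
  have -> : k%:R * (Cs * k%:R^-1 ^+ 4) = Cs * k%:R^-1 ^+ 3 by field; rewrite gt_eqF.
  by rewrite ler_pM2l.
have sgn_of (r0 : R) (w : nat -> R) : r0 != 0 -> (forall k, (0 < k)%N -> 0 < w k) ->
    (forall k, (0 < k)%N -> 0 < r0 * w k) \/ (forall k, (0 < k)%N -> r0 * w k < 0).
  move=> r00 wp; have [r0p|r0n|/eqP] := ltgtP r0 0; last by rewrite (negbTE r00).
    by right=> k k0; rewrite nmulr_rlt0// wp.
  by left=> k k0; rewrite pmulr_rgt0// wp.
split.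
- move=> nt; rewrite /n_tang -m0E in nt.
  (* Fixed by the normalisation with [q1 = 0] and [kap0 = mm i0 * r0]. Here [k rho_k / s] is
     [r0 * k * s], so the drift of the eigenvalues is negligible. *)
  pose r0 := - (2 * A22 * chi * mm i0)^-1.
  have r00 : r0 != 0 by rewrite oppr_eq0 invr_eq0 !mulf_neq0// pnatr_eq0.
  apply: (core (fun k => r0 * (alpha ^+ k * alpha ^+ k)) 0 (mm i0 * r0) (`|r0| * Cs) (`|r0| * Cs) 0 `|r0|).
  + by rewrite mulr_ge0// ltW.
  + by rewrite mulr_ge0// ltW.
  + by [].
  + move=> k /sk[h _ _]; rewrite /= normrM [`|alpha ^+ k * _|]ger0_norm; last by rewrite mulr_ge0// ltW.
    have -> : `|r0| * Cs * (alpha ^+ k * k%:R^-1) = `|r0| * (alpha ^+ k * (Cs * k%:R^-1)) by ring.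
    by rewrite ler_wpM2l// ler_pM2l.
  + move=> k /sk[_ h k0]; rewrite subr0.
    have -> : k%:R * (r0 * (alpha ^+ k * alpha ^+ k)) / alpha ^+ k = r0 * (k%:R * alpha ^+ k).
      by field; rewrite gt_eqF.
    rewrite normrM [`|k%:R * _|]ger0_norm; last by rewrite mulr_ge0// ltW.
    by rewrite -mulrA ler_wpM2l.
  + move=> k _; rewrite mul0r; set z := (X in `|X|); have -> : z = 0 by rewrite /z; ring.
    by rewrite normr0.
  + by apply: sgn_of => // k _; rewrite mulr_gt0.
  + by rewrite mul0r addr0 /r0; field; rewrite A22n chin nt.
  + move=> k _ /=; rewrite normrM ler_wpM2l//.
    by rewrite [alpha ^ _](_ : _ = alpha ^+ k * alpha ^+ k)// -exprD addnn -mul2n.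
- move=> nt ne; rewrite /n_tang -m0E in nt.
  (* This is [chi_eig] times the slope of [lambda * sigma] along [v], hence nonzero. *)
  pose w := chi_eig * alpha * sig1 + alpha^-1 * lam1.
  have wn : w != 0.
    apply: contraNneq ne => w0; rewrite /n_eig slope.
    have -> : chi_eig / alpha * lam1 + alpha * sig1 =
       chi_eig * w + (1 - chi_eig * chi_eig) * (alpha * sig1) by rewrite /w; field.
    by rewrite w0 sg2 subrr mul0r mulr0 addr0.
  (* Now [k rho_k / s] equals [r0] exactly, and the normalisation [- A22 * q1 * w = 1/2] fixes it;
     the tangency term is absent since [mm i0 = 0]. *)
  pose r0 := - (2 * A22 * w)^-1.
  have r00 : r0 != 0 by rewrite oppr_eq0 invr_eq0 !mulf_neq0// pnatr_eq0.
  have kpos k : (0 < k)%N -> 0 < alpha ^+ k * k%:R^-1 by move=> k0; rewrite mulr_gt0// invr_gt0 ltr0n.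
  apply: (core (fun k => r0 * (alpha ^+ k * k%:R^-1)) r0 0 `|r0| 0 0 `|r0|) => //.
  + by move=> k /kpos k0; rewrite normrM [`|alpha ^+ k * _|]ger0_norm// ltW.
  + move=> k k0; have kn : k%:R != 0 :> R by rewrite pnatr_eq0 -lt0n.
    have -> : k%:R * (r0 * (alpha ^+ k * k%:R^-1)) / alpha ^+ k - r0 = 0.
      by field; rewrite kn gt_eqF.
    by rewrite normr0 mul0r.
  + by move=> k _; rewrite nt !mul0r mulr0 subrr normr0.
  + exact: sgn_of.
  + by rewrite mulr0 add0r -/w /r0; field; rewrite A22n wn.
  + by move=> k _ /=; rewrite normrM ler_wpM2l// -pmulrn.
Qed.
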